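(* Let $k$ be an algebraically closed field and let $F:\mathsf{Qcoh}\,\mathbb{P}^1_k\to\mathsf{Mod}\,k$ be a $k$-linear, right exact functor which preserves direct limits and preserves coherence. Then there exist a coherent torsion sheaf $\mathcal{T}$ on $\mathbb{P}^1_k$ and nonnegative integers $n$ and $n_i$ (for $i\ge -n$) such that there is an isomorphism of functors $$F\;\cong\;\bigoplus_{i=-n}^{\infty} H^1(\mathbb{P}^1_k,(-)(i))^{\oplus n_i}\;\oplus\;H^0(\mathbb{P}^1_k,-\otimes\mathcal{T}).$$
   Context: $\mathsf{Qcoh}\,X$ is the category of quasi-coherent sheaves on a $k$-scheme $X$, and $\mathsf{Mod}\,k$ is the category of $k$-vector spaces. Direct limits are filtered (directed) colimits. $F$ is coherence preserving if it sends coherent sheaves to finite dimensional vector spaces. Tensor products are over $\mathcal{O}_{\mathbb{P}^1_k}$. $H^1(\mathbb{P}^1_k,(-)(i))$ denotes the functor $\mathcal{M}\mapsto H^1(\mathbb{P}^1_k,\mathcal{M}\otimes\mathcal{O}_{\mathbb{P}^1_k}(i))$. The zero sheaf counts as a coherent torsion sheaf. *)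

(* Defs.v *)
From HB Require Import structures.
From mathcomp Require Import all_boot all_order all_algebra.
From mathcomp Require Import finmap.
From mathcomp Require Import boolp.

Set Implicit Arguments.
Unset Strict Implicit.
Unset Printing Implicit Defensive.

Import GRing.Theory.
Local Open Scope ring_scope.

(** ** Modules: products, direct sums, finite generation *)

Section DependentProduct.
Variables (k : comNzRingType) (I : Type) (V : I -> lmodType k).

Definition pi_mod := forall i, V i.

HB.instance Definition _ := gen_eqMixin pi_mod.
HB.instance Definition _ := gen_choiceMixin pi_mod.

Local Ltac pi_ext := move=> *; apply: functional_extensionality_dep => ?.

Program Definition pi_zmodMixin := @GRing.isZmodule.Build pi_mod
  (fun=> 0) (fun f i => - f i) (fun f g i => f i + g i) _ _ _ _.
Next Obligation. by pi_ext; rewrite addrA. Qed.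
Next Obligation. by pi_ext; rewrite addrC. Qed.
Next Obligation. by pi_ext; rewrite add0r. Qed.
Next Obligation. by pi_ext; rewrite addNr. Qed.
HB.instance Definition _ := pi_zmodMixin.

Program Definition pi_lmodMixin := @GRing.Zmodule_isLmodule.Build k pi_mod
  (fun a f i => a *: f i) _ _ _ _.
Next Obligation. by pi_ext; rewrite scalerA. Qed.
Next Obligation. by pi_ext; rewrite scale1r. Qed.
Next Obligation. by pi_ext; rewrite scalerDr. Qed.
Next Obligation. by pi_ext; rewrite scalerDl. Qed.
HB.instance Definition _ := pi_lmodMixin.

End DependentProduct.

Section DirectSum.
Variables (k : comNzRingType) (I : choiceType) (V : I -> lmodType k).

Definition fin_supp : {pred pi_mod V} :=
  fun f => `[< exists s : seq I, forall i, i \notin s -> f i = 0 >].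

Lemma fin_supp_submod : submod_closed fin_supp.
Proof.
split=> [|a f g /asboolP[s sf] /asboolP[s' sg]]; apply/asboolP.
  by exists [::].
exists (s ++ s') => i; rewrite mem_cat negb_or => /andP[/sf fi0 /sg gi0].
by change (a *: f i + g i = 0); rewrite fi0 gi0 scaler0 addr0.
Qed.

HB.instance Definition _ := GRing.isSubmodClosed.Build k (pi_mod V) fin_supp
  fin_supp_submod.

Record direct_sum := DirectSum {
  dsum_val : pi_mod V; dsum_valP : dsum_val \in fin_supp }.

HB.instance Definition _ := [isSub for dsum_val].
HB.instance Definition _ := [Choice of direct_sum by <:].
HB.instance Definition _ := [SubChoice_isSubLmodule of direct_sum by <:].

Definition dsum_fun (s : direct_sum) : forall i, V i := dsum_val s.
Coercion dsum_fun : direct_sum >-> Funclass.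

End DirectSum.

Definition finitely_generated (R : nzRingType) (V : lmodType R) : Prop :=
  exists (n : nat) (e : 'I_n -> V),
    forall v : V, exists c : 'I_n -> R, v = \sum_(i < n) c i *: e i.

(** ** Categories enriched in [k]-modules, [k]-linear functors, direct limits *)

Record lincat (k : comNzRingType) := Lincat {
  ob :> Type;
  hom : ob -> ob -> lmodType k;
  idm : forall A, hom A A;
  comp : forall A B C, hom B C -> hom A B -> hom A C;
  comp_linearl : forall A B C (f : hom A B),
    linear (fun g : hom B C => comp g f);
  comp_linearr : forall A B C (g : hom B C),
    linear (fun f : hom A B => comp g f);
  comp1m : forall A B (f : hom A B), comp (idm B) f = f;
  compm1 : forall A B (f : hom A B), comp f (idm A) = f;
  compmA : forall A B C D (h : hom C D) (g : hom B C) (f : hom A B),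
    comp h (comp g f) = comp (comp h g) f }.
Arguments hom {k l}.
Arguments idm {k l}.
Arguments comp {k l A B C}.

Record functor (k : comNzRingType) (C D : lincat k) := Functor {
  fob :> C -> D;
  fmap : forall A B : C, hom A B -> hom (fob A) (fob B);
  fmap_linear : forall A B : C, linear (@fmap A B);
  fmap1 : forall A : C, fmap (idm A) = idm (fob A);
  fmapM : forall (A B E : C) (g : hom B E) (f : hom A B),
    fmap (comp g f) = comp (fmap g) (fmap f) }.
Arguments fmap {k C D} _ {A B} _.

Section Functors.
Variables (k : comNzRingType).

Program Definition functor_comp (C D E : lincat k)
    (G : functor D E) (F : functor C D) : functor C E :=
  @Functor k C E (fun A => G (F A)) (fun A B f => fmap G (fmap F f)) _ _ _.
Next Obligation. by move=> a f g; rewrite !fmap_linear. Qed.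
Next Obligation. by rewrite !fmap1. Qed.
Next Obligation. by rewrite !fmapM. Qed.

Definition is_iso (C : lincat k) (A B : C) (f : hom A B) : Prop :=
  exists g : hom B A, comp g f = idm A /\ comp f g = idm B.

Definition functor_iso (C D : lincat k) (F G : functor C D) : Prop :=
  exists eta : forall A : C, hom (F A) (G A),
    (forall (A B : C) (f : hom A B),
       comp (eta B) (fmap F f) = comp (fmap G f) (eta A)) /\
    (forall A, is_iso (eta A)).

Record directed_diagram (C : lincat k) := DirectedDiagram {
  dd_index : Type;
  dd_le : dd_index -> dd_index -> Prop;
  dd_refl : forall i, dd_le i i;
  dd_trans : forall i j l, dd_le i j -> dd_le j l -> dd_le i l;
  dd_inhabited : inhabited dd_index;
  dd_directed : forall i j, exists l, dd_le i l /\ dd_le j l;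
  dd_ob : dd_index -> C;
  dd_map : forall i j, dd_le i j -> hom (dd_ob i) (dd_ob j);
  dd_map1 : forall i (ii : dd_le i i), dd_map ii = idm (dd_ob i);
  dd_mapM : forall i j l (ij : dd_le i j) (jl : dd_le j l) (il : dd_le i l),
    dd_map il = comp (dd_map jl) (dd_map ij) }.

Arguments dd_ob {C} d _.
Arguments dd_map {C} d {i j} _.

Definition is_cocone (C : lincat k) (D : directed_diagram C) (L : C)
    (c : forall i, hom (dd_ob D i) L) : Prop :=
  forall i j (ij : dd_le i j), comp (c j) (dd_map D ij) = c i.

Definition is_direct_limit (C : lincat k) (D : directed_diagram C) (L : C)
    (c : forall i, hom (dd_ob D i) L) : Prop :=
  is_cocone c /\
  forall (X : C) (d : forall i, hom (dd_ob D i) X), is_cocone d ->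
    exists! h : hom L X, forall i, comp h (c i) = d i.

Program Definition diagram_map (C E : lincat k) (F : functor C E)
    (D : directed_diagram C) : directed_diagram E :=
  @DirectedDiagram E (dd_index D) (@dd_le C D) _ _ _ _
    (fun i => F (dd_ob D i)) (fun i j ij => fmap F (dd_map D ij)) _ _.
Next Obligation. exact: dd_refl. Qed.
Next Obligation. exact: dd_trans H H0. Qed.
Next Obligation. exact: dd_inhabited. Qed.
Next Obligation. exact: dd_directed. Qed.
Next Obligation. by rewrite dd_map1 fmap1. Qed.
Next Obligation. by rewrite -fmapM (dd_mapM ij jl il). Qed.

Definition preserves_direct_limits (C E : lincat k) (F : functor C E) : Prop :=
  forall (D : directed_diagram C) (L : C) (c : forall i, hom (dd_ob D i) L),
    is_direct_limit c ->
    @is_direct_limit E (diagram_map F D) (F L) (fun i => fmap F (c i)).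

End Functors.

(** ** The category of [k]-vector spaces *)

Section ModCategory.
Variable k : comNzRingType.

Section LinearMaps.
Variables V W : lmodType k.

Definition linear_pred : {pred pi_mod (fun _ : V => W)} :=
  fun f => `[< linear (f : V -> W) >].

Lemma linear_pred_submod : submod_closed linear_pred.
Proof.
split=> [|a f g /asboolP lf /asboolP lg]; apply/asboolP => b u v.
  by change (0 = b *: (0 : W) + 0); rewrite scaler0 addr0.
change (a *: f (b *: u + v) + g (b *: u + v) =
  b *: (a *: f u + g u) + (a *: f v + g v)).
by rewrite lf lg !scalerDr !scalerA (mulrC a) addrACA.
Qed.

HB.instance Definition _ := GRing.isSubmodClosed.Build k _ linear_pred
  linear_pred_submod.

Record linmap := Linmap {
  linmap_val : pi_mod (fun _ : V => W);
  linmap_valP : linmap_val \in linear_pred }.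

HB.instance Definition _ := [isSub for linmap_val].
HB.instance Definition _ := [Choice of linmap by <:].
HB.instance Definition _ := [SubChoice_isSubLmodule of linmap by <:].

Definition linmap_fun (f : linmap) : V -> W := linmap_val f.
Coercion linmap_fun : linmap >-> Funclass.

Lemma linmapP (f : linmap) : linear (f : V -> W).
Proof. exact/asboolP/linmap_valP. Qed.

Lemma linmap_ext (f g : linmap) : (forall v, f v = g v) -> f = g.
Proof. by move=> fg; apply/val_inj/functional_extensionality_dep. Qed.

Definition mk_linmap (f : V -> W) (lf : linear f) : linmap :=
  @Linmap f (introT (asboolP _) lf).

End LinearMaps.

Program Definition Modk : lincat k :=
  @Lincat k (lmodType k) linmap
    (fun V => @mk_linmap V V id _)
    (fun U V W g f => @mk_linmap U W (fun u => g (f u)) _)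
    _ _ _ _ _.
Next Obligation. by []. Qed.
Next Obligation. by move=> a u v; rewrite !linmapP. Qed.
Next Obligation. by move=> a g h; apply: linmap_ext. Qed.
Next Obligation. by move=> a f h; apply: linmap_ext => v /=; rewrite linmapP. Qed.
Next Obligation. exact: linmap_ext. Qed.
Next Obligation. exact: linmap_ext. Qed.
Next Obligation. exact: linmap_ext. Qed.

End ModCategory.

Section FunctorSums.
Variables (k : comNzRingType) (C : lincat k).

Lemma dsum_map_proof (I : choiceType) (V W : I -> lmodType k)
    (phi : forall i, linmap (V i) (W i)) (f : direct_sum V) :
  ((fun i => phi i (f i)) : pi_mod W) \in @fin_supp k I W.
Proof.
have /asboolP[s sf] := dsum_valP f; apply/asboolP; exists s => i /sf fi0.
rewrite [f i]fi0; have := linmapP (phi i) (-1) 0 0.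
by rewrite scaler0 addr0 scaleN1r addNr.
Qed.

Program Definition functor_dsum (I : choiceType) (F : I -> functor C (Modk k)) :
    functor C (Modk k) :=
  @Functor k C (Modk k) (fun A => direct_sum (fun i => F i A))
    (fun A B f => @mk_linmap k _ _
       (fun s => DirectSum (dsum_map_proof (fun i => fmap (F i) f) s)) _)
    _ _ _.
Next Obligation.
move=> a u v; apply: val_inj; apply: functional_extensionality_dep => i /=.
exact: linmapP.
Qed.
Next Obligation.
move=> a f g; apply: linmap_ext => u; apply: val_inj.
apply: functional_extensionality_dep => i /=.
by rewrite fmap_linear.
Qed.
Next Obligation.
apply: linmap_ext => u; apply: val_inj.
by apply: functional_extensionality_dep => i /=; rewrite fmap1.
Qed.
Next Obligation.
apply: linmap_ext => u; apply: val_inj.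
by apply: functional_extensionality_dep => i /=; rewrite fmapM.
Qed.

(* [F^(+) n] *)
Definition functor_power (n : nat) (F : functor C (Modk k)) :=
  functor_dsum (fun _ : 'I_n => F).

Program Definition functor_add (F G : functor C (Modk k)) :
    functor C (Modk k) :=
  @Functor k C (Modk k) (fun A => (F A * G A)%type : lmodType k)
    (fun A B f => @mk_linmap k _ _
       (fun s : (F A * G A)%type => (fmap F f s.1, fmap G f s.2)) _)
    _ _ _.
Next Obligation. by move=> a u v /=; rewrite !linmapP. Qed.
Next Obligation. by move=> a f g; apply: linmap_ext => u /=; rewrite !fmap_linear. Qed.
Next Obligation. by apply: linmap_ext => -[u v] /=; rewrite !fmap1. Qed.
Next Obligation. by apply: linmap_ext => u /=; rewrite !fmapM. Qed.

End FunctorSums.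

(** ** The projective line *)

(* [k] being algebraically closed, the closed points of the projective line
   are [Some a], the zero of ['X - a], and [None], the point at infinity; the
   only other point is the generic one. *)
Definition P1 (k : closedFieldType) := option k.

Definition ratfun (k : closedFieldType) := {fraction {poly k}}.

(* The nonempty open subsets are the complements of the finite sets of closed
   points (they all contain the generic point).  The empty open set is left
   out: a sheaf has only the zero section over it, and, any two nonempty opens
   having a nonempty intersection, it occurs in no gluing condition. *)
Record open (k : closedFieldType) := Open { removed : {fset (P1 k)} }.

Section ProjectiveLine.
Variable k : closedFieldType.
Local Notation K := (ratfun k).
Local Notation "x %:F" := (tofrac x) : ring_scope.
Implicit Types (U V W : open k) (x : P1 k).

Definition mem_open x U : bool := x \notin removed U.
Definition sub_open V U : bool := (removed U `<=` removed V)%fset.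
Definition meet_open U V : open k := Open (removed U `|` removed V)%fset.
Definition whole : open k := Open fset0.

(* Every open subset other than the empty one and the whole line is affine. *)
Definition affine U : bool := removed U != fset0.

Lemma sub_open_mem V U x : sub_open V U -> mem_open x V -> mem_open x U.
Proof. by move=> /fsubsetP VU; apply: contra => /VU. Qed.

Lemma meet_openl U V : sub_open (meet_open U V) U.
Proof. exact: fsubsetUl. Qed.

Lemma meet_openr U V : sub_open (meet_open U V) V.
Proof. exact: fsubsetUr. Qed.

(* [inhabited I] says that the generic point is covered. *)
Definition open_cover U (I : Type) (V : I -> open k) : Prop :=
  inhabited I /\ (forall i, sub_open (V i) U) /\
  (forall x, mem_open x U -> exists i, mem_open x (V i)).

Definition regular_at x (f : K) : Prop :=
  match x with
  | Some a => exists p q : {poly k}, q.[a] != 0 /\ f = p%:F / q%:F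
  | None => exists p q : {poly k},
      q != 0 /\ (size p <= size q)%N /\ f = p%:F / q%:F
  end.

Lemma regular_at_const x (a : k) : regular_at x (a%:P)%:F.
Proof.
have E : (a%:P)%:F = (a%:P)%:F / (1%:P : {poly k})%:F :> K.
  by rewrite tofrac1 divr1.
case: x => [b|] /=; exists a%:P, 1%:P; first by rewrite hornerC oner_eq0.
by rewrite oner_eq0 size_poly1 size_polyC; split=> //; case: (a != 0).
Qed.

Lemma fracB (p q p' q' : {poly k}) : q != 0 -> q' != 0 ->
  p%:F / q%:F - p'%:F / q'%:F = (p * q' - p' * q)%:F / (q * q')%:F :> K.
Proof.
move=> q0 q0'; rewrite (tofracB (p * q')) (tofracM p) (tofracM p') (tofracM q).
have {}q0 : q%:F != 0 by rewrite tofrac_eq0.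
have {}q0' : q'%:F != 0 by rewrite tofrac_eq0.
by rewrite -(mulNr p'%:F) (addf_div _ _ q0 q0') mulNr.
Qed.

Lemma fracM (p q p' q' : {poly k}) :
  (p%:F / q%:F) * (p'%:F / q'%:F) = (p * p')%:F / (q * q')%:F :> K.
Proof. by rewrite (tofracM p) (tofracM q) mulf_div. Qed.

Lemma horner_neq0 (q : {poly k}) a : q.[a] != 0 -> q != 0.
Proof. by apply: contraNneq => ->; rewrite horner0. Qed.

Lemma size_mul_le (p q p' q' : {poly k}) : q != 0 -> q' != 0 ->
  (size p <= size q)%N -> (size p' <= size q')%N ->
  (size (p * p')%R <= size (q * q')%R)%N.
Proof.
move=> q0 q0' sp sp'; rewrite (size_mul q0 q0').
apply: leq_trans (size_polyMleq _ _) _.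
by rewrite -!subn1 leq_sub2r // leq_add.
Qed.

Lemma regular_atB x f g :
  regular_at x f -> regular_at x g -> regular_at x (f - g).
Proof.
case: x => [a|] /=.
  move=> [p [q [qa ->]]] [p' [q' [qa' ->]]].
  exists (p * q' - p' * q), (q * q'); split; first by rewrite hornerM mulf_neq0.
  by apply: fracB; [exact: horner_neq0 qa|exact: horner_neq0 qa'].
move=> [p [q [q0 [s ->]]]] [p' [q' [q0' [s' ->]]]].
exists (p * q' - p' * q), (q * q'); split; first by rewrite mulf_neq0.
split; last exact: fracB.
apply: leq_trans (size_polyD _ _) _; rewrite size_polyN geq_max.
by rewrite size_mul_le //= [q * q']mulrC size_mul_le.
Qed.

Lemma regular_atM x f g :
  regular_at x f -> regular_at x g -> regular_at x (f * g).
Proof.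
case: x => [a|] /=.
  move=> [p [q [qa ->]]] [p' [q' [qa' ->]]].
  exists (p * p'), (q * q'); split; first by rewrite hornerM mulf_neq0.
  exact: fracM.
move=> [p [q [q0 [s ->]]]] [p' [q' [q0' [s' ->]]]].
exists (p * p'), (q * q'); split; first by rewrite mulf_neq0.
by split; [exact: size_mul_le|exact: fracM].
Qed.

Definition regular_on U : {pred K} :=
  fun f => `[< forall x, mem_open x U -> regular_at x f >].

Lemma regular_on_subring U : subring_closed (regular_on U).
Proof.
split=> [|f g /asboolP rf /asboolP rg|f g /asboolP rf /asboolP rg];
  apply/asboolP => x xU.
- by have := regular_at_const x 1; rewrite tofrac1.
- exact: regular_atB (rf x xU) (rg x xU).
- exact: regular_atM (rf x xU) (rg x xU).
Qed.

HB.instance Definition _ U := GRing.isSubringClosed.Build K (regular_on U)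
  (regular_on_subring U).

(* The ring [O(U)] of sections of the structure sheaf over [U]. *)
Record regfun U := Regfun {
  regfun_val : K; regfun_valP : regfun_val \in regular_on U }.

HB.instance Definition _ U := [isSub for @regfun_val U].
HB.instance Definition _ U := [Choice of regfun U by <:].
HB.instance Definition _ U := [SubChoice_isSubComNzRing of regfun U by <:].

Lemma regfun_regular U (f : regfun U) x : mem_open x U -> regular_at x (val f).
Proof. by have /asboolP := regfun_valP f; apply. Qed.

Lemma regfun_res_proof U V (VU : sub_open V U) (f : regfun U) :
  val f \in regular_on V.
Proof.
by apply/asboolP => x xV; apply: regfun_regular; apply: sub_open_mem VU xV.
Qed.

Definition regfun_res U V (VU : sub_open V U) (f : regfun U) : regfun V :=
  Regfun (regfun_res_proof VU f).

Lemma regfun_const_proof U (a : k) : (a%:P)%:F \in regular_on U.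
Proof. by apply/asboolP => x _; apply: regular_at_const. Qed.

Definition regfun_const U (a : k) : regfun U := Regfun (regfun_const_proof U a).

Lemma regfun_const_is_zmod_morphism U : zmod_morphism (regfun_const U).
Proof. by move=> a b; apply: val_inj; rewrite /= polyCB tofracB. Qed.

Lemma regfun_const_is_monoid_morphism U : monoid_morphism (regfun_const U).
Proof.
split=> [|a b]; apply: val_inj; rewrite /= ?tofrac1 //.
by rewrite polyCM tofracM.
Qed.

HB.instance Definition _ U := GRing.isZmodMorphism.Build _ _ (regfun_const U)
  (regfun_const_is_zmod_morphism U).
HB.instance Definition _ U := GRing.isMonoidMorphism.Build _ _ (regfun_const U)
  (regfun_const_is_monoid_morphism U).

Lemma regfun_res_const U V (VU : sub_open V U) a :
  regfun_res VU (regfun_const U a) = regfun_const V a.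
Proof. exact: val_inj. Qed.

(* Restriction of scalars along [k -> O(U)]. *)
Section ScalarRestriction.
Variables (U : open k) (M : lmodType (regfun U)).

Definition kspace : Type := M.
HB.instance Definition _ := GRing.Zmodule.on kspace.

Program Definition kspace_lmodMixin :=
  @GRing.Zmodule_isLmodule.Build k kspace
    (fun a (m : M) => regfun_const U a *: m) _ _ _ _.
Next Obligation. by rewrite scalerA -rmorphM. Qed.
Next Obligation. by move=> m; rewrite rmorph1 scale1r. Qed.
Next Obligation. by move=> a m n; rewrite scalerDr. Qed.
Next Obligation. by move=> a b; rewrite rmorphD scalerDl. Qed.
HB.instance Definition _ := kspace_lmodMixin.

End ScalarRestriction.

(** ** Sheaves of modules over the structure sheaf *)

Record omod := Omod {
  sect :> forall U, lmodType (regfun U);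
  res : forall U V, sub_open V U -> sect U -> sect V;
  res_linear : forall U V (VU : sub_open V U) (a : regfun U) (m n : sect U),
    res VU (a *: m + n) = regfun_res VU a *: res VU m + res VU n;
  res_id : forall U (UU : sub_open U U) (m : sect U), res UU m = m;
  res_comp : forall U V W (VU : sub_open V U) (WV : sub_open W V)
    (WU : sub_open W U) (m : sect U), res WV (res VU m) = res WU m;
  sheaf_axiom : forall U (I : Type) (V : I -> open k)
      (VU : forall i, sub_open (V i) U), open_cover U V ->
    forall s : (forall i, sect (V i)),
      (forall i j, res (meet_openl (V i) (V j)) (s i) =
                   res (meet_openr (V i) (V j)) (s j)) ->
    exists! m : sect U, forall i, res (VU i) m = s i }.

Section Morphisms.
Variables M N : omod.

Definition omod_fun := pi_mod (fun U => pi_mod (fun _ : M U => kspace (N U))).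

Definition omod_app (f : omod_fun) U (m : M U) : N U := f U m.

Definition omod_hom_pred : {pred omod_fun} := fun f =>
  `[< (forall U, linear (@omod_app f U)) /\
      (forall U V (VU : sub_open V U) (m : M U),
         omod_app f (res VU m) = res VU (omod_app f m)) >].

Lemma omod_hom_submod : submod_closed omod_hom_pred.
Proof.
split=> [|c f g /asboolP[lf nf] /asboolP[lg ng]]; apply/asboolP; split.
- by move=> U a u v; change (0 = a *: (0 : N U) + 0); rewrite scaler0 addr0.
- move=> U V VU m; change (0 = res VU (0 : N U)).
  have := res_linear VU (-1) (0 : N U) 0.
  rewrite scaler0 addr0 (_ : regfun_res VU (-1) = -1) ?scaleN1r ?addNr //.
  exact: val_inj.
- move=> U a u v.
  change (regfun_const U c *: omod_app f (a *: u + v) + omod_app g (a *: u + v)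
   = a *: (regfun_const U c *: omod_app f u + omod_app g u)
     + (regfun_const U c *: omod_app f v + omod_app g v)).
  by rewrite lf lg !scalerDr !scalerA (mulrC a) addrACA.
- move=> U V VU m.
  change (regfun_const V c *: omod_app f (res VU m) + omod_app g (res VU m)
   = res VU (regfun_const U c *: omod_app f m + omod_app g m)).
  by rewrite res_linear nf ng regfun_res_const.
Qed.

HB.instance Definition _ := GRing.isSubmodClosed.Build k omod_fun omod_hom_pred
  omod_hom_submod.

Record omod_hom := OmodHom {
  omod_hom_val : omod_fun; omod_hom_valP : omod_hom_val \in omod_hom_pred }.

HB.instance Definition _ := [isSub for omod_hom_val].
HB.instance Definition _ := [Choice of omod_hom by <:].
HB.instance Definition _ := [SubChoice_isSubLmodule of omod_hom by <:].

Definition omod_hom_fun (f : omod_hom) : forall U, M U -> N U :=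
  omod_app (omod_hom_val f).
Coercion omod_hom_fun : omod_hom >-> Funclass.

Lemma omod_homP (f : omod_hom) U : linear (f U).
Proof. by have /asboolP[] := omod_hom_valP f. Qed.

Lemma omod_hom_res (f : omod_hom) U V (VU : sub_open V U) (m : M U) :
  f V (res VU m) = res VU (f U m).
Proof. by have /asboolP[_] := omod_hom_valP f; apply. Qed.

Lemma omod_hom_ext (f g : omod_hom) : (forall U m, f U m = g U m) -> f = g.
Proof.
move=> fg; apply: val_inj; apply: functional_extensionality_dep => U.
by apply: functional_extensionality_dep => m; apply: fg.
Qed.

Definition mk_omod_hom (f : forall U, M U -> N U) (lf : forall U, linear (f U))
    (nf : forall U V (VU : sub_open V U) (m : M U),
       f V (res VU m) = res VU (f U m)) : omod_hom :=
  @OmodHom f (introT (asboolP _) (conj lf nf)).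

End Morphisms.

Program Definition OMod : lincat k :=
  @Lincat k omod omod_hom
    (fun M => @mk_omod_hom M M (fun U m => m) _ _)
    (fun M N P g f => @mk_omod_hom M P (fun U m => g U (f U m)) _ _)
    _ _ _ _ _.
Next Obligation. by []. Qed.
Next Obligation. by move=> a u v; rewrite !omod_homP. Qed.
Next Obligation. by rewrite !omod_hom_res. Qed.
Next Obligation. by move=> a g h; apply: omod_hom_ext. Qed.
Next Obligation.
by move=> a f h; apply: omod_hom_ext => U m /=; rewrite [LHS]omod_homP.
Qed.
Next Obligation. exact: omod_hom_ext. Qed.
Next Obligation. exact: omod_hom_ext. Qed.
Next Obligation. exact: omod_hom_ext. Qed.

Definition locally_in_image (M N : omod) (f : omod_hom M N) U (n : N U) : Prop :=
  exists (I : Type) (V : I -> open k) (VU : forall i, sub_open (V i) U),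
    open_cover U V /\ forall i, exists m : M (V i), f (V i) m = res (VU i) n.

Definition sheaf_mono (M N : omod) (f : omod_hom M N) : Prop :=
  forall U, injective (f U).

Definition sheaf_epi (M N : omod) (f : omod_hom M N) : Prop :=
  forall U (n : N U), locally_in_image f n.

Definition sheaf_exact (M N P : omod) (f : omod_hom M N) (g : omod_hom N P) :
    Prop :=
  forall U (n : N U), g U n = 0 <-> locally_in_image f n.

Definition injective_omod (J : omod) : Prop :=
  forall (M N : omod) (j : omod_hom M N) (u : omod_hom M J), sheaf_mono j ->
    exists v : omod_hom N J, forall U m, v U (j U m) = u U m.

(* [V] is the locus in [U] where [f] does not vanish: the sections over [V]
   are the localization at [f] of the sections over [U].  (For [f = 0] this
   locus is empty.) *)
Definition quasi_coherent (M : omod) : Prop :=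
  forall U V (VU : sub_open V U) (f : regfun U), affine U -> f != 0 ->
    (forall x, mem_open x V <-> mem_open x U /\ regular_at x (val f)^-1) ->
    (forall m : M U, res VU m = 0 -> exists n, f ^+ n *: m = 0) /\
    (forall s : M V, exists (n : nat) (m : M U),
       res VU m = regfun_res VU f ^+ n *: s).

Record qcoh := QcohOb {
  qcoh_sheaf :> omod; qcohP : quasi_coherent qcoh_sheaf }.

Definition Qcoh : lincat k :=
  @Lincat k qcoh (fun M N => omod_hom M N : lmodType k)
    (fun M => @idm k OMod M) (fun M N P => @comp k OMod M N P)
    (fun M N P => @comp_linearl k OMod M N P)
    (fun M N P => @comp_linearr k OMod M N P)
    (fun M N => @comp1m k OMod M N) (fun M N => @compm1 k OMod M N)
    (fun M N P Q => @compmA k OMod M N P Q).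

(* The projective line is noetherian, so that coherent means quasi-coherent and
   of finite type. *)
Definition coherent (M : qcoh) : Prop :=
  forall U, affine U -> finitely_generated (M U).

Definition torsion (M : qcoh) : Prop :=
  forall U, affine U -> forall m : M U, exists f : regfun U,
    f != 0 /\ f *: m = 0.

(** ** Twisting sheaves, tensor products, cohomology *)

(* The rational functions, as a module over the regular functions on [U]. *)
Definition ratmod U : Type := K.
HB.instance Definition _ U := GRing.Zmodule.on (ratmod U).

Section RationalFunctions.
Variable U : open k.

Program Definition ratmod_lmodMixin :=
  @GRing.Zmodule_isLmodule.Build (regfun U) (ratmod U)
    (fun a (f : K) => (val a * f : K)) _ _ _ _.
Next Obligation. by rewrite mulrA. Qed.
Next Obligation. by move=> f; rewrite mul1r. Qed.
Next Obligation. by move=> a f g; rewrite mulrDr. Qed.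
Next Obligation. by move=> a b; rewrite mulrDl. Qed.
HB.instance Definition _ := ratmod_lmodMixin.

End RationalFunctions.

Section Twist.
Variable i : int.

(* The sheaf [O(i)], as the sheaf of the divisor [i * infinity]: a section
   [F(x0, x1)] homogeneous of degree [i] is identified with the rational
   function [F(x0, x1) / x1 ^ i] of ['X = x0 / x1]; at infinity, [O(i)] is
   generated by ['X ^ i]. *)
Definition twist_at x (f : K) : Prop :=
  match x with
  | Some _ => regular_at x f
  | None => regular_at x ('X%:F ^ (- i) * f)
  end.

Definition twist_on U : {pred ratmod U} :=
  fun f => `[< forall x, mem_open x U -> twist_at x f >].
Arguments twist_on : clear implicits.

Lemma regular_at0 x : regular_at x 0.
Proof. by have := regular_at_const x 0; rewrite tofrac0. Qed.

Lemma regular_at_lin x a f g :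
  regular_at x a -> regular_at x f -> regular_at x g -> regular_at x (a * f + g).
Proof.
move=> ra rf rg; rewrite -[g]opprK; apply: regular_atB.
  exact: regular_atM.
by rewrite -[- g]add0r; apply: regular_atB => //; apply: regular_at0.
Qed.

Lemma twist_on_submod U : submod_closed (twist_on U).
Proof.
split=> [|a f g /asboolP rf /asboolP rg]; apply/asboolP => x xU.
  by case: x xU => [b|] _; rewrite /twist_at ?mulr0; apply: regular_at0.
change (twist_at x (val a * f + g)).
have ra := regfun_regular a xU; have := rf x xU; have := rg x xU.
case: x {xU} ra => [b|] ra rgx rfx; first exact: regular_at_lin ra rfx rgx.
change (regular_at None ('X%:F ^ (- i) * (val a * (f : K) + (g : K)))).
by rewrite mulrDr mulrCA; apply: regular_at_lin ra rfx rgx.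
Qed.

HB.instance Definition _ U := GRing.isSubmodClosed.Build (regfun U) (ratmod U)
  (twist_on U) (twist_on_submod U).

Record twist_sect U := TwistSect {
  twist_val : ratmod U; twist_valP : twist_val \in twist_on U }.

HB.instance Definition _ U := [isSub for @twist_val U].
HB.instance Definition _ U := [Choice of twist_sect U by <:].
HB.instance Definition _ U := [SubChoice_isSubLmodule of twist_sect U by <:].

Lemma twist_res_proof U V (VU : sub_open V U) (f : twist_sect U) :
  (twist_val f : ratmod V) \in twist_on V.
Proof.
apply/asboolP => x xV; have /asboolP := twist_valP f; apply.
exact: sub_open_mem VU xV.
Qed.

Definition twist_res U V (VU : sub_open V U) (f : twist_sect U) :
  twist_sect V := TwistSect (twist_res_proof VU f).

Lemma twist_sheaf_axiom U (I : Type) (V : I -> open k)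
    (VU : forall j, sub_open (V j) U) : open_cover U V ->
  forall s : (forall j, twist_sect (V j)),
    (forall j l, twist_res (meet_openl (V j) (V l)) (s j) =
                 twist_res (meet_openr (V j) (V l)) (s l)) ->
  exists! m : twist_sect U, forall j, twist_res (VU j) m = s j.
Proof.
move=> [[j0] [_ cov]] s agree.
have E j l : twist_val (s j) = twist_val (s l) :> K.
  exact: (congr1 (fun u => twist_val u : K) (agree j l)).
have P : (twist_val (s j0) : ratmod U) \in twist_on U.
  apply/asboolP => x /cov[j xj]; rewrite (E j0 j).
  by have /asboolP := twist_valP (s j); apply.
exists (TwistSect P); split=> [j|m sm]; apply: val_inj; first exact: E.
exact: (esym (congr1 (fun u => twist_val u : K) (sm j0))).
Qed.

Program Definition twist : omod :=
  @Omod (fun U => twist_sect U) twist_res _ _ _ _.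
Next Obligation. exact: val_inj. Qed.
Next Obligation. exact: val_inj. Qed.
Next Obligation. exact: val_inj. Qed.
Next Obligation. exact: twist_sheaf_axiom. Qed.

End Twist.

Record bilinear_map (M N P : omod) := BilinearMap {
  bil_fun :> forall U, M U -> N U -> P U;
  bil_linearl : forall U (n : N U), linear (fun m : M U => bil_fun m n);
  bil_linearr : forall U (m : M U), linear (fun n : N U => bil_fun m n);
  bil_res : forall U V (VU : sub_open V U) (m : M U) (n : N U),
    bil_fun (res VU m) (res VU n) = res VU (bil_fun m n) }.

(* The functor [- (x) N], given by the universal property of the tensor
   product of sheaves of modules, which determines it up to a unique
   isomorphism. *)
Record tensor_functor (N : omod) := TensorFunctor {
  tens :> functor Qcoh Qcoh;
  tens_bil : forall M : qcoh, bilinear_map M N (tens M : qcoh);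
  tens_natural : forall (M M' : qcoh) (f : omod_hom M M') U (m : M U) (n : N U),
    (fmap tens (f : @hom k Qcoh M M') : omod_hom _ _) U (tens_bil M U m n) =
    tens_bil M' U (f U m) n;
  tens_univ : forall (M : qcoh) (P : omod) (b : bilinear_map M N P),
    exists! h : omod_hom (tens M : qcoh) P,
      forall U (m : M U) (n : N U), h U (tens_bil M U m n) = b U m n }.

Definition global (M : omod) : lmodType k := kspace (M whole).

Program Definition global_map (M N : omod) (f : omod_hom M N) :
    linmap (global M) (global N) :=
  @mk_linmap k (global M) (global N) (f whole) _.
Next Obligation. by move=> a m n; apply: omod_homP. Qed.

Program Definition H0 : functor Qcoh (Modk k) :=
  @Functor k Qcoh (Modk k) global global_map _ _ _.
Next Obligation. by move=> a f g; apply: linmap_ext. Qed.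
Next Obligation. exact: linmap_ext. Qed.
Next Obligation. exact: linmap_ext. Qed.

(* An exact sequence [0 -> M -> J -> Q -> 0] of sheaves of modules with [J]
   injective. *)
Record injective_embedding (M : omod) := InjectiveEmbedding {
  ie_inj : omod;
  ie_quo : omod;
  ie_in : omod_hom M ie_inj;
  ie_out : omod_hom ie_inj ie_quo;
  ie_injective : injective_omod ie_inj;
  ie_mono : sheaf_mono ie_in;
  ie_exact : sheaf_exact ie_in ie_out;
  ie_epi : sheaf_epi ie_out }.

(* The first right derived functor of the global sections of sheaves of
   modules, restricted to the quasi-coherent ones: its value at [M] is the
   cokernel of [Gamma J -> Gamma Q] for every [0 -> M -> J -> Q -> 0] as
   above, naturally in the sequence.  As there are enough injectives, this
   determines the functor up to a unique isomorphism compatible with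
   [delta]. *)
Record first_cohomology := FirstCohomology {
  H1 :> functor Qcoh (Modk k);
  delta : forall (M : qcoh) (S : injective_embedding M),
    linmap (global (ie_quo S)) (H1 M);
  delta_surj : forall (M : qcoh) (S : injective_embedding M)
    (h : H1 M : lmodType k), exists q, delta S q = h;
  delta_ker : forall (M : qcoh) (S : injective_embedding M)
    (q : global (ie_quo S)),
    delta S q = 0 <-> exists j, global_map (ie_out S) j = q;
  delta_natural : forall (M M' : qcoh) (S : injective_embedding M)
    (S' : injective_embedding M') (u : omod_hom M M')
    (v : omod_hom (ie_inj S) (ie_inj S')) (w : omod_hom (ie_quo S) (ie_quo S')),
    (forall U m, v U (ie_in S U m) = ie_in S' U (u U m)) ->
    (forall U j, w U (ie_out S U j) = ie_out S' U (v U j)) ->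
    forall q, (fmap H1 (u : @hom k Qcoh M M') : linmap _ _) (delta S q) =
              delta S' (global_map w q) }.

(** ** Properties of functors from quasi-coherent sheaves to vector spaces *)

Definition right_exact (F : functor Qcoh (Modk k)) : Prop :=
  forall (A B C : qcoh) (f : omod_hom A B) (g : omod_hom B C),
    sheaf_exact f g -> sheaf_epi g ->
    let Ff : linmap (F A) (F B) := fmap F (f : @hom k Qcoh A B) in
    let Fg : linmap (F B) (F C) := fmap F (g : @hom k Qcoh B C) in
    (forall c, exists b, Fg b = c) /\
    (forall b, Fg b = 0 <-> exists a, Ff a = b).

Definition preserves_coherence (F : functor Qcoh (Modk k)) : Prop :=
  forall M : qcoh, coherent M -> finitely_generated (F M : lmodType k).

End ProjectiveLine.

(* Main.v *)
(* A right exact functor [F] preserving direct sums is determined by its values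
   [N n = F (O(n))] as a graded module: every quasi-coherent sheaf has a
   presentation by direct sums of twisting sheaves, and if a natural
   transformation between two such functors is bijective on all [O(n)], then it
   is an isomorphism.  The Koszul sequence [0 -> O(n) -> O(n+1)^2 -> O(n+2) -> 0]
   shows moreover that bijectivity propagates downwards in [n], up to the socle
   of [N] (the elements killed by both homogeneous coordinates).

   As [N n] is finite dimensional, a dimension count gives a point [c] such that
   [l = x0 - c x1] acts surjectively on [N]; hence [l] acts bijectively on [N n]
   for [n >= n0].  The coordinate [x1 / l] of the complement of [c] then acts on
   [N n0] by a matrix [Z], and the torsion sheaf is the cokernel of
   [x1 / l - Z] on the complement of [c].  The socle element [v] in degree
   [- i - 2] provides a map from [H^1(- (i))]: dividing [v] repeatedly by the
   coordinates, which the Koszul sequence allows, gives a compatible system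
   of elements of [F (O(- i - 2a))], that is a natural map from the sections over
   the torus to [F], and this map kills the coboundaries.  The sum of these maps over
   bases of the socles and of the map from the torsion part is bijective on
   [O(n)] for [n >= n0] and on the socles below [n0]. *)

From HB Require Import structures.
From mathcomp Require Import all_boot all_order all_algebra.
From mathcomp Require Import finmap.
From mathcomp Require Import boolp.
From mathcomp Require Import ring zify.
Require Import Defs.

Set Implicit Arguments.
Unset Strict Implicit.
Unset Printing Implicit Defensive.

Import GRing.Theory Num.Theory Order.TTheory.
Local Open Scope ring_scope.

(** * Linear relations and quotient modules *)

(** The models of cohomology and of tensor products may be chosen, and they are chosen as cokernels
    of natural maps between sections over affine opens: the two-chart Cech quotient, twisted by
    ['X ^ i], for H^1(-(i)), and the cokernel of z - Z on M(C)^d for H^0(- tensor T). Sections over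
    an affine open are exact and commute with direct sums, so these cokernels are right exact and
    preserve sums. Moreover M(V) is the colimit of Hom(O(n - a e), M) along the powers of a form of
    degree e cutting out the complement of V. By Yoneda, a natural map from M(V) to F(M) is a
    sequence of elements of F(O(n - a e)), each the multiple of the next by the form. The obstacle
    is that F is only right exact: Koszul lifts exist, but are unique only up to the socle, so
    divisible systems have to be built by successive choices. Finite dimension gives c, because a
    chain of images in N 0 cannot decrease strictly more often than the dimension of N 0, and gives
    n0, because the nonincreasing dimensions of N n stabilise. *)

Lemma linear_of_relation (R : nzRingType) (V W : lmodType R)
    (r : V -> W -> Prop) :
  (forall v, exists w, r v w) -> (forall w, r 0 w -> w = 0) ->
  (forall a v w v' w', r v w -> r v' w' -> r (a *: v + v') (a *: w + w')) ->
  exists f : V -> W, linear f /\ forall v w, r v w <-> w = f v.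
Proof.
move=> tot fun0 lin; have [f fP] := choice tot.
(* Two values at the same argument differ by a value at 0, so single-valuedness is tested at 0
   only. *)
have uniq v w w' : r v w -> r v w' -> w = w'.
  move=> vw vw'; apply/subr0_eq/fun0.
  have := lin (-1) v w' v w vw' vw.
  by rewrite !scaleN1r addNr addrC.
exists f; split=> [a u v|v w]; last by split=> [vw|->]; [exact: uniq vw _|].
exact: uniq (fP _) (lin _ _ _ _ _ (fP u) (fP v)).
Qed.

Section Quotient.
Variables (R : nzRingType) (V : lmodType R).

Record submodule := Submodule {
  in_sub :> V -> Prop;
  in_sub0 : in_sub 0;
  in_subL : forall a u v, in_sub u -> in_sub v -> in_sub (a *: u + v) }.

Variable S : submodule.

Lemma in_subD u v : S u -> S v -> S (u + v).
Proof. by move=> Su Sv; rewrite -[u]scale1r; apply: in_subL. Qed.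

Lemma in_subZ a u : S u -> S (a *: u).
Proof. by move=> Su; rewrite -[_ *: _]addr0; apply: in_subL (in_sub0 S). Qed.

Lemma in_subN u : S u -> S (- u).
Proof. by rewrite -scaleN1r; apply: in_subZ. Qed.

(** A class is kept as the predicate of membership in it, so that extensionality turns congruence
    into equality of elements. *)
Record quotient := Quotient {
  coset : V -> Prop;
  cosetP : exists v, coset = (fun u => S (u - v)) }.

HB.instance Definition _ := gen_eqMixin quotient.
HB.instance Definition _ := gen_choiceMixin quotient.

Definition quot_pi v : quotient := Quotient (ex_intro _ v (erefl _)).
Definition quot_repr (q : quotient) : V := projT1 (cid (cosetP q)).

Lemma quot_reprK q : quot_pi (quot_repr q) = q.
Proof.
case: q => C ex; rewrite /quot_repr /=; case: cid => v /= eC.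
by rewrite /quot_pi; move: ex; rewrite eC => ex; congr Quotient; apply: Prop_irrelevance.
Qed.

Lemma quot_piP u v : quot_pi u = quot_pi v <-> S (u - v).
Proof.
split=> [[]|Suv].
  by move=> /(congr1 (fun P => P u)) <-; rewrite subrr; apply: in_sub0.
have E : (fun w => S (w - u)) = (fun w => S (w - v)).
  apply: funext => w; apply: propext; split=> Sw.
    by rewrite -(subrK u w) -addrA; apply: in_subD.
  by rewrite -(subrK v w) -addrA -[v - u]opprB; apply/in_subD/in_subN.
rewrite /quot_pi; move: (ex_intro _ u _) (ex_intro _ v _); rewrite E => e e'.
by congr Quotient; apply: Prop_irrelevance.
Qed.

Lemma quot_repr_pi v : S (quot_repr (quot_pi v) - v).
Proof. by apply/quot_piP; rewrite quot_reprK. Qed.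

Definition quot_add p q := quot_pi (quot_repr p + quot_repr q).
Definition quot_opp p := quot_pi (- quot_repr p).
Definition quot_scale a p := quot_pi (a *: quot_repr p).

Lemma quot_piD u v : quot_pi (u + v) = quot_add (quot_pi u) (quot_pi v).
Proof.
apply/quot_piP; rewrite -[_ - _]opprB; apply: in_subN.
by rewrite opprD addrACA; apply: in_subD; apply: quot_repr_pi.
Qed.

Lemma quot_piN u : quot_pi (- u) = quot_opp (quot_pi u).
Proof. by apply/quot_piP; rewrite opprK addrC; apply: quot_repr_pi. Qed.

Lemma quot_piZ a u : quot_pi (a *: u) = quot_scale a (quot_pi u).
Proof.
apply/quot_piP; rewrite -scalerBr; apply: in_subZ.
by rewrite -opprB; apply/in_subN/quot_repr_pi.
Qed.

Lemma quot_ind (P : quotient -> Prop) : (forall v, P (quot_pi v)) -> forall q, P q.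
Proof. by move=> Pv q; rewrite -(quot_reprK q). Qed.

Fact quot_addA : associative quot_add.
Proof.
by elim/quot_ind=> u; elim/quot_ind=> v; elim/quot_ind=> w; rewrite -!quot_piD addrA.
Qed.
Fact quot_addC : commutative quot_add.
Proof. by elim/quot_ind=> u; elim/quot_ind=> v; rewrite -!quot_piD addrC. Qed.
Fact quot_add0 : left_id (quot_pi 0) quot_add.
Proof. by elim/quot_ind=> u; rewrite -quot_piD add0r. Qed.
Fact quot_addN : left_inverse (quot_pi 0) quot_opp quot_add.
Proof. by elim/quot_ind=> u; rewrite -quot_piN -quot_piD addNr. Qed.

HB.instance Definition _ := GRing.isZmodule.Build quotient
  quot_addA quot_addC quot_add0 quot_addN.

Fact quot_scaleA a b v : quot_scale a (quot_scale b v) = quot_scale (a * b) v.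
Proof. by elim/quot_ind: v => u; rewrite -!quot_piZ scalerA. Qed.
Fact quot_scale1 : left_id 1 quot_scale.
Proof. by elim/quot_ind=> u; rewrite -quot_piZ scale1r. Qed.
Fact quot_scaleDr : right_distributive quot_scale +%R.
Proof.
move=> a; elim/quot_ind=> u; elim/quot_ind=> v.
by rewrite -[_ + _]quot_piD -!quot_piZ -[RHS]quot_piD scalerDr.
Qed.
Fact quot_scaleDl v : {morph quot_scale^~ v : a b / a + b}.
Proof.
move=> a b; elim/quot_ind: v => u.
by rewrite -!quot_piZ -[RHS]quot_piD scalerDl.
Qed.

HB.instance Definition _ := GRing.Zmodule_isLmodule.Build R quotient
  quot_scaleA quot_scale1 quot_scaleDr quot_scaleDl.

Fact quot_pi_linear : linear quot_pi.
Proof. by move=> a u v; rewrite quot_piD quot_piZ. Qed.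

HB.instance Definition _ := GRing.isLinear.Build R V quotient *:%R quot_pi
  quot_pi_linear.

Lemma quot_pi0 v : quot_pi v = 0 <-> S v.
Proof. by rewrite -[0](linear0 quot_pi) quot_piP subr0. Qed.

End Quotient.

(** * Rational functions *)

(** The order computation at a finite point a: u is ['X - a], and m and l are the multiplicities of
    a in numerator and denominator. *)
Lemma pole_quotient (F : fieldType) (p q u : F) (m l : nat) :
  p != 0 -> q != 0 -> u != 0 ->
  p * u ^+ m / (q * u ^+ l) * u ^ (- (m%:Z - l%:Z)) = p / q /\
  (p * u ^+ m / (q * u ^+ l))^-1 * u ^ (m%:Z - l%:Z) = q / p.
Proof.
move=> p0 q0 u0; rewrite opprB !expfzDr // -!exprnP -!exprnN.
have um := expf_neq0 m u0; have ul := expf_neq0 l u0.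
by split; field; rewrite ?p0 ?q0 ?um ?ul.
Qed.

Lemma pole_quotient_inf (F : fieldType) (p q u : F) (m l : nat) :
  p != 0 -> q != 0 -> u != 0 ->
  p / q * u^-1 ^ (- (l%:Z - m%:Z)) = (p * u ^+ l) / (q * u ^+ m) /\
  (p / q)^-1 * u^-1 ^ (l%:Z - m%:Z) = (q * u ^+ m) / (p * u ^+ l).
Proof.
move=> p0 q0 u0; rewrite !exprz_inv opprK opprB !expfzDr // -!exprnP -!exprnN.
have um := expf_neq0 m u0; have ul := expf_neq0 l u0.
by split; field; rewrite ?p0 ?q0 ?um ?ul.
Qed.

Section RationalFunctions.
Variable k : closedFieldType.
Local Notation K := (ratfun k).
Local Notation "x %:F" := (tofrac x) : ring_scope.
Implicit Types (x y : P1 k) (f g : K) (p q : {poly k}).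

Local Arguments regular_at : simpl never.

(** The linear form x0 - a x1 vanishing at x, dehomogenised by x1 = 1; for the point at infinity the
    form is x1 itself, hence the constant 1. *)
Definition lform x : {poly k} := if x is Some a then 'X - a%:P else 1.
Definition lin x : K := (lform x)%:F.
(* generator of the stalk of [O(1)] at [x] *)
Definition gen1 x : K := if x is Some _ then 1 else 'X%:F.

Lemma frac_repr f : exists p q, q != 0 /\ f = p%:F / q%:F.
Proof.
elim/quotW: f => r; exists (\n_r), (\d_r); split; first exact: denom_ratioP.
have d0 : (\d_r)%:F != 0 :> K by rewrite tofrac_eq0 denom_ratioP.
apply: (mulIf d0); rewrite divfK //.
rewrite /tofrac; unlock FracField.tofrac; rewrite -[LHS]FracField.pi_mul.
apply/eqmodP; rewrite /= FracField.equivfE /FracField.mulf.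
by rewrite !numden_Ratio ?oner_eq0 ?mulr1 ?mulf_neq0 ?oner_eq0 ?denom_ratioP // mulrC.
Qed.

Lemma frac_coprime f : exists p q, q != 0 /\ coprimep p q /\ f = p%:F / q%:F.
Proof.
have [p [q [q0 ->]]] := frac_repr f.
have d0 : gcdp p q != 0 by rewrite gcdp_eq0 negb_and q0 orbT.
have Ep := divpK (dvdp_gcdl p q); have Eq := divpK (dvdp_gcdr p q).
have q'0 : q %/ gcdp p q != 0 by apply: contraNneq q0 => q'0; rewrite -Eq q'0 mul0r.
exists (p %/ gcdp p q), (q %/ gcdp p q); split=> //; split.
  by apply: coprimep_div_gcd; rewrite q0 orbT.
apply/eqP; rewrite eqr_div ?tofrac_eq0 // -!tofracM tofrac_eq.
by rewrite -[X in X * _ == _]Ep -[X in _ == _ * X]Eq -mulrA [gcdp p q * _]mulrC.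
Qed.

Lemma X_neq0 : 'X%:F != 0 :> K.
Proof. by rewrite tofrac_eq0 polyX_eq0. Qed.

Lemma lform_neq0 x : lform x != 0.
Proof. by case: x => [a|] /=; rewrite ?polyXsubC_eq0 ?oner_eq0. Qed.

Lemma lin_neq0 x : lin x != 0.
Proof. by rewrite tofrac_eq0 lform_neq0. Qed.

Lemma gen1_neq0 x : gen1 x != 0.
Proof. by case: x => [a|] /=; rewrite ?oner_eq0 ?X_neq0. Qed.

(** A local parameter at x: ['X - a] at a finite point, [1 / 'X] at infinity. *)
Definition uni x : K := lin x / gen1 x.

Lemma uni_neq0 x : uni x != 0.
Proof. exact: mulf_neq0 (lin_neq0 x) (invr_neq0 (gen1_neq0 x)). Qed.

Lemma regular_atC x a : regular_at x (a%:P)%:F.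
Proof. exact: regular_at_const. Qed.

Lemma regular_at1 x : regular_at x 1.
Proof. by have := regular_atC x 1; rewrite tofrac1. Qed.

Lemma regular_atN x f : regular_at x f -> regular_at x (- f).
Proof. by move=> rf; rewrite -sub0r; apply: regular_atB => //; apply: regular_at0. Qed.

Lemma regular_atD x f g :
  regular_at x f -> regular_at x g -> regular_at x (f + g).
Proof. by move=> rf rg; rewrite -[g]opprK; apply/regular_atB/regular_atN. Qed.

Lemma regular_atX x f n : regular_at x f -> regular_at x (f ^+ n).
Proof.
move=> rf; elim: n => [|n IHn]; first exact: regular_at1.
by rewrite exprS; apply: regular_atM.
Qed.

Lemma regular_at_prod x (I : eqType) (r : seq I) (F : I -> K) :
  (forall i, i \in r -> regular_at x (F i)) -> regular_at x (\prod_(i <- r) F i).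
Proof.
elim: r => [|i r IHr] rF; first by rewrite big_nil; apply: regular_at1.
rewrite big_cons; apply: regular_atM; first by apply: rF; rewrite mem_head.
by apply: IHr => j jr; apply: rF; rewrite inE jr orbT.
Qed.

Lemma regular_at_poly a p : regular_at (Some a) p%:F.
Proof. by exists p, 1; rewrite hornerC oner_eq0 tofrac1 divr1. Qed.

Lemma regular_at_lin x y : regular_at x (lin y / gen1 x).
Proof.
case: x => [a|]; first by rewrite divr1; apply: regular_at_poly.
exists (lform y), 'X; rewrite polyX_eq0 size_polyX; split=> //; split=> //.
by case: y => [b|]; rewrite /= ?size_XsubC ?size_poly1.
Qed.

Lemma regular_at_lin_inv x y : y != x -> regular_at x (gen1 x / lin y).
Proof.
case: x => [a|].
  case: y => [b|] yx; last by rewrite /lin /= tofrac1 divr1; apply: regular_at1.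
  exists 1, ('X - b%:P); rewrite tofrac1 hornerXsubC subr_eq0; split=> //.
  by apply: contraNneq yx => ->.
case: y => [b|] // _; exists 'X, ('X - b%:P); rewrite polyXsubC_eq0.
by rewrite size_polyX size_XsubC.
Qed.

Lemma frac_eqE p q f : q != 0 -> (f == p%:F / q%:F) = (f * q%:F == p%:F).
Proof.
move=> q0; have q0' : q%:F != 0 :> K by rewrite tofrac_eq0.
by rewrite -(inj_eq (mulIf q0')) divfK.
Qed.

Lemma not_regular_at_lin_inv x : ~ regular_at x (gen1 x / lin x).
Proof.
case: x => [a|] /=.
  move=> [p [q [qa /eqP]]]; rewrite frac_eqE ?(horner_neq0 qa) //.
  rewrite mulrAC -[lin _]/(('X - a%:P)%:F) mul1r => /eqP E.
  have {}E : q = p * ('X - a%:P).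
    by apply/eqP; rewrite -tofrac_eq tofracM -E divfK ?tofrac_eq0 ?polyXsubC_eq0.
  by move: qa; rewrite E hornerM hornerXsubC subrr mulr0 eqxx.
rewrite /lin /= tofrac1 divr1 => -[p [q [q0 [s /eqP]]]].
rewrite frac_eqE // -tofracM tofrac_eq => /eqP E.
by move: s; rewrite -E mulrC size_mulX // ltnn.
Qed.

(** The integer n is the order of f at x: the two conditions together say that f is [uni x ^ n]
    times a unit of the local ring. *)
Lemma uniformizer x f : f != 0 -> exists n : int,
  regular_at x (f * uni x ^ (- n)) /\
  regular_at x (f^-1 * uni x ^ n).
Proof.
move=> f0; have [p [q [q0 Ef]]] := frac_repr f.
have p0 : p != 0 by apply: contraNneq f0 => p0; rewrite Ef p0 tofrac0 mul0r.
case: x => [a|].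
  have [m [p' p'a Ep]] := multiplicity_XsubC p a.
  have [l [q' q'a Eq]] := multiplicity_XsubC q a.
  rewrite p0 /= rootE in p'a; rewrite q0 /= rootE in q'a.
  have u0 : ('X - a%:P)%:F != 0 :> K by rewrite tofrac_eq0 polyXsubC_eq0.
  have p'0 : p'%:F != 0 :> K by rewrite tofrac_eq0 (horner_neq0 p'a).
  have q'0 : q'%:F != 0 :> K by rewrite tofrac_eq0 (horner_neq0 q'a).
  exists (m%:Z - l%:Z); rewrite /uni /gen1 divr1 Ef Ep Eq !tofracM !tofracXn.
  have [-> ->] := pole_quotient m l p'0 q'0 u0.
  by split; [exists p', q'|exists q', p'].
(* At infinity the order is deg q - deg p; padding p and q by powers of ['X] to a common size makes
   both quotients visibly regular. *)
exists ((size q)%:Z - (size p)%:Z); rewrite /uni /lin /lform /gen1 tofrac1 div1r.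
have P0 : p%:F != 0 :> K by rewrite tofrac_eq0.
have Q0 : q%:F != 0 :> K by rewrite tofrac_eq0.
have sz (r s : {poly k}) : r != 0 -> size (r * 'X^(size s)) = (size r + size s)%N.
  by move=> r0; rewrite size_mulXn // addnC.
rewrite Ef.
have [-> ->] := pole_quotient_inf (size p) (size q) P0 Q0 X_neq0.
rewrite -!tofracXn -!tofracM.
split; [exists (p * 'X^(size q)), (q * 'X^(size p))
       |exists (q * 'X^(size p)), (p * 'X^(size q))];
  by rewrite mulf_neq0 ?expf_neq0 ?polyX_eq0 // !sz // addnC.
Qed.

Lemma regular_at_pole x f : exists n : nat,
  forall m, (n <= m)%N -> regular_at x (f * uni x ^+ m).
Proof.
have [->|f0] := eqVneq f 0; first by exists 0 => m _; rewrite mul0r; apply: regular_at0.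
have u0 := uni_neq0 x.
have [n [rf _]] := uniformizer x f0; exists `|n|%N => m nm.
have -> : uni x ^+ m = uni x ^ (- n) * uni x ^+ `|(m%:Z + n)%R|%N.
  by rewrite !exprnP -expfzDr //; congr (_ ^ _); lia.
by rewrite mulrA; apply/regular_atM/regular_atX/regular_at_lin.
Qed.

(** For nonzero f the order is at least 1, as otherwise the inverse of f would be regular; one
    factor [uni x] can then be removed. *)
Lemma regular_at_vanish x f : regular_at x f -> ~ regular_at x f^-1 ->
  regular_at x (f * (uni x)^-1).
Proof.
have [->|f0] := eqVneq f 0; first by rewrite mul0r.
have u0 := uni_neq0 x.
have [n [rf rfV]] := uniformizer x f0.
have [n1 _ _|n1 _] := boolP (1 <= n).
  have -> : f * (uni x)^-1 =
      f * uni x ^ (- n) * uni x ^+ `|(n - 1)%R|%N.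
    rewrite -mulrA exprnP -expfzDr //.
    by rewrite (_ : - n + _ = - 1); last lia.
  exact/regular_atM/regular_atX/regular_at_lin.
case; have -> : f^-1 = f^-1 * uni x ^ n * uni x ^+ `|n|%N.
  rewrite -mulrA exprnP -expfzDr //.
  by rewrite (_ : n + _ = 0) ?expr0z ?mulr1 //; lia.
exact/regular_atM/regular_atX/regular_at_lin.
Qed.

(** In lowest terms a nonconstant denominator has a root, k being algebraically closed, and
    coprimality keeps this root in every other denominator of f. *)
Lemma regular_at_finite_poly f :
  (forall a, regular_at (Some a) f) -> exists p, f = p%:F.
Proof.
move=> rf; have [p [q [q0 [co Ef]]]] := frac_coprime f.
have [/size_poly1P[c c0 Eq]|] := boolP (size q == 1)%N.
  exists (c^-1 *: p); rewrite Ef Eq -mul_polyC tofracM.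
  apply/eqP; rewrite eq_sym frac_eqE ?polyC_eq0 // mulrAC -tofracM -polyCM mulVf //.
  by rewrite polyC1 tofrac1 mul1r.
move=> /closed_rootP[a qa0]; have [p' [q' [q'a /eqP]]] := rf a.
rewrite {}Ef eqr_div ?tofrac_eq0 // ?(horner_neq0 q'a) // -!tofracM tofrac_eq => /eqP E.
have /dvdpP[c Eq'] : q %| q'.
  by rewrite -(Gauss_dvdpr _ (_ : coprimep q p)) 1?coprimep_sym // E dvdp_mull.
by move: q'a; rewrite Eq' hornerM (rootP qa0) mulr0 eqxx.
Qed.

Lemma regular_at_inftyP p n :
  regular_at None (p%:F / 'X%:F ^+ n) <-> (size p <= n.+1)%N.
Proof.
rewrite -tofracXn; split=> [[a [b [b0 [sab /eqP]]]]|sp]; last first.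
  by exists p, 'X^n; rewrite expf_neq0 ?polyX_eq0 // size_polyXn.
rewrite eqr_div ?tofrac_eq0 ?expf_neq0 ?polyX_eq0 // -!tofracM tofrac_eq => /eqP E.
have [->|p0] := eqVneq p 0; first by rewrite size_poly0.
have : (size (p * b)%R <= size b + n)%N.
  rewrite E; apply: leq_trans (size_polyMleq _ _) _; rewrite size_polyXn.
  by rewrite addnS /= leq_add2r.
rewrite size_mul //; move: b0; rewrite -size_poly_gt0; case: (size b) => // m _.
by rewrite addnS /= addSn addnC -addnS leq_add2l.
Qed.

Lemma regular_at_cofinite f : exists R : {fset P1 k},
  forall x, x \notin R -> regular_at x f.
Proof.
have [p [q [q0 Ef]]] := frac_repr f; have [r Er] := closed_field_poly_normal q.
exists [fset x in None :: map Some r]%fset => -[a|]; rewrite !inE //= => na.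
exists p, q; split=> //; rewrite Er hornerZ mulf_neq0 ?lead_coef_eq0 //.
rewrite -rootE root_prod_XsubC.
by move: na; rewrite mem_map // => ? ? [].
Qed.

End RationalFunctions.

(** * Open subsets and principal open subsets *)

Section Opens.
Variable k : closedFieldType.
Local Notation K := (ratfun k).
Local Notation "x %:F" := (tofrac x) : ring_scope.
Implicit Types (U V W : open k) (x y c : P1 k) (f g : K).

Local Arguments regular_at : simpl never.

Definition join_open V W : open k := Open (removed V `&` removed W)%fset.

Lemma mem_meet V W x : mem_open x (meet_open V W) = mem_open x V && mem_open x W.
Proof. by rewrite /mem_open /= inE negb_or. Qed.

Lemma mem_join V W x : mem_open x (join_open V W) = mem_open x V || mem_open x W.
Proof. by rewrite /mem_open /= inE negb_and. Qed.

Lemma sub_openP U V : reflect (forall x, mem_open x V -> mem_open x U) (sub_open V U).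
Proof.
apply: (iffP idP) => [VU x|VU]; first exact: sub_open_mem VU.
by apply/fsubsetP => x; apply: contraTT => /VU.
Qed.

Lemma sub_openxx U : sub_open U U.
Proof. exact/sub_openP. Qed.

Lemma sub_open_trans U V W : sub_open W V -> sub_open V U -> sub_open W U.
Proof. by move=> /sub_openP WV /sub_openP VU; apply/sub_openP => x /WV /VU. Qed.

Lemma sub_open_meet U V W : sub_open W U -> sub_open W V -> sub_open W (meet_open U V).
Proof.
by move=> /sub_openP WU /sub_openP WV; apply/sub_openP => x xW; rewrite mem_meet WU ?WV.
Qed.

Lemma sub_open_join U V W : sub_open V U -> sub_open W U -> sub_open (join_open V W) U.
Proof.
move=> /sub_openP VU /sub_openP WU; apply/sub_openP => x.
by rewrite mem_join => /orP[/VU|/WU].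
Qed.

Lemma sub_joinl V W : sub_open V (join_open V W).
Proof. by apply/sub_openP => x; rewrite mem_join => ->. Qed.

Lemma sub_joinr V W : sub_open W (join_open V W).
Proof. by apply/sub_openP => x; rewrite mem_join orbC => ->. Qed.

Lemma sub_whole U : sub_open U (whole k).
Proof. exact: fsub0set. Qed.

Lemma open_anti U V : sub_open U V -> sub_open V U -> U = V.
Proof.
case: U => A; case: V => B; rewrite /sub_open /= => AB BA.
by congr Open; apply/eqP; rewrite eqEfsubset AB BA.
Qed.

Lemma affineP U : reflect (exists c, ~~ mem_open c U) (affine U).
Proof.
apply: (iffP (fset0Pn _)) => -[c cU]; exists c; first by rewrite negbK.
by move: cU; rewrite negbK.
Qed.

Lemma affine_sub U V : sub_open V U -> affine U -> affine V.
Proof.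
by move=> /sub_openP VU /affineP[c cU]; apply/affineP; exists c; apply: contra cU => /VU.
Qed.

(** Quasi-compactness: one member of the cover misses finitely many points only, and adding a
    further member for each of those in U reaches U by binary unions. Arbitrary covers thus reduce
    to covers by two opens. *)
Lemma open_cover_ind U (P : open k -> Prop) (I : Type) (V : I -> open k) :
  open_cover U V ->
  (forall V W, sub_open V U -> sub_open W U -> P V -> P W -> P (join_open V W)) ->
  (forall i, P (V i)) -> P U.
Proof.
move=> [[i0] [VU cov]] PJ PV.
suff [W [WU W0 PW WL]] : exists W, [/\ sub_open W U, sub_open (V i0) W, P W &
    forall x, x \in (removed (V i0) : seq _) -> mem_open x U -> mem_open x W].
  suff -> : U = W by [].
  apply: open_anti => //; apply/sub_openP => x xU.
  have [xV|] := boolP (mem_open x (V i0)); first exact: (sub_openP _ _ W0).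
  by rewrite negbK => /WL; apply.
elim: (removed (V i0) : seq _) => [|y L [W [WU W0 PW WL]]].
  by exists (V i0); split=> //; apply: sub_openxx.
have [yU|yU] := boolP (mem_open y U); last first.
  by exists W; split=> // x; rewrite inE => /predU1P[->|/WL//]; rewrite (negPf yU).
have [i yi] := cov y yU; exists (join_open W (V i)); split.
- exact: sub_open_join.
- exact: sub_open_trans W0 (sub_joinl _ _).
- exact: PJ.
- move=> x; rewrite inE mem_join => /predU1P[->|xL xU]; first by rewrite yi orbT.
  by rewrite (WL x).
Qed.

(** * Regular functions and sections of the twisting sheaves *)

Lemma twist_atE n x f : twist_at n x f <-> regular_at x (gen1 x ^ (- n) * f).
Proof. by case: x => [a|] //; rewrite /gen1 exp1rz mul1r. Qed.

Lemma twist_at0 x f : twist_at 0 x f <-> regular_at x f.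
Proof. by rewrite twist_atE oppr0 expr0z mul1r. Qed.

Lemma twist_at_zero n x : twist_at n x 0.
Proof. by rewrite twist_atE mulr0; apply: regular_at0. Qed.

Lemma twist_atD n x f g : twist_at n x f -> twist_at n x g -> twist_at n x (f + g).
Proof. by rewrite !twist_atE mulrDr; apply: regular_atD. Qed.

Lemma twist_atM n m x f g :
  twist_at n x f -> twist_at m x g -> twist_at (n + m) x (f * g).
Proof.
rewrite !twist_atE opprD expfzDr ?gen1_neq0 // mulrACA; exact: regular_atM.
Qed.

Lemma twist_atN n x f : twist_at n x f -> twist_at n x (- f).
Proof. by rewrite !twist_atE mulrN; apply: regular_atN. Qed.

Lemma twist_atMl n x f g : regular_at x f -> twist_at n x g -> twist_at n x (f * g).
Proof. by move=> /twist_at0 rf /(twist_atM rf); rewrite add0r. Qed.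

Lemma twist_at_lin x y : twist_at 1 x (lin y).
Proof. by rewrite twist_atE mulrC; apply: regular_at_lin. Qed.

Lemma twist_at_linV x y : y != x -> twist_at (-1) x (lin y)^-1.
Proof. by move=> yx; rewrite twist_atE opprK; apply: regular_at_lin_inv. Qed.

Lemma twist_atX n m x f : twist_at n x f -> twist_at (n * m%:Z) x (f ^+ m).
Proof.
move=> tf; elim: m => [|m IHm].
  by rewrite mulr0 expr0 twist_at0; apply: regular_at1.
by rewrite -addn1 PoszD mulrDr mulr1 exprD expr1; apply: twist_atM.
Qed.

Lemma twist_at_linXz x y (n : int) : y != x -> twist_at n x (lin y ^ n).
Proof.
move=> yx; case: n => m.
  by have := twist_atX m (twist_at_lin x y); rewrite mul1r.
by have := twist_atX m.+1 (twist_at_linV yx); rewrite NegzE mulN1r exprVn.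
Qed.

Lemma twist_at_linX x y (n : nat) : twist_at n x (lin y ^+ n).
Proof. by have := twist_atX n (twist_at_lin x y); rewrite mul1r. Qed.

Definition is_sect n U f : Prop := forall x, mem_open x U -> twist_at n x f.

Lemma is_sect_sub n U V f : sub_open V U -> is_sect n U f -> is_sect n V f.
Proof. by move=> /sub_openP VU sf x /VU /sf. Qed.

Lemma is_sectM n m U f g : is_sect n U f -> is_sect m U g -> is_sect (n + m) U (f * g).
Proof. by move=> sf sg x xU; apply: twist_atM; [apply: sf|apply: sg]. Qed.

(** Total, with default value 0, so that regularity has to be proved only where the value is read;
    [mktw] follows the same pattern. *)
Definition mkreg U f : regfun U := insubd 0 f.

Lemma val_mkreg U f : is_sect 0 U f -> val (mkreg U f) = f.
Proof.
by move=> sf; apply: insubdK; apply/asboolP => x /sf; rewrite twist_at0.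
Qed.

Definition mktw n U f : twist k n U := insubd 0 (f : ratmod U).

Lemma val_mktw n U f : is_sect n U f -> twist_val (mktw n U f) = f :> K.
Proof. by move=> sf; apply: insubdK; apply/asboolP. Qed.

Lemma twist_sectP n U (s : twist k n U) : is_sect n U (twist_val s).
Proof. exact/asboolP/twist_valP. Qed.

Lemma mktwK n U (s : twist k n U) : mktw n U (twist_val s) = s.
Proof. by apply: val_inj; apply: val_mktw; apply: twist_sectP. Qed.

(** * Principal open subsets *)

(** The forms of two distinct points are a basis of the two-dimensional space of linear forms. *)
Lemma lform_dep x y c : x != y ->
  exists a b : k, a%:P * lform x + b%:P * lform y = lform c.
Proof.
have E (a b d e : k) : a%:P * ('X - b%:P) + d%:P * ('X - e%:P) =
    (a + d)%:P * 'X - (a * b + d * e)%:P.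
  by rewrite !(polyCD, polyCM); ring.
case: x => [a|]; case: y => [b|] //= ab.
- have ab0 : b - a != 0.
    by rewrite subr_eq0 eq_sym; apply: contraNneq ab => ->.
  case: c => [c|] /=.
    exists ((b - c) / (b - a)), ((c - a) / (b - a)); rewrite E.
    have -> : (b - c) / (b - a) + (c - a) / (b - a) = 1 by field.
    have -> : (b - c) / (b - a) * a + (c - a) / (b - a) * b = c by field.
    by rewrite polyC1 mul1r.
  exists (b - a)^-1, (- (b - a)^-1); rewrite E subrr polyC0 mul0r sub0r -polyCN -polyC1.
  have -> // : - ((b - a)^-1 * a + - (b - a)^-1 * b) = 1 by field.
- case: c => [c|] /=; last first.
    by exists 0, 1; rewrite polyC0 polyC1 mul0r add0r mul1r.
  by exists 1, (a - c); rewrite polyCB polyC1; ring.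
- case: c => [c|] /=; last first.
    by exists 1, 0; rewrite polyC0 polyC1 mul0r addr0 mul1r.
  by exists (b - c), 1; rewrite polyCB polyC1; ring.
Qed.

Definition comaximal (R : comNzRingType) (a b : R) : Prop :=
  exists u v, u * a + v * b = 1.

Lemma comaximalC (R : comNzRingType) (a b : R) : comaximal a b -> comaximal b a.
Proof. by case=> u [v E]; exists v, u; rewrite addrC. Qed.

Lemma comaximalMl (R : comNzRingType) (a b c : R) :
  comaximal a c -> comaximal b c -> comaximal (a * b) c.
Proof.
move=> [u [v E]] [u' [v' E']]; exists (u * u'), (u * a * v' + v * u' * b + v * v' * c).
by rewrite -[RHS]mulr1 -{1}E -E'; ring.
Qed.

Lemma comaximal_prod (R : comNzRingType) (I : eqType) (r : seq I) (F : I -> R) (c : R) :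
  (forall i, i \in r -> comaximal (F i) c) -> comaximal (\prod_(i <- r) F i) c.
Proof.
elim: r => [|i r IHr] cF; first by rewrite big_nil; exists 1, 0; rewrite mul0r addr0 mulr1.
rewrite big_cons; apply: comaximalMl; first by apply: cF; rewrite mem_head.
by apply: IHr => j jr; apply: cF; rewrite inE jr orbT.
Qed.

Lemma comaximalXl (R : comNzRingType) (a b : R) n : comaximal a b -> comaximal (a ^+ n) b.
Proof.
move=> ab; elim: n => [|n IHn]; last by rewrite exprS; apply: comaximalMl.
by rewrite expr0; exists 1, 0; rewrite mul0r addr0 mulr1.
Qed.

Lemma comaximalX (R : comNzRingType) (a b : R) n m :
  comaximal a b -> comaximal (a ^+ n) (b ^+ m).
Proof. by move=> /(comaximalXl n)/comaximalC/(comaximalXl m)/comaximalC. Qed.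

Lemma is_sect_ratio U c x : ~~ mem_open c U -> is_sect 0 U (lin x / lin c).
Proof.
move=> cU y yU; rewrite -(subrr (1 : int)).
apply: twist_atM; first exact: twist_at_lin.
by apply: twist_at_linV; apply: contraNneq cU => ->.
Qed.

Definition ratio U c x : regfun U := mkreg U (lin x / lin c).

(** For c outside U each factor is regular on U with one simple zero, at x, so the product cuts out
    the points of U missing from V. Every open inside an affine one is therefore principal. *)
Definition principal_fun U V c : regfun U :=
  \prod_(x <- (removed V `\` removed U)%fset) ratio U c x.

Lemma regfun_val_prod U (I : Type) (r : seq I) (F : I -> regfun U) :
  val (\prod_(i <- r) F i) = \prod_(i <- r) val (F i).
Proof. exact: rmorph_prod. Qed.

Lemma val_principal_fun U V c : ~~ mem_open c U ->
  val (principal_fun U V c) =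
  \prod_(x <- (removed V `\` removed U)%fset) (lin x / lin c).
Proof.
move=> cU; rewrite regfun_val_prod; apply: eq_bigr => x _.
exact/val_mkreg/is_sect_ratio.
Qed.

Definition is_locus U V (f : regfun U) : Prop :=
  forall x, mem_open x V <-> mem_open x U /\ regular_at x (val f)^-1.

Lemma principal_fun_locus U V c : sub_open V U -> ~~ mem_open c U ->
  is_locus V (principal_fun U V c).
Proof.
move=> /sub_openP VU cU x; rewrite val_principal_fun //; split=> [xV|[xU]].
  split; first exact: VU.
  rewrite -prodfV; apply: regular_at_prod => y.
  rewrite !inE => /andP[_ yV]; rewrite -twist_at0 invf_div -(subrr (1 : int)).
  apply: twist_atM; [exact: twist_at_lin|apply: twist_at_linV].
  by apply: contraTneq xV => <-; rewrite negbK.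
apply: contraPT => xV.
have xR : x \in (removed V `\` removed U)%fset.
  by rewrite !inE; move: xU xV; rewrite /mem_open negbK => -> ->.
(* The other factors are regular at x, so multiplying by them leaves the inverse of the factor of x
   regular, against its pole. *)
rewrite (bigD1_seq x) ?fset_uniq //= invfM => rx.
have xc : c != x by apply: contraNneq cU => ->.
have : regular_at x (\prod_(y <- (removed V `\` removed U)%fset | y != x) (lin y / lin c)).
  rewrite -big_filter; apply: regular_at_prod => y _; rewrite -twist_at0.
  exact: is_sect_ratio xU.
move=> /(regular_atM rx); rewrite mulfVK; last first.
  rewrite -big_filter; rewrite prodf_seq_neq0; apply/allP => y _.
  exact: mulf_neq0 (lin_neq0 y) (invr_neq0 (lin_neq0 c)).
rewrite invf_div => /regular_atM /(_ (regular_at_lin_inv xc)).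
by rewrite mulrC mulrA (divfK (lin_neq0 c)); apply: not_regular_at_lin_inv.
Qed.

Lemma principal_fun_neq0 U V c : ~~ mem_open c U -> principal_fun U V c != 0.
Proof.
move=> cU; rewrite -(inj_eq val_inj) val_principal_fun //.
rewrite prodf_seq_neq0; apply/allP => y _.
exact: mulf_neq0 (lin_neq0 y) (invr_neq0 (lin_neq0 c)).
Qed.

(** Factors belonging to different points are comaximal: a combination of [lin x] and [lin y] equals
    [lin c], and dividing by [lin c] gives 1. Products inherit this, as no point of U is missing
    from both V and W. *)
Lemma principal_fun_comaximal U V W c : ~~ mem_open c U ->
  (forall x, mem_open x U -> mem_open x V || mem_open x W) ->
  comaximal (principal_fun U V c) (principal_fun U W c).
Proof.
move=> cU cov; apply: comaximal_prod => x; rewrite !inE => /andP[xU xV].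
apply/comaximalC/comaximal_prod => y; rewrite !inE => /andP[yU yW].
have xy : y != x.
  by apply: contraTneq xV => <-; have := cov y yU; rewrite /mem_open yW orbF.
have [a [b E]] := lform_dep c xy.
exists (regfun_const U a), (regfun_const U b); apply: val_inj.
rewrite /= !val_mkreg; try exact: is_sect_ratio.
rewrite !mulrA -mulrDl -!tofracM -tofracD E divff //; exact: lin_neq0.
Qed.

End Opens.

(** * Sheaves of modules *)

HB.instance Definition _ (k : comNzRingType) (V W : lmodType k) (f : linmap V W) :=
  GRing.isLinear.Build k V W *:%R (linmap_fun f) (linmapP f).

Section Sheaves.
Variable k : closedFieldType.
Implicit Types (U V W : open k) (x y : P1 k) (M N P A B : omod k).

HB.instance Definition _ A B (f : omod_hom A B) U :=
  GRing.isLinear.Build (regfun U) (A U) (B U) *:%R (@omod_hom_fun k A B f U) (@omod_homP k A B f U).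

Fact regfun_res_zmod U V (VU : sub_open V U) : zmod_morphism (regfun_res VU).
Proof. by move=> a b; apply: val_inj. Qed.

Fact regfun_res_monoid U V (VU : sub_open V U) : monoid_morphism (regfun_res VU).
Proof. by split=> [|a b]; apply: val_inj. Qed.

HB.instance Definition _ U V (VU : sub_open V U) :=
  GRing.isZmodMorphism.Build _ _ (regfun_res VU) (regfun_res_zmod VU).
HB.instance Definition _ U V (VU : sub_open V U) :=
  GRing.isMonoidMorphism.Build _ _ (regfun_res VU) (regfun_res_monoid VU).

Fact res_zmod M U V (VU : sub_open V U) : zmod_morphism (@res k M U V VU).
Proof.
move=> m n; rewrite -scaleN1r addrC res_linear rmorphN rmorph1 scaleN1r.
by rewrite addrC.
Qed.

HB.instance Definition _ M U V (VU : sub_open V U) :=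
  GRing.isZmodMorphism.Build _ _ (@res k M U V VU) (res_zmod VU).

Lemma resZ M U V (VU : sub_open V U) (a : regfun U) (m : M U) :
  res VU (a *: m) = regfun_res VU a *: res VU m.
Proof. by rewrite -[a *: m]addr0 res_linear raddf0 addr0. Qed.

Lemma res_irr M U V (VU VU' : sub_open V U) (m : M U) : res VU m = res VU' m.
Proof. by rewrite (bool_irrelevance VU VU'). Qed.

Lemma res_res M U V V' W (VU : sub_open V U) (WV : sub_open W V)
    (V'U : sub_open V' U) (WV' : sub_open W V') (m : M U) :
  res WV (res VU m) = res WV' (res V'U m).
Proof. by rewrite !(res_comp _ _ (sub_open_trans WV VU)). Qed.

Lemma sheaf_separated M U (I : Type) (V : I -> open k)
    (VU : forall i, sub_open (V i) U) (m n : M U) :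
  open_cover U V -> (forall i, res (VU i) m = res (VU i) n) -> m = n.
Proof.
move=> cov E; have [] := sheaf_axiom VU cov (s := fun i => res (VU i) m).
  by move=> i j; apply: res_res.
by move=> h [_ uniq]; rewrite -(uniq m) // -(uniq n).
Qed.

Definition two (T : Type) (a b : T) (i : bool) := if i then a else b.

Lemma sub_two U V W : sub_open V U -> sub_open W U -> forall i, sub_open (two V W i) U.
Proof. by move=> VU WU []. Qed.

Lemma cover_two U V W : sub_open V U -> sub_open W U ->
  (forall x, mem_open x U -> mem_open x V || mem_open x W) -> open_cover U (two V W).
Proof.
move=> VU WU cov; split; first exact: (inhabits true).
by split=> [[]//|x /cov/orP[]]; [exists true|exists false].
Qed.

Lemma sheaf_separated2 M U V W (VU : sub_open V U) (WU : sub_open W U) (m n : M U) :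
  (forall x, mem_open x U -> mem_open x V || mem_open x W) ->
  res VU m = res VU n -> res WU m = res WU n -> m = n.
Proof.
move=> cov Em En.
apply: (@sheaf_separated M U bool (two V W) (sub_two VU WU)); first exact: cover_two.
by case=> /=; rewrite ?(res_irr _ VU) ?(res_irr _ WU).
Qed.

Lemma sheaf_glue2 M U V W (VU : sub_open V U) (WU : sub_open W U) (a : M V) (b : M W) :
  (forall x, mem_open x U -> mem_open x V || mem_open x W) ->
  res (meet_openl V W) a = res (meet_openr V W) b ->
  exists m, res VU m = a /\ res WU m = b.
Proof.
move=> cov E.
pose s := bool_rect (fun i => M (two V W i)) a b.
have [|m [sm _]] := sheaf_axiom (sub_two VU WU) (cover_two VU WU cov) (s := s).
  case=> -[]; [exact: res_irr|exact: E| |exact: res_irr].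
  have WV : sub_open (meet_open W V) (meet_open V W).
    by rewrite sub_open_meet ?meet_openl ?meet_openr.
  rewrite /s /= -(res_comp (meet_openr V W) WV) -[RHS](res_comp (meet_openl V W) WV).
  by rewrite E.
exists m; rewrite (res_irr VU (sub_two VU WU true)) (res_irr WU (sub_two VU WU false)).
by split; [apply: (sm true)|apply: (sm false)].
Qed.

(** ** Morphisms *)

Definition omod_id M : omod_hom M M := @idm k (OMod k) M.
Definition omod_comp A B C (g : omod_hom B C) (f : omod_hom A B) : omod_hom A C :=
  @comp k (OMod k) A B C g f.

Lemma omod_compE A B C (g : omod_hom B C) (f : omod_hom A B) U a :
  omod_comp g f U a = g U (f U a).
Proof. by []. Qed.

Lemma omod_homD A B (f g : omod_hom A B) U a : (f + g) U a = f U a + g U a.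
Proof. by []. Qed.

Lemma omod_homZ A B c (f : omod_hom A B) U a :
  (c *: f) U a = regfun_const U c *: f U a.
Proof. by []. Qed.

Lemma omod_hom0 A B U a : (0 : omod_hom A B) U a = 0.
Proof. by []. Qed.

Lemma omod_hom_eq2 A B V W (f g : omod_hom A B) :
  (forall x, mem_open x V || mem_open x W) ->
  (forall U a, sub_open U V -> f U a = g U a) ->
  (forall U a, sub_open U W -> f U a = g U a) -> f = g.
Proof.
move=> cov fV fW; apply: omod_hom_ext => U a.
apply: (sheaf_separated2 (VU := meet_openl U V) (WU := meet_openl U W)).
- by move=> x xU; rewrite !mem_meet xU; apply: cov.
- by rewrite -!omod_hom_res fV // meet_openr.
- by rewrite -!omod_hom_res fW // meet_openr.
Qed.

(** The families f and g are total in U but are used only over opens inside V, respectively W; the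
    value over a general U is glued from those over its intersections with V and W. *)
Lemma omod_hom_glue2 A B V W (f g : forall U, A U -> B U) :
  (forall x, mem_open x V || mem_open x W) ->
  (forall U, sub_open U V -> linear (f U)) ->
  (forall U, sub_open U W -> linear (g U)) ->
  (forall U U' (s : sub_open U' U), sub_open U V ->
     forall a, f U' (res s a) = res s (f U a)) ->
  (forall U U' (s : sub_open U' U), sub_open U W ->
     forall a, g U' (res s a) = res s (g U a)) ->
  (forall U a, sub_open U V -> sub_open U W -> f U a = g U a) ->
  exists h : omod_hom A B, (forall U a, sub_open U V -> h U a = f U a) /\
                           (forall U a, sub_open U W -> h U a = g U a).
Proof.
move=> cov lf lg nf ng fg.
have covU U x : mem_open x U -> mem_open x (meet_open U V) || mem_open x (meet_open U W).
  by move=> xU; rewrite !mem_meet xU; apply: cov.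
have ex U (a : A U) : exists b : B U,
    res (meet_openl U V) b = f _ (res (meet_openl U V) a) /\
    res (meet_openl U W) b = g _ (res (meet_openl U W) a).
  apply: sheaf_glue2; first exact: covU.
  set X := meet_open (meet_open U V) _.
  have XV : sub_open X V := sub_open_trans (meet_openl _ _) (meet_openr _ _).
  have XW : sub_open X W := sub_open_trans (meet_openr _ _) (meet_openr _ _).
  rewrite -nf ?meet_openr // -ng ?meet_openr // fg //; congr (g _ _).
  exact: res_res.
pose h U a := projT1 (cid (ex U a)).
have hV U a : res (meet_openl U V) (h U a) = f _ (res (meet_openl U V) a).
  by rewrite /h; case: cid => b [].
have hW U a : res (meet_openl U W) (h U a) = g _ (res (meet_openl U W) a).
  by rewrite /h; case: cid => b [].
have hlin U : linear (h U).
  move=> c a b; apply: (sheaf_separated2 (VU := meet_openl U V) (WU := meet_openl U W)).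
  - exact: covU.
  - by rewrite raddfD /= resZ !hV raddfD /= resZ lf // meet_openr.
  - by rewrite raddfD /= resZ !hW raddfD /= resZ lg // meet_openr.
have hres U U' (s : sub_open U' U) a : h U' (res s a) = res s (h U a).
  apply: (sheaf_separated2 (VU := meet_openl U' V) (WU := meet_openl U' W)).
  - exact: covU.
  - have s' : sub_open (meet_open U' V) (meet_open U V).
      by rewrite sub_open_meet ?meet_openr // (sub_open_trans _ s) ?meet_openl.
    rewrite hV (res_res _ _ (meet_openl U V) s') nf ?meet_openr // -hV.
    exact: res_res.
  - have s' : sub_open (meet_open U' W) (meet_open U W).
      by rewrite sub_open_meet ?meet_openr // (sub_open_trans _ s) ?meet_openl.
    rewrite hW (res_res _ _ (meet_openl U W) s') ng ?meet_openr // -hW.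
    exact: res_res.
exists (mk_omod_hom hlin hres).
have sub_meet U V' : sub_open U V' -> sub_open U (meet_open U V').
  by move=> UV; rewrite sub_open_meet ?sub_openxx.
split=> U a UV; rewrite -[LHS](res_id (sub_openxx U)).
  rewrite -(res_comp (meet_openl U V) (sub_meet _ _ UV)) hV -nf ?meet_openr //.
  by rewrite (res_comp _ _ (sub_openxx U)) res_id.
rewrite -(res_comp (meet_openl U W) (sub_meet _ _ UV)) hW -ng ?meet_openr //.
by rewrite (res_comp _ _ (sub_openxx U)) res_id.
Qed.

(** ** Quasi-coherence over affine open subsets *)

Definition localizes M U V (VU : sub_open V U) (f : regfun U) : Prop :=
  (forall m : M U, res VU m = 0 -> exists n, f ^+ n *: m = 0) /\
  (forall s : M V, exists n (m : M U), res VU m = regfun_res VU f ^+ n *: s).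

Lemma regfun_neq0 U (f : regfun U) : f != 0 -> val f != 0.
Proof. by apply: contraNneq => E; apply/eqP/val_inj; rewrite E rmorph0. Qed.

Lemma locus_inv U V (VU : sub_open V U) (f : regfun U) : f != 0 -> is_locus V f ->
  exists h, h * regfun_res VU f = 1.
Proof.
move=> f0 fV; exists (mkreg V (val f)^-1); apply: val_inj => /=.
rewrite val_mkreg; last by move=> x /fV[_]; rewrite twist_at0.
exact: mulVf (regfun_neq0 f0).
Qed.

Lemma qcoh_localizes (M : qcoh k) U V (VU : sub_open V U) (f : regfun U) :
  affine U -> f != 0 -> is_locus V f -> localizes M VU f.
Proof. by move=> aU f0 fV; apply: (@qcohP k M). Qed.

Lemma two_locus U V W : affine U -> sub_open V U -> sub_open W U ->
  (forall x, mem_open x U -> mem_open x V || mem_open x W) ->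
  exists f g : regfun U, [/\ f != 0, g != 0, is_locus V f, is_locus W g & comaximal f g].
Proof.
move=> /affineP[c cU] VU WU cov.
exists (principal_fun U V c), (principal_fun U W c); split.
- exact: principal_fun_neq0.
- exact: principal_fun_neq0.
- exact: principal_fun_locus.
- exact: principal_fun_locus.
- exact: principal_fun_comaximal.
Qed.

Lemma locusM U V W (f g : regfun U) : f != 0 -> g != 0 ->
  is_locus V f -> is_locus W g -> is_locus (meet_open V W) (f * g).
Proof.
have inv (a b : regfun U) x : b != 0 -> mem_open x U ->
    regular_at x (val (a * b))^-1 -> regular_at x (val a)^-1.
  move=> b0 xU; rewrite /= invfM => /regular_atM /(_ (regfun_regular b xU)).
  by rewrite (divfK (regfun_neq0 b0)).
move=> f0 g0 fV gW x; rewrite mem_meet; split=> [/andP[/fV[xU rf] /gW[_ rg]]|[xU rfg]].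
  by split=> //=; rewrite invfM; apply: regular_atM.
apply/andP; split; [apply/fV|apply/gW]; split=> //; first exact: inv rfg.
by move: rfg; rewrite mulrC; apply: inv.
Qed.

(** Cech vanishing on an affine open. With f and g cutting out V and W, (f g)^n s extends to a
    section m over U, and u f^n + v g^n = 1 writes s as the sum of f^-n v m, defined on V, and g^-n
    u m, defined on W. *)
Lemma qcoh_split (M : qcoh k) U V W : affine U -> sub_open V U -> sub_open W U ->
  (forall x, mem_open x U -> mem_open x V || mem_open x W) ->
  forall s : M (meet_open V W), exists a b,
    s = res (meet_openl V W) a + res (meet_openr V W) b.
Proof.
move=> aU VU WU cov s; have [f [g [f0 g0 fV gW cfg]]] := two_locus aU VU WU cov.
have XU : sub_open (meet_open V W) U := sub_open_trans (meet_openl V W) VU.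
have fg0 : f * g != 0.
  by apply: contraTneq (mulf_neq0 (regfun_neq0 f0) (regfun_neq0 g0)) => /(congr1 val) /= ->; rewrite negbK.
have [_ /(_ s)[n [m E]]] := qcoh_localizes M XU aU fg0 (locusM f0 g0 fV gW).
have [u [v uv]] := comaximalX n n cfg.
have [fi fiP] := locus_inv VU f0 fV; have [gi giP] := locus_inv WU g0 gW.
pose fx := regfun_res XU f; pose gx := regfun_res XU g.
pose fix' := regfun_res (meet_openl V W) fi; pose gix := regfun_res (meet_openr V W) gi.
have fxP : fix' * fx = 1 by rewrite -(rmorph1 (regfun_res (meet_openl V W))) -fiP rmorphM; congr (_ * _); apply: val_inj.
have gxP : gix * gx = 1 by rewrite -(rmorph1 (regfun_res (meet_openr V W))) -giP rmorphM; congr (_ * _); apply: val_inj.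
exists ((fi ^+ n * regfun_res VU v) *: res VU m), ((gi ^+ n * regfun_res WU u) *: res WU m).
rewrite !resZ !(res_comp _ _ XU) E !scalerA -scalerDl.
rewrite -[LHS]scale1r; congr (_ *: _).
have -> : regfun_res (meet_openl V W) (fi ^+ n * regfun_res VU v) = fix' ^+ n * regfun_res XU v.
  by rewrite rmorphM rmorphXn; congr (_ * _); apply: val_inj.
have -> : regfun_res (meet_openr V W) (gi ^+ n * regfun_res WU u) = gix ^+ n * regfun_res XU u.
  by rewrite rmorphM rmorphXn; congr (_ * _); apply: val_inj.
rewrite rmorphM -/fx -/gx.
have {}uv : regfun_res XU u * fx ^+ n + regfun_res XU v * gx ^+ n = 1.
  by rewrite -!rmorphXn -!rmorphM -rmorphD uv rmorph1.
have E1 : fix' ^+ n * fx ^+ n = 1 by rewrite -exprMn fxP expr1n.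
have E2 : gix ^+ n * gx ^+ n = 1 by rewrite -exprMn gxP expr1n.
rewrite exprMn; move: uv E1 E2.
move: (fix' ^+ n) (gix ^+ n) (fx ^+ n) (gx ^+ n) => a b a' b' uv E1 E2.
rewrite (_ : _ + _ = (a * a') * regfun_res XU v * b' + (b * b') * regfun_res XU u * a'); last ring.
by rewrite E1 E2 !mul1r addrC.
Qed.

(** Quasi-coherence extends the local preimages up to powers of p and q, so that over U a power of p
    and a power of q carry b into the image; comaximality combines them. *)
Lemma qcoh_image2 (A B : qcoh k) (f : omod_hom A B) U V W
    (VU : sub_open V U) (WU : sub_open W U) :
  affine U -> (forall x, mem_open x U -> mem_open x V || mem_open x W) ->
  forall b, (exists a, f V a = res VU b) -> (exists a, f W a = res WU b) ->
    exists a, f U a = b.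
Proof.
move=> aU cov b exV exW; have [p [q [p0 q0 pV qW cpq]]] := two_locus aU VU WU cov.
have aux X (XU : sub_open X U) (t : regfun U) : t != 0 -> is_locus X t ->
    (exists a, f X a = res XU b) -> exists n a, f U a = t ^+ n *: b.
  move=> t0 tX [a Ea]; have [_ /(_ a)[n [a' Ea']]] := qcoh_localizes A XU aU t0 tX.
  have [ker _] := qcoh_localizes B XU aU t0 tX.
  have [|l El] := ker (f U a' - t ^+ n *: b).
    by rewrite raddfB /= resZ -omod_hom_res Ea' linearZ /= Ea rmorphXn subrr.
  exists (l + n)%N, (t ^+ l *: a'); rewrite linearZ /=; apply/eqP.
  by rewrite exprD -scalerA -subr_eq0 -scalerBr El.
have [n [a Ea]] := aux _ _ _ p0 pV exV; have [m [a' Ea']] := aux _ _ _ q0 qW exW.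
have [u [v uv]] := comaximalX n m cpq; exists (u *: a + v *: a').
by rewrite linearD !linearZ /= Ea Ea' !scalerA -scalerDl uv scale1r.
Qed.

(** This is the exactness of sections over affine opens: it is known for two opens and spread to all
    covers by [open_cover_ind]. *)
Lemma qcoh_image (A B : qcoh k) (f : omod_hom A B) U (b : B U) :
  affine U -> locally_in_image f b -> exists a, f U a = b.
Proof.
move=> aU [I [V [VU [cov im]]]].
suff /(_ (sub_openxx U)) : forall UU : sub_open U U, exists a, f U a = res UU b.
  by case=> a; rewrite res_id; exists a.
apply: (open_cover_ind (P := fun X => forall XU, exists a, f X a = res XU b) cov).
  move=> X Y XU YU PX PY ZU.
  apply: (qcoh_image2 (VU := sub_joinl X Y) (WU := sub_joinr X Y)).
  - exact: affine_sub ZU aU.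
  - by move=> x; rewrite mem_join.
  - by have [a Ea] := PX XU; exists a; rewrite (res_comp _ _ XU).
  - by have [a Ea] := PY YU; exists a; rewrite (res_comp _ _ YU).
by move=> i VU'; have [a Ea] := im i; exists a; rewrite Ea; apply: res_irr.
Qed.

End Sheaves.

(** * Finitely supported sums *)

Section FinSum.
Variables (J : choiceType).

Definition finsupp (V : zmodType) (g : J -> V) : Prop :=
  exists s : seq J, forall j, j \notin s -> g j = 0.

Definition fsum (V : zmodType) (g : J -> V) : V :=
  if pselect (finsupp g) is left ex then \sum_(j <- undup (projT1 (cid ex))) g j
  else 0.

Lemma fsumE (V : zmodType) (g : J -> V) (s : seq J) :
  uniq s -> (forall j, j \notin s -> g j = 0) -> fsum g = \sum_(j <- s) g j.
Proof.
move=> us gs; rewrite /fsum; case: pselect => [ex|[]]; last by exists s.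
case: cid => t /= gt.
have E (r r' : seq J) : uniq r -> uniq r' -> (forall j, j \notin r -> g j = 0) ->
    (forall j, j \notin r' -> g j = 0) -> \sum_(j <- r) g j = \sum_(j <- r') g j.
  move=> ur ur' gr gr'.
  rewrite (bigID [in r']) /= [X in _ + X]big1 => [|j /gr' //]; rewrite addr0.
  rewrite [RHS](bigID [in r]) /= [X in _ + X]big1 => [|j /gr //]; rewrite addr0.
  rewrite -big_filter -[RHS]big_filter; apply: perm_big; apply: uniq_perm; rewrite ?filter_uniq //.
  by move=> j; rewrite !mem_filter andbC.
by apply: E => //; [exact: undup_uniq|move=> j; rewrite mem_undup; apply: gt].
Qed.

Lemma fsum_morph (V W : zmodType) (h : {additive V -> W}) (g : J -> V) :
  finsupp g -> h (fsum g) = fsum (fun j => h (g j)).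
Proof.
case=> s gs; rewrite !(@fsumE _ _ (undup s)) ?undup_uniq //.
- by rewrite raddf_sum.
- by move=> j; rewrite mem_undup => /gs ->; rewrite raddf0.
- by move=> j; rewrite mem_undup => /gs.
Qed.

Lemma fsumD (V : zmodType) (f g : J -> V) : finsupp f -> finsupp g ->
  fsum (fun j => f j + g j) = fsum f + fsum g.
Proof.
case=> s fs [t gt]; have u := undup_uniq (s ++ t).
have f0 j : j \notin undup (s ++ t) -> f j = 0.
  by rewrite mem_undup mem_cat negb_or => /andP[/fs].
have g0 j : j \notin undup (s ++ t) -> g j = 0.
  by rewrite mem_undup mem_cat negb_or => /andP[_ /gt].
by rewrite !(fsumE u) ?big_split // => j jn; rewrite f0 ?g0 ?addr0.
Qed.

Lemma fsum1 (V : zmodType) (g : J -> V) j :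
  (forall i, i != j -> g i = 0) -> fsum g = g j.
Proof.
by move=> g0; rewrite (@fsumE _ _ [:: j]) ?big_seq1 // => i; rewrite inE => /g0.
Qed.

End FinSum.

Lemma pole_shuffle (F : fieldType) (a b s d : F) : d != 0 ->
  a * (b * s) = b / d * (a * s * d).
Proof. by move=> d0; field. Qed.

Section Twists.
Variable k : closedFieldType.
Local Notation K := (ratfun k).
Local Notation "x %:F" := (tofrac x) : ring_scope.
Implicit Types (U V W : open k) (x y : P1 k) (M N P A B : omod k).
Local Arguments regular_at : simpl never.

(** * Quasi-coherence of sums of twisting sheaves *)

(** At a point of U outside V the function f vanishes, so each factor f absorbs one order of pole of
    s; only finitely many such points occur. *)
Lemma sect_extend n U V (f : regfun U) (s : K) : is_locus V f -> is_sect n V s ->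
  exists N : nat, forall m, (N <= m)%N -> is_sect n U (val f ^+ m * s).
Proof.
move=> fV sV.
have loc x : mem_open x U -> exists N : nat, forall m, (N <= m)%N -> twist_at n x (val f ^+ m * s).
  move=> xU; have [xV|xV] := boolP (mem_open x V).
    exists 0 => m _; apply: twist_atMl; first exact/regular_atX/regfun_regular.
    exact: sV.
  have rf := regfun_regular f xU.
  have nrf : ~ regular_at x (val f)^-1 by move=> rf'; move/negP: xV; apply; apply/fV.
  have [N NP] := regular_at_pole x (gen1 x ^ (- n) * s).
  exists N => m /NP; rewrite twist_atE => rs.
  have -> : gen1 x ^ (- n) * (val f ^+ m * s) =
      (val f * (uni x)^-1) ^+ m * (gen1 x ^ (- n) * s * uni x ^+ m).
    by rewrite exprMn exprVn; apply: pole_shuffle (expf_neq0 m (uni_neq0 x)).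
  exact/regular_atM/rs/regular_atX/regular_at_vanish.
suff [N NP] : exists N : nat, forall x, x \in (removed V : seq _) -> mem_open x U ->
    forall m, (N <= m)%N -> twist_at n x (val f ^+ m * s).
  exists N => m Nm x xU; have [xV|] := boolP (mem_open x V).
    apply: twist_atMl; first exact/regular_atX/regfun_regular.
    exact: sV.
  by rewrite negbK => /NP; apply.
elim: (removed V : seq _) => [|y L [N NP]]; first by exists 0.
have [yU|yU] := boolP (mem_open y U); last first.
  by exists N => x; rewrite inE => /predU1P[->|/NP//]; rewrite (negPf yU).
have [N' N'P] := loc y yU; exists (maxn N N') => x.
rewrite inE => /predU1P[-> _|xL xU] m; rewrite geq_max => /andP[Nm N'm].
  exact: N'P.
exact: NP.
Qed.

Section SumSheaf.
Variables (J : choiceType) (n : J -> int) (D : pred J).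

(** The predicate D selects a partial sum of one ambient family, so that inclusions of partial sums
    are the identity on coordinates. *)
Definition sum_on U : {pred pi_mod (fun _ : J => ratmod U : lmodType (regfun U))} :=
  fun f => `[< (forall j, is_sect (n j) U (f j)) /\
               (forall j, ~~ D j -> f j = 0) /\ finsupp f >].
Arguments sum_on : clear implicits.

Lemma sum_on_submod U : submod_closed (sum_on U).
Proof.
split=> [|a f g /asboolP[sf [Df [s fs]]] /asboolP[sg [Dg [t gt]]]]; apply/asboolP; split.
- by move=> j x _; apply: twist_at_zero.
- by split=> //; exists [::].
- move=> j x xU; apply: twist_atD; last exact: sg.
  by apply: twist_atMl; [apply: regfun_regular|apply: sf].
have E j : (a *: f + g) j = val a * f j + g j by [].
split=> [j Dj|]; first by rewrite E Df ?Dg // mulr0 addr0.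
exists (s ++ t) => j; rewrite mem_cat negb_or => /andP[/fs fj /gt gj].
by rewrite E fj gj mulr0 addr0.
Qed.

HB.instance Definition _ U := GRing.isSubmodClosed.Build (regfun U) _ (sum_on U)
  (sum_on_submod U).

Record sum_sect U := SumSect {
  sum_val : pi_mod (fun _ : J => ratmod U : lmodType (regfun U));
  sum_valP : sum_val \in sum_on U }.

HB.instance Definition _ U := [isSub for @sum_val U].
HB.instance Definition _ U := [Choice of sum_sect U by <:].
HB.instance Definition _ U := [SubChoice_isSubLmodule of sum_sect U by <:].

Definition sum_coord U (f : sum_sect U) (j : J) : K := sum_val f j.

Lemma sum_ext U (f g : sum_sect U) : (forall j, sum_coord f j = sum_coord g j) -> f = g.
Proof. by move=> E; apply/val_inj/functional_extensionality_dep. Qed.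

Lemma sum_coordP U (f : sum_sect U) : (forall j, is_sect (n j) U (sum_coord f j)) /\
  (forall j, ~~ D j -> sum_coord f j = 0) /\ @finsupp J K (sum_coord f).
Proof. exact/asboolP/sum_valP. Qed.

Definition mk_sum U (f : J -> K) (P : (forall j, is_sect (n j) U (f j)) /\
  (forall j, ~~ D j -> f j = 0) /\ @finsupp J K f) : sum_sect U :=
  @SumSect U (f : pi_mod (fun _ : J => ratmod U : lmodType (regfun U)))
    (introT (asboolP _) P).

Lemma sum_res_proof U V (VU : sub_open V U) (f : sum_sect U) :
  (forall j, is_sect (n j) V (sum_coord f j)) /\
  (forall j, ~~ D j -> sum_coord f j = 0) /\ @finsupp J K (sum_coord f).
Proof.
have [sf [Df ff]] := sum_coordP f; split=> // j.
exact: is_sect_sub VU (sf j).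
Qed.

Definition sum_res U V (VU : sub_open V U) (f : sum_sect U) : sum_sect V :=
  mk_sum (sum_res_proof VU f).

(** Restriction does not change the rational coordinates and any two members of the cover meet, so
    all local sections share one finitely supported family. Infinite direct sums thus need no
    sheafification. *)
Lemma sum_sheaf_axiom U (I : Type) (V : I -> open k)
    (VU : forall j, sub_open (V j) U) : open_cover U V ->
  forall s : (forall j, sum_sect (V j)),
    (forall j l, sum_res (meet_openl (V j) (V l)) (s j) =
                 sum_res (meet_openr (V j) (V l)) (s l)) ->
  exists! m : sum_sect U, forall j, sum_res (VU j) m = s j.
Proof.
move=> [[j0] [_ cov]] s agree.
have E j l i : sum_coord (s j) i = sum_coord (s l) i.
  exact: (congr1 (fun u => sum_coord u i) (agree j l)).
have P : (forall i, is_sect (n i) U (sum_coord (s j0) i)) /\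
    (forall i, ~~ D i -> sum_coord (s j0) i = 0) /\ @finsupp J K (sum_coord (s j0)).
  have [_ DP] := sum_coordP (s j0); split=> // i x /cov[j xj]; rewrite (E j0 j).
  by have [sP _] := sum_coordP (s j); apply: sP.
exists (mk_sum P); split=> [j|m sm]; apply: sum_ext => i; first exact: E.
exact: (esym (congr1 (fun u => sum_coord u i) (sm j0))).
Qed.

Program Definition sum_omod : omod k :=
  @Omod k (fun U => sum_sect U) sum_res _ _ _ _.
Next Obligation. exact: val_inj. Qed.
Next Obligation. exact: val_inj. Qed.
Next Obligation. exact: val_inj. Qed.
Next Obligation. exact: sum_sheaf_axiom. Qed.

Lemma sum_quasi_coherent : quasi_coherent sum_omod.
Proof.
move=> U V VU f aU f0 fV; split=> [m m0|s].
  exists 0%N; rewrite scale1r; apply: sum_ext => j.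
  exact: (congr1 (fun u => sum_coord u j) m0).
have [sP [sD [t st]]] := sum_coordP s.
have [N NP] : exists N : nat, forall j m, (N <= m)%N -> is_sect (n j) U (val f ^+ m * sum_coord s j).
  have [N NP] : exists N : nat, forall j, j \in t -> forall m, (N <= m)%N ->
      is_sect (n j) U (val f ^+ m * sum_coord s j).
    elim: (t) => [|i r [N NP]]; first by exists 0%N.
    have [N' N'P] := sect_extend fV (sP i); exists (maxn N N') => j.
    rewrite inE => /predU1P[->|jr] m; rewrite geq_max => /andP[Nm N'm].
      exact: N'P.
    exact: NP.
  exists N => j m Nm; have [jt|/st ->] := boolP (j \in t); first exact: NP.
  by rewrite mulr0 => x _; apply: twist_at_zero.
have P : (forall j, is_sect (n j) U (val f ^+ N * sum_coord s j)) /\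
    (forall j, ~~ D j -> val f ^+ N * sum_coord s j = 0) /\
    @finsupp J K (fun j => val f ^+ N * sum_coord s j).
  split=> [j|]; first exact: NP.
  split=> [j /sD ->|]; first by rewrite mulr0.
  by exists t => j /st ->; rewrite mulr0.
exists N, (mk_sum P); apply: sum_ext => j.
rewrite [LHS]/(val f ^+ N * sum_coord s j).
rewrite [RHS]/(val (regfun_res VU f ^+ N) * sum_coord s j).
by rewrite rmorphXn.
Qed.

Definition sum_qcoh : qcoh k := QcohOb sum_quasi_coherent.

End SumSheaf.

Lemma twist_quasi_coherent n : quasi_coherent (twist k n).
Proof.
move=> U V VU f aU f0 fV; split=> [m m0|s].
  exists 0%N; rewrite scale1r; apply: val_inj.
  exact: (congr1 (fun u => twist_val u : K) m0).
have [N NP] := sect_extend fV (twist_sectP s).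
exists N, (mktw n U (val f ^+ N * twist_val s)); apply: val_inj.
rewrite [LHS](val_mktw (NP N (leqnn N))).
rewrite [RHS]/(val (regfun_res VU f ^+ N) * twist_val s).
by rewrite rmorphXn.
Qed.

Definition twist_qcoh n : qcoh k := QcohOb (@twist_quasi_coherent n).

End Twists.

(** * Morphisms between twisting sheaves and their direct sums *)

Section TwistMaps.
Variable k : closedFieldType.
Local Notation K := (ratfun k).
Local Notation "x %:F" := (tofrac x) : ring_scope.
Implicit Types (U V W : open k) (x y : P1 k) (M N P A B : omod k).
Local Arguments regular_at : simpl never.

Lemma twist_ext n U (f g : twist k n U) : twist_val f = twist_val g :> K -> f = g.
Proof. exact: val_inj. Qed.

Lemma twist_valL n U (a : regfun U) (f g : twist k n U) :
  twist_val (a *: f + g) = val a * twist_val f + twist_val g :> K.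
Proof. by []. Qed.

Lemma twist_valZ n U (a : regfun U) (f : twist k n U) :
  twist_val (a *: f) = val a * twist_val f :> K.
Proof. by []. Qed.

Lemma twist_valD n U (f g : twist k n U) :
  twist_val (f + g) = (twist_val f : K) + twist_val g :> K.
Proof. by []. Qed.

Lemma twist_val_res n U V (VU : sub_open V U) (f : twist k n U) :
  twist_val (res VU f) = twist_val f :> K.
Proof. by []. Qed.

Lemma regfun_valL U (a b c : regfun U) : val (a * b + c) = val a * val b + val c.
Proof. by []. Qed.

Lemma regfun_valM U (a b : regfun U) : val (a * b) = val a * val b.
Proof. by []. Qed.

Lemma val_regfun_res U V (VU : sub_open V U) (a : regfun U) :
  val (regfun_res VU a) = val a.
Proof. by []. Qed.

Lemma is_sectD n U (f g : K) : is_sect n U f -> is_sect n U g -> is_sect n U (f + g).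
Proof. by move=> sf sg x xU; apply: twist_atD; [apply: sf|apply: sg]. Qed.

Lemma is_sect0 n U : is_sect n U 0.
Proof. by move=> x _; apply: twist_at_zero. Qed.

Lemma mktw0 n U : mktw n U 0 = 0.
Proof. by apply: twist_ext; rewrite (val_mktw (@is_sect0 n U)). Qed.

Lemma res_mktw n U V (VU : sub_open V U) (f : K) : is_sect n U f ->
  res VU (mktw n U f) = mktw n V f.
Proof.
move=> sf; apply: twist_ext; rewrite (val_mktw (is_sect_sub VU sf)).
by rewrite twist_val_res (val_mktw sf).
Qed.

(** ** Sums of twisting sheaves *)

Section Sums.
Variables (J : choiceType) (n : J -> int).
Implicit Type D : pred J.

Lemma sum_coordL D U (a : regfun U) (f g : sum_omod k n D U) j :
  sum_coord (a *: f + g) j = val a * sum_coord f j + sum_coord g j.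
Proof. by []. Qed.

Definition sum_part D U j (f : sum_omod k n D U) : twist k (n j) U :=
  mktw (n j) U (sum_coord f j).

Lemma val_sum_part D U j (f : sum_omod k n D U) :
  twist_val (sum_part j f) = sum_coord f j :> K.
Proof. by rewrite val_mktw //; have [] := sum_coordP f. Qed.

Fact sum_part_linear D U j : linear (@sum_part D U j).
Proof.
move=> a f g; apply: twist_ext; rewrite val_sum_part sum_coordL.
by rewrite twist_valL !val_sum_part.
Qed.

Lemma sum_part_res D U V (VU : sub_open V U) j (f : sum_omod k n D U) :
  sum_part j (res VU f) = res VU (sum_part j f).
Proof.
by apply: twist_ext; rewrite twist_val_res !val_sum_part.
Qed.

Definition sum_proj D j : omod_hom (sum_omod k n D) (twist k (n j)) :=
  mk_omod_hom (fun U => @sum_part_linear D U j)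
    (fun U V VU f => @sum_part_res D U V VU j f).

Lemma sum_inj_proof D j U (f : twist k (n j) U) :
  let g i : K := if (i == j) && D j then twist_val f else 0 in
  (forall i, is_sect (n i) U (g i)) /\ (forall i, ~~ D i -> g i = 0) /\ finsupp g.
Proof.
split=> [i|]; first case: eqP => [->|_] /=; try exact: is_sect0.
  by case: ifP => _; [apply: twist_sectP|apply: is_sect0].
split=> [i Di|]; first by case: ifP => // /andP[/eqP E Dj]; rewrite E Dj in Di.
by exists [:: j] => i; rewrite inE => /negPf ->.
Qed.

Definition sum_inj_fun D j U (f : twist k (n j) U) : sum_omod k n D U :=
  mk_sum (@sum_inj_proof D j U f).

Fact sum_inj_linear D j U : linear (@sum_inj_fun D j U).
Proof.
move=> a f g; apply: sum_ext => i; rewrite sum_coordL /sum_coord /=.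
by case: ifP => // _; rewrite mulr0 addr0.
Qed.

Fact sum_inj_res D j U V (VU : sub_open V U) (f : twist k (n j) U) :
  sum_inj_fun D (res VU f) = res VU (sum_inj_fun D f).
Proof. exact: sum_ext. Qed.

Definition sum_inj D j : omod_hom (twist k (n j)) (sum_omod k n D) :=
  mk_omod_hom (@sum_inj_linear D j) (fun U V VU f => @sum_inj_res D j U V VU f).

Lemma sum_inj_coord D j U (f : twist k (n j) U) i :
  sum_coord (sum_inj D j U f) i = if (i == j) && D j then twist_val f else 0.
Proof. by []. Qed.

Lemma sum_proj_inj D j U (f : twist k (n j) U) : D j ->
  sum_proj D j U (sum_inj D j U f) = f.
Proof.
by move=> Dj; apply: twist_ext; rewrite val_sum_part sum_inj_coord eqxx Dj.
Qed.

Lemma sum_proj_injE D i j : i != j ->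
  omod_comp (sum_proj D i) (sum_inj D j) = 0.
Proof.
move=> ij; apply: omod_hom_ext => U f; apply: twist_ext.
by rewrite val_sum_part sum_inj_coord (negPf ij).
Qed.

Lemma sum_coord_sum D U (I : Type) (r : seq I) (F : I -> sum_omod k n D U) j :
  sum_coord (\sum_(i <- r) F i) j = \sum_(i <- r) sum_coord (F i) j.
Proof. by elim: r => [|i r IHr]; rewrite ?big_nil // !big_cons -IHr. Qed.

Lemma sum_decomp D U (f : sum_omod k n D U) (s : seq J) : uniq s ->
  (forall j, j \notin s -> sum_coord f j = 0) ->
  f = \sum_(j <- s) sum_inj D j U (sum_proj D j U f).
Proof.
move=> us fs; apply: sum_ext => i; rewrite sum_coord_sum.
under eq_bigr => j _ do rewrite sum_inj_coord val_sum_part.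
have [is_|ni] := boolP (i \in s); last first.
  rewrite fs // big_seq big1 // => j js.
  by rewrite (_ : (i == j) = false) //; apply: contraNF ni => /eqP ->.
rewrite (bigD1_seq i) //= eqxx big1 ?addr0 => [|j ji]; last by rewrite eq_sym (negPf ji).
by case: ifPn => //= Di; have [_ [-> //]] := sum_coordP f.
Qed.

Section Lift.
Variables (D : pred J) (B : omod k) (phi : forall j, omod_hom (twist k (n j)) B).

Definition sum_lift_fun U (f : sum_omod k n D U) : B U :=
  fsum (fun j => phi j U (sum_part j f)).

Lemma sum_lift_supp U (f : sum_omod k n D U) :
  finsupp (fun j => phi j U (sum_part j f)).
Proof.
have [_ [_ [s fs]]] := sum_coordP f; exists s => j /fs fj.
by rewrite /sum_part fj mktw0 linear0.
Qed.

Fact sum_lift_linear U : linear (@sum_lift_fun U).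
Proof.
move=> a f g; rewrite /sum_lift_fun.
have -> : (fun j => phi j U (sum_part j (a *: f + g))) =
    (fun j => a *: phi j U (sum_part j f) + phi j U (sum_part j g)).
  by apply: functional_extensionality_dep => j; rewrite sum_part_linear linearP.
rewrite fsumD.
- by rewrite (fsum_morph (GRing.scale a)) //; apply: sum_lift_supp.
- by have [s fs] := sum_lift_supp f; exists s => j /fs ->; rewrite scaler0.
- exact: sum_lift_supp.
Qed.

Fact sum_lift_res U V (VU : sub_open V U) (f : sum_omod k n D U) :
  sum_lift_fun (res VU f) = res VU (sum_lift_fun f).
Proof.
rewrite /sum_lift_fun (fsum_morph (@res k B U V VU)); last exact: sum_lift_supp.
by congr fsum; apply: functional_extensionality_dep => j; rewrite sum_part_res omod_hom_res.
Qed.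

Definition sum_lift : omod_hom (sum_omod k n D) B :=
  mk_omod_hom sum_lift_linear (fun U V VU f => @sum_lift_res U V VU f).

Lemma sum_lift_inj j U (f : twist k (n j) U) : D j ->
  sum_lift U (sum_inj D j U f) = phi j U f.
Proof.
move=> Dj; rewrite [LHS]/(sum_lift_fun _) /sum_lift_fun (fsum1 (j := j)) => [|i ij].
  by congr (phi j U _); apply: twist_ext; rewrite val_sum_part sum_inj_coord eqxx Dj.
by rewrite /sum_part sum_inj_coord (negPf ij) mktw0 linear0.
Qed.

End Lift.

Section Inclusion.
Variables (D E : pred J) (DE : forall j, D j -> E j).

Lemma sum_incl_proof U (f : sum_omod k n D U) :
  (forall j, is_sect (n j) U (sum_coord f j)) /\
  (forall j, ~~ E j -> sum_coord f j = 0) /\ @finsupp J K (sum_coord f).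
Proof.
have [sf [Df ff]] := sum_coordP f; split=> //; split=> // j Ej; apply: Df.
by apply: contra Ej; apply: DE.
Qed.

Definition sum_incl_fun U (f : sum_omod k n D U) : sum_omod k n E U :=
  mk_sum (sum_incl_proof f).

Fact sum_incl_linear U : linear (@sum_incl_fun U).
Proof. by move=> a f g; apply: sum_ext. Qed.

Fact sum_incl_res U V (VU : sub_open V U) (f : sum_omod k n D U) :
  sum_incl_fun (res VU f) = res VU (sum_incl_fun f).
Proof. exact: sum_ext. Qed.

Definition sum_incl : omod_hom (sum_omod k n D) (sum_omod k n E) :=
  mk_omod_hom sum_incl_linear (fun U V VU f => @sum_incl_res U V VU f).

Lemma sum_incl_coord U (f : sum_omod k n D U) j :
  sum_coord (sum_incl U f) j = sum_coord f j.
Proof. by []. Qed.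

End Inclusion.
End Sums.

(** ** Multiplication maps between twisting sheaves *)

Section Multiplication.
Variables (n m : int) (g : K).

Section WithProof.
Hypothesis sg : is_sect (m - n) (whole k) g.

Lemma mul_sect U (f : twist k n U) : is_sect m U (g * twist_val f).
Proof.
have -> : m = m - n + n by rewrite subrK.
apply: is_sectM (twist_sectP f); exact: is_sect_sub (sub_whole U) sg.
Qed.

Definition mul_fun U (f : twist k n U) : twist k m U := mktw m U (g * twist_val f).

Lemma mul_fun_val U (f : twist k n U) : twist_val (mul_fun f) = g * twist_val f :> K.
Proof. by rewrite val_mktw //; apply: mul_sect. Qed.

Fact mul_linear U : linear (@mul_fun U).
Proof.
move=> a f h; apply: twist_ext; rewrite twist_valL !mul_fun_val twist_valL.
by rewrite mulrDr mulrCA.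
Qed.

Fact mul_res U V (VU : sub_open V U) (f : twist k n U) :
  mul_fun (res VU f) = res VU (mul_fun f).
Proof. by rewrite /mul_fun res_mktw //; apply: mul_sect. Qed.

Definition mul_hom_proof : omod_hom (twist k n) (twist k m) :=
  mk_omod_hom mul_linear (fun U V VU f => @mul_res U V VU f).

End WithProof.

(** Zero unless g is a global section of O(m - n): the degrees remain free parameters, and the
    section condition is discharged only when a value is computed. *)
Definition mul_hom : omod_hom (twist k n) (twist k m) :=
  if pselect (is_sect (m - n) (whole k) g) is left sg then mul_hom_proof sg else 0.

Lemma mul_homE U (f : twist k n U) : is_sect (m - n) (whole k) g ->
  twist_val (mul_hom U f) = g * twist_val f :> K.
Proof.
move=> sg; rewrite /mul_hom; case: pselect => // sg'.
by rewrite val_mktw //; apply: mul_sect.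
Qed.

End Multiplication.

Lemma mul_hom_comp n m l (g h : K) : is_sect (m - n) (whole k) g ->
  is_sect (l - m) (whole k) h ->
  omod_comp (mul_hom m l h) (mul_hom n m g) = mul_hom n l (h * g).
Proof.
move=> sg sh; apply: omod_hom_ext => U f; apply: twist_ext.
rewrite omod_compE !mul_homE ?mulrA //.
have -> : l - n = l - m + (m - n) by rewrite addrA subrK.
exact: is_sectM.
Qed.

Lemma mul_hom1 n : mul_hom n n 1 = omod_id (twist k n).
Proof.
apply: omod_hom_ext => U f; apply: twist_ext; rewrite mul_homE ?mul1r // subrr.
by move=> x _; rewrite twist_at0; apply: regular_at1.
Qed.

Lemma mul_homD n m (g h : K) : is_sect (m - n) (whole k) g -> is_sect (m - n) (whole k) h ->
  mul_hom n m (g + h) = mul_hom n m g + mul_hom n m h.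
Proof.
move=> sg sh; apply: omod_hom_ext => U f; apply: twist_ext.
rewrite omod_homD twist_valD.
by rewrite !mul_homE ?mulrDl //; apply: is_sectD.
Qed.

Lemma is_sectC U (a : k) : is_sect 0 U (a%:P)%:F.
Proof. by move=> x _; rewrite twist_at0; apply: regular_atC. Qed.

Lemma is_sectCM n U (a : k) (g : K) : is_sect n U g -> is_sect n U ((a%:P)%:F * g).
Proof. by move=> sg; rewrite -[n]add0r; apply: is_sectM sg; apply: is_sectC. Qed.

Lemma mul_homZ n m (a : k) (g : K) : is_sect (m - n) (whole k) g ->
  mul_hom n m ((a%:P)%:F * g) = a *: mul_hom n m g.
Proof.
move=> sg; apply: omod_hom_ext => U f; apply: twist_ext.
rewrite omod_homZ twist_valZ.
by rewrite !mul_homE ?mulrA //; apply: is_sectCM.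
Qed.

(** ** Morphisms from a twisting sheaf *)

(** Restriction made total in U, as [omod_hom_glue2] asks for families defined over every open. *)
Definition rest M V U (m : M V) : M U :=
  if pselect (sub_open U V) is left s then res s m else 0.

Lemma restE M V U (s : sub_open U V) (m : M V) : rest U m = res s m.
Proof. by rewrite /rest; case: pselect => // s'; apply: res_irr. Qed.

Definition is_gen n V (g : K) : Prop :=
  [/\ g != 0, is_sect n V g & is_sect (- n) V g^-1].

Lemma is_gen_sub n U V g : sub_open V U -> is_gen n U g -> is_gen n V g.
Proof. by move=> VU [g0 sg sV]; split=> //; apply: is_sect_sub VU _. Qed.

Lemma gen_ratio n V g (f : K) : is_gen n V g -> is_sect n V f -> is_sect 0 V (f / g).
Proof. by move=> [g0 sg sV] sf; rewrite -(subrr n); apply: is_sectM. Qed.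

Lemma twist_genE n V g (f : twist k n V) : is_gen n V g ->
  f = mkreg V (twist_val f / g) *: mktw n V g.
Proof.
move=> gg; have [g0 sg _] := gg; apply: twist_ext.
rewrite twist_valZ.
rewrite (val_mktw sg) val_mkreg ?(divfK g0) //.
exact: gen_ratio (twist_sectP f).
Qed.

Lemma twist_hom_eq n (B : omod k) V W g e (f h : omod_hom (twist k n) B) :
  (forall x, mem_open x V || mem_open x W) -> is_gen n V g -> is_gen n W e ->
  f V (mktw n V g) = h V (mktw n V g) -> f W (mktw n W e) = h W (mktw n W e) -> f = h.
Proof.
have aux X t U a : is_gen n X t -> sub_open U X ->
    f X (mktw n X t) = h X (mktw n X t) -> f U a = h U a.
  move=> gt UX E; have gt' := is_gen_sub UX gt.
  rewrite (twist_genE a gt') !linearZ /=; congr (_ *: _).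
  have [_ st _] := gt; by rewrite -(res_mktw UX st) !omod_hom_res E.
move=> cov gg ge Eg Ee; apply: (omod_hom_eq2 cov) => U a UV; first exact: aux gg UV Eg.
exact: aux ge UV Ee.
Qed.

(** O(n) is free of rank one on V and on W, with generators g and e, so a morphism is a pair of
    values related by the transition function [e / g]. Over an open inside a chart with generator t
    it sends a to [a / t] times the value on t. *)
Lemma twist_hom_ex n (B : omod k) V W g e (b : B V) (c : B W) :
  (forall x, mem_open x V || mem_open x W) -> is_gen n V g -> is_gen n W e ->
  res (meet_openr V W) c = mkreg (meet_open V W) (e / g) *: res (meet_openl V W) b ->
  exists f : omod_hom (twist k n) B, f V (mktw n V g) = b /\ f W (mktw n W e) = c.
Proof.
move=> cov gg ge E.
pose F X (t : K) (m : B X) U (a : twist k n U) : B U := mkreg U (twist_val a / t) *: rest U m.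
have lin X t m U : is_gen n X t -> sub_open U X -> linear (@F X t m U).
  move=> gt UX a u v; rewrite /F scalerA -scalerDl; congr (_ *: _); apply: val_inj.
  have gt' := is_gen_sub UX gt.
  rewrite regfun_valL.
  rewrite !val_mkreg; try by apply: (gen_ratio gt'); apply: twist_sectP.
  by rewrite twist_valL mulrDl mulrA.
have nat X t m U U' (s : sub_open U' U) : is_gen n X t -> sub_open U X -> forall a,
    F X t m U' (res s a) = res s (F X t m U a).
  move=> gt UX a; rewrite /F resZ (restE UX) (restE (sub_open_trans s UX)).
  rewrite (res_comp _ _ (sub_open_trans s UX)).
  congr (_ *: _); apply: val_inj; rewrite val_regfun_res.
  rewrite (val_mkreg (gen_ratio (is_gen_sub UX gt) (twist_sectP a))).
  exact: val_mkreg (gen_ratio (is_gen_sub (sub_open_trans s UX) gt) (twist_sectP _)).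
have [U UV|U UW|U U' s UV|U U' s UW|U a UV UW|h [hV hW]] :=
  @omod_hom_glue2 k (twist k n) B V W (F V g b) (F W e c) cov.
- exact: lin.
- exact: lin.
- exact: nat.
- exact: nat.
- have UX := sub_open_meet UV UW.
  rewrite /F (restE UV) (restE UW) -(res_comp (meet_openr V W) UX) E resZ scalerA.
  rewrite (res_comp _ _ UV); congr (_ *: _); apply: val_inj.
  have gX := is_gen_sub (meet_openl V W) gg; have eX := is_gen_sub (meet_openr V W) ge.
  have [e0 se _] := eX.
  rewrite regfun_valM val_regfun_res (val_mkreg (gen_ratio gX se)).
  rewrite (val_mkreg (gen_ratio (is_gen_sub UW ge) (twist_sectP a))).
  rewrite (val_mkreg (gen_ratio (is_gen_sub UV gg) (twist_sectP a))).
  by rewrite mulrA (divfK e0).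
have one X t m : is_gen n X t -> F X t m X (mktw n X t) = m.
  move=> [t0 st stV]; rewrite /F (restE (sub_openxx X)) res_id (val_mktw st).
  rewrite (_ : mkreg X _ = 1) ?scale1r //; apply: val_inj; rewrite divff // val_mkreg //.
  by move=> x _; rewrite twist_at0; apply: regular_at1.
exists h; split; first by rewrite hV ?sub_openxx ?one.
by rewrite hW ?sub_openxx ?one.
Qed.

End TwistMaps.

(** * Presentations of quasi-coherent sheaves by sums of twisting sheaves *)

Section Presentations.
Variable k : closedFieldType.
Local Notation K := (ratfun k).
Local Notation "x %:F" := (tofrac x) : ring_scope.
Implicit Types (U V W : open k) (x y : P1 k) (M N P A B : qcoh k).
Local Arguments regular_at : simpl never.

(** Euclid's argument: 1 plus the product of the ['X - a] has a root, k being algebraically closed,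
    and no a in s is one. *)
Lemma exists_notin (s : seq k) : exists c : k, c \notin s.
Proof.
pose p : {poly k} := 1 + \prod_(a <- s) ('X - a%:P).
have [s0|s0] := boolP (size s == 0)%N.
  by exists 0; rewrite (size0nil (eqP s0)).
have /closed_rootP[c pc] : size p != 1%N.
  rewrite /p addrC size_addl size_prod_XsubC ?size_poly1 //.
  by rewrite ltnS lt0n.
exists c; apply/negP => cs; move: pc; rewrite rootE hornerD hornerC.
have /rootP -> : root (\prod_(a <- s) ('X - a%:P)) c by rewrite root_prod_XsubC.
by rewrite addr0 oner_eq0.
Qed.

Lemma exists_mem_open V : exists q, mem_open q V.
Proof.
have [c cs] := exists_notin (pmap id (removed V : seq _)).
exists (Some c); apply: contra cs => cV.
by rewrite -(mem_map (@Some_inj _)) pmapS_filter map_id mem_filter.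
Qed.

(** ** Powers of the form defining the complement of an affine open subset *)

Definition codeg V : nat := size (removed V : seq (P1 k)).
Definition coform V : K := \prod_(x <- removed V) lin x.
Definition codegree V (n : int) (a : nat) : int := n - (a * codeg V)%:Z.
(** The form h = [coform V], of degree [codeg V], cuts out the complement of V. For r outside V this
    is a generator over V of O(n - a deg h), whose degree is [codegree V n a]. *)
Definition cogen V (n : int) (r : P1 k) (a : nat) : K := lin r ^ n / coform V ^+ a.

Lemma linz_neq0 x (n : int) : lin x ^ n != 0.
Proof. exact: expfz_neq0 (lin_neq0 x). Qed.

Lemma coform_neq0 V : coform V != 0.
Proof. by rewrite prodf_seq_neq0; apply/allP => x _; apply: lin_neq0. Qed.

Lemma coform_sect V U b : is_sect (b * codeg V)%N U (coform V ^+ b).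
Proof.
move=> x _; rewrite mulnC PoszM; apply: twist_atX.
rewrite /coform /codeg; elim: (removed V : seq _) => [|y s IHs].
  by rewrite big_nil twist_at0; apply: regular_at1.
by rewrite big_cons -[size _]add1n PoszD; apply: twist_atM IHs; apply: twist_at_lin.
Qed.

Lemma coform_inv_sect V b : is_sect (- (b * codeg V)%N%:Z) V (coform V ^+ b)^-1.
Proof.
move=> x xV; rewrite -exprVn mulnC PoszM -mulNr; apply: twist_atX.
rewrite /coform -prodfV /codeg.
have {xV} : forall y, y \in (removed V : seq _) -> y != x.
  by move=> y yV; apply: contraNneq xV => <-.
elim: (removed V : seq _) => [|y s IHs] xs.
  by rewrite big_nil twist_at0; apply: regular_at1.
rewrite big_cons -[size _]add1n PoszD opprD; apply: twist_atM.
  by apply: twist_at_linV; apply: xs; rewrite mem_head.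
by apply: IHs => z zs; apply: xs; rewrite inE zs orbT.
Qed.

Lemma linz_gen n U x : ~~ mem_open x U -> is_gen n U (lin x ^ n).
Proof.
move=> xU; split; first exact: linz_neq0.
  by move=> y yU; apply: twist_at_linXz; apply: contraNneq xU => ->.
rewrite invr_expz => y yU; apply: twist_at_linXz.
by apply: contraNneq xU => ->.
Qed.

Lemma cogen_gen V n r a : ~~ mem_open r V -> is_gen (codegree V n a) V (cogen V n r a).
Proof.
move=> rV; have [r0 sr srV] := linz_gen n rV; split.
- exact: mulf_neq0 r0 (invr_neq0 (expf_neq0 a (coform_neq0 V))).
- by rewrite /codegree /cogen; apply: is_sectM sr (@coform_inv_sect V a).
- rewrite /codegree /cogen opprB addrC invfM invrK.
  exact: is_sectM srV (@coform_sect V V a).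
Qed.

Lemma codegreeB V n a b : codegree V n a - codegree V n (a + b) = (b * codeg V)%N%:Z.
Proof. by rewrite /codegree mulnDl PoszD; ring. Qed.

Lemma coform_mul_sect V n a b :
  is_sect (codegree V n a - codegree V n (a + b)) (whole k) (coform V ^+ b).
Proof. by rewrite codegreeB; apply: coform_sect. Qed.

Lemma cogen_shift (F : fieldType) (l h : F) a b : h != 0 ->
  h ^+ b * (l / h ^+ (a + b)) = l / h ^+ a.
Proof.
move=> h0; have ha := expf_neq0 a h0; have hb := expf_neq0 b h0.
by rewrite exprD; field; rewrite ha hb.
Qed.

(** The transition maps, multiplication by powers of h; they carry generator to generator, so
    evaluation at [cogen] is compatible with them. *)
Definition coshift V n a b : omod_hom (twist k (codegree V n (a + b))) (twist k (codegree V n a)) :=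
  mul_hom _ _ (coform V ^+ b).

Lemma coshift_gen V n r a b : ~~ mem_open r V ->
  coshift V n a b V (mktw _ V (cogen V n r (a + b))) = mktw _ V (cogen V n r a).
Proof.
move=> rV; have [_ sg _] := cogen_gen n a rV; have [_ sg' _] := cogen_gen n (a + b) rV.
apply: twist_ext; rewrite (mul_homE _ (coform_mul_sect V n a b)).
by rewrite (val_mktw sg) (val_mktw sg') (cogen_shift _ _ _ (coform_neq0 V)).
Qed.

Section TwoCharts.
Variables (V : open k) (q : P1 k) (qV : mem_open q V).
Let W := Open [fset q]%fset.
Let X := meet_open V W.

Lemma chart_notin : ~~ mem_open q W.
Proof. by rewrite negbK inE. Qed.

Lemma chart_affine : affine W.
Proof. by apply/affineP; exists q; apply: chart_notin. Qed.

Lemma chart_cover x : mem_open x V || mem_open x W.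
Proof. by rewrite /(mem_open x W) inE; case: eqP => [->|]; rewrite ?qV ?orbT. Qed.

Definition chart_fun : regfun W := principal_fun W X q.

Lemma val_chart_fun : val chart_fun = coform V / lin q ^+ codeg V.
Proof.
rewrite val_principal_fun ?chart_notin //.
have -> : (removed X `\` removed W)%fset = removed V.
  apply/fsetP => x; rewrite !inE; case: eqP => [->|_] //=; last by rewrite orbF.
  by rewrite (negPf qV).
rewrite /coform /codeg; elim: (removed V : seq _) => [|x s IHs].
  by rewrite !big_nil expr0 divr1.
by rewrite !big_cons IHs mulf_div -exprS.
Qed.

Lemma chart_localizes M : localizes M (meet_openr V W) chart_fun.
Proof.
apply: qcoh_localizes; first exact: chart_affine.
  exact: principal_fun_neq0 chart_notin.
exact: principal_fun_locus (meet_openr V W) chart_notin.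
Qed.

(** With l, r, h standing for [lin q], [lin r] and [coform V], this is the transition function
    between the generators over W and over V. *)
Lemma chart_identity (F : fieldType) (l r h : F) (n : int) (a d : nat) :
  l != 0 -> r != 0 -> h != 0 ->
  l ^ (n - (a * d)%N%:Z) / (r ^ n / h ^+ a) = (h / l ^+ d) ^+ a * (l / r) ^ n.
Proof.
move=> l0 r0 h0; rewrite expfzDr // -exprnN expfzMl exprz_inv -invr_expz.
have hl := expf_neq0 (a * d) l0; have hh := expf_neq0 a h0; have hr := expfz_neq0 n r0.
rewrite exprMn exprVn -exprM (mulnC d a).
by field; rewrite hr hl hh.
Qed.

Lemma chart_identity2 (F : fieldType) (l h : F) (n : int) (a b d : nat) :
  l != 0 -> h != 0 ->
  h ^+ b * l ^ (n - ((a + b) * d)%N%:Z) = (h / l ^+ d) ^+ b * l ^ (n - (a * d)%N%:Z).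
Proof.
move=> l0 h0; rewrite mulnDl PoszD opprD addrA [in LHS]expfzDr // -exprnN.
rewrite exprMn exprVn -exprM (mulnC d b).
by rewrite -mulrA [X in _ = _ * X]mulrC.
Qed.

Lemma section_extends M n r (m : M V) : ~~ mem_open r V ->
  exists a (f : omod_hom (twist k (codegree V n a)) M),
    f V (mktw _ V (cogen V n r a)) = m.
Proof.
move=> rV; pose c := mkreg X ((lin q / lin r) ^ n).
have [_ /(_ (c *: res (meet_openl V W) m))[N [m1 Em1]]] := chart_localizes M.
have gg := cogen_gen n N rV.
have ge := linz_gen (codegree V n N) chart_notin.
have [|f [fV _]] := twist_hom_ex (b := m) (c := m1) chart_cover gg ge; last by exists N, f.
rewrite Em1 scalerA; congr (_ *: _); apply: val_inj.
rewrite regfun_valM -rmorphXn val_regfun_res rmorphXn /= -/chart_fun val_chart_fun.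
rewrite (val_mkreg (gen_ratio (is_gen_sub (meet_openl V W) gg)
  (is_sect_sub (meet_openr V W) (let: And3 _ s _ := ge in s)))).
rewrite val_mkreg.
  rewrite /codegree /cogen; exact: esym (chart_identity _ _ _ (lin_neq0 q) (lin_neq0 r) (coform_neq0 V)).
have [_ sq _] := linz_gen n chart_notin; have [_ _ sr] := linz_gen n rV.
rewrite expfzMl exprz_inv -invr_expz -(subrr n).
exact: is_sectM (is_sect_sub (meet_openr V W) sq) (is_sect_sub (meet_openl V W) sr).
Qed.

(** The value on the generator over W restricts to 0 on the overlap, so a power of [chart_fun] kills
    it. With [section_extends] this identifies M(V) with the colimit of Hom(O(n - a deg h), M). *)
Lemma hom_vanishes M n r a (f : omod_hom (twist k (codegree V n a)) M) :
  ~~ mem_open r V -> f V (mktw _ V (cogen V n r a)) = 0 ->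
  exists b, omod_comp f (coshift V n a b) = 0.
Proof.
move=> rV f0; have gg := cogen_gen n a rV.
have ge := linz_gen (codegree V n a) chart_notin.
pose m1 := f W (mktw _ W (lin q ^ codegree V n a)).
have [/(_ m1) ker _] := chart_localizes M.
have [|b Eb] := ker.
  rewrite /m1 -omod_hom_res (twist_genE (res _ _) (is_gen_sub (meet_openl V W) gg)).
  have [_ sg _] := gg.
  by rewrite linearZ /= -(res_mktw (meet_openl V W) sg) omod_hom_res f0 raddf0 scaler0.
exists b; have gg' := cogen_gen n (a + b) rV.
have ge' := linz_gen (codegree V n (a + b)) chart_notin.
apply: (twist_hom_eq chart_cover gg' ge'); first by rewrite omod_compE coshift_gen ?f0.
rewrite omod_compE omod_hom0 -Eb /m1 -linearZ /=; congr (f W _); apply: twist_ext.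
have [_ se _] := ge; have [_ se' _] := ge'.
rewrite twist_valZ (mul_homE _ (coform_mul_sect V n a b)) (val_mktw se) (val_mktw se').
by rewrite rmorphXn /= val_chart_fun /codegree; apply: chart_identity2 (lin_neq0 q) (coform_neq0 V).
Qed.

End TwoCharts.

(** A morphism f extending m composes with p to one vanishing on the generator, hence killed by a
    further power of [coform V]; precomposing f with that power keeps m in the image. *)
Lemma kernel_section M B (p : omod_hom M B) V (m : M V) : affine V -> p V m = 0 ->
  exists n (f : omod_hom (twist k n) M), omod_comp p f = 0 /\
    exists t : twist k n V, f V t = m.
Proof.
move=> /affineP[r rV] pm; have [q qV] := exists_mem_open V.
have [a [f fm]] := section_extends qV 0 m rV.
have [|b E] := @hom_vanishes V q qV B 0 r a (omod_comp p f) rV; first by rewrite omod_compE fm.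
exists (codegree V 0 (a + b)), (omod_comp f (coshift V 0 a b)); split; first by rewrite -E; apply: omod_hom_ext.
by exists (mktw _ V (cogen V 0 r (a + b))); rewrite omod_compE coshift_gen.
Qed.

(** All morphisms from twisting sheaves into the kernel of p, without bound on the degree: p = 0
    gives generators of M, and a presentation map p gives its relations. *)
Definition pres_index M B (p : omod_hom M B) : choiceType :=
  {j : {n : int & omod_hom (twist k n) M} | `[< omod_comp p (projT2 j) = 0 >]}.

Definition pres_degree M B (p : omod_hom M B) (j : pres_index p) : int := projT1 (val j).

Definition pres_sum M B (p : omod_hom M B) : qcoh k :=
  sum_qcoh k (pres_degree (p := p)) xpredT.

Definition pres_map M B (p : omod_hom M B) : omod_hom (pres_sum p) M :=
  sum_lift xpredT (fun j : pres_index p => projT2 (val j)).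

Lemma pres_map_affine M B (p : omod_hom M B) V (m : M V) : affine V -> p V m = 0 ->
  exists s, pres_map p V s = m.
Proof.
move=> aV pm; have [n [f [pf [t ft]]]] := kernel_section aV pm.
have P : `[< omod_comp p (projT2 (existT (fun n => omod_hom (twist k n) M) n f)) = 0 >] by apply/asboolP.
pose j : pres_index p := exist _ (existT _ n f) P.
exists (sum_inj k (pres_degree (p := p)) xpredT j V t).
by rewrite /pres_map sum_lift_inj.
Qed.

Lemma pres_map_comp M B (p : omod_hom M B) : omod_comp p (pres_map p) = 0.
Proof.
apply: omod_hom_ext => U s; rewrite omod_compE omod_hom0.
rewrite [pres_map p U s]/(sum_lift_fun _ _) /sum_lift_fun.
rewrite (fsum_morph (@omod_hom_fun k M B p U)); last exact: sum_lift_supp.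
rewrite (@fsumE _ _ _ [::]) ?big_nil // => j _.
have /asboolP E := valP j; exact: (congr1 (fun h : omod_hom _ _ => h U (sum_part j s)) E).
Qed.

Lemma affine_cover U : open_cover U
  (two (meet_open U (Open [fset None]%fset)) (meet_open U (Open [fset (Some 0)]%fset))).
Proof.
apply: cover_two; try exact: meet_openl.
by move=> x xU; rewrite !mem_meet xU /= /mem_open !inE; case: x {xU}.
Qed.

Lemma pres_map_local M B (p : omod_hom M B) U (m : M U) : p U m = 0 ->
  locally_in_image (pres_map p) m.
Proof.
move=> pm; exists bool; eexists; 
exists (sub_two (meet_openl U (Open [fset None]%fset)) (meet_openl U (Open [fset (Some 0)]%fset))).
split; first exact: affine_cover.
move=> i; apply: pres_map_affine; last by rewrite omod_hom_res pm raddf0.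
by apply/affineP; case: i; [exists None|exists (Some 0)];
  rewrite /two mem_meet /mem_open !inE eqxx andbF.
Qed.

Lemma pres_map_exact M B (p : omod_hom M B) : sheaf_exact (pres_map p) p.
Proof.
move=> U m; split; first exact: pres_map_local.
move=> [I [V [VU [cov im]]]]; apply: (sheaf_separated (VU := VU) cov) => i.
have [s Es] := im i; rewrite raddf0 -omod_hom_res -Es.
exact: (congr1 (fun h : omod_hom _ _ => h (V i) s) (pres_map_comp p)).
Qed.

Lemma pres_map_epi M : sheaf_epi (pres_map (0 : omod_hom M M)).
Proof. by move=> U m; apply: pres_map_local. Qed.

Lemma twist_coherent n : coherent (twist_qcoh k n).
Proof.
move=> U /affineP[c cU]; exists 1%N, (fun=> mktw n U (lin c ^ n)) => v.
exists (fun=> mkreg U (twist_val v / lin c ^ n)); rewrite big_ord1.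
exact: twist_genE (linz_gen n cU).
Qed.

End Presentations.

(** * Functors to vector spaces *)

Section Functors.
Variable k : closedFieldType.
Local Notation K := (ratfun k).
Local Notation "x %:F" := (tofrac x) : ring_scope.
Implicit Types (U V W : open k) (x y : P1 k) (M N P A B C : qcoh k).
Implicit Types (F G : functor (Qcoh k) (Modk k)).
Local Arguments regular_at : simpl never.

Definition fval F A : lmodType k := F A.
Definition fapp F A B (f : omod_hom A B) : linmap (fval F A) (fval F B) :=
  fmap F (f : @hom k (Qcoh k) A B).

Lemma fapp_comp F A B C (g : omod_hom B C) (f : omod_hom A B) v :
  fapp F (omod_comp g f) v = fapp F g (fapp F f v).
Proof. by rewrite /fapp (fmapM F (g : @hom k (Qcoh k) B C) f). Qed.

Lemma fapp_id F A v : fapp F (omod_id A) v = v.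
Proof. by rewrite /fapp (fmap1 F A). Qed.

Lemma fappL F A B a (f g : omod_hom A B) v :
  fapp F (a *: f + g) v = a *: fapp F f v + fapp F g v.
Proof. by rewrite /fapp (fmap_linear F a (f : @hom k (Qcoh k) A B) g). Qed.

Lemma fapp0 F A B v : fapp F (0 : omod_hom A B) v = 0.
Proof. by have := fappL (F := F) (-1) (0 : omod_hom A B) 0 v; rewrite scaler0 addr0 scaleN1r addNr. Qed.

Lemma fappZ F A B a (f : omod_hom A B) v : fapp F (a *: f) v = a *: fapp F f v.
Proof. by rewrite -[a *: f]addr0 fappL fapp0 addr0. Qed.

Lemma fappD F A B (f g : omod_hom A B) v : fapp F (f + g) v = fapp F f v + fapp F g v.
Proof. by rewrite -[f in LHS]scale1r fappL scale1r. Qed.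

Lemma fapp_sum F A B (I : Type) (r : seq I) (f : I -> omod_hom A B) v :
  fapp F (\sum_(i <- r) f i) v = \sum_(i <- r) fapp F (f i) v.
Proof.
by elim: r => [|i r IHr]; rewrite ?big_nil ?fapp0 // !big_cons fappD IHr.
Qed.

Lemma omod_hom_sum A B (I : Type) (r : seq I) (f : I -> omod_hom A B) U a :
  (\sum_(i <- r) f i) U a = \sum_(i <- r) f i U a.
Proof. by elim: r => [|i r IHr]; rewrite ?big_nil // !big_cons omod_homD IHr. Qed.

Lemma right_exactP F : right_exact F ->
  forall A B C (f : omod_hom A B) (g : omod_hom B C), sheaf_exact f g -> sheaf_epi g ->
  (forall c, exists b, fapp F g b = c) /\
  (forall b, fapp F g b = 0 <-> exists a, fapp F f a = b).
Proof. by move=> rF A B C f g ex ep; apply: (rF A B C f g ex ep). Qed.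

(** ** Functors preserving direct sums of twisting sheaves *)

Section SumEndo.
Variables (J : choiceType) (n : J -> int).

Definition sum_all : qcoh k := sum_qcoh k n xpredT.
Definition sum_in j : omod_hom (twist_qcoh k (n j)) sum_all := sum_inj k n xpredT j.
Definition sum_out j : omod_hom sum_all (twist_qcoh k (n j)) := sum_proj k n xpredT j.

Lemma sum_out_in j : omod_comp (sum_out j) (sum_in j) = omod_id (twist_qcoh k (n j)).
Proof. by apply: omod_hom_ext => U f; apply: sum_proj_inj. Qed.

End SumEndo.

(** Only surjectivity of the map from the sum of the F(O(n_j)) is asked; the projections [sum_out]
    already make it injective. *)
Definition preserves_sums F : Prop :=
  forall (J : choiceType) (n : J -> int) (v : fval F (sum_all n)),
    exists s : seq J, uniq s /\ v = \sum_(j <- s) fapp F (sum_in n j) (fapp F (sum_out n j) v).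

Section SumDiagram.
Variables (J : choiceType) (n : J -> int).

Let part (s : seq J) : qcoh k := sum_qcoh k n (mem s).

Lemma part_incl_mem (s t : seq J) : {subset s <= t} -> forall j, mem s j -> mem t j.
Proof. by move=> st j /st. Qed.

Definition part_incl (s t : seq J) (st : {subset s <= t}) : omod_hom (part s) (part t) :=
  sum_incl k n (part_incl_mem st).

Definition part_all (s : seq J) : omod_hom (part s) (sum_all n) :=
  @sum_incl k J n (mem s) xpredT (fun j _ => isT).

Program Definition sum_diagram : directed_diagram (Qcoh k) :=
  @DirectedDiagram k (Qcoh k) (seq J) (fun s t => {subset s <= t}) _ _ _ _
    part part_incl _ _.
Next Obligation. by []. Qed.
Next Obligation. by move=> z /H /H0. Qed.
Next Obligation. exact: (inhabits [::]). Qed.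
Next Obligation. by exists (i ++ j); split=> z zs; rewrite mem_cat zs ?orbT. Qed.
Next Obligation. by apply: omod_hom_ext => U f; apply: sum_ext. Qed.
Next Obligation. by apply: omod_hom_ext => U f; apply: sum_ext. Qed.

(** A cocone is determined by its values on the one-term sums [[:: j]], and these assemble to the
    limit map by [sum_lift]. *)
Lemma sum_direct_limit : @is_direct_limit k (Qcoh k) sum_diagram (sum_all n) part_all.
Proof.
split=> [s t st|X d cd]; first by apply: omod_hom_ext => U f; apply: sum_ext.
pose d' s : omod_hom (part s) X := d s.
pose phi j : omod_hom (twist k (n j)) X :=
  omod_comp (d [:: j] : omod_hom (part [:: j]) X) (sum_inj k n (mem [:: j]) j).
have dE s j U (f : twist k (n j) U) : j \in s ->
    phi j U f = d' s U (sum_inj k n (mem s) j U f).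
  move=> js; have js' : {subset [:: j] <= s} by move=> i; rewrite inE => /eqP ->.
  rewrite /phi -(cd [:: j] s js'); congr (d' s U _).
  by apply: sum_ext => i; rewrite sum_incl_coord !sum_inj_coord /= js inE eqxx.
have partE s U (f : part s U) : f = \sum_(j <- undup s) sum_inj k n (mem s) j U (sum_proj k n (mem s) j U f).
  apply: sum_decomp (undup_uniq _) _ => j; rewrite mem_undup => js.
  by have [_ [-> //]] := sum_coordP f.
have lim s U (f : part s U) : sum_lift xpredT phi U (part_all s U f) = d' s U f.
  rewrite {1 2}[f]partE !raddf_sum /= big_seq [RHS]big_seq; apply: eq_bigr => j.
  rewrite mem_undup => js; rewrite -(dE s j _ _ js) -(sum_lift_inj (D := xpredT) phi) //.
  by congr (sum_lift xpredT phi U _); apply: sum_ext => i; rewrite sum_incl_coord !sum_inj_coord /= js andbT.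
exists (sum_lift xpredT phi : @hom k (Qcoh k) (sum_all n) X); split.
  by move=> s; apply: omod_hom_ext => U f; apply: lim.
move=> h hd; apply: omod_hom_ext => U f.
have [fP [_ [s fs]]] := sum_coordP f.
have P : (forall j, is_sect (n j) U (sum_coord f j)) /\
    (forall j, ~~ mem s j -> sum_coord f j = 0) /\ @finsupp J K (sum_coord f).
  by split=> //; split=> //; exists s.
have -> : f = part_all s U (mk_sum P) by apply: sum_ext.
rewrite lim /d' -(hd s); reflexivity.
Qed.

End SumDiagram.
End Functors.

Canonical twist_qcoh.
Canonical sum_qcoh.

Lemma dep_choice (A : Type) (B : A -> Type) (P : forall a, B a -> Prop) :
  (forall a, exists b, P a b) -> exists f : forall a, B a, forall a, P a (f a).
Proof.
by move=> ex; exists (fun a => projT1 (cid (ex a))) => a; case: cid.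
Qed.

(** * Direct sums, Koszul exactness and the isomorphism criterion *)

Section FunctorProperties.
Variable k : closedFieldType.
Local Notation K := (ratfun k).
Local Notation "x %:F" := (tofrac x) : ring_scope.
Implicit Types (U V W : open k) (M P A B C : qcoh k).
Implicit Types (F G : functor (Qcoh k) (Modk k)).
Local Arguments regular_at : simpl never.

Lemma quot_lin_lift (V W : lmodType k) (f : linmap V W) (S : submodule V) :
  (forall v, S v -> f v = 0) -> exists g : linmap (quotient S) W,
    forall v, g (quot_pi S v) = f v.
Proof.
move=> fS; have E v : f (quot_repr (quot_pi S v)) = f v.
  by apply/subr0_eq; rewrite -linearB; apply/fS/quot_repr_pi.
have lg : linear (fun q : quotient S => f (quot_repr q)).
  move=> a; elim/quot_ind=> u; elim/quot_ind=> v.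
  by rewrite -linearP !E linearP.
by exists (mk_linmap lg).
Qed.

(** The elements coming from finite partial sums form a submodule S. The projection modulo S and the
    zero map agree on every finite partial sum, so uniqueness in the universal property of the limit
    makes the projection zero. *)
Lemma direct_limits_sums F : preserves_direct_limits F -> preserves_sums F.
Proof.
move=> lim J n v.
pose part (s : seq J) : qcoh k := sum_qcoh k n (mem s).
pose part_in s : omod_hom (part s) (sum_all k n) := part_all k n s.
have [_ univ] := lim _ _ _ (sum_direct_limit k n).
pose S' (x : fval F (sum_all k n)) := exists s (y : fval F (part s)), fapp F (part_in s) y = x.
have incl (s t : seq J) (st : {subset s <= t}) (y : fval F (part s)) :
    fapp F (part_in t) (fapp F (part_incl k n st) y) = fapp F (part_in s) y.
  rewrite -fapp_comp; congr (fapp F _ y).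
  by apply: omod_hom_ext => U f; apply: sum_ext.
have S0 : S' 0 by exists [::], 0; rewrite linear0.
have SL a x y : S' x -> S' y -> S' (a *: x + y).
  move=> [s [x' <-]] [t [y' <-]].
  have st : {subset s <= s ++ t} by move=> j js; rewrite mem_cat js.
  have ts : {subset t <= s ++ t} by move=> j jt; rewrite mem_cat jt orbT.
  exists (s ++ t), (a *: fapp F (part_incl k n st) x' + fapp F (part_incl k n ts) y').
  by rewrite linearP /= !incl.
pose S := Submodule S0 SL.
have [s [y Ey]] : S' v.
  apply/(@quot_pi0 _ _ S).
  pose q : linmap (fval F (sum_all k n)) (quotient S) := mk_linmap (@quot_pi_linear _ _ S).
  have [|h [_ hu]] := univ (quotient S) (fun s => 0 : linmap (fval F (part s)) (quotient S)).
    by move=> s t st; apply: linmap_ext.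
  have hq : h = q.
    apply: hu => s; apply: linmap_ext => y.
    by apply/(@quot_pi0 _ _ S); exists s, y.
  have h0 : h = (0 : linmap _ _) by apply: hu => s; apply: linmap_ext.
  by rewrite -[quot_pi S v]/(q v) -hq h0.
exists (undup s); split; first exact: undup_uniq.
rewrite -Ey.
under eq_bigr => j _ do rewrite -!fapp_comp.
rewrite -fapp_sum; congr (fapp F _ y); apply: omod_hom_ext => U f.
rewrite omod_hom_sum; apply: (sum_decomp (undup_uniq s)) => j; rewrite mem_undup => js.
by have [_ [D0 _]] := sum_coordP f; apply: D0.
Qed.

(** ** Koszul exactness *)

(** The homogeneous coordinates x0, for [true], and x1, for [false], in the chart x1 = 1. *)
Definition xsect (c : bool) : K := if c then 'X%:F else 1.

Lemma xsect_sect c U : is_sect 1 U (xsect c).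
Proof.
have E : xsect c = if c then lin (Some 0) else lin None.
  by case: c; rewrite /= /lin /= ?subr0 ?tofrac1.
by rewrite E => x _; case: c {E}; apply: twist_at_lin.
Qed.

Section Koszul.
Variables (n m l : int) (nm : m = n + 1) (ml : l = m + 1).

Lemma koszul_sect1 c : is_sect (m - n) (whole k) (xsect c).
Proof. by rewrite nm addrC addKr; apply: xsect_sect. Qed.

Lemma koszul_sect2 c : is_sect (l - m) (whole k) (xsect c).
Proof. by rewrite ml addrC addKr; apply: xsect_sect. Qed.

Let S : qcoh k := @sum_all k bool (fun _ => m).

Definition koszul_in : omod_hom (twist_qcoh k n) S :=
  omod_comp (sum_in k (fun _ : bool => m) true) (mul_hom n m (xsect true)) +
  omod_comp (sum_in k (fun _ : bool => m) false) (mul_hom n m (xsect false)).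

(** The sign makes this x0 s_false - x1 s_true, which vanishes on the pair (x0 h, x1 h). *)
Definition koszul_out : omod_hom S (twist_qcoh k l) :=
  sum_lift xpredT (fun c : bool => (-1) ^+ c *: mul_hom m l (xsect (~~ c))).

Lemma koszul_in_coord U (h : twist k n U) c :
  sum_coord (koszul_in U h) c = xsect c * twist_val h.
Proof.
have -> : sum_coord (koszul_in U h) c =
    sum_coord (sum_inj k (fun _ : bool => m) xpredT true U (mul_hom n m (xsect true) U h)) c +
    sum_coord (sum_inj k (fun _ : bool => m) xpredT false U (mul_hom n m (xsect false) U h)) c.
  by [].
rewrite !sum_inj_coord !(mul_homE _ (koszul_sect1 _)).
by case: c; rewrite /= ?addr0 ?add0r.
Qed.

Lemma koszul_out_val U (s : S U) :
  twist_val (koszul_out U s) = sum_coord s false * 'X%:F - sum_coord s true :> K.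
Proof.
rewrite [koszul_out U s]/(sum_lift_fun _ _) /sum_lift_fun.
rewrite (@fsumE _ _ _ [:: true; false]) //; last by case.
rewrite !big_cons big_nil addr0 twist_valD.
have E (c : bool) : twist_val (((-1) ^+ c *: mul_hom m l (xsect (~~ c))) U (sum_part c s)) =
   (((-1) ^+ c)%:P)%:F * (xsect (~~ c) * sum_coord s c) :> K.
  by rewrite omod_homZ twist_valZ (mul_homE _ (koszul_sect2 _)) val_sum_part.
rewrite !E /= expr1 expr0 polyCN polyC1 tofracN tofrac1 mulN1r !mul1r.
by rewrite addrC [sum_coord s false * _]mulrC.
Qed.

Lemma koszul_exact : sheaf_exact koszul_in koszul_out.
Proof.
have comp0 U h : koszul_out U (koszul_in U h) = 0.
  apply: twist_ext; rewrite koszul_out_val !koszul_in_coord /= mul1r.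
  by rewrite mulrC subrr.
move=> U s; split=> [E|[I [V [VU [cov im]]]]]; last first.
  apply: (sheaf_separated (VU := VU) cov) => i; have [h Eh] := im i.
  by rewrite raddf0 -omod_hom_res -Eh comp0.
have {}E : sum_coord s true = sum_coord s false * 'X%:F.
  apply/esym/subr0_eq; rewrite -koszul_out_val E; reflexivity.
have [sP _] := sum_coordP s.
(* The preimage is s_false, as x1 is 1. At infinity the degree bound comes from the other component:
   s_true = x0 s_false has degree m = n + 1, and x0 generates O(1) there. *)
have sn : is_sect n U (sum_coord s false).
  case=> [a|] xU; first exact: sP false (Some a) xU.
  have := sP true None xU; rewrite !twist_atE E; move: (sum_coord s false : K) => b.
  rewrite nm opprD (expfzDr _ _ (gen1_neq0 None)) exprN1 -mulrA.
  by rewrite [X in _ * X]mulrC (mulfK (gen1_neq0 None)).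
exists unit, (fun=> U), (fun=> sub_openxx U); split.
  by split; [exact: inhabits tt|split=> [_|x xU]; [exact: sub_openxx|exists tt]].
move=> _; exists (mktw n U (sum_coord s false)); rewrite res_id; apply: sum_ext => c.
rewrite koszul_in_coord (val_mktw sn); case: c => /=; last by rewrite mul1r.
by rewrite E mulrC.
Qed.

(** Each of the two opens covering U misses the zero of one coordinate, and division by that
    coordinate gives a preimage there. *)
Lemma koszul_epi : sheaf_epi koszul_out.
Proof.
have aux U (c : bool) (t : twist k l U) : ~~ mem_open (if c then None else Some 0) U ->
    exists s, koszul_out U s = t.
  move=> cU; pose g : K := (-1) ^+ c * twist_val t / xsect (~~ c).
  have sg : is_sect m U g.
    have E : xsect (~~ c) = lin (if c then None else Some 0).
      by case: (c); rewrite /= /lin /= ?subr0 ?tofrac1.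
    have -> : m = l - 1 by rewrite ml addrK.
    apply: is_sectM; last by move=> x xU; rewrite E; apply: twist_at_linV; apply: contraNneq cU => ->.
    case: (c); last by rewrite expr0 mul1r; apply: twist_sectP.
    by move=> x xU; rewrite expr1 mulN1r; apply/twist_atN/twist_sectP.
  exists (sum_inj k (fun _ : bool => m) xpredT c U (mktw m U g)); apply: twist_ext.
  rewrite koszul_out_val !sum_inj_coord (val_mktw sg) /g; case: (c) => /=.
    by rewrite expr1 mul0r sub0r divr1 mulN1r opprK.
  by rewrite expr0 mul1r subr0 (divfK (X_neq0 k)).
move=> U t; exists bool; eexists.
exists (sub_two (meet_openl U (Open [fset None]%fset)) (meet_openl U (Open [fset (Some 0)]%fset))).
split; first exact: affine_cover.
by case; [apply: (aux _ true)|apply: (aux _ false)];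
  rewrite mem_meet /mem_open !inE eqxx andbF.
Qed.

Definition xmul F (p q : int) (c : bool) : linmap (fval F (twist_qcoh k p)) (fval F (twist_qcoh k q)) :=
  fapp F (mul_hom p q (xsect c)).

Variable F : functor (Qcoh k) (Modk k).
Hypothesis rF : right_exact F.
Let Nn := fval F (twist_qcoh k n).
Let Nm := fval F (twist_qcoh k m).
Let Nl := fval F (twist_qcoh k l).

Lemma koszul_out_sum_in c :
  omod_comp koszul_out (sum_in k (fun _ : bool => m) c) = (-1) ^+ c *: mul_hom m l (xsect (~~ c)).
Proof. by apply: omod_hom_ext => U f; rewrite omod_compE sum_lift_inj. Qed.

Lemma sum_out_koszul_in c :
  omod_comp (sum_out k (fun _ : bool => m) c) koszul_in = mul_hom n m (xsect c).
Proof.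
apply: omod_hom_ext => U f; apply: twist_ext.
by rewrite omod_compE val_sum_part koszul_in_coord (mul_homE _ (koszul_sect1 _)).
Qed.

(** F keeps the Koszul sequence exact at its middle term, so a syzygy of the two coordinates comes
    from degree n; two lifts differ by an element of the socle. *)
Lemma koszul_lift (f g : Nm) : xmul F m l false f = xmul F m l true g ->
  exists h : Nn, xmul F n m true h = f /\ xmul F n m false h = g.
Proof.
move=> E; have [_ ex] := right_exactP rF koszul_exact koszul_epi.
pose b := fapp F (sum_in k (fun _ : bool => m) true) f + fapp F (sum_in k (fun _ : bool => m) false) g.
have out c c' (v : Nm) : fapp F (sum_out k (fun _ : bool => m) c)
    (fapp F (sum_in k (fun _ : bool => m) c') v) = if c == c' then v else 0.
  rewrite -fapp_comp; case: eqP => [->|/eqP cc]; first by rewrite sum_out_in fapp_id.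
  by rewrite /sum_out /sum_in sum_proj_injE ?fapp0.
have [|h Eh] := (ex b).1.
  rewrite linearD /= -!fapp_comp !koszul_out_sum_in !fappZ expr1 expr0 scale1r scaleN1r.
  by move: E; rewrite /xmul => ->; rewrite addNr.
exists h; rewrite /xmul -!sum_out_koszul_in !fapp_comp.
have -> : fapp F koszul_in h = b by [].
by rewrite !linearD /= !out /= addr0 add0r.
Qed.

Lemma koszul_gen (v : Nl) : exists f g : Nm, v = xmul F m l false f + xmul F m l true g.
Proof.
have [/(_ v)[b Eb] _] := right_exactP rF koszul_exact koszul_epi.
have {}Eb : v = fapp F koszul_out b by rewrite Eb.
pose o c := fapp F (sum_out k (fun _ : bool => m) c) b.
have E : b = fapp F (sum_in k (fun _ : bool => m) true) (o true) +
    fapp F (sum_in k (fun _ : bool => m) false) (o false).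
  rewrite /o -!fapp_comp -fappD -[LHS]fapp_id; congr (fapp F _ b).
  apply: omod_hom_ext => U s; rewrite omod_homD !omod_compE.
  rewrite [LHS](@sum_decomp k _ _ _ U s [:: true; false]) //; last by case.
  by rewrite !big_cons big_nil addr0.
rewrite {}Eb; move: (o true) (o false) E => f g ->; exists (- f), g.
rewrite linearD /= -(fapp_comp koszul_out) -[X in _ + X]fapp_comp !koszul_out_sum_in.
by rewrite (fappZ ((-1) ^+ true)) (fappZ ((-1) ^+ false)) expr1 expr0 scale1r scaleN1r linearN.
Qed.

End Koszul.

(** ** The criterion for a natural transformation to be an isomorphism *)

Section Criterion.
Variables (F G : functor (Qcoh k) (Modk k)).
Variable zeta : forall A, linmap (fval G A) (fval F A).
Hypothesis zeta_nat : forall A B (f : omod_hom A B) v,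
  zeta B (fapp G f v) = fapp F f (zeta A v).
Hypotheses (rF : right_exact F) (rG : right_exact G).
Hypotheses (sF : preserves_sums F) (sG : preserves_sums G).
Hypothesis zeta_inj : forall n v, zeta (twist_qcoh k n) v = 0 -> v = 0.
Hypothesis zeta_surj : forall n w, exists v, zeta (twist_qcoh k n) v = w.

Lemma sum_nat_inj (J : choiceType) (n : J -> int) v : zeta (sum_all k n) v = 0 -> v = 0.
Proof.
move=> v0; have [s [_ ->]] := sG v; apply: big1 => j _.
by rewrite (@zeta_inj (n j) (fapp G (sum_out k n j) v)) ?linear0 // zeta_nat v0 linear0.
Qed.

Lemma sum_nat_surj (J : choiceType) (n : J -> int) w : exists v, zeta (sum_all k n) v = w.
Proof.
have [s [_ ->]] := sF w.
have [v vP] : exists v : forall j, fval G (twist_qcoh k (n j)), forall j,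
    zeta (twist_qcoh k (n j)) (v j) = fapp F (sum_out k n j) w.
  exact: (dep_choice (fun j => zeta_surj (fapp F (sum_out k n j) w))).
exists (\sum_(j <- s) fapp G (sum_in k n j) (v j)).
by rewrite linear_sum; apply: eq_bigr => j _; rewrite /= zeta_nat vP.
Qed.

Lemma nat_surj A w : exists v, zeta A v = w.
Proof.
pose p := pres_map (0 : omod_hom A A).
have [surF _] := right_exactP rF (pres_map_exact p) (@pres_map_epi k A).
have [b <-] := surF w; have [v <-] := sum_nat_surj b.
by exists (fapp G p v); rewrite zeta_nat.
Qed.

(** The four lemma on a presentation of A by sums of twisting sheaves, on which the transformation
    is already bijective. *)
Lemma nat_inj A v : zeta A v = 0 -> v = 0.
Proof.
pose p := pres_map (0 : omod_hom A A); pose q := pres_map p.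
have epi : sheaf_epi p by apply: pres_map_epi.
have exact : sheaf_exact q p by apply: pres_map_exact.
have [surG kerG] := right_exactP rG exact epi.
have [_ kerF] := right_exactP rF exact epi.
have [b <-] := surG v; rewrite zeta_nat => /kerF[a Ea].
have [c Ec] := sum_nat_surj a.
suff -> : b = fapp G q c by apply/kerG; exists c.
apply/subr0_eq/sum_nat_inj; rewrite linearB /=; apply/eqP; rewrite subr_eq0; apply/eqP.
by rewrite -Ea -Ec zeta_nat.
Qed.

End Criterion.

(* Induction downwards along the Koszul sequence: the kernel of
   [N n -> N (n + 1) ^ 2] is the socle in degree [n]. *)
Section Socle.
Variables (F G : functor (Qcoh k) (Modk k)).
Variable zeta : forall A, linmap (fval G A) (fval F A).
Hypothesis zeta_nat : forall A B (f : omod_hom A B) v,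
  zeta B (fapp G f v) = fapp F f (zeta A v).
Hypotheses (rF : right_exact F) (rG : right_exact G).
Variable n0 : int.
Let N F n := fval F (twist_qcoh k n).
Let Z n : linmap (N G n) (N F n) := zeta (twist_qcoh k n).
Hypothesis zeta_inj : forall n, n0 <= n -> forall v, Z n v = 0 -> v = 0.
Hypothesis zeta_surj : forall n, n0 <= n -> forall w, exists v, Z n v = w.
Hypothesis socle_inj : forall n, n < n0 -> forall v : N G n,
  (forall c, xmul G n (n + 1) c v = 0) -> Z n v = 0 -> v = 0.
Hypothesis socle_surj : forall n, n < n0 -> forall w : N F n,
  (forall c, xmul F n (n + 1) c w = 0) -> exists v, Z n v = w.

Lemma socle_bij (d : nat) n : n0 <= n + d%:Z ->
  (forall v, Z n v = 0 -> v = 0) /\ (forall w, exists v, Z n v = w).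
Proof.
elim/ltn_ind: d n => d IHd n nd.
have [le_n|lt_n] := lerP n0 n; first by split; [exact: zeta_inj|exact: zeta_surj].
have [inj1 surj1] : (forall v, Z (n + 1) v = 0 -> v = 0) /\ (forall w, exists v, Z (n + 1) v = w).
  apply: (IHd d.-1); lia.
have [inj2 surj2] : (forall v, Z (n + 1 + 1) v = 0 -> v = 0) /\
    (forall w, exists v, Z (n + 1 + 1) v = w).
  have [le_n1|lt_n1] := lerP n0 (n + 1 + 1); first by split; [exact: zeta_inj|exact: zeta_surj].
  apply: (IHd d.-2); lia.
have natx p q c v : Z q (xmul G p q c v) = xmul F p q c (Z p v) by apply: zeta_nat.
split=> [v v0|w].
  by apply: socle_inj => // c; apply: inj1; rewrite natx v0 linear0.
have [f Ef] := surj1 (xmul F n (n + 1) true w).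
have [g Eg] := surj1 (xmul F n (n + 1) false w).
have sect (p : int) c : is_sect (p + 1 - p) (whole k) (xsect c).
  by rewrite addrC addKr; apply: xsect_sect.
have comm (H : functor (Qcoh k) (Modk k)) (v : N H n) :
    xmul H (n + 1) (n + 1 + 1) false (xmul H n (n + 1) true v) =
    xmul H (n + 1) (n + 1 + 1) true (xmul H n (n + 1) false v).
  by rewrite /xmul -!fapp_comp !mul_hom_comp ?sect // [xsect true * _]mulrC.
(* The elements f and g are candidates for the coordinate multiples of a preimage of w; they form a
   syzygy because this can be tested after applying the injective Z in degree n + 2. The lift h then
   matches w up to a socle element. *)
have [|h [hf hg]] := koszul_lift (erefl (n + 1)) (erefl (n + 1 + 1)) rG (f := f) (g := g).
  by apply/subr0_eq/inj2; rewrite linearB /= !natx Ef Eg comm subrr.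
have [|u Eu] := socle_surj lt_n (w := w - Z n h).
  by move=> c; rewrite linearB /= -natx; case: c; rewrite ?hf ?hg ?Ef ?Eg subrr.
by exists (h + u); rewrite linearD /= Eu addrC subrK.
Qed.

Lemma socle_bijection n :
  (forall v, Z n v = 0 -> v = 0) /\ (forall w, exists v, Z n v = w).
Proof. by apply: (@socle_bij `|n0 - n|%N); lia. Qed.

End Socle.
End FunctorProperties.

(** * Finite-dimensional vector spaces *)

Section FiniteDimension.
Variable k : fieldType.
Implicit Types V W : lmodType k.

Definition indep V d (e : 'I_d -> V) : Prop :=
  forall c : 'I_d -> k, \sum_i c i *: e i = 0 -> forall i, c i = 0.

Definition spans V d (e : 'I_d -> V) (S : V -> Prop) : Prop :=
  forall v, S v -> exists c : 'I_d -> k, v = \sum_i c i *: e i.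

(** With more vectors than generators the coefficient matrix has more rows than columns, hence a
    nonzero left kernel. *)
Lemma indep_bound V n m (g : 'I_n -> V) (e : 'I_m -> V) :
  spans g (fun=> True) -> indep e -> (m <= n)%N.
Proof.
move=> sg ie; have [A EA] := choice (fun i => sg (e i) I).
rewrite leqNgt; apply/negP => nm.
pose M := \matrix_(i, j) A i j.
have : kermx M != 0.
  rewrite kermx_eq0; apply: contraL nm => /eqP fM.
  by rewrite -leqNgt -fM rank_leq_col.
case/rowV0Pn=> u /sub_kermxP uM; apply/negP/negPn/eqP/rowP => i; rewrite mxE.
apply: (ie (fun i => u 0 i)); under eq_bigr => j _ do rewrite EA scaler_sumr.
rewrite exchange_big big1 //= => j _.
under eq_bigr => l _ do rewrite scalerA.
have E : \sum_l u 0 l * A l j = (u *m M) 0 j.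
  by rewrite mxE; apply: eq_bigr => l _; rewrite mxE.
by rewrite -scaler_suml E uM mxE scale0r.
Qed.

Definition extend V d (e : 'I_d -> V) (v : V) (i : 'I_d.+1) : V := oapp e v (unlift ord_max i).

Lemma extend_sum V d (e : 'I_d -> V) v (c : 'I_d.+1 -> k) :
  \sum_i c i *: extend e v i = \sum_i c (lift ord_max i) *: e i + c ord_max *: v.
Proof.
rewrite big_ord_recr /= /extend unlift_none /=; congr (_ + _); apply: eq_bigr => i _.
have -> : widen_ord (leqnSn d) i = lift ord_max i by apply: val_inj; rewrite /= /bump leqNgt ltn_ord.
by rewrite liftK.
Qed.

Lemma extend_indep V d (e : 'I_d -> V) v : indep e ->
  (forall c : 'I_d -> k, v <> \sum_i c i *: e i) -> indep (extend e v).
Proof.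
move=> ie nv c; rewrite extend_sum => E.
have c0 : c ord_max = 0.
  apply/eqP/negP => /negP c0; apply: (nv (fun i => - (c ord_max)^-1 * c (lift ord_max i))).
  apply: (scalerI c0); rewrite scaler_sumr.
  under eq_bigr => i _ do rewrite scalerA mulrA mulrN divff // mulN1r scaleNr.
  by rewrite sumrN; apply/eqP; rewrite -addr_eq0 addrC E.
move: E; rewrite c0 scale0r addr0 => /ie cl i.
by case: (unliftP ord_max i) => [j ->|->].
Qed.

(** An independent family in S of maximal length: lengths are bounded by [indep_bound], and a vector
    outside the span would extend the family. *)
Lemma basis_exists V (S : submodule V) n (g : 'I_n -> V) : spans g (fun=> True) ->
  exists d (e : 'I_d -> V), [/\ forall i, S (e i), indep e & spans e S].
Proof.
move=> sg; pose P d := `[< exists e : 'I_d -> V, (forall i, S (e i)) /\ indep e >].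
have P0 : exists d, P d.
  by exists 0%N; apply/asboolP; exists (fun=> 0); split=> [[]|c _ []].
have Pn d : P d -> (d <= n)%N by move=> /asboolP[e [_ ie]]; exact: indep_bound sg ie.
case: (ex_maxnP P0 Pn) => d /asboolP[e [Se ie]] dmax; exists d, e; split=> // v Sv.
apply: contrapT => nv; have /dmax : P d.+1; last by rewrite ltnn.
apply/asboolP; exists (extend e v); split=> [i|]; last first.
  by apply: extend_indep => // c E; apply: nv; exists c.
by rewrite /extend; case: (unlift _ _) => [j|] //=.
Qed.

Definition whole_submodule V : submodule V :=
  @Submodule _ V (fun=> True) I (fun _ _ _ _ _ => I).

Definition is_basis V d (e : 'I_d -> V) : Prop := indep e /\ spans e (fun=> True).

Lemma fg_basis V : finitely_generated V -> exists d (e : 'I_d -> V), is_basis e.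
Proof.
move=> [n [g sg]]; have sg' : spans g (fun=> True) by move=> v _; apply: sg.
by have [d [e [_ ie se]]] := basis_exists (whole_submodule V) sg'; exists d, e.
Qed.

Lemma surj_dim V W d d' (e : 'I_d -> V) (e' : 'I_d' -> W) (f : {linear V -> W}) :
  is_basis e -> is_basis e' -> (forall w, exists v, f v = w) -> (d' <= d)%N.
Proof.
move=> [_ se] [ie' _] sf; have [u Eu] := choice (fun i => sf (e' i)).
apply: (indep_bound (e := u) se) => c E; apply: ie'.
transitivity (f (\sum_i c i *: u i)); last by rewrite E linear0.
by rewrite linear_sum; apply: eq_bigr => i _; rewrite linearZ /= Eu.
Qed.

(** Preimages u of the target basis are independent. A kernel vector in their span is zero; one
    outside would give d + 1 independent vectors. *)
Lemma surj_dim_inj V W d (e : 'I_d -> V) (e' : 'I_d -> W) (f : {linear V -> W}) :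
  is_basis e -> is_basis e' -> (forall w, exists v, f v = w) ->
  forall v, f v = 0 -> v = 0.
Proof.
move=> [_ se] [ie' _] sf v fv0; have [u Eu] := choice (fun i => sf (e' i)).
have fu (c : 'I_d -> k) : f (\sum_i c i *: u i) = \sum_i c i *: e' i.
  by rewrite linear_sum; apply: eq_bigr => i _; rewrite linearZ /= Eu.
have iu : indep u by move=> c E; apply: ie'; rewrite -fu E linear0.
have [[c Ec]|nv] := pselect (exists c : 'I_d -> k, v = \sum_i c i *: u i).
  have c0 := ie' c; rewrite Ec big1 // => i _; rewrite c0 ?scale0r //.
  by rewrite -fu -Ec.
have : indep (extend u v) by apply: extend_indep => // c E; apply: nv; exists c.
by move=> /(indep_bound se); rewrite ltnn.
Qed.

(** One vector from each difference of consecutive steps gives r independent vectors: in a linear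
    relation the term of lowest index would fall into the next step. *)
Lemma chain_bound V n (g : 'I_n -> V) (S : nat -> V -> Prop) (r : nat) :
  spans g (fun=> True) ->
  (forall i a u v, S i u -> S i v -> S i (a *: u + v)) -> (forall i, S i 0) ->
  (forall i v, S i.+1 v -> S i v) ->
  (forall i, (i < r)%N -> exists v, S i v /\ ~ S i.+1 v) -> (r <= n)%N.
Proof.
move=> sg SL S0 Sdec Sstrict.
have [u uP] := @choice _ _ (fun (i : 'I_r) v => S i v /\ ~ S i.+1 v)
  (fun i => Sstrict i (ltn_ord i)).
apply: (indep_bound (e := u) sg) => c E.
have SN i v : S i v -> S i (- v).
  by move=> Sv; rewrite -[- v]addr0 -scaleN1r; apply: SL.
have Sle i j v : (i <= j)%N -> S j v -> S i v.
  by move=> /subnK <-; elim: (j - i)%N => [|m IHm] //= /Sdec.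
have Ssum i (P : pred 'I_r) : (forall j : 'I_r, P j -> (i <= j)%N) -> S i (\sum_(j : 'I_r | P j) c j *: u j).
  move=> Pi; elim/big_rec: _ => [//|j v Pj Sv]; apply: SL => //.
  by apply: (Sle i j) => //; [exact: Pi|have [] := uP j].
suff all0 m : (m <= r)%N -> forall i : 'I_r, (i < m)%N -> c i = 0.
  by move=> i; apply: (all0 r).
elim: m => [//|m IHm] mr i; rewrite ltnS leq_eqVlt => /predU1P[im|]; last exact/IHm/ltnW.
apply/eqP/negP => /negP ci0; have [_] := uP i; apply.
have -> : u i = - ((c i)^-1 *: \sum_(j : 'I_r | (i < j)%N) c j *: u j).
  move: E; rewrite (bigD1 i) //= (bigID (fun j : 'I_r => (i < j)%N)) /=.
  rewrite [X in _ + (_ + X)]big1 => [|j /andP[ji]]; last first.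
    rewrite -leqNgt leq_eqVlt => /predU1P[ij|]; first by rewrite (val_inj ij) eqxx in ji.
    by rewrite im => /(IHm (ltnW mr)) ->; rewrite scale0r.
  rewrite addr0 => /eqP; rewrite addr_eq0 => /eqP /(congr1 (GRing.scale (c i)^-1)).
  rewrite scalerA mulVf // scale1r scalerN => ->; congr (- (_ *: _)).
  by apply: eq_bigl => j; case: (ltngtP i j) => ij; rewrite ?andbT ?andbF //; apply: contraTneq ij => ->; rewrite ltnn.
apply: SN; rewrite -[_ *: _]addr0; apply: SL => //.
exact: Ssum.
Qed.

End FiniteDimension.

Lemma dep_sequence (T : nat -> Type) (P : forall a, T a -> Prop)
    (R : forall a, T a -> T a.+1 -> Prop) (x0 : T 0%N) :
  P 0%N x0 -> (forall a x, P a x -> exists y, P a.+1 y /\ R a x y) ->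
  exists s : forall a, T a, s 0%N = x0 /\ forall a, P a (s a) /\ R a (s a) (s a.+1).
Proof.
move=> P0 step.
pose next a (x : {x : T a | P a x}) : {y : T a.+1 | P a.+1 y} :=
  let: exist y Py := cid (step a (sval x) (svalP x)) in exist _ y Py.1.
pose s := nat_rect (fun a => {x : T a | P a x}) (exist _ x0 P0) next.
exists (fun a => sval (s a)); split=> // a; split; first exact: svalP (s a).
by rewrite /s /= /next; case: cid => y [].
Qed.

(** * The graded module of a right exact functor *)

Lemma sub_swap (V : zmodType) (a b c d : V) : a - b = c - d -> b - d = a - c.
Proof.
by move/eqP; rewrite subr_eq => /eqP ->; rewrite -(addrA c) (addrC c) addrK addrC.
Qed.

Section GradedModule.
Variable k : closedFieldType.
Local Notation K := (ratfun k).
Local Notation "x %:F" := (tofrac x) : ring_scope.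
Implicit Types (U V W : open k) (c a b : k) (n m l p q r : int) (g h : K).
Local Arguments regular_at : simpl never.

Definition graded F n : lmodType k := fval F (twist_qcoh k n).
(** For g = 1 and provably equal p and q this serves as the transport between [graded F p] and
    [graded F q]. *)
Definition mu (F : functor (Qcoh k) (Modk k)) p q g : linmap (graded F p) (graded F q) :=
  fapp F (mul_hom p q g).

Lemma mu_comp F p q r g h v :
  is_sect (q - p) (whole k) g -> is_sect (r - q) (whole k) h ->
  mu F q r h (mu F p q g v) = mu F p r (h * g) v.
Proof. by move=> sg sh; rewrite /mu -fapp_comp mul_hom_comp. Qed.

Lemma mu1 F n v : mu F n n 1 v = v.
Proof. by rewrite /mu mul_hom1; apply: fapp_id. Qed.

Definition lc c : K := lin (Some c).

Lemma lc_sect c U : is_sect 1 U (lc c).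
Proof. by move=> x _; apply: twist_at_lin. Qed.

Lemma one_sect U : is_sect 1 U (1 : K).
Proof. exact: (@xsect_sect k false). Qed.

Lemma X_sect U : is_sect 1 U ('X%:F : K).
Proof. exact: (@xsect_sect k true). Qed.

Lemma sect_degree n m U g : is_sect n U g -> n = m -> is_sect m U g.
Proof. by move=> sg <-. Qed.

Lemma lc_expand c : lc c = 'X%:F + ((- c)%:P)%:F * 1.
Proof. by rewrite /lc /lin /= tofracB polyCN tofracN mulr1. Qed.

Lemma mu_lc F p q c v : q = p + 1 ->
  mu F p q (lc c) v = mu F p q 'X%:F v - c *: mu F p q 1 v.
Proof.
move=> pq.
have s1 : is_sect (q - p) (whole k) (1 : K).
  by apply: (sect_degree (@one_sect _)); rewrite pq; ring.
have sX : is_sect (q - p) (whole k) ('X%:F : K).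
  by apply: (sect_degree (@X_sect _)); rewrite pq; ring.
rewrite /mu lc_expand mul_homD ?mul_homZ //; last exact: is_sectCM.
by rewrite fappD fappZ scaleNr.
Qed.

Section Structure.
Variable F : functor (Qcoh k) (Modk k).
Hypotheses (rF : right_exact F) (fF : preserves_coherence F).
Local Notation N := (graded F).
Local Notation mu := (mu F).

Lemma graded_basis n : exists d (e : 'I_d -> N n), is_basis e.
Proof. exact/fg_basis/fF/twist_coherent. Qed.

(* Koszul exactness for the coordinates [x - c] and [1]. *)
Lemma lift_lc n m l c (f g : N m) : m = n + 1 -> l = m + 1 ->
  mu m l 1 f = mu m l (lc c) g ->
  exists h : N n, mu n m (lc c) h = f /\ mu n m 1 h = g.
Proof.
move=> nm ml E; have [|h [hX h1]] := koszul_lift nm ml rF (f := f + c *: g) (g := g).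
  rewrite /xmul /= linearD linearZ /=; move: E; rewrite -/(mu m l 1) mu_lc // => E.
  by rewrite -[fapp _ _ f]/(mu m l 1 f) E subrK.
exists h; rewrite mu_lc //; split=> //.
by move: hX h1; rewrite /xmul /= -/(mu _ _ _) -/(mu _ _ _) => -> ->; rewrite addrK.
Qed.

(** The forms of two distinct points are coordinates too. The equation says x0 (f - g) = x1 (a f - b
    g), so f - g = x1 h and a f - b g = x0 h for some h, and then (x0 - b x1) h = (a - b) f. *)
Lemma lift_lc2 n m l a b (f g : N m) : m = n + 1 -> l = m + 1 -> a != b ->
  mu m l (lc a) f = mu m l (lc b) g -> exists h : N n, mu n m (lc b) h = f.
Proof.
move=> nm ml ab; rewrite !mu_lc // => E.
have [|h [hX h1]] := koszul_lift nm ml rF (f := a *: f - b *: g) (g := f - g).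
  rewrite /xmul /= !linearB !linearZ /= ?scalerN; exact: sub_swap E.
exists ((a - b)^-1 *: h); rewrite linearZ /= mu_lc //.
move: hX h1; rewrite /xmul /= -/(mu _ _ _) -/(mu _ _ _) => -> ->.
have -> : a *: f - b *: g - b *: (f - g) = (a - b) *: f.
  by rewrite scalerBr opprB addrA addrNK scalerBl.
by rewrite scalerA mulVf ?scale1r // subr_eq0.
Qed.

(** ** Linear forms acting surjectively *)

Definition lc_surj c n : Prop := forall v : N (n + 1), exists u : N n, mu n (n + 1) (lc c) u = v.

Lemma mu_comm n m m' l g h (v : N n) : m = n + 1 -> m' = n + 1 -> l = n + 1 + 1 ->
  is_sect 1 (whole k) g -> is_sect 1 (whole k) h ->
  mu m l h (mu n m g v) = mu m' l g (mu n m' h v).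
Proof.
move=> -> -> -> sg sh; rewrite !mu_comp ?[h * g]mulrC //;
  by [apply: (sect_degree sg); ring|apply: (sect_degree sh); ring].
Qed.

(** Degree n + 2 is generated by coordinate multiples from degree n + 1, and multiplication by a
    coordinate commutes with [lc c]. *)
Lemma lc_surj_up c n : lc_surj c n -> lc_surj c (n + 1).
Proof.
move=> sc v.
have [f [g ->]] := koszul_gen (erefl (n + 1)) (erefl (n + 1 + 1)) rF v.
have [g' Eg] := sc g; have [f' Ef] := sc f.
rewrite /xmul /= -!/(mu _ _ _).
have Xg : mu (n + 1) (n + 1 + 1) 'X%:F g = mu (n + 1) (n + 1 + 1) (lc c) (mu n (n + 1) 'X%:F g').
  by rewrite -Eg (mu_comm (m' := n + 1)) //; [exact: lc_sect|exact: X_sect].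
have Xf : mu (n + 1) (n + 1 + 1) 1 f = mu (n + 1) (n + 1 + 1) (lc c) (mu n (n + 1) 1 f').
  by rewrite -Ef (mu_comm (m' := n + 1)) //; [exact: lc_sect|exact: one_sect].
exists (mu n (n + 1) 1 f' + mu n (n + 1) 'X%:F g').
by rewrite linearD /= -Xf -Xg.
Qed.

(** From x1 v = (x0 - c x1) u, Koszul exactness for x0 - c x1 and x1 makes v itself a multiple of x0
    - c x1. With the upward step, surjectivity does not depend on the degree. *)
Lemma lc_surj_down c n : lc_surj c (n + 1) -> lc_surj c n.
Proof.
move=> sc v; have [u Eu] := sc (mu (n + 1) (n + 1 + 1) 1 v).
by have [h [Eh _]] := lift_lc (erefl _) (erefl _) (esym Eu); exists h.
Qed.

Lemma int_shift_ind (P : int -> Prop) n : P n ->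
  (forall m, P m -> P (m + 1)) -> (forall m, P (m + 1) -> P m) -> forall m, P m.
Proof.
move=> Pn up down m; have [le_nm|/ltW le_mn] := lerP n m.
  have -> : m = n + `|m - n|%N by lia.
  by elim: `|m - n|%N => [|d IHd]; rewrite ?addr0 // -addn1 PoszD addrA; apply: up.
have : P (m + `|n - m|%N) by have -> : m + `|n - m|%N = n by lia.
by elim: `|n - m|%N => [|d IHd]; rewrite ?addr0 // -addn1 PoszD addrA => /down.
Qed.

Lemma lc_surj_all c n m : lc_surj c n -> lc_surj c m.
Proof. by move=> sc; apply: (int_shift_ind sc); [apply: lc_surj_up|apply: lc_surj_down]. Qed.

Definition lc_image c n (v : N n) : Prop := exists u : N (n - 1), mu (n - 1) n (lc c) u = v.

Definition lcs (s : seq k) : K := \prod_(a <- s) lc a.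

Lemma lcs_sect s U : is_sect (size s) U (lcs s).
Proof.
rewrite /lcs; elim: s => [|a s IHs].
  by rewrite big_nil => x _; rewrite twist_at0; apply: regular_at1.
by rewrite big_cons -[size _]add1n PoszD; apply: is_sectM IHs; apply: lc_sect.
Qed.

(** Divisibility by [lc c] survives the removal of a factor [lc a] with a distinct from c, by
    [lift_lc2]; the factors are peeled off one at a time. *)
Lemma lcs_image c s p q (v : N p) : c \notin s -> q = p + size s ->
  lc_image c (mu p q (lcs s) v) -> lc_image c v.
Proof.
elim: s q => [|a s IHs] q; rewrite ?inE ?negb_or => ns.
  by rewrite addr0 => -> ; rewrite /lcs big_nil mu1.
case/andP: ns => ca ns Eq; pose q' := p + size s.
have qq' : q = q' + 1 by rewrite Eq /q' /= -addn1 PoszD addrA.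
rewrite /lcs big_cons -(mu_comp (q := q')).
- move=> [u Eu]; apply: (IHs q') => //; rewrite /lc_image.
  have Eu' : mu q' q (lc a) (mu p q' (lcs s) v) = mu q' q (lc c) (mu (q - 1) q' 1 u).
    rewrite -Eu mu_comp ?mulr1 //.
      by rewrite qq' addrK subrr => x _; rewrite twist_at0; apply: regular_at1.
    by apply: (sect_degree (@lc_sect _ _)); rewrite qq'; ring.
  apply: (lift_lc2 (l := q) _ _ _ Eu'); [by rewrite subrK|exact: qq'|by rewrite eq_sym].
- by apply: (sect_degree (@lcs_sect s _)); rewrite /q'; ring.
- by apply: (sect_degree (@lc_sect a _)); rewrite qq'; ring.
Qed.

Lemma exists_distinct (r : nat) : exists s : seq k, uniq s /\ size s = r.
Proof.
elim: r => [|r [s [us sr]]]; first by exists [::].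
by have [c cs] := exists_notin s; exists (c :: s); rewrite /= cs us sr.
Qed.

(** Otherwise take d + 1 distinct points, d being the dimension of N 0: the images in N 0 of the
    products of the first i forms would decrease strictly for d + 1 steps. *)
Lemma exists_lc_surj : exists c, forall n, lc_surj c n.
Proof.
apply: contrapT => no.
have {}no c n : ~ lc_surj c n.
  by move=> sc; apply: no; exists c => m; apply: lc_surj_all sc.
have [d [e [_ se]]] := graded_basis 0.
have [s [us sr]] := exists_distinct d.+1.
pose S i (v : N 0) := exists u : N (- i%:Z), mu (- i%:Z) 0 (lcs (take i s)) u = v.
have takeS i : (i < d.+1)%N -> lcs (take i.+1 s) = lcs (take i s) * lc (nth 0 s i).
  by move=> lt_i; rewrite (take_nth 0) ?sr // /lcs -cats1 big_cat big_seq1.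
have sect i : (i <= d.+1)%N -> is_sect (0 - - i%:Z) (whole k) (lcs (take i s)).
  by move=> le_i; apply: (sect_degree (@lcs_sect _ _)); rewrite size_take sr; case: ltngtP le_i => //; lia.
suff : (d.+1 <= d)%N by rewrite ltnn.
(* The chain is made constant past d + 1, where the list of points ends. *)
pose S' i v := S (minn i d.+1) v.
apply: (chain_bound (S := S') se).
- move=> i a u v [u' <-] [v' <-]; exists (a *: u' + v'); by rewrite linearP.
- by move=> i; exists 0; rewrite linear0.
- move=> i v; rewrite /S'; have [le_i|lt_i] := leqP d.+1 i.
    by rewrite (minn_idPr (leq_trans le_i (leqnSn i))).
  rewrite (minn_idPl lt_i) => -[u <-].
  exists (mu (- i.+1%:Z) (- i%:Z) (lc (nth 0 s i)) u); rewrite mu_comp ?takeS //.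
    by apply: (sect_degree (@lc_sect _ _)); lia.
  by apply: sect; apply: ltnW.
move=> i lt_i; rewrite /S' (minn_idPl lt_i) (minn_idPl (ltnW lt_i)).
apply: contrapT => noti.
(* If two consecutive images coincide, every w of degree - i is a multiple of the next form: w and
   some multiple of that form have the same image, the first i forms kill the difference, and
   [lcs_image] divides it. *)
apply: (no (nth 0 s i) (- i%:Z - 1)) => v.
have eqi : - i%:Z - 1 + 1 = - i%:Z by rewrite subrK.
pose w : N (- i%:Z) := mu _ _ 1 v.
have [u Eu] : lc_image (nth 0 s i) w.
  have [u Eu] : S i.+1 (mu (- i%:Z) 0 (lcs (take i s)) w).
    by apply: contrapT => nS; apply: noti; exists (mu (- i%:Z) 0 (lcs (take i s)) w); split=> //; exists w.
  pose u' : N (- i%:Z - 1) := mu _ _ 1 u.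
  have su : is_sect (- i%:Z - 1 - - i.+1%:Z) (whole k) (1 : K).
    by apply: (sect_degree (n := 0)); [move=> x _; rewrite twist_at0; apply: regular_at1|lia].
  have sl : is_sect (- i%:Z - (- i%:Z - 1)) (whole k) (lc (nth 0 s i)).
    by apply: (sect_degree (@lc_sect _ _)); ring.
  have sl' : is_sect (- i%:Z - - i.+1%:Z) (whole k) (lc (nth 0 s i)).
    by apply: (sect_degree (@lc_sect _ _)); lia.
  have E : mu (- i%:Z) 0 (lcs (take i s)) (w - mu (- i%:Z - 1) (- i%:Z) (lc (nth 0 s i)) u') = 0.
    rewrite linearB /= -Eu takeS // -(mu_comp _ sl' (sect _ (ltnW lt_i))) -linearB /=.
    by rewrite /u' mu_comp // mulr1 subrr linear0.
  have [|||t Et] := @lcs_image (nth 0 s i) (take i s) (- i%:Z) 0 (w - mu (- i%:Z - 1) (- i%:Z) (lc (nth 0 s i)) u').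
  - by move: us; rewrite -{1}(cat_take_drop i s) (drop_nth 0) ?sr // cat_uniq /= negb_or => /and3P[_ /andP[]].
  - by rewrite size_take sr lt_i; ring.
  - by rewrite E; exists 0; rewrite linear0.
  by exists (t + u'); rewrite linearD /= Et subrK.
have sw : is_sect (- i%:Z - (- i%:Z - 1 + 1)) (whole k) (1 : K).
  by apply: (sect_degree (n := 0)); [move=> x _; rewrite twist_at0; apply: regular_at1|ring].
have sw' : is_sect (- i%:Z - 1 + 1 - - i%:Z) (whole k) (1 : K).
  by apply: (sect_degree (n := 0)); [move=> x _; rewrite twist_at0; apply: regular_at1|ring].
have -> : v = mu (- i%:Z) _ 1 w by rewrite /w mu_comp // mulr1 mu1.
exists u; rewrite -Eu mu_comp ?mul1r //.
by apply: (sect_degree (@lc_sect _ _)); ring.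
Qed.

(** ** The stable range *)

(** Along the surjections the dimension does not increase, so it is constant from the degree of
    minimal dimension on, and a surjection between spaces of equal dimension is injective. *)
Lemma exists_stable c : (forall n, lc_surj c n) -> exists n0 : nat, forall n, n0%:Z <= n ->
  forall v : N n, mu n (n + 1) (lc c) v = 0 -> v = 0.
Proof.
move=> sc; have [d dP] := dep_choice (fun n : nat => graded_basis n%:Z).
have ex : exists v : nat, `[< exists n : nat, d n = v >] by exists (d 0%N); apply/asboolP; exists 0%N.
case: (ex_minnP ex) => v /asboolP[n0 En0] vmin; exists n0 => n.
case: n => [n|//] le_n.
have dec (m : nat) : (d m.+1 <= d m)%N.
  have [e eP] := dP m; have [e' eP'] := dP m.+1.
  apply: (surj_dim (f := mu m%:Z m.+1%:Z (lc c)) eP eP').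
  have -> : m.+1%:Z = m%:Z + 1 by rewrite -addn1 PoszD.
  exact: sc.
have dn0 (m : nat) : (n0 <= m)%N -> d m = v.
  move=> /subnK <-; elim: (m - n0)%N => [//|j IHj]; apply/eqP; rewrite eqn_leq.
  rewrite vmin ?andbT; last by apply/asboolP; exists (j.+1 + n0)%N.
  by rewrite -IHj addSn dec.
have [e eP] := dP n; have [e' eP'] := dP n.+1.
have E : n.+1%:Z = n%:Z + 1 by rewrite -addn1 PoszD.
have dd : d n.+1 = d n by rewrite !dn0 // ltnW.
move: e' eP'; rewrite dd E => e' eP'.
exact: (surj_dim_inj (f := mu n%:Z (n%:Z + 1) (lc c)) eP eP' (sc n)).
Qed.

End Structure.
End GradedModule.

(** * Compatible systems in the graded module *)

Section Systems.
Variable k : closedFieldType.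
Local Notation K := (ratfun k).
Local Notation "x %:F" := (tofrac x) : ring_scope.
Implicit Types (U V W : open k) (c : k) (n m l p q r : int) (g h : K).
Local Arguments regular_at : simpl never.

Definition compl (x : P1 k) : open k := Open [fset x]%fset.
Definition torus : open k := meet_open (compl None) (compl (Some 0)).

Lemma codeg_compl x : codeg (compl x) = 1%N.
Proof. exact: cardfs1. Qed.

Lemma coform_compl x : coform (compl x) = lin x.
Proof. exact: big_seq_fset1. Qed.

Lemma codeg_torus : codeg torus = 2%N.
Proof. by rewrite /codeg /torus /= cardfs2. Qed.

Lemma coform_torus : coform torus = 'X%:F.
Proof.
have -> : coform torus = lin None * lin (Some 0).
  rewrite /coform (_ : removed torus = [fset None; Some 0]%fset) //.
  by rewrite big_fsetU1 ?inE //= big_seq_fset1.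
by rewrite /lin /= tofrac1 mul1r polyC0 subr0.
Qed.

Lemma codegree_compl x n a : codegree (compl x) n a = n - a%:Z.
Proof. by rewrite /codegree codeg_compl muln1. Qed.

Lemma codegree_torus n a : codegree torus n a = n - a%:Z - a%:Z.
Proof. by rewrite /codegree codeg_torus muln2 -addnn PoszD; ring. Qed.

Lemma one_sect0 n U : n = 0 -> is_sect n U (1 : K).
Proof. by move=> -> x _; rewrite twist_at0; apply: regular_at1. Qed.

Lemma one_sectn (n : nat) U : is_sect n U (1 : K).
Proof. by have := fun x => @twist_at_linX k x None n; rewrite /lin /= tofrac1 expr1n => P x _. Qed.

Lemma X_sectn (n : nat) U : is_sect n U ('X%:F ^+ n : K).
Proof.
move=> x xU; have := twist_atX n (X_sect xU); by rewrite mul1r.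
Qed.

Variable F : functor (Qcoh k) (Modk k).
Hypotheses (rF : right_exact F) (fF : preserves_coherence F).
Local Notation N := (graded F).
Local Notation mu := (mu F).

(** Surjectivity of l = [lc c] gives Z with x1 e_j = l (sum of Z j i e_i) on a basis e of degree n0.
    Koszul exactness for l and x1 lifts such a relation to elements s'_j one degree lower with l
    s'_j = s_j and x1 s'_j = sum of Z j i s_i; these satisfy the same relation, so the process
    continues. *)
Lemma torsion_system c (n0 : int) : (forall n, lc_surj F c n) ->
  (forall n, n0 <= n -> forall v : N n, mu n (n + 1) (lc c) v = 0 -> v = 0) ->
  let D := codegree (compl (Some c)) n0 in
  exists d (s : forall a, 'I_d -> N (D a)) (Z : 'I_d -> 'I_d -> k),
    [/\ is_basis (s 0%N), forall a j, mu (D a.+1) (D a) (lc c) (s a.+1 j) = s a j &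
      forall a j, mu (D a.+1) (D a) 1 (s a.+1 j) = \sum_i Z j i *: s a i].
Proof.
move=> sc st D; have [d [e [ie se]]] := graded_basis fF (D 0%N).
have D1 a : D a = D a.+1 + 1 by rewrite /D !codegree_compl; lia.
have [Z EZ] : exists Z : 'I_d -> 'I_d -> k, forall j, mu (D 0%N) (D 0%N + 1) 1 (e j) =
    mu (D 0%N) (D 0%N + 1) (lc c) (\sum_i Z j i *: e i).
  have [u Eu] := dep_choice (fun j => sc (D 0%N) (mu (D 0%N) (D 0%N + 1) 1 (e j))).
  have [Z EZ] := dep_choice (fun j => se (u j) I).
  by exists Z => j; rewrite -EZ Eu.
pose P a (s : 'I_d -> N (D a)) := forall j, mu (D a) (D a + 1) 1 (s j) =
  mu (D a) (D a + 1) (lc c) (\sum_i Z j i *: s i).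
pose R a (s : 'I_d -> N (D a)) (s' : 'I_d -> N (D a.+1)) := (forall j, mu (D a.+1) (D a) (lc c) (s' j) = s j) /\
  forall j, mu (D a.+1) (D a) 1 (s' j) = \sum_i Z j i *: s i.
have [|s [s0 sP]] := dep_sequence (P := P) (R := R) EZ.
  move=> a s Ps.
  have [s' Es'] := dep_choice (fun j => lift_lc rF (D1 a) (erefl _) (Ps j)).
  exists s'; split; last by split=> j; have [] := Es' j.
  move=> j; rewrite -D1; have [_ ->] := Es' j; rewrite linear_sum /=.
  by apply: eq_bigr => i _; rewrite linearZ /=; have [-> _] := Es' i.
exists d, s, Z; split; first by rewrite s0.
  by move=> a j; have [_ [-> _]] := sP a.
by move=> a j; have [_ [_ ->]] := sP a.
Qed.

Section CofreeSystem.
Variables (i : int) (v : N (- i - 2)).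
Hypothesis v_socle : forall c : bool, xmul F (- i - 2) (- i - 2 + 1) c v = 0.

Let dg (a b : nat) : int := - i - a%:Z - b%:Z.

(** A chosen Koszul lift, 0 when there is none: totality allows [array] to be defined by recursion
    before its compatibility is known. *)
Definition klift n p q (f : N p) (g : N q) : N n :=
  if pselect (exists h : N n, mu n p 'X%:F h = f /\ mu n q 1 h = g) is left ex
  then projT1 (cid ex) else 0.

Lemma kliftP n p q l (f : N p) (g : N q) : p = n + 1 -> q = n + 1 -> l = n + 1 + 1 ->
  mu p l 1 f = mu q l 'X%:F g ->
  mu n p 'X%:F (klift n f g) = f /\ mu n q 1 (klift n f g) = g.
Proof.
move=> ep eq el; subst p q l => E; rewrite /klift; case: pselect => [ex|[]].
  by case: cid.
exact: (koszul_lift (erefl _) (erefl _) rF E).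
Qed.

(* [array a b] plays the role of [x0 ^- a * x1 ^- b]. *)
Fixpoint array (a : nat) : forall b, N (dg a b) :=
  match a return forall b, N (dg a b) with
  | 0%N => fun=> 0
  | a'.+1 => fix row b : N (dg a'.+1 b) :=
      match b return N (dg a'.+1 b) with
      | 0%N => 0
      | b'.+1 => if (a' == 0%N) && (b' == 0%N) then mu (- i - 2) (dg a'.+1 b'.+1) 1 v
                 else klift (dg a'.+1 b'.+1) (array a' b'.+1) (row b')
      end
  end.

Lemma arrayS a b : array a.+1 b.+1 = if (a == 0%N) && (b == 0%N)
  then mu (- i - 2) (dg a.+1 b.+1) 1 v
  else klift (dg a.+1 b.+1) (array a b.+1) (array a.+1 b).
Proof. by []. Qed.

Lemma array0 a : array a 0 = 0.
Proof. by case: a. Qed.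

Lemma mu_degree n p q g (w : N n) : q = p -> mu n q g w = 0 -> mu n p g w = 0.
Proof. by move=> ->. Qed.

(** Induction on a + b: the condition for a lift at (a + 1, b + 1) says that its two neighbours have
    the same multiple at (a, b), which is the previous case. The start at (1, 1) agrees with the
    zeros on the axes because v is killed by both coordinates. *)
Lemma array_step d a b : (a + b <= d)%N ->
  mu (dg a.+1 b) (dg a b) 'X%:F (array a.+1 b) = array a b /\
  mu (dg a b.+1) (dg a b) 1 (array a b.+1) = array a b.
Proof.
elim: d a b => [|d IHd] a b.
  rewrite leqn0 addn_eq0 => /andP[/eqP-> /eqP->].
  by rewrite array0 !linear0.
have lift a' b' : (a' + b' <= d)%N ->
    mu (dg a'.+1 b'.+1) (dg a' b'.+1) 'X%:F (array a'.+1 b'.+1) = array a' b'.+1 /\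
    mu (dg a'.+1 b'.+1) (dg a'.+1 b') 1 (array a'.+1 b'.+1) = array a'.+1 b'.
  move=> le_ab; rewrite arrayS; case: ifP => [/andP[/eqP-> /eqP->]|_].
    have eq2 : - i - 2 = dg 1 1 by rewrite /dg; lia.
    have s0 : is_sect (dg 1 1 - (- i - 2)) (whole k) (1 : K) by apply: one_sect0; rewrite /dg; lia.
    rewrite !mu_comp ?mulr1 ?mul1r //.
    - have e1 : - i - 2 + 1 = dg 0 1 by rewrite /dg; lia.
      have e2 : - i - 2 + 1 = dg 1 0 by rewrite /dg; lia.
      by split; [exact: (mu_degree e1 (v_socle true))|exact: (mu_degree e2 (v_socle false))].
    - by apply: (sect_degree (@one_sect _ _)); rewrite /dg; lia.
    - by apply: (sect_degree (@X_sect _ _)); rewrite /dg; lia.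
  have [E1 E2] := IHd _ _ le_ab.
  by apply: (@kliftP _ _ _ (dg a' b')); rewrite ?E1 ?E2 // /dg; lia.
move=> le_ab; split.
  case: b le_ab => [|b] le_ab; first by rewrite !array0 linear0.
  by apply: (lift a b _).1; lia.
case: a le_ab => [|a] le_ab; first exact: linear0.
by apply: (lift a b _).2; lia.
Qed.

Lemma array_stepX a b : mu (dg a.+1 b) (dg a b) 'X%:F (array a.+1 b) = array a b.
Proof. by have [] := array_step (leqnn (a + b)). Qed.

Lemma array_step1 a b : mu (dg a b.+1) (dg a b) 1 (array a b.+1) = array a b.
Proof. by have [] := array_step (leqnn (a + b)). Qed.

Lemma array_powX a b j :
  mu (dg (a + j) b) (dg a b) ('X%:F ^+ j) (array (a + j) b) = array a b.
Proof.
elim: j => [|j IHj]; first by rewrite addn0 expr0 mu1.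
rewrite addnS exprSr -(mu_comp (q := dg (a + j) b)).
- by rewrite array_stepX IHj.
- by apply: (sect_degree (@X_sect _ _)); rewrite /dg; lia.
- by apply: (sect_degree (@X_sectn _ _)); rewrite /dg; lia.
Qed.

Lemma array_pow1 a b j :
  mu (dg a (b + j)) (dg a b) 1 (array a (b + j)) = array a b.
Proof.
elim: j => [|j IHj]; first by rewrite addn0 mu1.
have -> : 1 = 1 * 1 :> K by rewrite mulr1.
rewrite addnS -(mu_comp (q := dg a (b + j))).
- by rewrite array_step1 IHj.
- by apply: (sect_degree (@one_sect _ _)); rewrite /dg; lia.
- by apply: (sect_degree (@one_sectn j _)); rewrite /dg; lia.
Qed.

(** The diagonal of the array, with transition x0 x1, which is ['X] in this chart. The two vanishing
    statements come from the zeros on the axes and will kill sections extending to a chart; the last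
    statement recovers v from the entry (1, 1). *)
Lemma cofree_system :
  let D := codegree torus (- i) in
  exists s : forall a, N (D a),
    [/\ forall a, mu (D a.+1) (D a) 'X%:F (s a.+1) = s a,
        forall a, mu (D a) (D a + a%:Z) ('X%:F ^+ a) (s a) = 0,
        forall a, mu (D a) (D a + a%:Z) 1 (s a) = 0 &
        forall a, mu (D a.+1) (- i - 2) ('X%:F ^+ a) (s a.+1) = v].
Proof.
move=> D; have Dd a : D a = dg a a by rewrite /D codegree_torus.
have s0 a : is_sect (D a - dg a a) (whole k) (1 : K) by apply: one_sect0; rewrite Dd subrr.
exists (fun a => mu (dg a a) (D a) 1 (array a a)); split=> a.
- have sD : is_sect (D a - D a.+1) (whole k) ('X%:F : K).
    apply: (sect_degree (n := 1 + 1)); last by rewrite !Dd /dg; lia.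
    by rewrite -['X%:F]mulr1; apply: is_sectM; [exact: X_sect|exact: one_sect].
  rewrite (mu_comp _ (s0 _) sD) mulr1.
  rewrite -(array_step1 a a) -(array_stepX a a.+1).
  have sa : is_sect (dg a a.+1 - dg a.+1 a.+1) (whole k) ('X%:F : K).
    by apply: (sect_degree (@X_sect _ _)); rewrite /dg; lia.
  have sb : is_sect (dg a a - dg a a.+1) (whole k) (1 : K).
    by apply: (sect_degree (@one_sect _ _)); rewrite /dg; lia.
  rewrite (mu_comp _ sa sb) mu_comp ?mul1r //.
  apply: (sect_degree (n := 1 + 1)); last by rewrite /dg; lia.
  by rewrite -['X%:F]mulr1; apply: is_sectM; [exact: X_sect|exact: one_sect].
- have sa : is_sect (D a + a%:Z - D a) (whole k) ('X%:F ^+ a : K).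
    by apply: (sect_degree (@X_sectn a _)); lia.
  rewrite (mu_comp _ (s0 a) sa) mulr1; apply: (@mu_degree _ _ (dg 0 a)).
    by rewrite Dd /dg; lia.
  exact: (array_powX 0 a a).
- have sa : is_sect (D a + a%:Z - D a) (whole k) (1 : K).
    by apply: (sect_degree (@one_sectn a _)); lia.
  rewrite (mu_comp _ (s0 a) sa) mulr1; apply: (@mu_degree _ _ (dg a 0)).
    by rewrite Dd /dg; lia.
  by rewrite (array_pow1 a 0 a) array0.
have sa : is_sect (- i - 2 - D a.+1) (whole k) ('X%:F ^+ a : K).
  apply: (sect_degree (n := a%:Z + a%:Z)); last by rewrite Dd /dg; lia.
  by rewrite -[_ ^+ a]mulr1; apply: is_sectM; [exact: X_sectn|exact: one_sectn].
rewrite (mu_comp _ (s0 _) sa).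
have sX : is_sect (dg 1 a.+1 - dg a.+1 a.+1) (whole k) ('X%:F ^+ a : K).
  by apply: (sect_degree (@X_sectn a _)); rewrite /dg; lia.
have s1 : is_sect (dg 1 1 - dg 1 a.+1) (whole k) (1 : K).
  by apply: (sect_degree (@one_sectn a _)); rewrite /dg; lia.
have sz : is_sect (- i - 2 - dg 1 1) (whole k) (1 : K) by apply: one_sect0; rewrite /dg; lia.
have sz' : is_sect (dg 1 1 - (- i - 2)) (whole k) (1 : K) by apply: one_sect0; rewrite /dg; lia.
have E : mu (dg a.+1 a.+1) (- i - 2) ('X%:F ^+ a * 1) (array a.+1 a.+1) =
    mu (dg 1 1) (- i - 2) 1 (mu (dg 1 a.+1) (dg 1 1) 1 (mu (dg a.+1 a.+1) (dg 1 a.+1) ('X%:F ^+ a) (array a.+1 a.+1))).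
  rewrite (mu_comp _ sX s1) mul1r mu_comp ?mul1r ?mulr1 //.
  apply: (sect_degree (n := a%:Z + a%:Z)); last by rewrite /dg; lia.
  by rewrite -[_ ^+ a]mulr1; apply: is_sectM; [exact: X_sectn|exact: one_sectn].
rewrite E (array_powX 1 a.+1 a) (array_pow1 1 1 a) /= mu_comp // mulr1.
exact: mu1.
Qed.

End CofreeSystem.
End Systems.

(** * Natural transformations out of sections over an affine open subset *)

Section NaturalMaps.
Variable k : closedFieldType.
Local Notation K := (ratfun k).
Local Notation "x %:F" := (tofrac x) : ring_scope.
Implicit Types (U V W : open k) (A B C M : qcoh k).
Local Arguments regular_at : simpl never.

Variables (F : functor (Qcoh k) (Modk k)) (V : open k) (n : int) (r : P1 k).
Hypothesis rV : ~~ mem_open r V.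
Let D a := codegree V n a.
Variable s : forall a, graded F (D a).
Hypothesis s_step : forall a, mu F (D a.+1) (D a) (coform V) (s a.+1) = s a.

Lemma codegree_step a : is_sect (D a - D a.+1) (whole k) (coform V).
Proof. by rewrite -[coform V]expr1 -addn1; apply: coform_mul_sect. Qed.

Lemma system_shift a b : fapp F (coshift V n a b) (s (a + b)) = s a.
Proof.
rewrite -[LHS]/(mu F _ _ _ _); elim: b => [|b IHb]; first by rewrite addn0 expr0 mu1.
have := coform_mul_sect V n a b; rewrite addnS exprSr => sb.
rewrite -(mu_comp _ (codegree_step _) sb) s_step; exact: IHb.
Qed.

Definition section_rel M (m : kspace (M V)) (x : fval F M) : Prop :=
  exists a (f : omod_hom (twist k (D a)) M),
    f V (mktw _ V (cogen V n r a)) = m /\ x = fapp F f (s a).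

Lemma section_rel_raise M a b (f : omod_hom (twist k (D a)) M) :
  exists f' : omod_hom (twist k (D (a + b))) M,
    f' V (mktw _ V (cogen V n r (a + b))) = f V (mktw _ V (cogen V n r a)) /\
    fapp F f' (s (a + b)) = fapp F f (s a).
Proof.
exists (omod_comp f (coshift V n a b)).
by rewrite omod_compE coshift_gen // (fapp_comp f) system_shift.
Qed.

Lemma section_rel_common M (m m' : kspace (M V)) x x' :
  section_rel m x -> section_rel m' x' ->
  exists a (f f' : omod_hom (twist k (D a)) M),
    [/\ f V (mktw _ V (cogen V n r a)) = m, x = fapp F f (s a),
        f' V (mktw _ V (cogen V n r a)) = m' & x' = fapp F f' (s a)].
Proof.
move=> [a [f [<- ->]]] [b [g [<- ->]]].
have [f' [Ef Ef']] := section_rel_raise b f; have [g' [Eg Eg']] := section_rel_raise a g.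
by move: g' Eg Eg'; rewrite addnC => g' Eg Eg'; exists (a + b)%N, f', g'.
Qed.

(** Yoneda for the colimit of the Hom(O(D a), M), which is M(V): the compatible system s defines a
    map to F(M). Totality is [section_extends], and well-definedness, tested at 0, is
    [hom_vanishes]. *)
Lemma natural_map : exists theta : forall M, linmap (kspace (M V)) (fval F M),
  forall M a (f : omod_hom (twist k (D a)) M),
    theta M (f V (mktw _ V (cogen V n r a))) = fapp F f (s a).
Proof.
have [q qV] := exists_mem_open V.
have ex M : exists theta : kspace (M V) -> fval F M,
    linear theta /\ forall m x, section_rel m x <-> x = theta m.
  apply: (linear_of_relation (r := @section_rel M)).
  - move=> m; have [a [f fm]] := section_extends qV n m rV.
    by exists (fapp F f (s a)), a, f.
  - move=> x [a [f [f0 ->]]]; have [b fb] := hom_vanishes qV rV f0.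
    by rewrite -(system_shift a b) -fapp_comp fb fapp0.
  move=> c m x m' x' mx mx'; have [a [f [f' [<- -> <- ->]]]] := section_rel_common mx mx'.
  by exists a, (c *: f + f'); rewrite fappL.
have [theta thetaP] := dep_choice ex.
exists (fun M => mk_linmap (thetaP M).1) => M a f.
by apply/esym/(thetaP M).2; exists a, f.
Qed.

Lemma natural_map_natural (theta : forall M, linmap (kspace (M V)) (fval F M)) :
  (forall M a (f : omod_hom (twist k (D a)) M),
    theta M (f V (mktw _ V (cogen V n r a))) = fapp F f (s a)) ->
  forall A B (f : omod_hom A B) m, theta B (f V m) = fapp F f (theta A m).
Proof.
move=> thetaP A B f m; have [q qV] := exists_mem_open V.
have [a [g <-]] := section_extends qV n m rV.
by rewrite -[f V _]/(omod_comp f g V _) !thetaP fapp_comp.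
Qed.

Lemma natural_map_twist (theta : forall M, linmap (kspace (M V)) (fval F M)) :
  (forall M a (f : omod_hom (twist k (D a)) M),
    theta M (f V (mktw _ V (cogen V n r a))) = fapp F f (s a)) ->
  forall m a t, is_sect (m - D a) (whole k) t ->
    theta (twist_qcoh k m) (mktw m V (t * cogen V n r a)) = mu F (D a) m t (s a).
Proof.
move=> thetaP m a t st; rewrite /mu -thetaP; congr (theta _ _); apply: twist_ext.
have [_ sg _] := cogen_gen n a rV.
rewrite mul_homE // (val_mktw sg) val_mktw //.
have -> : m = m - D a + D a by rewrite subrK.
exact: is_sectM (is_sect_sub (sub_whole V) st) sg.
Qed.

End NaturalMaps.

(** * Right exact functors preserving direct sums *)

Section Good.
Variable k : closedFieldType.
Implicit Types (U V W : open k) (A B C M : qcoh k).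
Implicit Types (F G R S : functor (Qcoh k) (Modk k)).

Definition good F : Prop := right_exact F /\ preserves_sums F.

Definition natural F G (eta : forall A, linmap (fval F A) (fval G A)) : Prop :=
  forall A B (f : omod_hom A B) v, eta B (fapp F f v) = fapp G f (eta A v).

Definition sections_map V A B (f : omod_hom A B) : linmap (kspace (A V)) (kspace (B V)) :=
  @mk_linmap k (kspace (A V)) (kspace (B V)) (f V) (fun a u v => omod_homP f (regfun_const V a) u v).

Program Definition sections V : functor (Qcoh k) (Modk k) :=
  @Functor k (Qcoh k) (Modk k) (fun M => kspace ((M : qcoh k) V)) (@sections_map V) _ _ _.
Next Obligation. by move=> a f g; apply: linmap_ext. Qed.
Next Obligation. exact: linmap_ext. Qed.
Next Obligation. exact: linmap_ext. Qed.

Lemma fapp_sections V A B (f : omod_hom A B) v : fapp (sections V) f v = f V v.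
Proof. by []. Qed.

Lemma sum_sections_decomp (J : choiceType) (n : J -> int) V (v : sum_all k n V) :
  exists s : seq J, uniq s /\ v = \sum_(j <- s) sum_in k n j V (sum_out k n j V v).
Proof.
have [_ [_ [s vs]]] := sum_coordP v; exists (undup s); rewrite undup_uniq; split=> //.
by apply: sum_decomp (undup_uniq s) _ => j; rewrite mem_undup; apply: vs.
Qed.

Lemma good_sections V : affine V -> good (sections V).
Proof.
move=> aV; split=> [A B C f g ex ep|J n v]; last first.
  exact: sum_sections_decomp.
split=> [c|b]; first exact: qcoh_image aV (ep V c).
split=> [/ex /(qcoh_image aV)|[a <-]]; first by [].
apply/ex; exists unit, (fun=> V), (fun=> sub_openxx V); split.
  by split; [exact: inhabits tt|split=> [_|x xU]; [exact: sub_openxx|exists tt]].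
by move=> _; exists a; rewrite res_id.
Qed.

(** All summands on the right-hand side of the theorem obtain right exactness and preservation of
    sums in this way, from sections over affine opens. *)
Lemma good_coker R S G (rho : forall A, linmap (fval R A) (fval S A))
    (p : forall A, linmap (fval S A) (fval G A)) :
  natural rho -> natural p -> (forall A g, exists s, p A s = g) ->
  (forall A s, p A s = 0 <-> exists r, rho A r = s) -> good R -> good S -> good G.
Proof.
move=> nrho np psurj pker [rR sR] [rS sS]; split=> [A B C f g ex ep|J n v]; last first.
  have [u <-] := psurj _ v; have [s [us Es]] := sS _ _ u; exists s; split=> //.
  by rewrite {1}Es linear_sum; apply: eq_bigr => j _; rewrite /= !np.
have [surR _] := right_exactP rR ex ep; have [surS kerS] := right_exactP rS ex ep.
have [comp0 _] : (forall a, fapp G g (fapp G f a) = 0) /\ True.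
  split=> // a; have [u <-] := psurj _ a; rewrite -!np.
  by rewrite (_ : fapp S g _ = 0) ?linear0 //; apply/kerS; exists u.
rewrite /= -![fmap G _]/(fapp G _).
split=> [c|b].
  have [u <-] := psurj _ c; have [w <-] := surS u.
  by exists (p B w); rewrite -np.
split=> [|[a <-]]; last exact: comp0.
have [u <-] := psurj _ b; rewrite -np => /pker[r Er]; have [r' Er'] := surR r.
(* Correcting u by [rho B r'] puts it into the kernel of S(g), hence into the image of S(f), without
   changing its class. *)
have /kerS[a Ea] : fapp S g (u - rho B r') = 0.
  by rewrite linearB /= -nrho Er' Er subrr.
exists (p A a); rewrite -np Ea linearB /=.
by rewrite (_ : p B (rho B r') = 0) ?subr0 //; apply/pker; exists r'.
Qed.

(** The components outside s vanish, since distinct summands are orthogonal; enlarging makes one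
    index list serve several functors. *)
Lemma sums_enlarge F (J : choiceType) (n : J -> int) (v : fval F (sum_all k n)) (s t : seq J) :
  uniq s -> v = \sum_(j <- s) fapp F (sum_in k n j) (fapp F (sum_out k n j) v) ->
  uniq t -> {subset s <= t} ->
  v = \sum_(j <- t) fapp F (sum_in k n j) (fapp F (sum_out k n j) v).
Proof.
move=> us Es ut st.
have out0 j : j \notin s -> fapp F (sum_out k n j) v = 0.
  move=> js; rewrite Es linear_sum /= big_seq big1 // => i is_.
  rewrite -fapp_comp /sum_out /sum_in sum_proj_injE ?fapp0 //.
  by apply: contraNneq js => ->.
rewrite (bigID [in s]) /= [X in _ + X]big1 => [|j /out0 ->]; last by rewrite linear0.
rewrite addr0 -big_filter {1}Es; apply: perm_big; apply: uniq_perm; rewrite ?filter_uniq //.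
by move=> j; rewrite mem_filter; case: (boolP (j \in s)) => [/st|].
Qed.

Lemma good_add F G : good F -> good G -> good (functor_add F G).
Proof.
move=> [rF sF] [rG sG]; split=> [A B C f g ex ep|J n [u v]]; last first.
  have [s [us Es]] := sF _ n u; have [t [ut Et]] := sG _ _ v.
  have sub1 : {subset s <= undup (s ++ t)} by move=> j js; rewrite mem_undup mem_cat js.
  have sub2 : {subset t <= undup (s ++ t)} by move=> j js; rewrite mem_undup mem_cat js orbT.
  exists (undup (s ++ t)); rewrite undup_uniq; split=> //.
  have /= := sums_enlarge us Es (undup_uniq _) sub1.
  have /= := sums_enlarge ut Et (undup_uniq _) sub2.
  move: (undup _) => r Ev Eu; rewrite {1}Eu {1}Ev.
  by elim: (r) => [|j r' IHr]; rewrite ?big_nil // !big_cons -IHr.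
have [surF kerF] := right_exactP rF ex ep; have [surG kerG] := right_exactP rG ex ep.
split=> [[c c']|[b b']].
  by have [b Eb] := surF c; have [b' Eb'] := surG c'; exists (b, b'); congr pair.
split=> [[/kerF[a Ea] /kerG[a' Ea']]|[[a a'] [<- <-]]].
  by exists (a, a'); congr pair.
by congr pair; [apply/kerF; exists a|apply/kerG; exists a'].
Qed.

Lemma dsum_ext (I : choiceType) (E : I -> lmodType k) (s t : direct_sum E) :
  (forall i, s i = t i) -> s = t.
Proof. by move=> st; apply/val_inj/functional_extensionality_dep. Qed.

Lemma dsum_supp (I : choiceType) (E : I -> lmodType k) (s : direct_sum E) :
  exists r : seq I, uniq r /\ forall i, i \notin r -> s i = 0.
Proof.
have /asboolP[r sr] := dsum_valP s; exists (undup r); rewrite undup_uniq.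
by split=> // i; rewrite mem_undup; apply: sr.
Qed.

Lemma dsum_choice (I : choiceType) (E : I -> lmodType k) (r : seq I)
    (P : forall i, E i -> Prop) :
  (forall i, i \in r -> exists x, P i x) ->
  exists s : direct_sum E, (forall i, i \in r -> P i (s i)) /\ forall i, i \notin r -> s i = 0.
Proof.
move=> ex; have [f fP] := dep_choice (P := fun i x => if i \in r then P i x else x = 0 :> E i)
  (fun i => match boolP (i \in r) as b in alt_spec _ _ b' return exists x, if b' then P i x else x = 0
   with AltTrue ir => ex i ir | AltFalse _ => ex_intro _ 0 (erefl _) end).
have ff : (f : pi_mod E) \in @fin_supp k I E.
  by apply/asboolP; exists r => i ir; have := fP i; rewrite (negPf ir).
by exists (DirectSum ff); split=> i ir; have := fP i; rewrite ?ir ?(negPf ir).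
Qed.

Lemma dsum_sum (I : choiceType) (E : I -> lmodType k) (T : Type) (r : seq T)
    (s : T -> direct_sum E) i : (\sum_(t <- r) s t : direct_sum E) i = \sum_(t <- r) s t i.
Proof. by elim: r => [|t r IHr]; rewrite ?big_nil // !big_cons -IHr. Qed.

Lemma good_dsum (I : choiceType) (Fs : I -> functor (Qcoh k) (Modk k)) :
  (forall i, good (Fs i)) -> good (functor_dsum Fs).
Proof.
move=> gF; split=> [A B C f g ex ep|J n v].
  have ex' i := right_exactP (gF i).1 ex ep.
  split=> [c|b].
    have [r [_ cr]] := dsum_supp (c : direct_sum _).
    have [b [br b0]] := dsum_choice (r := r) (P := fun i x => fapp (Fs i) g x = (c : direct_sum _) i)
      (fun i _ => (ex' i).1 _).
    exists b; apply: dsum_ext => i.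
    have [ir|ir] := boolP (i \in r); first exact: br.
    by rewrite [LHS]/(fapp (Fs i) g (b i)) b0 // [LHS](linear0 (fapp (Fs i) g)) cr.
  split=> [gb0|[a <-]]; last first.
    by apply: dsum_ext => i; apply/(ex' i).2; exists ((a : direct_sum _) i).
  have gb i : fapp (Fs i) g ((b : direct_sum _) i) = 0.
    exact: (congr1 (fun s : direct_sum _ => s i) gb0).
  have [r [_ br]] := dsum_supp (b : direct_sum _).
  have [a [ar a0]] := dsum_choice (r := r) (P := fun i x => fapp (Fs i) f x = (b : direct_sum _) i)
      (fun i _ => ((ex' i).2 _).1 (gb i)).
  exists a; apply: dsum_ext => i.
  have [ir|ir] := boolP (i \in r); first exact: ar.
  by rewrite [LHS]/(fapp (Fs i) f (a i)) a0 // [LHS](linear0 (fapp (Fs i) f)) br.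
have [r [_ vr]] := dsum_supp (v : direct_sum _).
have [t tP] := dep_choice (fun i => (gF i).2 J n ((v : direct_sum _) i)).
exists (undup (flatten (map t r))); rewrite undup_uniq; split=> //.
apply: dsum_ext => i; rewrite (@dsum_sum I (fun i => Fs i (sum_all k n))).
have [ir|ir] := boolP (i \in r); last first.
  rewrite vr // big1 // => j _.
  rewrite [LHS]/(fapp (Fs i) (sum_in k n j) (fapp (Fs i) (sum_out k n j) ((v : direct_sum _) i))) vr //.
  have E : fapp (Fs i) (sum_in k n j) (fapp (Fs i) (sum_out k n j) 0) = 0 by rewrite !linear0.
  exact: E.
have [ut Et] := tP i.
apply: (sums_enlarge ut Et (undup_uniq _)) => j jt.
by rewrite mem_undup; apply/flattenP; exists (t i) => //; apply: map_f.
Qed.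

(** ** Natural transformations out of sums and cokernels *)

Lemma natural_coker R S G F (rho : forall A, linmap (fval R A) (fval S A))
    (p : forall A, linmap (fval S A) (fval G A)) (theta : forall A, linmap (fval S A) (fval F A)) :
  natural p -> natural theta -> (forall A g, exists s, p A s = g) ->
  (forall A s, p A s = 0 <-> exists r, rho A r = s) ->
  (forall A r, theta A (rho A r) = 0) ->
  exists zeta : forall A, linmap (fval G A) (fval F A),
    natural zeta /\ forall A s, zeta A (p A s) = theta A s.
Proof.
move=> np nt psurj pker t0.
have ex A : exists z : fval G A -> fval F A,
    linear z /\ forall g x, (exists s, p A s = g /\ theta A s = x) <-> x = z g.
  apply: (linear_of_relation (r := fun g x => exists s, p A s = g /\ theta A s = x)).
  - by move=> g; have [s <-] := psurj A g; exists (theta A s), s.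
  - by move=> x [s [/pker[r <-] <-]].
  - by move=> a _ _ _ _ [s [<- <-]] [s' [<- <-]]; exists (a *: s + s'); rewrite !linearP.
have [z zP] := dep_choice ex.
have zp A s : z A (p A s) = theta A s by apply/esym/(zP A).2; exists s.
exists (fun A => mk_linmap (zP A).1); split=> [A B f g|A s]; last exact: zp.
by have [s <-] := psurj A g; rewrite -np /= !zp nt.
Qed.

Lemma natural_dsum (I : choiceType) (Fs : I -> functor (Qcoh k) (Modk k)) F
    (eta : forall i A, linmap (fval (Fs i) A) (fval F A)) :
  (forall i, natural (eta i)) ->
  exists zeta : forall A, linmap (fval (functor_dsum Fs) A) (fval F A),
    natural zeta /\ forall A s, zeta A s = fsum (fun i => eta i A ((s : direct_sum _) i)).
Proof.
move=> ne; pose z A (s : fval (functor_dsum Fs) A) := fsum (fun i => eta i A ((s : direct_sum _) i)).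
have supp A (s : fval (functor_dsum Fs) A) : finsupp (fun i => eta i A ((s : direct_sum _) i)).
  by have [r [_ sr]] := dsum_supp (s : direct_sum _); exists r => i /sr ->; rewrite linear0.
have lz A : linear (@z A).
  move=> a s t; rewrite /z.
  have -> : (fun i => eta i A ((a *: s + t : direct_sum _) i)) =
      (fun i => a *: eta i A ((s : direct_sum _) i) + eta i A ((t : direct_sum _) i)).
    by apply: functional_extensionality_dep => i; rewrite -linearP.
  rewrite fsumD ?(fsum_morph (GRing.scale a)) //.
  by have [r sr] := supp A s; exists r => i /sr ->; rewrite scaler0.
exists (fun A => mk_linmap (@lz A)); split=> // A B f s.
rewrite /= /z (fsum_morph (fapp F f)) //; congr fsum.
by apply: functional_extensionality_dep => i; apply: ne.
Qed.

Lemma natural_add F G H (eta : forall A, linmap (fval F A) (fval H A))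
    (theta : forall A, linmap (fval G A) (fval H A)) : natural eta -> natural theta ->
  exists zeta : forall A, linmap (fval (functor_add F G) A) (fval H A),
    natural zeta /\ forall A s, zeta A s = eta A s.1 + theta A s.2.
Proof.
move=> ne nt.
have lz A : linear (fun s : fval (functor_add F G) A => eta A s.1 + theta A s.2).
  by move=> a s t; rewrite !linearP addrACA scalerDr.
exists (fun A => mk_linmap (@lz A)); split=> // A B f s.
by rewrite /= linearD /= -ne -nt.
Qed.

End Good.

(** * First cohomology by the two affine charts *)

Section Flasque.
Variable k : closedFieldType.
Local Notation K := (ratfun k).
Local Notation "x %:F" := (tofrac x) : ring_scope.
Implicit Types (U W : open k) (M N J Q : omod k).
Local Arguments regular_at : simpl never.

(* The extension by zero of the structure sheaf of [V]. *)
Section ExtensionByZero.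
Variable V : open k.

Definition ext0_on U : {pred ratmod U} :=
  fun f => `[< is_sect 0 U f /\ (~~ sub_open U V -> f = 0) >].
Arguments ext0_on : clear implicits.

Lemma ext0_on_submod U : submod_closed (ext0_on U).
Proof.
split=> [|a f g /asboolP[sf f0] /asboolP[sg g0]]; apply/asboolP; split=> //.
- by move=> x _; apply: twist_at_zero.
- move=> x xU; apply: twist_atD; last exact: sg.
  by apply: twist_atMl; [apply: regfun_regular|apply: sf].
move=> UV; rewrite (f0 UV) (g0 UV) scaler0 addr0 //.
Qed.

HB.instance Definition _ U := GRing.isSubmodClosed.Build (regfun U) (ratmod U)
  (ext0_on U) (ext0_on_submod U).

Record ext0_sect U := Ext0Sect {
  ext0_val : ratmod U; ext0_valP : ext0_val \in ext0_on U }.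

HB.instance Definition _ U := [isSub for @ext0_val U].
HB.instance Definition _ U := [Choice of ext0_sect U by <:].
HB.instance Definition _ U := [SubChoice_isSubLmodule of ext0_sect U by <:].

Lemma ext0P U (f : ext0_sect U) : is_sect 0 U (ext0_val f) /\
  (~~ sub_open U V -> ext0_val f = 0 :> K).
Proof. exact/asboolP/ext0_valP. Qed.

Lemma ext0_res_proof U W (WU : sub_open W U) (f : ext0_sect U) :
  (ext0_val f : ratmod W) \in ext0_on W.
Proof.
have [sf f0] := ext0P f; apply/asboolP; split; first exact: is_sect_sub WU sf.
move=> WV; apply: f0; apply: contra WV; exact: sub_open_trans.
Qed.

Definition ext0_res U W (WU : sub_open W U) (f : ext0_sect U) : ext0_sect W :=
  Ext0Sect (ext0_res_proof WU f).

(** If the common rational function of the local sections is nonzero, every member of the cover lies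
    in V, and then so does U. *)
Lemma ext0_sheaf_axiom U (I : Type) (W : I -> open k)
    (WU : forall j, sub_open (W j) U) : open_cover U W ->
  forall s : (forall j, ext0_sect (W j)),
    (forall j l, ext0_res (meet_openl (W j) (W l)) (s j) =
                 ext0_res (meet_openr (W j) (W l)) (s l)) ->
  exists! m : ext0_sect U, forall j, ext0_res (WU j) m = s j.
Proof.
move=> [[j0] [_ cov]] s agree.
have E j l : ext0_val (s j) = ext0_val (s l) :> K.
  exact: (congr1 (fun u => ext0_val u : K) (agree j l)).
have P : (ext0_val (s j0) : ratmod U) \in ext0_on U.
  apply/asboolP; split=> [x /cov[j xj]|UV].
    by rewrite (E j0 j); have [sj _] := ext0P (s j); apply: sj.
  apply: contrapT => s0; move/negP: UV; apply; apply/sub_openP => x /cov[j xj].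
  have [_ sj0] := ext0P (s j); apply: (sub_open_mem _ xj).
  have [//|WV] := boolP (sub_open (W j) V); case: s0.
  by rewrite (E j0 j); apply: sj0.
exists (Ext0Sect P); split=> [j|m sm]; apply: val_inj; first exact: E.
exact: (esym (congr1 (fun u => ext0_val u : K) (sm j0))).
Qed.

Program Definition ext0 : omod k := @Omod k (fun U => ext0_sect U) ext0_res _ _ _ _.
Next Obligation. exact: val_inj. Qed.
Next Obligation. exact: val_inj. Qed.
Next Obligation. exact: val_inj. Qed.
Next Obligation. exact: ext0_sheaf_axiom. Qed.

Lemma ext0_inE U (f : ext0_sect U) : twist_val (mktw 0 U (ext0_val f)) = ext0_val f :> K.
Proof. by rewrite val_mktw //; have [] := ext0P f. Qed.

Fact ext0_in_linear U : linear (fun f : ext0 U => mktw 0 U (ext0_val f)).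
Proof. by move=> a f g; apply: twist_ext; rewrite twist_valL !ext0_inE. Qed.

Fact ext0_in_res U W (WU : sub_open W U) (f : ext0 U) :
  mktw 0 W (ext0_val (res WU f)) = res WU (mktw 0 U (ext0_val f)).
Proof. by apply: twist_ext; rewrite twist_val_res !ext0_inE. Qed.

Definition ext0_in : omod_hom ext0 (twist k 0) :=
  mk_omod_hom ext0_in_linear (fun U W WU f => @ext0_in_res U W WU f).

Lemma ext0_mono : sheaf_mono ext0_in.
Proof.
move=> U f g /(congr1 (fun u => twist_val u : K)); rewrite !ext0_inE => E.
exact: val_inj.
Qed.

Section Value.
Variables (J : omod k) (x : J V).

Definition ext0_val_fun U (f : ext0 U) : J U := mkreg U (ext0_val f) *: rest U x.

Fact ext0_val_linear U : linear (@ext0_val_fun U).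
Proof.
move=> a f g; rewrite /ext0_val_fun scalerA -scalerDl; congr (_ *: _); apply: val_inj.
have [sf _] := ext0P f; have [sg _] := ext0P g; have [sfg _] := ext0P (a *: f + g).
by rewrite regfun_valL (val_mkreg sf) (val_mkreg sg) (val_mkreg sfg).
Qed.

Fact ext0_val_res U W (WU : sub_open W U) (f : ext0 U) :
  ext0_val_fun (res WU f) = res WU (ext0_val_fun f).
Proof.
have [sf f0] := ext0P f; rewrite /ext0_val_fun resZ.
have E : mkreg W (ext0_val (res WU f)) = regfun_res WU (mkreg U (ext0_val f)).
  by apply: val_inj; rewrite val_regfun_res (val_mkreg sf) val_mkreg //; apply: is_sect_sub WU sf.
rewrite E; have [UV|UV] := boolP (sub_open U V).
  by rewrite (restE UV) (restE (sub_open_trans WU UV)) (res_comp _ _ (sub_open_trans WU UV)).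
have -> : mkreg U (ext0_val f) = 0 by apply: val_inj; rewrite (val_mkreg sf) f0.
by rewrite rmorph0 !scale0r.
Qed.

Definition ext0_to : omod_hom ext0 J :=
  mk_omod_hom ext0_val_linear (fun U W WU f => @ext0_val_res U W WU f).

End Value.

(** A section over V is a morphism from the extension by zero of the structure sheaf of V;
    injectivity extends it to the whole structure sheaf, and the value at 1 extends x. *)
Lemma injective_flasque J (x : J V) : injective_omod J ->
  exists y : J (whole k), res (sub_whole V) y = x.
Proof.
move=> /(_ ext0 (twist k 0) ext0_in (ext0_to x) ext0_mono)[v Ev].
have s1 U : is_sect 0 U (1 : K) by apply: one_sect0.
exists (v _ (mktw 0 (whole k) 1)); rewrite -omod_hom_res (res_mktw _ (s1 _)).
have P : (1 : ratmod V) \in ext0_on V by apply/asboolP; split=> //; rewrite sub_openxx.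
have -> : mktw 0 V 1 = ext0_in V (Ext0Sect P).
  by apply: twist_ext; rewrite (val_mktw (s1 V)).
rewrite Ev [LHS]/(mkreg V 1 *: rest V x) (restE (sub_openxx V)) res_id.
have -> : mkreg V 1 = 1 by apply: val_inj; exact: val_mkreg (s1 V).
exact: scale1r.
Qed.

End ExtensionByZero.

Lemma exact_lift M N P (f : omod_hom M N) (g : omod_hom N P) U (n : N U) :
  sheaf_mono f -> sheaf_exact f g -> g U n = 0 -> exists m, f U m = n.
Proof.
move=> mono ex /ex[I [V [VU [cov im]]]].
have [s Es] := dep_choice im.
have [|m [sm _]] := sheaf_axiom VU cov (s := s).
  by move=> i j; apply: mono; rewrite !omod_hom_res !Es; apply: res_res.
exists m; apply: (sheaf_separated (VU := VU) cov) => i.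
by rewrite -omod_hom_res sm Es.
Qed.

Lemma exact_comp0 M N P (f : omod_hom M N) (g : omod_hom N P) U (m : M U) :
  sheaf_exact f g -> g U (f U m) = 0.
Proof.
move=> ex; apply/ex; exists unit, (fun=> U), (fun=> sub_openxx U); split.
  by split; [exact: inhabits tt|split=> [_|x xU]; [exact: sub_openxx|exists tt]].
by move=> _; exists m; rewrite res_id.
Qed.

(** Vanishing of H^1 on affine opens: two local lifts differ on the overlap by a section of M, which
    [qcoh_split] distributes between the two opens as corrections. *)
Lemma affine_lift (M : qcoh k) N P (f : omod_hom M N) (g : omod_hom N P) U (p : P U) :
  sheaf_mono f -> sheaf_exact f g -> sheaf_epi g -> affine U -> exists n, g U n = p.
Proof.
move=> mono ex epi aU; have [I [V [VU [cov im]]]] := epi U p.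
suff /(_ (sub_openxx U)) : forall UU : sub_open U U, exists n, g U n = res UU p.
  by case=> n; rewrite res_id; exists n.
apply: (open_cover_ind (P := fun X => forall XU, exists n, g X n = res XU p) cov); last first.
  by move=> i VU'; have [a Ea] := im i; exists a; rewrite Ea; apply: res_irr.
move=> X Y XU YU PX PY ZU; have [n1 E1] := PX XU; have [n2 E2] := PY YU.
have covZ x : mem_open x (join_open X Y) -> mem_open x X || mem_open x Y.
  by rewrite mem_join.
have [|m Em] := exact_lift (n := res (meet_openl X Y) n1 - res (meet_openr X Y) n2) mono ex.
  by rewrite raddfB /= !omod_hom_res E1 E2 (res_res _ _ YU (meet_openr X Y)) subrr.
have [a [b Eab]] := qcoh_split (affine_sub ZU aU) (sub_joinl X Y) (sub_joinr X Y) covZ m.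
have [|n [nX nY]] := sheaf_glue2 (a := n1 - f X a) (b := n2 + f Y b)
  (sub_joinl X Y) (sub_joinr X Y) covZ.
  rewrite raddfB raddfD /= -!omod_hom_res; apply/eqP.
  by rewrite subr_eq -addrA -raddfD /= [X in f _ X]addrC -Eab Em addrC subrK.
exists n; apply: (sheaf_separated2 (VU := sub_joinl X Y) (WU := sub_joinr X Y) covZ).
  by rewrite -omod_hom_res nX raddfB /= (exact_comp0 _ ex) subr0 E1 (res_comp _ _ XU).
by rewrite -omod_hom_res nY raddfD /= (exact_comp0 _ ex) addr0 E2 (res_comp _ _ YU).
Qed.

End Flasque.

Section Cohomology.
Variable k : closedFieldType.
Implicit Types (U V W : open k) (M A B : qcoh k).

Definition chart0 : open k := compl None.
Definition chart1 : open k := compl (Some 0).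

Lemma affine_chart0 : affine chart0.
Proof. by apply/affineP; exists None; rewrite negbK inE. Qed.
Lemma affine_chart1 : affine chart1.
Proof. by apply/affineP; exists (Some 0); rewrite negbK inE. Qed.
Lemma affine_torus : affine (torus k).
Proof. exact: affine_sub (meet_openl _ _) affine_chart0. Qed.

Lemma chart_cover01 x : mem_open x chart0 || mem_open x chart1.
Proof. by rewrite /mem_open !inE; case: x. Qed.

Definition sub_torus0 : sub_open (torus k) chart0 := meet_openl _ _.
Definition sub_torus1 : sub_open (torus k) chart1 := meet_openr _ _.

(** A sum instead of the usual difference: the sign is absorbed in b. *)
Definition is_boundary M (m : kspace (M (torus k))) : Prop :=
  exists (a : M chart0) (b : M chart1), (m : M (torus k)) = res sub_torus0 a + res sub_torus1 b.

Fact is_boundary0 M : @is_boundary M 0.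
Proof. by exists 0, 0; rewrite !raddf0 addr0. Qed.

Fact is_boundaryL M c m m' : @is_boundary M m -> @is_boundary M m' -> is_boundary (c *: m + m').
Proof.
move=> [a [b ->]] [a' [b' ->]].
exists (regfun_const _ c *: a + a'), (regfun_const _ c *: b + b').
by rewrite !raddfD /= !resZ !regfun_res_const [RHS]addrACA -scalerDr.
Qed.

Definition cech_boundary M : submodule (kspace (M (torus k))) :=
  Submodule (@is_boundary0 M) (@is_boundaryL M).

Definition cech M : lmodType k := quotient (cech_boundary M).
Definition cech_pi M : linmap (kspace (M (torus k))) (cech M) :=
  mk_linmap (@quot_pi_linear _ _ (cech_boundary M)).

Lemma cech_surj M (h : cech M) : exists m, cech_pi M m = h.
Proof. by elim/quot_ind: h => m; exists m. Qed.

Lemma cech_pi0 M m : cech_pi M m = 0 <-> is_boundary m.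
Proof. exact: quot_pi0. Qed.

Lemma cech_map_ex A B (f : omod_hom A B) : exists g : linmap (cech A) (cech B),
  forall m, g (cech_pi A m) = cech_pi B (f (torus k) m).
Proof.
have lf : linear (fun m : kspace (A (torus k)) => cech_pi B (f (torus k) m)).
  by move=> c u v; rewrite -linearP; congr (cech_pi B _); exact: omod_homP.
have [|g gP] := quot_lin_lift (f := mk_linmap lf) (S := cech_boundary A); last by exists g.
move=> _ [a [b ->]]; apply/cech_pi0; exists (f _ a), (f _ b).
by rewrite raddfD /= !omod_hom_res.
Qed.

Definition cech_map A B (f : omod_hom A B) : linmap (cech A) (cech B) :=
  projT1 (cid (cech_map_ex f)).

Lemma cech_mapE A B (f : omod_hom A B) m :
  cech_map f (cech_pi A m) = cech_pi B (f (torus k) m).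
Proof. by rewrite /cech_map; case: cid. Qed.

Lemma cech_ext A (W : lmodType k) (f g : linmap (cech A) W) :
  (forall m, f (cech_pi A m) = g (cech_pi A m)) -> f = g.
Proof. by move=> fg; apply: linmap_ext => h; have [m <-] := cech_surj h. Qed.

Program Definition cech_functor : functor (Qcoh k) (Modk k) :=
  @Functor k (Qcoh k) (Modk k) cech cech_map _ _ _.
Next Obligation.
move=> c f g; apply: cech_ext => m.
rewrite [RHS]/(c *: cech_map f (cech_pi A m) + cech_map g (cech_pi A m)).
by rewrite !cech_mapE; apply: linmapP.
Qed.
Next Obligation. by apply: cech_ext => m; rewrite cech_mapE. Qed.
Next Obligation. by apply: cech_ext => m; rewrite /= !cech_mapE. Qed.

Section Delta.
Variables (M : qcoh k) (S : injective_embedding M).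
Local Notation J := (ie_inj S).
Local Notation Q := (ie_quo S).

(** The connecting map of the two-chart Cech complex, as a relation since the lifts of q to J are
    choices. *)
Definition delta_rel (q : global Q) (h : cech M) : Prop :=
  exists (j0 : J chart0) (j1 : J chart1) (m : M (torus k)),
    [/\ ie_out S _ j0 = res (sub_whole _) (q : Q (whole k)),
        ie_out S _ j1 = res (sub_whole _) (q : Q (whole k)),
        ie_in S _ m = res sub_torus0 j0 - res sub_torus1 j1 & h = cech_pi M m].

Lemma delta_rel_total q : exists h, delta_rel q h.
Proof.
have [j0 E0] := affine_lift (res (sub_whole chart0) (q : Q (whole k)))
  (@ie_mono _ _ S) (@ie_exact _ _ S) (@ie_epi _ _ S) affine_chart0.
have [j1 E1] := affine_lift (res (sub_whole chart1) (q : Q (whole k)))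
  (@ie_mono _ _ S) (@ie_exact _ _ S) (@ie_epi _ _ S) affine_chart1.
have [|m Em] := exact_lift (n := res sub_torus0 j0 - res sub_torus1 j1)
  (@ie_mono _ _ S) (@ie_exact _ _ S).
  by rewrite raddfB /= !omod_hom_res E0 E1 (res_res _ _ (sub_whole chart1) sub_torus1) subrr.
by exists (cech_pi M m), j0, j1, m.
Qed.

Lemma delta_rel_linear c q h q' h' : delta_rel q h -> delta_rel q' h' ->
  delta_rel (c *: q + q') (c *: h + h').
Proof.
move=> [j0 [j1 [m [E0 E1 Em ->]]]] [j0' [j1' [m' [E0' E1' Em' ->]]]].
exists (regfun_const _ c *: j0 + j0'), (regfun_const _ c *: j1 + j1'), (regfun_const _ c *: m + m').
have resL U (a b : Q (whole k)) : res (sub_whole U) (regfun_const _ c *: a + b) =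
    regfun_const _ c *: res (sub_whole U) a + res (sub_whole U) b.
  by rewrite raddfD /= resZ regfun_res_const.
split; first by rewrite linearP /= E0 E0' [RHS]resL.
- by rewrite linearP /= E1 E1' [RHS]resL.
- by rewrite linearP /= Em Em' !raddfD /= !resZ !regfun_res_const ?scalerN ?opprD addrACA.
- by rewrite -linearP.
Qed.

Lemma delta_rel_ker q : delta_rel q 0 <-> exists j, global_map (ie_out S) j = q.
Proof.
split=> [[j0 [j1 [m [E0 E1 Em /esym/cech_pi0[a [b Eab]]]]]]|[j <-]]; last first.
  exists (res (sub_whole _) (j : J (whole k))), (res (sub_whole _) (j : J (whole k))), 0.
  rewrite !omod_hom_res raddf0 (res_res _ _ (sub_whole chart1) sub_torus1) subrr linear0.
  by split.
have [|j [J0 J1]] := sheaf_glue2 (a := j0 - ie_in S _ a) (b := j1 + ie_in S _ b)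
    (sub_whole chart0) (sub_whole chart1) (fun x _ => chart_cover01 x).
  rewrite raddfB raddfD /= -!omod_hom_res; apply/eqP.
  rewrite subr_eq -addrA -raddfD /= [X in ie_in S _ X]addrC.
  by rewrite [X in ie_in S _ X](esym Eab) Em addrC subrK.
exists j; apply: (sheaf_separated2 (VU := sub_whole chart0) (WU := sub_whole chart1)).
- by move=> x _; apply: chart_cover01.
- by rewrite -omod_hom_res J0 raddfB /= (exact_comp0 _ (@ie_exact _ _ S)) subr0 E0.
- by rewrite -omod_hom_res J1 raddfD /= (exact_comp0 _ (@ie_exact _ _ S)) addr0 E1.
Qed.

Lemma delta_rel_fun0 h : delta_rel 0 h -> h = 0.
Proof.
move=> [j0 [j1 [m [E0 E1 Em ->]]]]; apply/cech_pi0.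
have [|a Ea] := exact_lift (n := j0) (@ie_mono _ _ S) (@ie_exact _ _ S).
  by rewrite E0; exact: raddf0.
have [|b Eb] := exact_lift (n := j1) (@ie_mono _ _ S) (@ie_exact _ _ S).
  by rewrite E1; exact: raddf0.
exists a, (- b); apply: (@ie_mono _ _ S); rewrite Em raddfD /= !omod_hom_res Ea.
by rewrite !raddfN /= Eb.
Qed.

(** As J is flasque, a section m over the torus extends to y over the line; the image of y in Q on
    one chart and 0 on the other glue to a section q, whose connecting class is that of m. *)
Lemma delta_rel_surj h : exists q, delta_rel q h.
Proof.
have [m <-] := cech_surj h.
have [y Ey] := injective_flasque (ie_in S _ m) (@ie_injective _ _ S).
have [|q [q0 q1]] := sheaf_glue2 (a := ie_out S _ (res (sub_whole chart0) y)) (b := 0 : Q chart1)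
    (sub_whole chart0) (sub_whole chart1) (fun x _ => chart_cover01 x).
  rewrite raddf0 -omod_hom_res (res_comp _ _ (sub_whole (torus k))) Ey.
  exact: exact_comp0 (@ie_exact _ _ S).
exists q, (res (sub_whole chart0) y), 0, m; split=> //.
- by rewrite linear0 q1.
- by rewrite raddf0 subr0 (res_comp _ _ (sub_whole (torus k))) Ey.
Qed.

Lemma delta_map_ex : exists d : linmap (global Q) (cech M),
  forall q h, delta_rel q h <-> h = d q.
Proof.
have [d [ld dP]] := linear_of_relation delta_rel_total delta_rel_fun0 delta_rel_linear.
by exists (mk_linmap ld).
Qed.

Definition delta_map : linmap (global Q) (cech M) := projT1 (cid delta_map_ex).

Lemma delta_mapP q h : delta_rel q h <-> h = delta_map q.
Proof. by rewrite /delta_map; case: cid. Qed.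

End Delta.

Program Definition cech_cohomology : first_cohomology k :=
  @FirstCohomology k cech_functor delta_map _ _ _.
Next Obligation. by have [q /delta_mapP ->] := delta_rel_surj S h; exists q. Qed.
Next Obligation.
split=> [E|/delta_rel_ker/delta_mapP -> //].
by apply/delta_rel_ker/delta_mapP; rewrite E.
Qed.
Next Obligation.
rewrite -[LHS]/(cech_map u (delta_map S q)).
have [j0 [j1 [m [E0 E1 Em Eh]]]] := (@delta_mapP _ S q (delta_map S q)).2 (erefl _).
rewrite Eh cech_mapE; apply/delta_mapP.
exists (v _ j0), (v _ j1), (u _ m); split=> //.
- by rewrite -H0 E0 omod_hom_res.
- by rewrite -H0 E1 omod_hom_res.
- by rewrite -H Em raddfB /= !omod_hom_res.
Qed.

End Cohomology.

(** * Restriction to an open subset, products, kernels *)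

Section Constructions.
Variable k : closedFieldType.
Implicit Types (U V W : open k).

Definition rscal U V (VU : sub_open V U) (E : lmodType (regfun V)) : Type := E.

Section RestrictScalars.
Variables (U V : open k) (VU : sub_open V U) (E : lmodType (regfun V)).

HB.instance Definition _ := GRing.Zmodule.on (rscal VU E).

Program Definition rscal_lmodMixin :=
  @GRing.Zmodule_isLmodule.Build (regfun U) (rscal VU E)
    (fun a (m : E) => regfun_res VU a *: m) _ _ _ _.
Next Obligation. by rewrite scalerA -rmorphM. Qed.
Next Obligation. by move=> m; rewrite rmorph1 scale1r. Qed.
Next Obligation. by move=> a m n; rewrite scalerDr. Qed.
Next Obligation. by move=> a b; rewrite rmorphD scalerDl. Qed.
HB.instance Definition _ := rscal_lmodMixin.

End RestrictScalars.

Lemma sub_meet2 U V C : sub_open V U -> sub_open (meet_open V C) (meet_open U C).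
Proof.
by move=> VU; rewrite sub_open_meet ?meet_openr // (sub_open_trans _ VU) ?meet_openl.
Qed.

Section Push.
Variables (C : open k) (M : omod k).

(** The direct image of the restriction of M to C. *)
Definition push_sect U : lmodType (regfun U) := rscal (meet_openl U C) (M (meet_open U C)).
Definition push_res U V (VU : sub_open V U) (m : push_sect U) : push_sect V :=
  res (sub_meet2 C VU) (m : M (meet_open U C)).

Fact push_res_linear U V (VU : sub_open V U) (a : regfun U) (m n : push_sect U) :
  push_res VU (a *: m + n) = regfun_res VU a *: push_res VU m + push_res VU n.
Proof.
have E : regfun_res (sub_meet2 C VU) (regfun_res (meet_openl U C) a) =
    regfun_res (meet_openl V C) (regfun_res VU a) by apply: val_inj.
exact: etrans (res_linear (sub_meet2 C VU) _ (m : M _) (n : M _))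
  (congr1 (fun c => c *: (push_res VU m : M _) + push_res VU n) E).
Qed.

Lemma push_sheaf_axiom U (I : Type) (V : I -> open k) (VU : forall i, sub_open (V i) U) :
  open_cover U V -> forall s : (forall i, push_sect (V i)),
  (forall i j, push_res (meet_openl (V i) (V j)) (s i) =
               push_res (meet_openr (V i) (V j)) (s j)) ->
  exists! m : push_sect U, forall i, push_res (VU i) m = s i.
Proof.
move=> [inh [_ cov]] s agree.
have cov' : open_cover (meet_open U C) (fun i => meet_open (V i) C).
  split=> //; split=> [i|x]; first exact: sub_meet2.
  by rewrite mem_meet => /andP[/cov[i xi] xC]; exists i; rewrite mem_meet xi.
apply: (sheaf_axiom (fun i => sub_meet2 C (VU i)) cov') => i j.
have s' : sub_open (meet_open (meet_open (V i) C) (meet_open (V j) C))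
    (meet_open (meet_open (V i) (V j)) C).
  by apply/sub_openP => x; rewrite !mem_meet => /andP[/andP[-> ->] /andP[-> _]].
have := congr1 (fun m => res s' (m : M (meet_open (meet_open (V i) (V j)) C))) (agree i j).
by rewrite /push_res (res_comp _ _ (meet_openl _ _)) (res_comp _ _ (meet_openr _ _)).
Qed.

Program Definition push : omod k := @Omod k push_sect push_res push_res_linear _ _ push_sheaf_axiom.
Next Obligation. exact: res_id. Qed.
Next Obligation. exact: res_comp. Qed.

End Push.

Lemma push_quasi_coherent C (M : qcoh k) : quasi_coherent (push C M).
Proof.
move=> U V VU f aU f0 fV.
have fV' : is_locus (meet_open V C) (regfun_res (meet_openl U C) f).
  move=> x; rewrite !mem_meet val_regfun_res; split=> [/andP[/fV[-> rf] ->] //|[/andP[xU ->] rf]].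
  by rewrite andbT; apply/fV.
have f0' : regfun_res (meet_openl U C) f != 0.
  by apply: contraNneq f0 => /(congr1 val) /= E; apply/eqP/val_inj.
have [l1 l2] := qcoh_localizes M (sub_meet2 C VU) (affine_sub (meet_openl U C) aU) f0' fV'.
split=> [m m0|s].
  have [n En] := l1 m m0; exists n.
  by rewrite [LHS]/(regfun_res (meet_openl U C) (f ^+ n) *: (m : M _)) rmorphXn.
have [n [m Em]] := l2 s; exists n, m.
have E : regfun_res (sub_meet2 C VU) (regfun_res (meet_openl U C) f) ^+ n =
    regfun_res (meet_openl V C) (regfun_res VU f ^+ n).
  by rewrite -!rmorphXn; apply: val_inj.
exact: etrans Em (congr1 (fun c => c *: (s : M (meet_open V C))) E).
Qed.

Definition push_qcoh C (M : qcoh k) : qcoh k := QcohOb (@push_quasi_coherent C M).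

Section PiSheaf.
Variables (I : Type) (A : I -> omod k).

Definition pi_sect U : lmodType (regfun U) := pi_mod (fun i => A i U).
Definition pi_res U V (VU : sub_open V U) (m : pi_sect U) : pi_sect V :=
  fun i => res VU (m i).

Lemma pi_ext U (m n : pi_sect U) : (forall i, m i = n i) -> m = n.
Proof. exact: functional_extensionality_dep. Qed.

Lemma pi_sheaf_axiom U (T : Type) (V : T -> open k) (VU : forall t, sub_open (V t) U) :
  open_cover U V -> forall s : (forall t, pi_sect (V t)),
  (forall i j, pi_res (meet_openl (V i) (V j)) (s i) =
               pi_res (meet_openr (V i) (V j)) (s j)) ->
  exists! m : pi_sect U, forall t, pi_res (VU t) m = s t.
Proof.
move=> cov s agree.
have ex i : exists! m : A i U, forall t, res (VU t) m = s t i.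
  apply: (sheaf_axiom VU cov) => t u.
  exact: (congr1 (fun m : pi_sect _ => m i) (agree t u)).
have [m mP] := dep_choice ex.
exists m; split=> [t|n nP]; first by apply: pi_ext => i; have [mi _] := mP i; apply: mi.
apply: pi_ext => i; have [_ mi] := mP i; apply: mi => t.
exact: (congr1 (fun m : pi_sect _ => m i) (nP t)).
Qed.

Program Definition pi_omod : omod k := @Omod k pi_sect pi_res _ _ _ pi_sheaf_axiom.
Next Obligation. by apply: pi_ext => i; exact: res_linear. Qed.
Next Obligation. by apply: pi_ext => i; exact: res_id. Qed.
Next Obligation. by apply: pi_ext => i; exact: res_comp. Qed.

End PiSheaf.

(** The index set is finite, so the maximum of the exponents needed in the factors serves all of
    them. *)
Lemma pi_quasi_coherent (I : finType) (A : I -> qcoh k) : quasi_coherent (pi_omod A).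
Proof.
move=> U V VU f aU f0 fV.
have loc i := qcoh_localizes (A i) VU aU f0 fV.
split=> [m m0|s].
  have [n nP] := dep_choice (fun i => (loc i).1 (m i) (congr1 (fun s : pi_sect _ _ => s i) m0)).
  exists (\max_i n i)%N; apply: pi_ext => i.
  transitivity (f ^+ (\max_j n j - n i)%N *: (f ^+ n i *: m i)); last by rewrite nP scaler0.
  by rewrite scalerA -exprD subnK ?leq_bigmax.
have [n nP] := dep_choice (fun i => (loc i).2 (s i)); have [m mP] := dep_choice nP.
exists (\max_i n i)%N, (fun i => f ^+ (\max_j n j - n i)%N *: m i); apply: pi_ext => i.
have E : res VU (f ^+ (\max_j n j - n i)%N *: m i) = regfun_res VU f ^+ (\max_j n j)%N *: s i.
  by rewrite resZ mP scalerA rmorphXn -exprD subnK ?leq_bigmax.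
exact: E.
Qed.

Section Kernel.
Variables (A B : omod k) (f : omod_hom A B).

Definition ker_on U : {pred A U} := fun m => `[< f U m = 0 >].
Arguments ker_on : clear implicits.

Lemma ker_on_submod U : submod_closed (ker_on U).
Proof.
split=> [|a m n /asboolP m0 /asboolP n0]; apply/asboolP; first exact: raddf0.
by rewrite linearP /= m0 n0 scaler0 addr0.
Qed.

HB.instance Definition _ U := GRing.isSubmodClosed.Build (regfun U) (A U) (ker_on U)
  (ker_on_submod U).

Record ker_sect U := KerSect { ker_val : A U; ker_valP : ker_val \in ker_on U }.

HB.instance Definition _ U := [isSub for @ker_val U].
HB.instance Definition _ U := [Choice of ker_sect U by <:].
HB.instance Definition _ U := [SubChoice_isSubLmodule of ker_sect U by <:].

Lemma ker_sectP U (m : ker_sect U) : f U (ker_val m) = 0.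
Proof. exact/asboolP/ker_valP. Qed.

Definition mk_ker U (m : A U) (m0 : f U m = 0) : ker_sect U := KerSect (introT (asboolP _) m0).

Lemma ker_res_proof U V (VU : sub_open V U) (m : ker_sect U) : f V (res VU (ker_val m)) = 0.
Proof. by rewrite omod_hom_res ker_sectP raddf0. Qed.

Definition ker_res U V (VU : sub_open V U) (m : ker_sect U) : ker_sect V :=
  mk_ker (ker_res_proof VU m).

Lemma ker_ext U (m n : ker_sect U) : ker_val m = ker_val n -> m = n.
Proof. exact: val_inj. Qed.

Lemma ker_sheaf_axiom U (T : Type) (V : T -> open k) (VU : forall t, sub_open (V t) U) :
  open_cover U V -> forall s : (forall t, ker_sect (V t)),
  (forall i j, ker_res (meet_openl (V i) (V j)) (s i) =
               ker_res (meet_openr (V i) (V j)) (s j)) ->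
  exists! m : ker_sect U, forall t, ker_res (VU t) m = s t.
Proof.
move=> cov s agree.
have [|m [mP mU]] := sheaf_axiom VU cov (s := fun t => ker_val (s t)).
  by move=> i j; apply: (congr1 (@ker_val _) (agree i j)).
have m0 : f U m = 0.
  apply: (sheaf_separated (VU := VU) cov) => t.
  by rewrite -omod_hom_res mP ker_sectP raddf0.
exists (mk_ker m0); split=> [t|n nP]; apply: ker_ext; first exact: mP.
by apply: mU => t; rewrite -(nP t).
Qed.

Program Definition ker_omod : omod k := @Omod k (fun U => ker_sect U) ker_res _ _ _ ker_sheaf_axiom.
Next Obligation. by apply: ker_ext; exact: res_linear. Qed.
Next Obligation. by apply: ker_ext; exact: res_id. Qed.
Next Obligation. by apply: ker_ext; exact: res_comp. Qed.

End Kernel.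

Lemma ker_quasi_coherent (A B : qcoh k) (f : omod_hom A B) : quasi_coherent (ker_omod f).
Proof.
move=> U V VU t aU t0 tV.
have [a1 a2] := qcoh_localizes A VU aU t0 tV.
have [b1 _] := qcoh_localizes B VU aU t0 tV.
split=> [m m0|s].
  have [n En] := a1 (ker_val m) (congr1 (@ker_val _ _ _ _) m0).
  by exists n; apply: ker_ext.
have [n [m Em]] := a2 (ker_val s).
have [|l El] := b1 (f U m); first by rewrite -omod_hom_res Em linearZ /= ker_sectP scaler0.
have m0 : f U (t ^+ l *: m) = 0 by rewrite linearZ.
exists (l + n)%N, (mk_ker m0); apply: ker_ext.
have E : res VU (t ^+ l *: m) = regfun_res VU t ^+ (l + n) *: ker_val s.
  by rewrite resZ Em rmorphXn scalerA -exprD.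
exact: E.
Qed.

End Constructions.

(** * Twisting *)

Section Twisting.
Variable k : closedFieldType.
Local Notation K := (ratfun k).
Local Notation "x %:F" := (tofrac x) : ring_scope.
Local Notation chart0 := (chart0 k).
Local Notation chart1 := (chart1 k).
Local Notation torus := (torus k).
Implicit Types (U V W : open k).
Local Arguments regular_at : simpl never.

Lemma Xz_sect (n : int) U : sub_open U torus -> is_sect 0 U ('X%:F ^ n : K).
Proof.
move=> /sub_openP Ut x /Ut; rewrite mem_meet => /andP[x0 x1].
have -> : 'X%:F ^ n = lin (Some 0) ^ n * lin None ^ (- n) :> K.
  by rewrite /lin /= tofrac1 exp1rz mulr1 polyC0 subr0.
rewrite -(subrr n); apply: twist_atM; apply: twist_at_linXz.
  by apply: contraNneq x1 => <-; rewrite inE.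
by apply: contraNneq x0 => <-; rewrite inE.
Qed.

Definition xpow (n : int) U : regfun U := mkreg U ('X%:F ^ n).

Lemma val_xpow n U : sub_open U torus -> val (xpow n U) = 'X%:F ^ n.
Proof. by move=> Ut; apply/val_mkreg/Xz_sect. Qed.

Lemma res_xpow n U V (VU : sub_open V U) : sub_open U torus ->
  regfun_res VU (xpow n U) = xpow n V.
Proof.
by move=> Ut; apply: val_inj; rewrite val_regfun_res !val_xpow ?(sub_open_trans VU Ut).
Qed.

Lemma xpowK n U : sub_open U torus -> xpow n U * xpow (- n) U = 1.
Proof.
move=> Ut; apply: val_inj; rewrite regfun_valM !val_xpow // -expfzDr ?subrr //.
exact: X_neq0.
Qed.

Lemma gen_chart0 n : is_gen n chart0 (1 : K).
Proof.
have : ~~ mem_open None chart0 by rewrite negbK inE.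
by move=> /(linz_gen n); rewrite /lin /= tofrac1 exp1rz.
Qed.

Lemma gen_chart1 n : is_gen n chart1 ('X%:F ^ n : K).
Proof.
have : ~~ mem_open (Some 0) chart1 by rewrite negbK inE.
by move=> /(linz_gen n); rewrite /lin /= polyC0 subr0.
Qed.

Section Object.
Variables (i : int) (M : qcoh k).

Definition tw_pair : qcoh k :=
  QcohOb (@pi_quasi_coherent k bool (fun b => push_qcoh (if b then chart0 else chart1) M)).

Definition torus0 U : sub_open (meet_open U torus) (meet_open U chart0).
Proof. by apply/sub_openP => x; rewrite !mem_meet => /and3P[-> ->]. Qed.
Definition torus1 U : sub_open (meet_open U torus) (meet_open U chart1).
Proof. by apply/sub_openP => x; rewrite !mem_meet => /and3P[-> _ ->]. Qed.

(** M(i) is glued from M on the two charts: on the torus a tensor 1 equals b tensor ['X ^ i], that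
    is b = ['X ^ (- i)] a. As the kernel of a map between direct images it is quasi-coherent. *)
Definition tw_diff U (s : tw_pair U) : M (meet_open U torus) :=
  xpow (- i) (meet_open U torus) *: res (torus0 U) (s true : M (meet_open U chart0)) -
  res (torus1 U) (s false : M (meet_open U chart1)).

Fact tw_diff_linear U : linear (@tw_diff U : tw_pair U -> push_qcoh torus M U).
Proof.
move=> a s t.
rewrite [RHS]/(regfun_res (meet_openl U torus) a *: tw_diff s + tw_diff t) /tw_diff.
have E (b : bool) X (XU : sub_open X U) (h : sub_open X (meet_open U (if b then chart0 else chart1))) :
    res h ((a *: s + t) b : M _) = regfun_res XU a *: res h (s b : M _) + res h (t b : M _).
  rewrite [LHS](res_linear h (regfun_res (meet_openl U _) a) (s b : M _) (t b : M _)).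
  by congr (_ *: _ + _); apply: val_inj.
rewrite (E true _ (meet_openl U torus)) (E false _ (meet_openl U torus)).
by rewrite scalerDr scalerA mulrC -scalerA opprD addrACA -scalerBr.
Qed.

Fact tw_diff_res U V (VU : sub_open V U) (s : tw_pair U) :
  tw_diff (res VU s) = res VU (tw_diff s : push_qcoh torus M U).
Proof.
have E : res (sub_meet2 torus VU) (tw_diff s) =
    xpow (- i) (meet_open V torus) *: res (torus0 V) (res (sub_meet2 chart0 VU) (s true : M _)) -
    res (torus1 V) (res (sub_meet2 chart1 VU) (s false : M _)).
  rewrite /tw_diff raddfB /= resZ res_xpow ?meet_openr //.
  by congr (_ *: _ - _); apply: res_res.
exact: esym E.
Qed.

Definition tw_cond : omod_hom tw_pair (push_qcoh torus M) :=
  mk_omod_hom tw_diff_linear (fun U V VU s => @tw_diff_res U V VU s).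

Definition twisted : qcoh k := QcohOb (@ker_quasi_coherent k tw_pair (push_qcoh torus M) tw_cond).

Definition part0 U (s : twisted U) : M (meet_open U chart0) := (ker_val s : tw_pair U) true.
Definition part1 U (s : twisted U) : M (meet_open U chart1) := (ker_val s : tw_pair U) false.

Lemma tw_ext U (s t : twisted U) : part0 s = part0 t -> part1 s = part1 t -> s = t.
Proof. by move=> E0 E1; apply: ker_ext; apply: pi_ext; case. Qed.

Lemma tw_rel U (s : twisted U) :
  res (torus1 U) (part1 s) = xpow (- i) (meet_open U torus) *: res (torus0 U) (part0 s).
Proof. by apply/esym/subr0_eq; apply: (ker_sectP s). Qed.

Lemma mk_tw_cond U (a : M (meet_open U chart0)) (b : M (meet_open U chart1)) :
  res (torus1 U) b = xpow (- i) (meet_open U torus) *: res (torus0 U) a ->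
  tw_cond U ((fun c => if c return push_qcoh (if c then chart0 else chart1) M U then a else b) : tw_pair U) = 0.
Proof.
move=> E; have D : xpow (- i) (meet_open U torus) *: res (torus0 U) a - res (torus1 U) b = 0.
  by rewrite E subrr.
exact: D.
Qed.

Definition mk_tw U a b E : twisted U := mk_ker (@mk_tw_cond U a b E).

Lemma part0L U (c : regfun U) (s t : twisted U) :
  part0 (c *: s + t) = regfun_res (meet_openl U chart0) c *: part0 s + part0 t.
Proof. by []. Qed.
Lemma part1L U (c : regfun U) (s t : twisted U) :
  part1 (c *: s + t) = regfun_res (meet_openl U chart1) c *: part1 s + part1 t.
Proof. by []. Qed.
Lemma part0_res U V (VU : sub_open V U) (s : twisted U) :
  part0 (res VU s) = res (sub_meet2 chart0 VU) (part0 s).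
Proof. by []. Qed.
Lemma part1_res U V (VU : sub_open V U) (s : twisted U) :
  part1 (res VU s) = res (sub_meet2 chart1 VU) (part1 s).
Proof. by []. Qed.

Definition coef0 U (t : twist k i U) : regfun (meet_open U chart0) :=
  mkreg _ (twist_val t).
Definition coef1 U (t : twist k i U) : regfun (meet_open U chart1) :=
  mkreg _ (twist_val t / 'X%:F ^ i).

Lemma val_coef0 U (t : twist k i U) : val (coef0 t) = twist_val t.
Proof.
have := gen_ratio (is_gen_sub (meet_openr U chart0) (gen_chart0 i))
  (is_sect_sub (meet_openl U chart0) (twist_sectP t)).
by rewrite divr1; exact: val_mkreg.
Qed.

Lemma val_coef1 U (t : twist k i U) : val (coef1 t) = twist_val t / 'X%:F ^ i.
Proof.
apply: val_mkreg; exact: gen_ratio (is_gen_sub (meet_openr U chart1) (gen_chart1 i))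
  (is_sect_sub (meet_openl U chart1) (twist_sectP t)).
Qed.

Lemma tw_bil_proof U (m : M U) (t : twist k i U) :
  res (torus1 U) (coef1 t *: res (meet_openl U chart1) m) =
  xpow (- i) (meet_open U torus) *: res (torus0 U) (coef0 t *: res (meet_openl U chart0) m).
Proof.
rewrite !resZ scalerA (res_res _ _ (meet_openl U chart0) (torus0 U)); congr (_ *: _).
apply: val_inj; rewrite regfun_valM !val_regfun_res val_coef0 val_coef1.
by rewrite val_xpow ?meet_openr // -invr_expz mulrC.
Qed.

Definition tw_bil_fun U (m : M U) (t : twist k i U) : twisted U := mk_tw (tw_bil_proof m t).

Lemma part0_bil U (m : M U) t : part0 (tw_bil_fun m t) = coef0 t *: res (meet_openl U chart0) m.
Proof. by []. Qed.
Lemma part1_bil U (m : M U) t : part1 (tw_bil_fun m t) = coef1 t *: res (meet_openl U chart1) m.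
Proof. by []. Qed.

Program Definition tw_bil : bilinear_map M (twist k i) twisted :=
  @BilinearMap k M (twist k i) twisted tw_bil_fun _ _ _.
Next Obligation.
move=> a m m'; apply: tw_ext; rewrite ?part0L ?part1L ?part0_bil ?part1_bil.
  by rewrite raddfD /= resZ scalerDr !scalerA mulrC.
by rewrite raddfD /= resZ scalerDr !scalerA mulrC.
Qed.
Next Obligation.
move=> a t t'; apply: tw_ext; rewrite ?part0L ?part1L ?part0_bil ?part1_bil.
  rewrite scalerA -scalerDl; congr (_ *: _); apply: val_inj.
  by rewrite regfun_valL !val_coef0.
rewrite scalerA -scalerDl; congr (_ *: _); apply: val_inj.
by rewrite regfun_valL !val_coef1 twist_valL mulrDl mulrA.
Qed.
Next Obligation.
apply: tw_ext; rewrite ?part0_res ?part1_res ?part0_bil ?part1_bil resZ.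
  rewrite (res_res _ _ (meet_openl U chart0) (sub_meet2 chart0 VU)); congr (_ *: _).
  by apply: val_inj; rewrite val_regfun_res !val_coef0.
rewrite (res_res _ _ (meet_openl U chart1) (sub_meet2 chart1 VU)); congr (_ *: _).
by apply: val_inj; rewrite val_regfun_res !val_coef1.
Qed.

Definition one0 U : twist k i U := mktw i U 1.
Definition one1 U : twist k i U := mktw i U ('X%:F ^ i).

Lemma val_one0 U : sub_open U chart0 -> twist_val (one0 U) = 1 :> K.
Proof. by move=> UC; have [_ s _] := is_gen_sub UC (gen_chart0 i); rewrite val_mktw. Qed.
Lemma val_one1 U : sub_open U chart1 -> twist_val (one1 U) = 'X%:F ^ i :> K.
Proof. by move=> UC; have [_ s _] := is_gen_sub UC (gen_chart1 i); rewrite val_mktw. Qed.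

(** Inside a chart every section of the twist is a pure tensor with the local generator of O(i), 1
    here and ['X ^ i] on the other chart; this determines the maps out of the twist. *)
Lemma tw_repr0 U (s : twisted U) : sub_open U chart0 ->
  s = tw_bil U (rest U (part0 s)) (one0 U).
Proof.
move=> UC; have U0 := sub_open_meet (sub_openxx U) UC; rewrite (restE U0).
have E0 : part0 s = res (meet_openl U chart0) (res U0 (part0 s)).
  by rewrite (res_comp _ _ (sub_openxx _)) res_id.
apply: tw_ext; rewrite ?part0_bil ?part1_bil.
  rewrite (_ : coef0 _ = 1) ?scale1r //; apply: val_inj.
  by rewrite val_coef0 val_one0.
have t1 : sub_open (meet_open U chart1) (meet_open U torus).
  by apply/sub_openP => x; rewrite !mem_meet => /andP[xU ->]; rewrite xU (sub_open_mem UC xU).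
rewrite -[LHS](res_id (sub_openxx _)) -(res_comp (torus1 U) t1) tw_rel resZ.
rewrite (res_comp _ _ (sub_open_trans t1 (torus0 U))) [in RHS](res_comp _ _ (sub_open_trans t1 (torus0 U))).
congr (_ *: _); apply: val_inj; rewrite val_regfun_res val_xpow ?meet_openr // val_coef1 val_one0 //.
by rewrite div1r invr_expz.
Qed.

Lemma tw_repr1 U (s : twisted U) : sub_open U chart1 ->
  s = tw_bil U (rest U (part1 s)) (one1 U).
Proof.
move=> UC; have U1 := sub_open_meet (sub_openxx U) UC; rewrite (restE U1).
have X0 : 'X%:F ^ i != 0 :> K := expfz_neq0 i (X_neq0 k).
apply: tw_ext; rewrite ?part0_bil ?part1_bil; last first.
  rewrite (res_comp _ _ (sub_openxx _)) res_id.
  rewrite (_ : coef1 _ = 1) ?scale1r //; apply: val_inj.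
  by rewrite val_coef1 val_one1 // (mulfV X0).
have t0 : sub_open (meet_open U chart0) (meet_open U torus).
  by apply/sub_openP => x; rewrite !mem_meet => /andP[xU ->]; rewrite xU (sub_open_mem UC xU).
have := congr1 (fun m => xpow i _ *: res t0 m) (tw_rel s).
rewrite resZ res_xpow ?meet_openr // scalerA xpowK ?scale1r ?(sub_open_trans t0) ?meet_openr //.
rewrite [X in _ = X](res_comp _ _ (sub_openxx _)) res_id => <-.
rewrite (res_comp _ _ (sub_open_trans t0 (torus1 U))) [in RHS](res_comp _ _ (sub_open_trans t0 (torus1 U))).
congr (_ *: _); apply: val_inj.
by rewrite val_coef0 val_one1 // val_xpow // (sub_open_trans t0) ?meet_openr.
Qed.

End Object.

Lemma bilZ (M N P : omod k) (b : bilinear_map M N P) U (a : regfun U) m n :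
  b U (a *: m) n = a *: b U m n.
Proof.
have := bil_linearl b n a m 0; rewrite addr0 => ->.
suff -> : b U 0 n = 0 by rewrite addr0.
by have := bil_linearl b n (-1) 0 0; rewrite scaler0 addr0 scaleN1r addNr.
Qed.

Lemma bilZr (M N P : omod k) (b : bilinear_map M N P) U (a : regfun U) m n :
  b U m (a *: n) = a *: b U m n.
Proof.
have := bil_linearr b m a n 0; rewrite addr0 => ->.
suff -> : b U m 0 = 0 by rewrite addr0.
by have := bil_linearr b m (-1) 0 0; rewrite scaler0 addr0 scaleN1r addNr.
Qed.

Section Functoriality.
Variable i : int.

Lemma tw_map_proof (A B : qcoh k) (f : omod_hom A B) U (s : twisted i A U) :
  res (torus1 U) (f _ (part1 s)) =
  xpow (- i) (meet_open U torus) *: res (torus0 U) (f _ (part0 s)).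
Proof. by rewrite -!omod_hom_res -linearZ /= tw_rel. Qed.

Definition tw_map_fun (A B : qcoh k) (f : omod_hom A B) U (s : twisted i A U) : twisted i B U :=
  mk_tw (tw_map_proof f s).

Fact tw_map_linear (A B : qcoh k) (f : omod_hom A B) U : linear (@tw_map_fun A B f U).
Proof.
by move=> a s t; apply: tw_ext; [exact: (omod_homP f _ (part0 s))|exact: (omod_homP f _ (part1 s))].
Qed.

Fact tw_map_res (A B : qcoh k) (f : omod_hom A B) U V (VU : sub_open V U) (s : twisted i A U) :
  tw_map_fun f (res VU s) = res VU (tw_map_fun f s).
Proof. by apply: tw_ext; apply: omod_hom_res. Qed.

Definition tw_map (A B : qcoh k) (f : omod_hom A B) : omod_hom (twisted i A) (twisted i B) :=
  mk_omod_hom (@tw_map_linear A B f) (fun U V VU s => @tw_map_res A B f U V VU s).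

Program Definition tw_functor : functor (Qcoh k) (Qcoh k) :=
  @Functor k (Qcoh k) (Qcoh k) (twisted i) tw_map _ _ _.
Next Obligation.
move=> a f g; apply: omod_hom_ext => U s; apply: tw_ext; rewrite omod_homD omod_homZ.
  rewrite part0L; congr (_ *: _ + _); exact: val_inj.
rewrite part1L; congr (_ *: _ + _); exact: val_inj.
Qed.
Next Obligation. by apply: omod_hom_ext => U s; apply: tw_ext. Qed.
Next Obligation. by apply: omod_hom_ext => U s; apply: tw_ext. Qed.

(** The value on m tensor a local generator is forced on each chart, and the two prescriptions agree
    on the torus because b lets the transition function move from one argument to the other. *)
Lemma tw_univ (M : qcoh k) (P : omod k) (b : bilinear_map M (twist k i) P) :
  exists! h : omod_hom (twisted i M) P,
    forall U (m : M U) (n : twist k i U), h U (tw_bil i M U m n) = b U m n.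
Proof.
have X0 : 'X%:F ^ i != 0 :> K := expfz_neq0 i (X_neq0 k).
pose f U (s : twisted i M U) : P U := b U (rest U (part0 s)) (one0 i U).
pose g U (s : twisted i M U) : P U := b U (rest U (part1 s)) (one1 i U).
have res1 U V (VU : sub_open V U) : sub_open U chart0 -> one0 i V = res VU (one0 i U).
  by move=> UC; have [_ s _] := is_gen_sub UC (gen_chart0 i); rewrite /one0 (res_mktw VU s).
have resX U V (VU : sub_open V U) : sub_open U chart1 -> one1 i V = res VU (one1 i U).
  by move=> UC; have [_ s _] := is_gen_sub UC (gen_chart1 i); rewrite /one1 (res_mktw VU s).
have [U UC a s t|U UC a s t|U V VU UC s|U V VU UC s|U s UC0 UC1|h [h0 h1]] :=
  @omod_hom_glue2 k (twisted i M) P _ _ f g (@chart_cover01 k).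
- rewrite /f -bil_linearl; congr (b U _ _).
  rewrite !(restE (sub_open_meet (sub_openxx U) UC)) part0L raddfD /= resZ; congr (_ *: _ + _).
  exact: val_inj.
- rewrite /g -bil_linearl; congr (b U _ _).
  rewrite !(restE (sub_open_meet (sub_openxx U) UC)) part1L raddfD /= resZ; congr (_ *: _ + _).
  exact: val_inj.
- rewrite /f (res1 _ _ VU UC) -bil_res; congr (b V _ _).
  rewrite (restE (sub_open_meet (sub_openxx U) UC)).
  rewrite (restE (sub_open_meet (sub_openxx V) (sub_open_trans VU UC))).
  exact: res_res.
- rewrite /g (resX _ _ VU UC) -bil_res; congr (b V _ _).
  rewrite (restE (sub_open_meet (sub_openxx U) UC)).
  rewrite (restE (sub_open_meet (sub_openxx V) (sub_open_trans VU UC))).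
  exact: res_res.
- rewrite /f /g.
  have U0 := sub_open_meet (sub_openxx U) UC0; have U1 := sub_open_meet (sub_openxx U) UC1.
  have Ut := sub_open_meet (sub_openxx U) (sub_open_meet UC0 UC1).
  rewrite (restE U0) (restE U1).
  have -> : res U1 (part1 s) = xpow (- i) U *: res U0 (part0 s).
    rewrite -(res_comp (torus1 U) Ut) tw_rel resZ res_xpow ?meet_openr //.
    by rewrite (res_comp _ _ U0).
  rewrite bilZ -bilZr; congr (b U _ _); apply: twist_ext.
  by rewrite twist_valZ val_xpow ?(sub_open_meet UC0 UC1) // val_one0 // val_one1 // -invr_expz (mulVf X0).
have hb U (m : M U) n : h U (tw_bil i M U m n) = b U m n.
  apply: (sheaf_separated2 (VU := meet_openl U chart0) (WU := meet_openl U chart1)).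
  - by move=> x xU; rewrite !mem_meet xU; apply: chart_cover01.
  - rewrite -omod_hom_res -!bil_res h0 ?meet_openr //; move: (res _ m) (res _ n) => {}m {}n.
    have UC := meet_openr U chart0; move: (meet_open U chart0) UC m n => {}U UC m n.
    rewrite /f part0_bil (restE (sub_open_meet (sub_openxx U) UC)) resZ.
    rewrite (res_comp _ _ (sub_openxx U)) res_id bilZ -bilZr; congr (b U _ _); apply: twist_ext.
    by rewrite twist_valZ val_regfun_res val_coef0 val_one0 // mulr1.
  - rewrite -omod_hom_res -!bil_res h1 ?meet_openr //; move: (res _ m) (res _ n) => {}m {}n.
    have UC := meet_openr U chart1; move: (meet_open U chart1) UC m n => {}U UC m n.
    rewrite /g part1_bil (restE (sub_open_meet (sub_openxx U) UC)) resZ.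
    rewrite (res_comp _ _ (sub_openxx U)) res_id bilZ -bilZr; congr (b U _ _); apply: twist_ext.
    by rewrite twist_valZ val_regfun_res val_coef1 val_one1 // (divfK X0).
exists h; split=> // h' h'b; apply: (omod_hom_eq2 (@chart_cover01 k)) => U s UC.
  by rewrite (tw_repr0 s UC) hb h'b.
by rewrite (tw_repr1 s UC) hb h'b.
Qed.

Definition tw_tensor : tensor_functor (twist k i).
Proof.
refine (@TensorFunctor k (twist k i) tw_functor (tw_bil i) _ tw_univ).
move=> M M' f U m n; apply: tw_ext.
  have E : f _ (coef0 n *: res (meet_openl U chart0) m) =
    coef0 n *: res (meet_openl U chart0) (f U m) by rewrite linearZ /= omod_hom_res.
  exact: E.
have E : f _ (coef1 n *: res (meet_openl U chart1) m) =
  coef1 n *: res (meet_openl U chart1) (f U m) by rewrite linearZ /= omod_hom_res.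
exact: E.
Defined.

End Functoriality.

(** ** The cohomology of a twist *)

Section TwistedCohomology.
Variable i : int.
Implicit Types A B M : qcoh k.

Lemma torus_chart0 : sub_open torus chart0. Proof. exact: meet_openl. Qed.
Lemma torus_chart1 : sub_open torus chart1. Proof. exact: meet_openr. Qed.

Definition torus_lift M (m : kspace (M torus)) : kspace (twisted i M torus) :=
  tw_bil i M torus m (one0 i torus).

Lemma torus_lift_linear M : linear (@torus_lift M).
Proof. by move=> a m m'; exact: (bil_linearl (tw_bil i M) (one0 i torus) (regfun_const _ a)). Qed.

Lemma torus_lift_inj M (m : kspace (M torus)) : torus_lift m = 0 -> m = 0.
Proof.
move=> E; have := congr1 (fun s => rest torus (part0 (s : twisted i M torus))) E.
have Ut := sub_open_meet (sub_openxx torus) torus_chart0.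
rewrite !(restE Ut) [part0 (0 : twisted i M torus)](_ : _ = 0) // raddf0 part0_bil resZ.
rewrite (res_comp _ _ (sub_openxx _)) res_id (_ : regfun_res _ _ = 1) ?scale1r //.
by apply: val_inj; rewrite val_regfun_res val_coef0 val_one0 // torus_chart0.
Qed.

Definition htw_pi M : linmap (kspace (M torus)) (fval (functor_comp (cech_cohomology k) (tw_tensor i)) M) :=
  mk_linmap (f := fun m : kspace (M torus) => cech_pi (twisted i M) (torus_lift m))
    (fun a m m' => etrans (congr1 (cech_pi (twisted i M)) (torus_lift_linear a m m')) (linmapP _ a _ _)).

Lemma htw_pi_natural : @natural k (sections torus) (functor_comp (cech_cohomology k) (tw_tensor i)) htw_pi.
Proof.
move=> A B f m.
have E : cech_map (tw_map i f) (cech_pi (twisted i A) (torus_lift m)) =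
    cech_pi (twisted i B) (torus_lift (f torus m)).
  rewrite cech_mapE; congr (cech_pi _ _).
  exact: (tens_natural (tw_tensor i) f (m : A torus) (one0 i torus)).
exact: esym E.
Qed.

Lemma htw_pi_surj M g : exists m, htw_pi M m = g.
Proof.
have [s <-] := cech_surj g.
by exists (rest torus (part0 (s : twisted i M torus))); rewrite [in RHS](tw_repr0 s torus_chart0).
Qed.

(** The coboundaries of M(i), trivialised on the torus by the generator 1; the other chart uses the
    generator ['X ^ i], whence the factor. H^1(M(i)) becomes a cokernel of sections of M itself. *)
Definition htw_rho_fun M (s : (kspace (M chart0) * kspace (M chart1))%type) : kspace (M torus) :=
  res torus_chart0 (s.1 : M chart0) + xpow i torus *: res torus_chart1 (s.2 : M chart1) : M torus.

Fact htw_rho_linear M : linear (@htw_rho_fun M).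
Proof.
move=> a [s s'] [t t'].
have E : res torus_chart0 (regfun_const _ a *: (s : M chart0) + (t : M chart0)) +
    xpow i torus *: res torus_chart1 (regfun_const _ a *: (s' : M chart1) + (t' : M chart1)) =
  regfun_const _ a *: (res torus_chart0 (s : M chart0) + xpow i torus *: res torus_chart1 (s' : M chart1)) +
  (res torus_chart0 (t : M chart0) + xpow i torus *: res torus_chart1 (t' : M chart1)) :> M torus.
  rewrite !res_linear !regfun_res_const !scalerDr !scalerA [xpow _ _ * _]mulrC.
  by rewrite addrACA.
exact: E.
Qed.

Definition htw_rho M : linmap (fval (functor_add (sections chart0) (sections chart1)) M)
    (fval (sections torus) M) := mk_linmap (@htw_rho_linear M).

Lemma htw_rho_natural :
  @natural k (functor_add (sections chart0) (sections chart1)) (sections torus) htw_rho.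
Proof.
move=> A B f [s t].
have E : res torus_chart0 (f _ (s : A chart0)) + xpow i torus *: res torus_chart1 (f _ (t : A chart1)) =
    f _ (res torus_chart0 (s : A chart0) + xpow i torus *: res torus_chart1 (t : A chart1)).
  by rewrite linearD linearZ /= !omod_hom_res.
exact: E.
Qed.

Lemma htw_pi_ker M s : htw_pi M s = 0 <-> exists r, htw_rho M r = s.
Proof.
have lift0 (a : M chart0) : res (sub_torus0 k) (tw_bil i M chart0 a (one0 i chart0)) =
    torus_lift (res torus_chart0 a).
  rewrite -bil_res (res_irr (sub_torus0 k) torus_chart0 a); congr (tw_bil i M _ _ _).
  by have [_ s0 _] := gen_chart0 i; exact: res_mktw s0.
have lift1 (b : M chart1) : res (sub_torus1 k) (tw_bil i M chart1 b (one1 i chart1)) =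
    torus_lift (xpow i torus *: res torus_chart1 b).
  rewrite -bil_res (res_irr (sub_torus1 k) torus_chart1 b) /torus_lift bilZ -bilZr; congr (tw_bil i M _ _ _); apply: twist_ext.
  rewrite twist_val_res twist_valZ val_one1 ?sub_openxx // val_one0 ?torus_chart0 //.
  by rewrite mulr1 val_xpow ?sub_openxx.
have liftD (m n : M torus) : torus_lift (m + n) = torus_lift m + torus_lift n.
  have := torus_lift_linear 1 (m : kspace (M torus)) (n : kspace (M torus)).
  by rewrite !scale1r.
split=> [/cech_pi0[a [b E]]|[[a b] <-]]; last first.
  apply/cech_pi0; exists (tw_bil i M chart0 a (one0 i chart0)), (tw_bil i M chart1 b (one1 i chart1)).
  by rewrite lift0 lift1 -liftD.
rewrite (tw_repr0 a (sub_openxx _)) (tw_repr1 b (sub_openxx _)) lift0 lift1 -liftD in E.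
exists (rest chart0 (part0 a), rest chart1 (part1 b)).
apply/esym/subr0_eq/torus_lift_inj.
have := torus_lift_linear (-1) (htw_rho_fun (rest chart0 (part0 a), rest chart1 (part1 b))) s.
rewrite !scaleN1r => D.
by rewrite addrC D E addNr.
Qed.

Lemma good_htw : good (functor_comp (cech_cohomology k) (tw_tensor i)).
Proof.
apply: (good_coker htw_rho_natural htw_pi_natural htw_pi_surj htw_pi_ker).
  by apply: good_add; apply: good_sections; [exact: affine_chart0|exact: affine_chart1].
exact/good_sections/affine_torus.
Qed.

End TwistedCohomology.

End Twisting.

(** * The cokernel of a morphism of sheaves supported on an affine open subset *)

Section Cokernel.
Variable k : closedFieldType.
Implicit Types (U V W X Y C : open k).

(* As open subsets are quasi-compact, the sheaf axiom may be tested on covers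
   by two open subsets. *)
Lemma sheaf_of_two (P : open k -> Type) (r : forall U V, sub_open V U -> P U -> P V) :
  (forall U (UU : sub_open U U) m, r U U UU m = m) ->
  (forall U V W (VU : sub_open V U) (WV : sub_open W V) (WU : sub_open W U) m,
     r V W WV (r U V VU m) = r U W WU m) ->
  (forall U V W (VU : sub_open V U) (WU : sub_open W U) m n,
     (forall x, mem_open x U -> mem_open x V || mem_open x W) ->
     r U V VU m = r U V VU n -> r U W WU m = r U W WU n -> m = n) ->
  (forall X Y (a : P X) (b : P Y), r _ _ (meet_openl X Y) a = r _ _ (meet_openr X Y) b ->
     exists m, r _ _ (sub_joinl X Y) m = a /\ r _ _ (sub_joinr X Y) m = b) ->
  forall U (I : Type) (V : I -> open k) (VU : forall i, sub_open (V i) U), open_cover U V ->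
  forall s : (forall i, P (V i)),
    (forall i j, r _ _ (meet_openl (V i) (V j)) (s i) = r _ _ (meet_openr (V i) (V j)) (s j)) ->
  exists! m : P U, forall i, r _ _ (VU i) m = s i.
Proof.
move=> rid rcomp sep glue.
have sepI U (I : Type) (V : I -> open k) (VU : forall i, sub_open (V i) U) (m n : P U) :
    open_cover U V -> (forall i, r _ _ (VU i) m = r _ _ (VU i) n) -> m = n.
  move=> cov E; suff /(_ (sub_openxx U)) : forall UU : sub_open U U, r _ _ UU m = r _ _ UU n.
    by rewrite !rid.
  apply: (open_cover_ind (P := fun X => forall XU, r _ X XU m = r _ X XU n) cov).
    move=> X Y XU YU EX EY ZU; apply: (sep _ _ _ (sub_joinl X Y) (sub_joinr X Y)).
    - by move=> x; rewrite mem_join.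
    - by rewrite !(rcomp _ _ _ _ _ XU).
    - by rewrite !(rcomp _ _ _ _ _ YU).
  by move=> i iU; rewrite (bool_irrelevance iU (VU i)).
move=> U I V VU cov s agree.
have [m mP] : exists m : P U, forall i, r _ _ (meet_openl U (V i)) m = r _ _ (meet_openr U (V i)) (s i).
  apply: (open_cover_ind (P := fun X => exists m : P X,
    forall i, r _ _ (meet_openl X (V i)) m = r _ _ (meet_openr X (V i)) (s i)) cov); last by move=> i; exists (s i).
  move=> X Y XU YU [m mX] [n nY]; have [|p [pX pY]] := glue X Y m n.
    have [inh [_ c]] := cov.
    pose Z := meet_open X Y; have ZX : sub_open Z X := meet_openl X Y; have ZY : sub_open Z Y := meet_openr X Y.
    apply: (sepI _ I (fun i => meet_open Z (V i)) (fun i => meet_openl Z (V i))) => [|i].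
      split=> //; split=> [i|x xZ]; first exact: meet_openl.
      have [i xi] := c x (sub_open_mem (sub_open_trans ZX XU) xZ).
      by exists i; rewrite mem_meet xZ.
    rewrite !(rcomp _ _ _ _ _ (sub_open_trans (meet_openl Z (V i)) _)) //.
    have E W (ZW : sub_open Z W) (w : P W)
        (wW : forall i, r _ _ (meet_openl W (V i)) w = r _ _ (meet_openr W (V i)) (s i)) :
        r _ _ (sub_open_trans (meet_openl Z (V i)) ZW) w = r _ _ (meet_openr Z (V i)) (s i).
      have ZiW : sub_open (meet_open Z (V i)) (meet_open W (V i)) := sub_meet2 (V i) ZW.
      by rewrite -(rcomp _ _ _ (meet_openl W (V i)) ZiW) wW (rcomp _ _ _ _ _ (meet_openr Z (V i))).
    by rewrite (E X) // (E Y).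
  exists p => i; pose Z := meet_open (join_open X Y) (V i).
  have Xi : sub_open (meet_open X (V i)) Z := sub_meet2 (V i) (sub_joinl X Y).
  have Yi : sub_open (meet_open Y (V i)) Z := sub_meet2 (V i) (sub_joinr X Y).
  apply: (sep _ _ _ Xi Yi).
  - by move=> x; rewrite !mem_meet mem_join => /andP[/orP[]-> ->]; rewrite ?orbT.
  - rewrite (rcomp _ _ _ _ _ (sub_open_trans (meet_openl X (V i)) (sub_joinl X Y))).
    rewrite (rcomp _ _ _ _ _ (meet_openr X (V i))) -(rcomp _ _ _ (sub_joinl X Y) (meet_openl X (V i))).
    by rewrite pX mX.
  - rewrite (rcomp _ _ _ _ _ (sub_open_trans (meet_openl Y (V i)) (sub_joinr X Y))).
    rewrite (rcomp _ _ _ _ _ (meet_openr Y (V i))) -(rcomp _ _ _ (sub_joinr X Y) (meet_openl Y (V i))).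
    by rewrite pY nY.
exists m; split=> [i|n nP].
  have iU : sub_open (V i) (meet_open U (V i)) := sub_open_meet (VU i) (sub_openxx (V i)).
  by rewrite -(rcomp _ _ _ (meet_openl U (V i)) iU) mP (rcomp _ _ _ _ _ (sub_openxx _)) rid.
apply: (sepI _ _ _ VU _ _ cov) => i; rewrite nP.
have iU : sub_open (V i) (meet_open U (V i)) := sub_open_meet (VU i) (sub_openxx (V i)).
by rewrite -(rcomp _ _ _ (meet_openl U (V i)) iU) mP (rcomp _ _ _ _ _ (sub_openxx _)) rid.
Qed.

Variables (E G : qcoh k) (f : omod_hom E G) (C : open k).
Hypothesis aC : affine C.
Hypothesis Esurj : forall U (e : E (meet_open U C)), exists e', res (meet_openl U C) e' = e.
Hypothesis Einj : forall U (e : E U), res (meet_openl U C) e = 0 -> e = 0.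
Hypothesis Ginj : forall U (g : G U), res (meet_openl U C) g = 0 -> g = 0.

Fact image_sub0 U : exists e, f U e = 0.
Proof. by exists 0; rewrite linear0. Qed.
Fact image_subL U (a : regfun U) (u v : G U) : (exists e, f U e = u) -> (exists e, f U e = v) ->
  exists e, f U e = a *: u + v.
Proof. by move=> [e <-] [e' <-]; exists (a *: e + e'); rewrite linearP. Qed.
Definition image_sub U : submodule (G U) := Submodule (image_sub0 U) (@image_subL U).

Definition coker_sect U : lmodType (regfun U) := quotient (image_sub U).
Definition coker_pi U (g : G U) : coker_sect U := quot_pi (image_sub U) g.
Definition coker_res U V (VU : sub_open V U) (q : coker_sect U) : coker_sect V :=
  coker_pi (res VU (quot_repr q)).

Lemma coker_piP U (g g' : G U) : coker_pi g = coker_pi g' <-> exists e, f U e = g - g'.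
Proof. exact: quot_piP. Qed.

Lemma coker_pi0 U (g : G U) : coker_pi g = 0 <-> exists e, f U e = g.
Proof. exact: quot_pi0. Qed.

Lemma coker_piL U (a : regfun U) (g g' : G U) :
  coker_pi (a *: g + g') = a *: coker_pi g + coker_pi g'.
Proof. exact: quot_pi_linear. Qed.

Lemma coker_resE U V (VU : sub_open V U) (g : G U) :
  coker_res VU (coker_pi g) = coker_pi (res VU g).
Proof.
apply/coker_piP; have [e Ee] := quot_repr_pi (image_sub U) g; exists (res VU e).
by rewrite omod_hom_res Ee raddfB.
Qed.

Lemma image_two U V W (VU : sub_open V U) (WU : sub_open W U) (g : G U) :
  (forall x, mem_open x U -> mem_open x V || mem_open x W) ->
  (exists e, f V e = res VU g) -> (exists e, f W e = res WU g) -> exists e, f U e = g.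
Proof.
move=> cov [v Ev] [w Ew].
have [|||e Ee] := @qcoh_image2 k E G f _ _ _ (sub_meet2 C VU) (sub_meet2 C WU)
    (affine_sub (meet_openr U C) aC) _ (res (meet_openl U C) g).
- by move=> x; rewrite !mem_meet => /andP[/cov cx ->]; rewrite !andbT.
- by exists (res (meet_openl V C) v); rewrite omod_hom_res Ev; apply: res_res.
- by exists (res (meet_openl W C) w); rewrite omod_hom_res Ew; apply: res_res.
have [e' Ee'] := Esurj e; exists e'; apply/subr0_eq/Ginj.
by rewrite raddfB /= -omod_hom_res Ee' Ee subrr.
Qed.

Lemma split_two X Y (g : E (meet_open X Y)) :
  exists a b, g = res (meet_openl X Y) a + res (meet_openr X Y) b.
Proof.
pose J := join_open (meet_open X C) (meet_open Y C).
have aJ : affine J.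
  by apply: affine_sub aC; apply: sub_open_join; apply: meet_openr.
have s : sub_open (meet_open (meet_open X C) (meet_open Y C)) (meet_open X Y).
  by apply/sub_openP => x; rewrite !mem_meet => /andP[/andP[-> _] /andP[->]].
have [|a [b Eab]] := qcoh_split aJ (sub_joinl _ _) (sub_joinr _ _) _ (res s g).
  by move=> x; rewrite mem_join.
have [a' Ea'] := Esurj a; have [b' Eb'] := Esurj b; exists a', b'; apply/subr0_eq/Einj.
have t : sub_open (meet_open (meet_open X Y) C) (meet_open (meet_open X C) (meet_open Y C)).
  by apply/sub_openP => x; rewrite !mem_meet => /andP[/andP[-> ->] ->].
rewrite -(res_comp s t) [res s _](_ : _ = 0) ?raddf0 // raddfB raddfD /= Eab -Ea' -Eb'.
apply/eqP; rewrite subr_eq0; apply/eqP.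
by congr (_ + _); apply: res_res.
Qed.

(** The presheaf cokernel is a sheaf because sections of E and G are controlled by those inside the
    affine C: separatedness is the locality of the image, [image_two], and gluing corrects
    representatives by [split_two], the Cech vanishing for E. *)
Lemma coker_sheaf_axiom U (I : Type) (V : I -> open k) (VU : forall i, sub_open (V i) U) :
  open_cover U V -> forall s : (forall i, coker_sect (V i)),
  (forall i j, coker_res (meet_openl (V i) (V j)) (s i) =
               coker_res (meet_openr (V i) (V j)) (s j)) ->
  exists! m : coker_sect U, forall i, coker_res (VU i) m = s i.
Proof.
apply: (sheaf_of_two (P := coker_sect) (r := coker_res)).
- by move=> U' UU m; elim/quot_ind: m => m; rewrite -[quot_pi _ _]/(coker_pi m) coker_resE res_id.
- move=> X Y Z YX ZY ZX m; elim/quot_ind: m => m.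
  by rewrite -[quot_pi _ _]/(coker_pi m) !coker_resE (res_comp _ _ ZX).
- move=> X Y Z YX ZX m n cov; elim/quot_ind: m => m; elim/quot_ind: n => n.
  rewrite -[quot_pi _ m]/(coker_pi m) -[quot_pi _ n]/(coker_pi n) !coker_resE.
  by move=> /coker_piP EY /coker_piP EZ; apply/coker_piP; apply: image_two cov _ _; rewrite raddfB.
move=> X Y a b; elim/quot_ind: a => a; elim/quot_ind: b => b.
rewrite -[quot_pi _ a]/(coker_pi a) -[quot_pi _ b]/(coker_pi b) !coker_resE => /coker_piP[e Ee].
have [u [v Euv]] := split_two e.
have [||m [mX mY]] := sheaf_glue2 (sub_joinl X Y) (sub_joinr X Y) (a := a - f X u) (b := b + f Y v).
- by move=> x; rewrite mem_join.
- rewrite raddfB raddfD /= -!omod_hom_res; move: Ee; rewrite Euv linearD /= => Ee.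
  by apply/subr0_eq; rewrite opprD addrACA -opprD Ee subrr.
exists (coker_pi m); rewrite !coker_resE mX mY; split; apply/coker_piP.
  by exists (- u); rewrite linearN /= addrC addKr.
by exists v; rewrite addrC addKr.
Qed.

Program Definition coker_omod : omod k :=
  @Omod k coker_sect coker_res _ _ _ coker_sheaf_axiom.
Next Obligation.
elim/quot_ind: m => m; elim/quot_ind: n => n.
rewrite -[quot_pi _ m]/(coker_pi m) -[quot_pi _ n]/(coker_pi n) -coker_piL !coker_resE.
by rewrite res_linear coker_piL.
Qed.
Next Obligation. by elim/quot_ind: m => m; rewrite -[quot_pi _ _]/(coker_pi m) coker_resE res_id. Qed.
Next Obligation.
by elim/quot_ind: m => m; rewrite -[quot_pi _ _]/(coker_pi m) !coker_resE (res_comp _ _ WU).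
Qed.

Lemma coker_quasi_coherent : quasi_coherent coker_omod.
Proof.
move=> U V VU t aU t0 tV.
have [_ e2] := qcoh_localizes E VU aU t0 tV; have [g1 g2] := qcoh_localizes G VU aU t0 tV.
have piZ (X : open k) (a : regfun X) (g : G X) : a *: (coker_pi g : coker_omod X) = coker_pi (a *: g).
  by have := coker_piL a g 0; rewrite !addr0.
split; elim/quot_ind=> g; rewrite -[quot_pi _ g]/(coker_pi g).
  rewrite [res _ _]coker_resE => /coker_pi0[e Ee]; have [n [e' Ee']] := e2 e.
  have [|l El] := g1 (t ^+ n *: g - f U e').
    by rewrite raddfB /= resZ -omod_hom_res Ee' linearZ /= Ee rmorphXn subrr.
  exists (l + n)%N; rewrite piZ; apply/coker_pi0; exists (t ^+ l *: e').
  by rewrite linearZ /= exprD -scalerA; apply/esym/subr0_eq; rewrite -scalerBr.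
have [n [m Em]] := g2 g; exists n, (coker_pi m).
by rewrite [res _ _]coker_resE Em piZ.
Qed.

Definition coker_qcoh : qcoh k := QcohOb coker_quasi_coherent.

End Cokernel.

(** * The torsion sheaf of an endomorphism *)

Section MatrixAction.
Variables (R : comNzRingType) (V : lmodType R) (d : nat).

Definition mx_act (B : 'M[R]_d) (v : 'I_d -> V) : 'I_d -> V := fun i => \sum_j B i j *: v j.

Lemma mx_actM B C v : mx_act B (mx_act C v) = mx_act (B *m C) v.
Proof.
apply: functional_extensionality_dep => i; rewrite /mx_act.
under eq_bigr do rewrite scaler_sumr.
rewrite exchange_big; apply: eq_bigr => l _; rewrite mxE scaler_suml.
by apply: eq_bigr => j _; rewrite scalerA.
Qed.

Lemma mx_act_scalar a v i : mx_act a%:M v i = a *: v i.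
Proof.
rewrite /mx_act (bigD1 i) //= mxE eqxx big1 ?addr0 // => j ji.
by rewrite mxE eq_sym (negPf ji) scale0r.
Qed.

Lemma mx_actL B a u v i : mx_act B (fun j => a *: u j + v j) i = a *: mx_act B u i + mx_act B v i.
Proof.
rewrite /mx_act scaler_sumr -big_split; apply: eq_bigr => j _.
by rewrite scalerDr !scalerA mulrC.
Qed.

Lemma mx_act_surj B a v : \det B * a = 1 -> mx_act B (mx_act (\adj B) (fun i => a *: v i)) = v.
Proof.
move=> Ba; apply: functional_extensionality_dep => i.
by rewrite mx_actM mul_mx_adj mx_act_scalar scalerA Ba scale1r.
Qed.

End MatrixAction.

Section TorsionSheaf.
Variable k : closedFieldType.
Local Notation K := (ratfun k).
Local Notation "x %:F" := (tofrac x) : ring_scope.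
Implicit Types (U V W X : open k) (M A B : qcoh k).
Local Arguments regular_at : simpl never.

Variables (c : k) (d : nat) (Z : 'I_d -> 'I_d -> k).
Let C := compl (Some c).

Lemma affine_compl : affine C.
Proof. by apply/affineP; exists (Some c); rewrite negbK inE. Qed.

(* The coordinate vanishing at infinity on the complement of [c]. *)
Definition inv_coord : K := lin None / lin (Some c).
Definition inv_coord_on X : regfun X := mkreg X inv_coord.

Lemma val_inv_coord X : sub_open X C -> val (inv_coord_on X) = inv_coord.
Proof.
move=> XC; apply: val_mkreg; apply: is_sect_ratio.
by apply/negP => /(sub_open_mem XC); rewrite /mem_open inE eqxx.
Qed.

Lemma res_inv_coord X V (VX : sub_open V X) : sub_open X C ->
  regfun_res VX (inv_coord_on X) = inv_coord_on V.
Proof. by move=> XC; apply: val_inj; rewrite val_regfun_res !val_inv_coord ?(sub_open_trans VX). Qed.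

(* The indices of [Z] are transposed: the classes [e j] of the standard basis satisfy
   [z e_j = \sum_i Z j i e_i] in the cokernel. *)
Definition char_mx X : 'M[regfun X]_d :=
  (inv_coord_on X)%:M - \matrix_(i, j) regfun_const X (Z j i).

Lemma char_mx_res X V (VX : sub_open V X) : sub_open X C ->
  map_mx (regfun_res VX) (char_mx X) = char_mx V.
Proof.
move=> XC; apply/matrixP => i j; rewrite !mxE rmorphB rmorphMn /= res_inv_coord //.
by rewrite regfun_res_const.
Qed.

Lemma inv_coord_notC (a : k) : inv_coord != (a%:P)%:F.
Proof.
rewrite /inv_coord eq_sym frac_eqE ?lform_neq0 // -tofracM tofrac_eq.
apply: contraTneq (oner_neq0 k) => /(congr1 (horner^~ c)).
by rewrite hornerM !hornerE subrr mulr0 => <-; rewrite eqxx.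
Qed.

(** The determinant is a characteristic polynomial evaluated at z; it splits into factors z - a, and
    z is not constant. *)
Lemma det_char_mx_neq0 : \det (inv_coord%:M - \matrix_(i, j) (Z j i)%:P%:F) != 0 :> K.
Proof.
pose kap := (@tofrac {poly k}) \o polyC.
pose ev : {rmorphism {poly k} -> K} := horner_eval inv_coord \o map_poly kap.
have -> : inv_coord%:M - \matrix_(i, j) (Z j i)%:P%:F = map_mx ev (char_poly_mx (\matrix_(i, j) Z j i)).
  apply/matrixP => i j; rewrite !mxE rmorphB rmorphMn /= /horner_eval map_polyX hornerX.
  by rewrite map_polyC hornerC.
rewrite det_map_mx -/(char_poly _).
have [r Er] := closed_field_poly_normal (char_poly (\matrix_(i, j) Z j i)).
rewrite Er (monicP (char_poly_monic _)) scale1r rmorph_prod.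
rewrite prodf_seq_neq0; apply/allP => a _ /=.
rewrite /horner_eval rmorphB /= map_polyX map_polyC hornerD hornerN hornerX hornerC subr_eq0.
exact: inv_coord_notC.
Qed.

(** The determinant is a nonzero rational function, invertible off finitely many points. As c is
    outside C, it can be kept in W, so that C and W cover the line. *)
Lemma char_mx_unit : exists W, mem_open (Some c) W /\
  forall X, sub_open X C -> sub_open X W -> exists a, \det (char_mx X) * a = 1.
Proof.
set D : K := \det (inv_coord%:M - \matrix_(i, j) (Z j i)%:P%:F).
have [R RP] := regular_at_cofinite D^-1.
exists (Open (R `\ Some c)%fset); split; first by rewrite /mem_open !inE eqxx.
move=> X XC XW; exists (mkreg X D^-1); apply: val_inj.
rewrite regfun_valM val_mkreg.
  have -> : val (\det (char_mx X)) = D.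
    rewrite -[LHS]/(GRing.RMorphism.clone _ _ val _ _) -det_map_mx.
    congr (\det _); apply/matrixP => i j; rewrite !mxE rmorphB rmorphMn /= val_inv_coord //.
  exact: mulfV det_char_mx_neq0.
move=> x xX; apply/twist_at0/RP.
have := sub_open_mem XW xX; have := sub_open_mem XC xX.
by rewrite /mem_open !inE => /negPf ->.
Qed.

(** The direct image from C of d copies of M; the cokernel of z - Z on it is the tensor product of M
    with the torsion sheaf. *)
Definition pwr M : qcoh k := QcohOb (@pi_quasi_coherent k 'I_d (fun _ => push_qcoh C M)).

Definition pwr_val M U (v : pwr M U) : 'I_d -> M (meet_open U C) := v.
Definition mk_pwr M U (v : 'I_d -> M (meet_open U C)) : pwr M U := v.

Lemma pwr_ext M U (u v : pwr M U) : (forall j, pwr_val u j = pwr_val v j) -> u = v.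
Proof. exact: pi_ext. Qed.

Lemma pwr_valL M U (a : regfun U) (u v : pwr M U) j :
  pwr_val (a *: u + v) j = regfun_res (meet_openl U C) a *: pwr_val u j + pwr_val v j.
Proof. by []. Qed.

Lemma pwr_res M U V (VU : sub_open V U) (v : pwr M U) j :
  pwr_val (res VU v) j = res (sub_meet2 C VU) (pwr_val v j).
Proof. by []. Qed.

Definition char_fun M U (v : pwr M U) : pwr M U := mk_pwr (mx_act (char_mx (meet_open U C)) (pwr_val v)).

Lemma char_funE M U (v : pwr M U) j :
  pwr_val (char_fun v) j = mx_act (char_mx (meet_open U C)) (pwr_val v) j.
Proof. by []. Qed.

Fact char_fun_linear M U : linear (@char_fun M U).
Proof.
move=> a u v; apply: pwr_ext => j; rewrite pwr_valL !char_funE -mx_actL.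
by congr (mx_act _ _ _).
Qed.

Lemma res_mx_act M U V (VU : sub_open V U) (B : 'M[regfun U]_d) (v : 'I_d -> M U) j :
  res VU (mx_act B v j) = mx_act (map_mx (regfun_res VU) B) (fun i => res VU (v i)) j.
Proof. by rewrite /mx_act raddf_sum; apply: eq_bigr => i _; rewrite /= resZ mxE. Qed.

Fact char_fun_res M U V (VU : sub_open V U) (v : pwr M U) : char_fun (res VU v) = res VU (char_fun v).
Proof.
apply: pwr_ext => j; rewrite pwr_res !char_funE res_mx_act char_mx_res ?meet_openr //.
Qed.

Definition char_hom M : omod_hom (pwr M) (pwr M) :=
  mk_omod_hom (@char_fun_linear M) (fun U V VU v => @char_fun_res M U V VU v).

Lemma pwr_surj M U (v : pwr M (meet_open U C)) : exists v' : pwr M U, res (meet_openl U C) v' = v.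
Proof.
have s : sub_open (meet_open U C) (meet_open (meet_open U C) C) := sub_open_meet (sub_openxx _) (meet_openr _ _).
exists (mk_pwr (fun j => res s (pwr_val v j))); apply: pwr_ext => j.
by rewrite pwr_res /= (res_comp _ _ (sub_openxx _)) res_id.
Qed.

Lemma pwr_inj M U (v : pwr M U) : res (meet_openl U C) v = 0 -> v = 0.
Proof.
have s : sub_open (meet_open U C) (meet_open (meet_open U C) C) := sub_open_meet (sub_openxx _) (meet_openr _ _).
move=> v0; apply: pwr_ext => j; have := congr1 (fun u => res s (pwr_val u j)) v0.
by rewrite pwr_res (res_comp _ _ (sub_openxx _)) res_id raddf0.
Qed.

Definition torsion_of M : qcoh k :=
  coker_qcoh (char_hom M) affine_compl (@pwr_surj M) (@pwr_inj M) (@pwr_inj M).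

Definition tcls M U (v : 'I_d -> M (meet_open U C)) : torsion_of M U := coker_pi (char_hom M) (mk_pwr v).

Lemma tcls_surj M U (q : torsion_of M U) : exists v, q = tcls v.
Proof. by elim/quot_ind: q => v; exists v. Qed.

Lemma tcls0 M U (v : 'I_d -> M (meet_open U C)) :
  tcls v = 0 <-> exists u, mx_act (char_mx (meet_open U C)) u = v.
Proof. exact: coker_pi0. Qed.

Lemma tclsL M U (a : regfun U) (u v : 'I_d -> M (meet_open U C)) :
  tcls (fun j => regfun_res (meet_openl U C) a *: u j + v j) = a *: tcls u + tcls v.
Proof. exact: (@coker_piL k (pwr M) (pwr M) (char_hom M) U a u v). Qed.

Lemma tcls_res M U V (VU : sub_open V U) (v : 'I_d -> M (meet_open U C)) :
  res VU (tcls v) = tcls (fun j => res (sub_meet2 C VU) (v j)).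
Proof. exact: (@coker_resE k (pwr M) (pwr M) (char_hom M) U V VU v). Qed.

Lemma tclsZ M U (a : regfun U) (v : 'I_d -> M (meet_open U C)) :
  a *: tcls v = tcls (fun j => regfun_res (meet_openl U C) a *: v j).
Proof.
have z : tcls (fun=> 0 : M (meet_open U C)) = 0.
  by apply/tcls0; exists (fun=> 0); apply: functional_extensionality_dep => i; rewrite /mx_act big1 // => j _; rewrite scaler0.
rewrite -[LHS]addr0 -z -tclsL; congr tcls; apply: functional_extensionality_dep => j.
by rewrite addr0.
Qed.

Definition dlt M U (j : 'I_d) (m : M (meet_open U C)) : 'I_d -> M (meet_open U C) :=
  fun i => if i == j then m else 0.

Lemma tcls_decomp M U (v : 'I_d -> M (meet_open U C)) : tcls v = \sum_j tcls (dlt j (v j)).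
Proof.
have D u w : tcls (fun j => u j + w j) = tcls u + tcls w :> torsion_of M U.
  rewrite -[tcls u]scale1r -tclsL; congr tcls; apply: functional_extensionality_dep => j.
  by rewrite rmorph1 scale1r.
have z : tcls (fun=> 0 : M (meet_open U C)) = 0.
  by have := tclsZ 0 (fun=> 0 : M (meet_open U C)); rewrite scale0r => ->; congr tcls; apply: functional_extensionality_dep => j; rewrite scaler0.
transitivity (tcls (fun i => \sum_j dlt j (v j) i)).
  congr tcls; apply: functional_extensionality_dep => i.
  by rewrite (bigD1 i) //= /dlt eqxx big1 ?addr0 // => j ji; rewrite eq_sym (negPf ji).
elim: (index_enum _) => [|j r IHr].
  by rewrite big_nil -z; congr tcls; apply: functional_extensionality_dep => i; rewrite big_nil.
rewrite big_cons -IHr -D; congr tcls; apply: functional_extensionality_dep => i.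
by rewrite big_cons.
Qed.

Lemma tcls_eq M U (u v : 'I_d -> M (meet_open U C)) :
  tcls u = tcls v <-> exists e, mx_act (char_mx (meet_open U C)) e = (fun j => u j - v j).
Proof. exact: (@coker_piP k (pwr M) (pwr M) (char_hom M) U u v). Qed.

Definition trep M U (q : torsion_of M U) : 'I_d -> M (meet_open U C) := projT1 (cid (tcls_surj q)).

Lemma trepK M U (q : torsion_of M U) : tcls (trep q) = q.
Proof. by rewrite /trep; case: cid => v /= ->. Qed.

Lemma trep_tcls M U (v : 'I_d -> M (meet_open U C)) :
  exists e, mx_act (char_mx (meet_open U C)) e = (fun j => trep (tcls v) j - v j).
Proof. by apply/tcls_eq; rewrite trepK. Qed.

(** Where the determinant is invertible, Cramer's rule makes z - Z surjective. *)
Lemma torsion_of_vanish W : (forall X, sub_open X C -> sub_open X W -> exists a, \det (char_mx X) * a = 1) ->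
  forall M U (q : torsion_of M U), sub_open U W -> q = 0.
Proof.
move=> detW M U q UW; rewrite -(trepK q); apply/tcls0.
have [a Ea] := detW _ (meet_openr U C) (sub_open_trans (meet_openl U C) UW).
by exists (mx_act (\adj (char_mx (meet_open U C))) (fun i => a *: trep q i)); apply: mx_act_surj.
Qed.

(** ** Tensor product with the torsion sheaf *)

Definition tmap_fun A B (f : omod_hom A B) U (q : torsion_of A U) : torsion_of B U :=
  tcls (fun j => f _ (trep q j)).

Lemma hom_mx_act A B (f : omod_hom A B) U (D : 'M[regfun U]_d) (v : 'I_d -> A U) j :
  f U (mx_act D v j) = mx_act D (fun i => f U (v i)) j.
Proof. by rewrite /mx_act linear_sum; apply: eq_bigr => i _; rewrite /= linearZ. Qed.

Lemma tmapE A B (f : omod_hom A B) U (v : 'I_d -> A (meet_open U C)) :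
  tmap_fun f (tcls v) = tcls (fun j => f _ (v j)).
Proof.
have [e Ee] := trep_tcls v; apply/tcls_eq; exists (fun j => f _ (e j)).
by apply: functional_extensionality_dep => j; rewrite -hom_mx_act Ee linearB.
Qed.

Fact tmap_linear A B (f : omod_hom A B) U : linear (@tmap_fun A B f U).
Proof.
move=> a p q; rewrite -(trepK p) -(trepK q) -tclsL !tmapE -tclsL; congr tcls.
by apply: functional_extensionality_dep => j; rewrite linearP.
Qed.

Fact tmap_res A B (f : omod_hom A B) U V (VU : sub_open V U) (q : torsion_of A U) :
  tmap_fun f (res VU q) = res VU (tmap_fun f q).
Proof.
rewrite -(trepK q) tcls_res !tmapE tcls_res; congr tcls.
by apply: functional_extensionality_dep => j; rewrite omod_hom_res.
Qed.

Definition tmap A B (f : omod_hom A B) : omod_hom (torsion_of A) (torsion_of B) :=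
  mk_omod_hom (@tmap_linear A B f) (fun U V VU q => @tmap_res A B f U V VU q).

Program Definition torsion_tens : functor (Qcoh k) (Qcoh k) :=
  @Functor k (Qcoh k) (Qcoh k) torsion_of tmap _ _ _.
Next Obligation.
move=> a f g; apply: omod_hom_ext => U q; rewrite -(trepK q) omod_homD omod_homZ.
rewrite [LHS]tmapE [X in _ = _ *: X + _]tmapE [X in _ = _ + X]tmapE -tclsL; congr tcls.
by apply: functional_extensionality_dep => j; rewrite omod_homD omod_homZ regfun_res_const.
Qed.
Next Obligation. by apply: omod_hom_ext => U q; rewrite -(trepK q) [LHS]tmapE. Qed.
Next Obligation. by apply: omod_hom_ext => U q; rewrite -(trepK q) [LHS]tmapE /= !tmapE. Qed.

Local Notation O := (twist_qcoh k 0).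
Definition torsion_sheaf : qcoh k := torsion_of O.

Definition coef X (w : O X) : regfun X := mkreg X (twist_val w).

Lemma val_coef X (w : O X) : val (coef w) = twist_val w.
Proof. exact: val_mkreg (twist_sectP w). Qed.

Lemma coefL X (a : regfun X) (u v : O X) : coef (a *: u + v) = a * coef u + coef v.
Proof. by apply: val_inj; rewrite regfun_valL !val_coef twist_valL. Qed.

Lemma coef_res X V (VX : sub_open V X) (w : O X) : coef (res VX w) = regfun_res VX (coef w).
Proof. by apply: val_inj; rewrite val_regfun_res !val_coef twist_val_res. Qed.

Definition tbil_fun M U (m : M U) (q : torsion_sheaf U) : torsion_of M U :=
  tcls (fun j => coef (trep q j) *: res (meet_openl U C) m).

Lemma coefB X (u v : O X) : coef (u - v) = coef u - coef v.
Proof. by rewrite addrC -scaleN1r coefL mulN1r addrC. Qed.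

Lemma tbilE M U (m : M U) (w : 'I_d -> O (meet_open U C)) :
  tbil_fun m (tcls w) = tcls (fun j => coef (w j) *: res (meet_openl U C) m).
Proof.
have [e Ee] := trep_tcls w; apply/tcls_eq; exists (fun j => coef (e j) *: res (meet_openl U C) m).
apply: functional_extensionality_dep => j; rewrite -scalerBl -coefB.
have -> : trep (tcls w) j - w j = mx_act (char_mx (meet_open U C)) e j by rewrite Ee.
rewrite /mx_act; elim: (index_enum _) => [|i r IHr].
  rewrite !big_nil (_ : coef 0 = 0) ?scale0r //.
  by apply: val_inj; rewrite val_coef.
by rewrite !big_cons coefL scalerDl IHr scalerA.
Qed.

Fact tbil_res M U V (VU : sub_open V U) (m : M U) (n : torsion_sheaf U) :
  tbil_fun (res VU m) (res VU n) = res VU (tbil_fun m n).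
Proof.
rewrite -(trepK n) tcls_res !tbilE tcls_res; congr tcls.
apply: functional_extensionality_dep => j.
by rewrite resZ coef_res; congr (_ *: _); apply: res_res.
Qed.

Program Definition tbil M : bilinear_map M torsion_sheaf (torsion_of M) :=
  @BilinearMap k M torsion_sheaf (torsion_of M) (@tbil_fun M) _ _ _.
Next Obligation.
move=> a m m'; rewrite -(trepK n) !tbilE -tclsL; congr tcls.
apply: functional_extensionality_dep => j.
by rewrite raddfD /= resZ scalerDr !scalerA mulrC.
Qed.
Next Obligation.
move=> a p q; rewrite -(trepK p) -(trepK q) -tclsL !tbilE -tclsL; congr tcls.
by apply: functional_extensionality_dep => j; rewrite scalerA -scalerDl coefL.
Qed.
Next Obligation. exact: tbil_res. Qed.

Definition tgen U (j : 'I_d) : torsion_sheaf U := tcls (dlt j (mktw 0 _ 1 : O (meet_open U C))).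

Lemma val_mktw1 X : twist_val (mktw 0 X 1 : O X) = 1 :> K.
Proof. exact/val_mktw/one_sect0. Qed.

Lemma mktw1_res X V (VX : sub_open V X) : res VX (mktw 0 X 1 : O X) = mktw 0 V 1.
Proof. exact/res_mktw/one_sect0. Qed.

Lemma coef_one X : coef (mktw 0 X 1 : O X) = 1.
Proof. by apply: val_inj; rewrite val_coef val_mktw1. Qed.

Lemma coefK X (w : O X) : w = coef w *: (mktw 0 X 1 : O X).
Proof. by apply: twist_ext; rewrite twist_valZ val_coef val_mktw1 mulr1. Qed.

Lemma tgen_res U V (VU : sub_open V U) j : res VU (tgen U j) = tgen V j.
Proof.
rewrite tcls_res; congr tcls; apply: functional_extensionality_dep => i.
by rewrite /dlt; case: eqP => _; rewrite ?raddf0 ?mktw1_res.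
Qed.

Lemma bil_suml (M N P : omod k) (b : bilinear_map M N P) U (J : Type) (r : seq J) a m n :
  b U (\sum_(i <- r) a i *: m i) n = \sum_(i <- r) a i *: b U (m i) n.
Proof.
elim: r => [|i r IHr]; last by rewrite !big_cons bil_linearl IHr.
by rewrite !big_nil -[X in b U X n](scale0r 0) bilZ scale0r.
Qed.

Lemma bil_sumr (M N P : omod k) (b : bilinear_map M N P) U (J : Type) (r : seq J) a m n :
  b U m (\sum_(i <- r) a i *: n i) = \sum_(i <- r) a i *: b U m (n i).
Proof.
elim: r => [|i r IHr]; last by rewrite !big_cons bil_linearr IHr.
by rewrite !big_nil -[X in b U m X](scale0r 0) bilZr scale0r.
Qed.

Lemma tgen_rel U i : sub_open U C -> \sum_j char_mx U j i *: tgen U j = 0.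
Proof.
move=> UC; transitivity (tcls (mx_act (char_mx (meet_open U C)) (dlt i (mktw 0 _ 1 : O (meet_open U C))))).
  rewrite tcls_decomp; apply: eq_bigr => j _; rewrite tclsZ; congr tcls.
  apply: functional_extensionality_dep => l; rewrite /dlt; case: eqP => [_|_]; last by rewrite scaler0.
  rewrite /mx_act (bigD1 i) //= eqxx big1 ?addr0 => [|l' /negPf ->]; last by rewrite scaler0.
  by rewrite -(char_mx_res (meet_openl U C) UC) [X in _ = X *: _]mxE.
by apply/tcls0; exists (dlt i (mktw 0 _ 1 : O (meet_open U C))).
Qed.

Lemma rest_mx_act M U (u : 'I_d -> M (meet_open U C)) j : sub_open U C ->
  rest U (mx_act (char_mx (meet_open U C)) u j) = mx_act (char_mx U) (fun i => rest U (u i)) j.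
Proof.
move=> UC; have s := sub_open_meet (sub_openxx U) UC.
rewrite (restE s) res_mx_act char_mx_res ?meet_openr //.
by congr (mx_act _ _ _); apply: functional_extensionality_dep => i; rewrite (restE s).
Qed.

Lemma restL M U (a : regfun U) (u v : M (meet_open U C)) : sub_open U C ->
  rest U (regfun_res (meet_openl U C) a *: u + v) = a *: rest U u + rest U v.
Proof.
move=> UC; rewrite !(restE (sub_open_meet (sub_openxx U) UC)) raddfD /= resZ.
by congr (_ *: _ + _); apply: val_inj.
Qed.

Section Universal.
Variables (M : qcoh k) (P : omod k) (b : bilinear_map M torsion_sheaf P).

Definition univ_fun U (q : torsion_of M U) : P U := \sum_j b U (rest U (trep q j)) (tgen U j).

(** Changing the representative by z - Z applied to e adds, once the matrix has moved to the second
    argument of b, the relations [tgen_rel] between the generators, which vanish. *)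
Lemma univ_funE U v : sub_open U C -> univ_fun (tcls v) = \sum_j b U (rest U (v j)) (tgen U j).
Proof.
move=> UC; have [e Ee] := trep_tcls v; apply/subr0_eq; rewrite -sumrB.
transitivity (\sum_j b U (mx_act (char_mx U) (fun i => rest U (e i)) j) (tgen U j)).
  apply: eq_bigr => j _; rewrite -rest_mx_act // Ee.
  have := bil_linearl b (tgen U j) (-1) (rest U (v j)) (rest U (trep (tcls v) j)).
  rewrite !scaleN1r addrC => <-; congr (b U _ _).
  by rewrite addrC !(restE (sub_open_meet (sub_openxx U) UC)) raddfB.
transitivity (\sum_i b U (rest U (e i)) (\sum_j char_mx U j i *: tgen U j)).
  under eq_bigr do rewrite /mx_act bil_suml.
  by rewrite exchange_big; apply: eq_bigr => i _; rewrite bil_sumr.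
rewrite big1 // => i _; rewrite tgen_rel //.
by have := bilZr b 0 (rest U (e i)) (0 : torsion_sheaf U); rewrite scaler0 scale0r.
Qed.

Lemma tcls_gen U (v : 'I_d -> M (meet_open U C)) : sub_open U C ->
  tcls v = \sum_j tbil M U (rest U (v j)) (tgen U j).
Proof.
move=> UC; rewrite tcls_decomp; apply: eq_bigr => j _.
rewrite [RHS]tbilE; congr tcls; apply: functional_extensionality_dep => i.
have -> : res (meet_openl U C) (rest U (v j)) = v j.
  by rewrite (restE (sub_open_meet (sub_openxx U) UC)) (res_comp _ _ (sub_openxx _)) res_id.
rewrite /dlt; case: eqP => _; first by rewrite coef_one scale1r.
by rewrite (_ : coef 0 = 0) ?scale0r //; apply: val_inj; rewrite val_coef.
Qed.

Lemma tcls_coef U (w : 'I_d -> O (meet_open U C)) : sub_open U C ->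
  tcls w = \sum_j coef (rest U (w j)) *: tgen U j.
Proof.
move=> UC; rewrite tcls_decomp; apply: eq_bigr => j _; rewrite tclsZ; congr tcls.
apply: functional_extensionality_dep => i; rewrite /dlt; case: eqP => _; last by rewrite scaler0.
rewrite -coef_res [LHS]coefK; congr (coef _ *: _).
by rewrite (restE (sub_open_meet (sub_openxx U) UC)) (res_comp _ _ (sub_openxx _)) res_id.
Qed.

(** Over opens in C the map is forced by its values on the generators [tgen]; over opens in W both
    the torsion sheaf and [torsion_of M] vanish, and the map is 0. *)
Lemma torsion_univ : exists! h : omod_hom (torsion_of M) P,
  forall U (m : M U) (n : torsion_sheaf U), h U (tbil M U m n) = b U m n.
Proof.
have [W [cW detW]] := char_mx_unit; have vanW := torsion_of_vanish detW.
have cov x : mem_open x C || mem_open x W.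
  by have [->|xc] := eqVneq x (Some c); rewrite ?cW ?orbT // /mem_open inE xc.
have lin_f U : sub_open U C -> linear (@univ_fun U).
  move=> UC a p q; rewrite -(trepK p) -(trepK q) -tclsL !univ_funE //.
  rewrite scaler_sumr -big_split; apply: eq_bigr => j _ /=.
  by rewrite -bil_linearl restL.
have b0 U m : b U m 0 = 0.
  by have := bilZr b 0 m (0 : torsion_sheaf U); rewrite scaler0 scale0r.
have [|U UW a p q|U V VU UC q|U V VU UW q|U q UC UW|h [h0 h1]] :=
  @omod_hom_glue2 k (torsion_of M) P C W univ_fun (fun U _ => 0) cov.
- exact: lin_f.
- by rewrite scaler0 addr0.
- rewrite -(trepK q) tcls_res !univ_funE ?(sub_open_trans VU) // raddf_sum; apply: eq_bigr => j _ /=.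
  rewrite -bil_res tgen_res; congr (b V _ _).
  rewrite (restE (sub_open_meet (sub_openxx U) UC)).
  rewrite (restE (sub_open_meet (sub_openxx V) (sub_open_trans VU UC))); exact: res_res.
- by rewrite raddf0.
- rewrite (vanW _ _ q UW); have := lin_f U UC (-1) 0 0.
  by rewrite scaler0 addr0 scaleN1r addNr.
have hb U (m : M U) n : h U (tbil M U m n) = b U m n.
  apply: (sheaf_separated2 (VU := meet_openl U C) (WU := meet_openl U W)).
  - by move=> x xU; rewrite !mem_meet xU; apply: cov.
  - rewrite -omod_hom_res -!bil_res h0 ?meet_openr //; move: (res _ m) (res _ n) => {}m {}n.
    have UC := meet_openr U C; move: (meet_open U C) UC m n => {}U UC m n.
    rewrite -(trepK n) [tbil _ _ _ _]tbilE univ_funE // tcls_coef // bil_sumr.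
    apply: eq_bigr => j _; rewrite -bilZ; congr (b U _ _).
    rewrite (restE (sub_open_meet (sub_openxx U) UC)) resZ (res_comp _ _ (sub_openxx U)) res_id.
    by rewrite (restE (sub_open_meet (sub_openxx U) UC)) coef_res.
  - rewrite -omod_hom_res -!bil_res h1 ?meet_openr //.
    by rewrite (vanW _ _ (res _ n)) ?meet_openr.
exists h; split=> // h' h'b; apply: (omod_hom_eq2 cov) => U s Us; last first.
  by rewrite (vanW _ _ s Us) !raddf0.
rewrite -(trepK s) tcls_gen // !linear_sum; apply: eq_bigr => j _ /=.
by rewrite hb h'b.
Qed.

End Universal.

Definition torsion_tensor : tensor_functor torsion_sheaf.
Proof.
refine (@TensorFunctor k torsion_sheaf torsion_tens tbil _ torsion_univ).
move=> A B f U m n; rewrite -(trepK n) [LHS](_ : _ = tmap_fun f (tbil_fun m (tcls (trep n)))) //.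
rewrite [RHS](_ : _ = tbil_fun (f U m) (tcls (trep n))) // !tbilE tmapE; congr tcls.
by apply: functional_extensionality_dep => j; rewrite linearZ /= omod_hom_res.
Defined.

Lemma mx_act_char M X (v : 'I_d -> M X) j :
  mx_act (char_mx X) v j = inv_coord_on X *: v j - \sum_i regfun_const X (Z i j) *: v i.
Proof.
rewrite -(mx_act_scalar (inv_coord_on X) v j) /mx_act -sumrB; apply: eq_bigr => i _.
by rewrite !mxE scalerBl.
Qed.

Lemma tcls_span U (m : 'I_d -> O U) :
  tcls (fun j => res (meet_openl U C) (m j)) = \sum_j coef (m j) *: tgen U j.
Proof.
rewrite tcls_decomp; apply: eq_bigr => j _; rewrite tclsZ; congr tcls.
apply: functional_extensionality_dep => i; rewrite /dlt; case: eqP => _; last by rewrite scaler0.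
by rewrite [LHS]coefK coef_res.
Qed.

(** U is covered by its parts in C and in W, cut out by f and g. The sheaf vanishes on the second
    part, so powers of g kill every section; on the first, representatives extend after
    multiplication by a power of f. Finite generation and torsion both follow. *)
Lemma torsion_sheaf_local U : affine U -> exists f g : regfun U,
  [/\ g != 0, comaximal f g, forall q : torsion_sheaf U, exists n, g ^+ n *: q = 0 &
    forall q : torsion_sheaf U, exists n (m : 'I_d -> O U), f ^+ n *: q = \sum_j coef (m j) *: tgen U j].
Proof.
move=> aU; have [W [cW detW]] := char_mx_unit; have vanW := torsion_of_vanish detW.
have cov x : mem_open x U -> mem_open x (meet_open U C) || mem_open x (meet_open U W).
  rewrite !mem_meet => ->; have [->|xc] := eqVneq x (Some c); rewrite ?cW ?orbT //=.
  by rewrite /C /mem_open inE xc.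
have [f [g [f0 g0 fV gW cfg]]] := two_locus aU (meet_openl U C) (meet_openl U W) cov.
exists f, g; split=> // q.
  have [ker _] := qcoh_localizes torsion_sheaf (meet_openl U W) aU g0 gW.
  by apply: ker; apply: vanW; apply: meet_openr.
have [_ ext] := qcoh_localizes O (meet_openl U C) aU f0 fV.
have [n nP] := dep_choice (fun j => ext (trep q j)); have [m mP] := dep_choice nP.
exists (\max_i n i)%N, (fun j => f ^+ (\max_i n i - n j)%N *: m j).
rewrite -tcls_span -{1}(trepK q) tclsZ; congr tcls; apply: functional_extensionality_dep => j.
by rewrite resZ mP scalerA !rmorphXn -exprD subnK ?leq_bigmax.
Qed.

Lemma torsion_sheaf_coherent : coherent torsion_sheaf.
Proof.
move=> U aU; have [f [g [g0 cfg gq fq]]] := torsion_sheaf_local aU.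
exists d, (fun j => tgen U j) => q.
have [n En] := gq q; have [l [m Em]] := fq q; have [u [v uv]] := comaximalX l n cfg.
exists (fun j => u * coef (m j)); rewrite -[LHS]scale1r -uv scalerDl -!scalerA En scaler0 addr0 Em.
by rewrite scaler_sumr; apply: eq_bigr => j _; rewrite scalerA.
Qed.

Lemma torsion_sheaf_torsion : torsion torsion_sheaf.
Proof.
move=> U aU q; have [f [g [g0 cfg gq fq]]] := torsion_sheaf_local aU.
have [n En] := gq q; exists (g ^+ n); split; last exact: En.
apply: contraNneq (expf_neq0 n (regfun_neq0 g0)) => /(congr1 val) E.
apply/eqP; rewrite -rmorphXn; exact: E.
Qed.

(** ** Global sections *)

Fact finite_supp (E : 'I_d -> lmodType k) (s : pi_mod E) : s \in @fin_supp k _ E.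
Proof. by apply/asboolP; exists (enum 'I_d) => i; rewrite mem_enum. Qed.

Definition mk_dsum (E : 'I_d -> lmodType k) (s : pi_mod E) : direct_sum E := DirectSum (finite_supp s).

Local Notation sectC := (functor_power d (sections C)).
Local Notation H0T := (functor_comp (H0 k) torsion_tens).

(** The projection exhibiting H^0(M tensor T) as the cokernel of z - Z on M(C)^d. *)
Definition glob_fun M (s : fval sectC M) : kspace (torsion_of M (whole k)) :=
  tcls (fun j => res (meet_openr (whole k) C) ((s : direct_sum _) j : M C)).

Fact glob_linear M : linear (@glob_fun M).
Proof.
move=> a s t.
have E : tcls (fun j => res (meet_openr (whole k) C) (regfun_const C a *: ((s : direct_sum _) j : M C) + ((t : direct_sum _) j : M C))) =
  regfun_const (whole k) a *: tcls (fun j => res (meet_openr (whole k) C) ((s : direct_sum _) j : M C)) +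
  tcls (fun j => res (meet_openr (whole k) C) ((t : direct_sum _) j : M C)).
  rewrite -tclsL; congr tcls; apply: functional_extensionality_dep => j.
  by rewrite raddfD /= resZ !regfun_res_const.
exact: E.
Qed.

Definition glob M : linmap (fval sectC M) (fval H0T M) := mk_linmap (@glob_linear M).

Lemma glob_natural : @natural k sectC H0T glob.
Proof.
move=> A B f s.
have E : tcls (fun j => res (meet_openr (whole k) C) (f C ((s : direct_sum _) j : A C))) =
    tmap_fun f (tcls (fun j => res (meet_openr (whole k) C) ((s : direct_sum _) j : A C))).
  by rewrite tmapE; congr tcls; apply: functional_extensionality_dep => j; rewrite omod_hom_res.
exact: E.
Qed.

Lemma sub_whole_meet : sub_open C (meet_open (whole k) C).
Proof. by rewrite sub_open_meet ?sub_whole ?sub_openxx. Qed.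

Lemma glob_surj M g : exists s, glob M s = g.
Proof.
exists (mk_dsum (E := fun=> kspace (M C)) (fun j => res sub_whole_meet (trep (g : torsion_of M (whole k)) j))).
rewrite -[RHS](trepK (g : torsion_of M (whole k))).
rewrite [LHS](_ : _ = tcls (fun j => res (meet_openr (whole k) C) (res sub_whole_meet (trep (g : torsion_of M (whole k)) j)))) //.
congr tcls; apply: functional_extensionality_dep => j.
by rewrite (res_comp _ _ (sub_openxx _)) res_id.
Qed.

Definition char_sections_fun M (s : fval sectC M) : fval sectC M :=
  mk_dsum (E := fun=> kspace (M C)) (mx_act (char_mx C) (fun j => (s : direct_sum _) j : M C)).

Fact char_sections_linear M : linear (@char_sections_fun M).
Proof.
move=> a s t; apply: dsum_ext => j.
exact: (mx_actL (char_mx C) (regfun_const C a) (fun j => (s : direct_sum _) j : M C)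
  (fun j => (t : direct_sum _) j : M C) j).
Qed.

Definition char_sections M : linmap (fval sectC M) (fval sectC M) := mk_linmap (@char_sections_linear M).

Lemma char_sections_natural : @natural k sectC sectC char_sections.
Proof.
by move=> A B f s; apply: dsum_ext => j; exact: esym (hom_mx_act f (char_mx C) (fun j => (s : direct_sum _) j : A C) j).
Qed.

Lemma glob_ker M s : glob M s = 0 <-> exists r, char_sections M r = s.
Proof.
split=> [/tcls0[u Eu]|[r <-]].
  exists (mk_dsum (E := fun=> kspace (M C)) (fun j => res sub_whole_meet (u j))).
  apply: dsum_ext => j.
  rewrite [LHS](_ : _ = mx_act (char_mx C) (fun j => res sub_whole_meet (u j)) j) //.
  rewrite -(char_mx_res sub_whole_meet) ?meet_openr // -res_mx_act Eu.
  by rewrite (res_comp _ _ (sub_openxx _)) res_id.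
apply/tcls0; exists (fun j => res (meet_openr (whole k) C) ((r : direct_sum _) j : M C)).
apply: functional_extensionality_dep => j.
by rewrite -(char_mx_res (meet_openr (whole k) C)) ?sub_openxx // -res_mx_act.
Qed.

Lemma good_torsion : good H0T.
Proof.
have gC : good sectC by apply: good_dsum => _; apply: good_sections affine_compl.
exact: (good_coker char_sections_natural glob_natural glob_surj glob_ker gC gC).
Qed.

End TorsionSheaf.

(** * The cohomology of the twisting sheaves *)

Section TwistCohomology.
Variable k : closedFieldType.
Local Notation K := (ratfun k).
Local Notation "x %:F" := (tofrac x) : ring_scope.
Local Notation X := ('X%:F : K).
Local Notation chart0 := (chart0 k).
Local Notation chart1 := (chart1 k).
Local Notation torus := (torus k).
Implicit Types (U V W : open k) (M : qcoh k) (m n : int) (f g t : K).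
Local Arguments regular_at : simpl never.

Variable i : int.
Local Notation Hi := (functor_comp (cech_cohomology k) (tw_tensor k i)).

Lemma is_sect_finite n f : (forall a, regular_at (Some a) f) -> is_sect n chart0 f.
Proof. by move=> rf [a _|]; [exact: rf|rewrite /mem_open !inE]. Qed.

Lemma chart0_finite n f : is_sect n chart0 f -> forall a, regular_at (Some a) f.
Proof. by move=> sf a; have := sf (Some a); rewrite /mem_open !inE; apply. Qed.

Lemma chart1_infty n f : is_sect n chart1 f -> regular_at None (X ^ (- n) * f).
Proof. by move=> sf; have := sf None; rewrite /mem_open !inE; apply. Qed.

Lemma is_sect_chart1 n f : (forall a, a != 0 -> regular_at (Some a) f) ->
  regular_at None (X ^ (- n) * f) -> is_sect n chart1 f.
Proof.
move=> rf ri [a|]; rewrite /mem_open !inE //= => a0; apply: rf.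
by apply: contraNneq a0 => ->.
Qed.

Lemma htw_zero m t : is_sect m torus t ->
  htw_pi i (twist_qcoh k m) (mktw m torus t) = 0 <->
  exists f g, [/\ is_sect m chart0 f, is_sect m chart1 g & t = f + X ^ i * g].
Proof.
move=> st; split=> [/htw_pi_ker[[a b] E]|[f [g [sf sg Et]]]].
  exists (twist_val (a : twist k m chart0)), (twist_val (b : twist k m chart1)).
  split; try exact: twist_sectP.
  have := congr1 (fun s : twist k m torus => twist_val s : K) E.
  rewrite (val_mktw st) => <-.
  rewrite [LHS](_ : _ = twist_val (res (torus_chart0 k) (a : twist k m chart0) +
    xpow i torus *: res (torus_chart1 k) (b : twist k m chart1))) //.
  by rewrite twist_valD twist_valZ !twist_val_res val_xpow ?sub_openxx.
apply/htw_pi_ker; exists (mktw m chart0 f, mktw m chart1 g).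
have E : res (torus_chart0 k) (mktw m chart0 f) + xpow i torus *: res (torus_chart1 k) (mktw m chart1 g) = mktw m torus t.
  apply: twist_ext; rewrite (val_mktw st) Et twist_valD twist_valZ !twist_val_res.
  by rewrite (val_mktw sf) (val_mktw sg) val_xpow ?sub_openxx.
exact: E.
Qed.

Lemma htw_mul m n g t : is_sect (n - m) (whole k) g -> is_sect m torus t ->
  fapp Hi (mul_hom m n g) (htw_pi i (twist_qcoh k m) (mktw m torus t)) =
  htw_pi i (twist_qcoh k n) (mktw n torus (g * t)).
Proof.
move=> sg st; rewrite -htw_pi_natural; congr (htw_pi _ _ _); apply: twist_ext.
rewrite fapp_sections mul_homE // (val_mktw st) val_mktw //.
by have -> : n = n - m + m; [rewrite subrK|apply: is_sectM st; exact: is_sect_sub (sub_whole _) sg].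
Qed.

Lemma htw_elem m (g : fval Hi (twist_qcoh k m)) : exists t, is_sect m torus t /\
  g = htw_pi i (twist_qcoh k m) (mktw m torus t).
Proof.
have [s <-] := htw_pi_surj g; exists (twist_val (s : twist k m torus)).
by split; [exact: twist_sectP|rewrite mktwK].
Qed.

(** On the torus only powers of ['X] occur in denominators. The padding by ['X^l] keeps the exponent
    at least l, so that coefficients near ['X ^ -1] can be separated without case distinctions. *)
Lemma torus_laurent m t : is_sect m torus t -> exists (p : {poly k}) N, forall l, t = (p * 'X^l)%:F / X ^+ (N + l).
Proof.
move=> st; have [N NP] := regular_at_pole (Some 0) t.
have [p Ep] : exists p, t * X ^+ N = p%:F.
  apply: regular_at_finite_poly => a; have [->|a0] := eqVneq a 0.
    by have := NP N (leqnn N); rewrite (_ : uni (Some 0) = X) // /uni /gen1 /lin /= polyC0 subr0 divr1.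
  apply: regular_atM; last by apply: regular_atX; apply: regular_at_poly.
  have := st (Some a); apply; rewrite mem_meet /mem_open !inE /=.
  by apply: contraNneq a0 => -[->].
have X0 := X_neq0 k; have XN N' := expf_neq0 N' X0.
exists p, N => l; apply: (canRL (mulfK (XN (N + l)%N))).
by rewrite exprD mulrA Ep tofracM tofracXn.
Qed.

Lemma X_regular (a : k) (l : int) : a != 0 -> regular_at (Some a) (X ^ l).
Proof.
move=> a0; have := @twist_at_linXz k (Some a) (Some 0) l.
by rewrite /lin /= polyC0 subr0; apply; apply: contraNneq a0 => -[->].
Qed.

Lemma pole_combine (F : fieldType) (x p : F) (a b : int) (n l r : nat) : x != 0 ->
  a + b - n%:Z = - l%:Z - r%:Z -> x ^ a * (x ^ b * (p / x ^+ n)) = 1 / x ^+ l * (p / x ^+ r).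
Proof.
move=> x0 E; have {}E : x ^ a * x ^ b * x ^- n = x ^- l * x ^- r.
  by rewrite !exprnN -!expfzDr // E.
by rewrite mul1r [RHS]mulrCA -E; ring.
Qed.

(** The monomials of p / X^N have exponents at most - e, which is what regularity at infinity
    requires when m + i >= - e. *)
Lemma polar_sect m (p : {poly k}) N e : - e%:Z <= m + i -> (e <= N)%N ->
  (size p <= (N - e).+1)%N -> is_sect m chart1 (X ^ (- i) * (p%:F / X ^+ N)).
Proof.
move=> em eN sp; have X0 := X_neq0 k; apply: is_sect_chart1 => [a a0|].
  apply: regular_atM; first exact: X_regular.
  apply: regular_atM; first exact: regular_at_poly.
  rewrite exprnN; exact: X_regular.
have -> : X ^ (- m) * (X ^ (- i) * (p%:F / X ^+ N)) =
    (1%:F / X ^+ `|(m + i + e%:Z)%R|%N) * (p%:F / X ^+ (N - e)).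
  rewrite tofrac1; apply: pole_combine X0 _; lia.
apply: regular_atM; last exact/regular_at_inftyP.
by apply/regular_at_inftyP; rewrite size_poly1.
Qed.

Lemma poly_cut N (p : {poly k}) :
  p%:F / X ^+ N = (drop_poly N p)%:F + (take_poly N p)%:F / X ^+ N.
Proof.
have XN N' := expf_neq0 N' (X_neq0 k).
by rewrite -{1}(poly_take_drop N p) tofracD tofracM tofracXn mulrDl (mulfK (XN N)) addrC.
Qed.

Lemma XzK t : t = X ^ i * (X ^ (- i) * t).
Proof. by rewrite mulrA -expfzDr ?subrr ?mul1r //; exact: X_neq0. Qed.

(** H^1(O(m + i)) = 0 for m + i >= -1: monomials of exponent at least 0 come from one chart, and all
    those of exponent at most -1 from the other. *)
Lemma htw_high m (g : fval Hi (twist_qcoh k m)) : -1 <= m + i -> g = 0.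
Proof.
move=> mi; have [t [st ->]] := htw_elem g; apply/(htw_zero st).
have [p [N /(_ 1%N)]] := torus_laurent st; rewrite poly_cut addn1; move: (p * 'X^1) => {}p Et.
exists (drop_poly N.+1 p)%:F, (X ^ (- i) * ((take_poly N.+1 p)%:F / X ^+ N.+1)); split.
- by apply: is_sect_finite => a; apply: regular_at_poly.
- by apply: (@polar_sect m _ _ 1) => //; rewrite subn1 size_take_poly.
by rewrite -XzK.
Qed.

Lemma Xinv_sect m : is_sect m torus X^-1.
Proof.
have sX : is_sect 0 torus X^-1 by have := @Xz_sect k (-1) torus (sub_openxx _).
case=> [a|] xU; first exact: (sX (Some a) xU).
by move: xU; rewrite mem_meet /mem_open !inE.
Qed.

Lemma htw_mid m (g : fval Hi (twist_qcoh k m)) : m = - i - 2 ->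
  exists a : k, g = a *: htw_pi i (twist_qcoh k m) (mktw m torus X^-1).
Proof.
move=> mi; have [t [st ->]] := htw_elem g.
have [p [N /(_ 2%N)]] := torus_laurent st; rewrite addn2; move: (p * 'X^2) => {}p Et.
(* The padding makes the denominator ['X ^+ N.+2], so this is the coefficient of ['X ^ -1], the only
   monomial coming from neither chart when m + i = -2. *)
pose a := p`_N.+1; exists a.
have sa : is_sect m torus ((a%:P)%:F * X^-1) by apply: is_sectCM; apply: Xinv_sect.
have su : is_sect m torus (t - (a%:P)%:F * X^-1).
  by move=> x xU; apply: twist_atD; [exact: st|apply: twist_atN; exact: sa].
have E : (mktw m torus t : kspace (twist_qcoh k m torus)) =
    a *: (mktw m torus X^-1 : kspace (twist_qcoh k m torus)) + mktw m torus (t - (a%:P)%:F * X^-1).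
  have E' : mktw m torus t = regfun_const torus a *: mktw m torus X^-1 + mktw m torus (t - (a%:P)%:F * X^-1).
    apply: twist_ext; rewrite twist_valL (val_mktw st) (val_mktw su) (val_mktw (Xinv_sect m)).
    by rewrite addrC subrK.
  exact: E'.
rewrite E linearP -[RHS]addr0; congr (_ + _); apply/(htw_zero su).
exists (drop_poly N.+2 p)%:F, (X ^ (- i) * ((take_poly N.+1 p)%:F / X ^+ N.+2)); split.
- by apply: is_sect_finite => b; apply: regular_at_poly.
- by apply: (@polar_sect m _ _ 2) => //; [rewrite mi; lia|rewrite subSS subn1 size_take_poly].
rewrite -XzK Et poly_cut -addrA; congr (_ + _).
have -> : take_poly N.+2 p = take_poly N.+1 p + a *: 'X^(N.+1).
  apply/polyP => l; rewrite coefD coefZ coefXn !coef_take_poly /a ltnS leq_eqVlt.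
  by case: eqVneq => [->|_] /=; rewrite ?ltnn ?mulr1 ?add0r ?mulr0 ?addr0.
rewrite tofracD mulrDl -addrA -[RHS]addr0; congr (_ + _).
have XN N' := expf_neq0 N' (X_neq0 k).
have E1 : X ^+ N.+1 / X ^+ N.+2 = X^-1 by rewrite [X ^+ N.+2]exprSr invfM mulrA (mulfV (XN N.+1)) mul1r.
rewrite -mul_polyC tofracM tofracXn -mulrA E1; exact: subrr.
Qed.

(** Being regular at all finite points, f is a polynomial, and the condition at infinity would make
    its degree negative. *)
Lemma no_neg_sect (e : nat) f : (forall a, regular_at (Some a) f) -> regular_at None (X ^+ e.+1 * f) -> f = 0.
Proof.
move=> rf ri; have [p Ep] := regular_at_finite_poly rf.
have : regular_at None ((p * 'X)%:F / X ^+ 0).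
  rewrite expr0 divr1 tofracM -Ep mulrC.
  have -> : X * f = (1%:F / X ^+ e) * (X ^+ e.+1 * f).
    by rewrite tofrac1 div1r exprSr mulrA mulrA (mulVf (expf_neq0 e (X_neq0 k))) mul1r.
  by apply: regular_atM => //; apply/regular_at_inftyP; rewrite size_poly1.
move/regular_at_inftyP; rewrite Ep; have [->|p0] := eqVneq p 0; first by rewrite tofrac0.
by rewrite size_mulX // ltnS leqn0 size_poly_eq0 (negPf p0).
Qed.

Lemma shift_identity (F : fieldType) (x y a b : F) : x != 0 ->
  y * x^-1 * (b - x * a) = 1 / x * (y * b) - y * a.
Proof. by move=> x0; field. Qed.

(** If x1 t = a + X^i b and x0 t = a' + X^i b' are coboundaries, then x0 a - a' = X^i (b' - x0 b) is
    a global section of O(m + i + 2), of negative degree, so it vanishes. Hence b = b' / x0, which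
    is regular enough to make t a coboundary already in degree m. *)
Lemma htw_low m (g : fval Hi (twist_qcoh k m)) : m + i <= -3 ->
  (forall c, xmul Hi m (m + 1) c g = 0) -> g = 0.
Proof.
move=> mi; have [t [st ->]] := htw_elem g => sg.
have s1 c : is_sect (m + 1 - m) (whole k) (xsect k c) by rewrite addrC addKr; apply: xsect_sect.
have stc c : is_sect (m + 1) torus (xsect k c * t).
  by rewrite [m + 1]addrC; apply: is_sectM st; exact: xsect_sect.
have ex c : exists f g, [/\ is_sect (m + 1) chart0 f, is_sect (m + 1) chart1 g & xsect k c * t = f + X ^ i * g].
  by apply/(htw_zero (stc c)); rewrite -(htw_mul (s1 c) st); apply: sg.
have [a' [b' [sa' sb' E']]] := ex true; have [a [b [sa sb E]]] := ex false.
rewrite /= mul1r in E; rewrite /= in E'.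
have X0 := X_neq0 k.
have E0 : X * a - a' = X ^ i * (b' - X * b).
  move: E'; rewrite E mulrDr => E'; rewrite mulrBr [X ^ i * (X * b)]mulrCA.
  by apply/eqP; rewrite subr_eq addrAC [_ + a']addrC -E' addrK.
have z0 : X * a - a' = 0.
  (* The section has degree m + i + 2 <= -1, the opposite of [(absz (m + i + 3)).+1]. *)
  apply: (@no_neg_sect (absz (m + i + 3))) => [c|].
    apply: regular_atB; last exact: chart0_finite sa' c.
    by apply: regular_atM (chart0_finite sa c); apply: regular_at_poly.
  have -> : X ^+ (absz (m + i + 3)).+1 * (X * a - a') =
      1%:F / X * (X ^ (- (m + 1)) * b') - (X ^ (- (m + 1)) * b).
    have xe : X ^+ (absz (m + i + 3)).+1 * X ^ i = X ^ (- (m + 1)) * X ^ (-1).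
      by rewrite -[X ^+ _]/(X ^ (Posz _)) -!expfzDr //; congr (_ ^ _); lia.
    by rewrite E0 mulrA xe exprN1 tofrac1; apply: shift_identity X0.
  have r1 : regular_at None (1%:F / X : K).
    by rewrite -[X in 1%:F / X]expr1; apply/regular_at_inftyP; rewrite size_poly1.
  apply: regular_atB; last exact: chart1_infty.
  by apply: regular_atM r1 _; apply: chart1_infty.
apply/(htw_zero st); exists a, b; split=> //.
  exact/is_sect_finite/(chart0_finite sa).
have Eb : b = b' * X^-1.
  move: E0; rewrite z0 => /esym/eqP; rewrite mulf_eq0 (negPf (expfz_neq0 i X0)) /= subr_eq0 => /eqP ->.
  by rewrite mulrAC (mulfV X0) mul1r.
apply: is_sect_chart1 => [c c0|].
  by have := sb (Some c); apply; rewrite /mem_open !inE; apply: contraNneq c0 => -[->].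
have -> : X ^ (- m) * b = X ^ (- (m + 1)) * b'; last exact: chart1_infty.
rewrite Eb [b' * _]mulrC mulrA; congr (_ * _); rewrite -exprN1 -expfzDr //; congr (_ ^ _); lia.
Qed.

Section CohomologyMap.
Variable F : functor (Qcoh k) (Modk k).
Hypothesis rF : right_exact F.
Variable v : graded F (- i - 2).
Hypothesis v_socle : forall c : bool, xmul F (- i - 2) (- i - 2 + 1) c v = 0.

(** The diagonal system of [cofree_system] gives a natural map from sections over the torus; it
    kills the sections extending to either chart and descends to the Cech quotient. *)
Lemma cohomology_map : exists zeta : forall M, linmap (fval Hi M) (fval F M),
  natural zeta /\ zeta (twist_qcoh k (- i - 2)) (htw_pi i _ (mktw (- i - 2) torus X^-1)) = v.
Proof.
have X0 := X_neq0 k; have XN N := expf_neq0 N X0.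
have [s [s_step sX s1 sv]] := cofree_system rF v_socle.
pose D a := codegree torus (- i) a.
have r_torus : ~~ mem_open None torus by rewrite mem_meet /mem_open !inE.
have cogenE a : cogen torus (- i) None a = 1 / X ^+ a.
  by rewrite /cogen coform_torus /lin /= tofrac1 exp1rz.
have [|theta thetaP] := natural_map r_torus (s := s).
  by move=> a; rewrite coform_torus; apply: s_step.
have ntheta := natural_map_natural r_torus thetaP.
have sD a : is_sect (D a + a%:Z - D a) (whole k) (X ^+ a).
  by apply: (sect_degree (@X_sectn k a _)); lia.
have oD a : is_sect (D a + a%:Z - D a) (whole k) (1 : K).
  by apply: (sect_degree (@one_sectn k a _)); lia.
have scog a : is_sect (D a) torus (1 / X ^+ a).
  by have [_ sg _] := cogen_gen (- i) a r_torus; rewrite -cogenE.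
have r0 : ~~ mem_open None chart0 by rewrite negbK inE.
have r1 : ~~ mem_open (Some 0) chart1 by rewrite negbK inE.
have [q0 q0V] := exists_mem_open chart0; have [q1 q1V] := exists_mem_open chart1.
have c0 a : codegree chart0 (- i) a = D a + a%:Z.
  by rewrite codegree_compl /D codegree_torus; lia.
have c1 a : codegree chart1 (- i) a = D a + a%:Z.
  by rewrite codegree_compl /D codegree_torus; lia.
have kill M : forall r, theta M (htw_rho i M r) = 0.
  move=> [a b].
  have E : htw_rho i M (a, b) = (res (torus_chart0 k) (a : M chart0) : kspace (M torus)) +
      (xpow i torus *: res (torus_chart1 k) (b : M chart1) : M torus) by [].
  rewrite E linearD /=.
  (* Restricted to the torus, the generator of the twist representing a is ['X ^+ q] times [cogen],
     and ['X ^+ q] annihilates [s q]. *)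
  have -> : theta M (res (torus_chart0 k) (a : M chart0)) = 0.
    have [q [f <-]] := section_extends q0V (- i) (a : M chart0) r0.
    have cE : cogen chart0 (- i) None q = 1.
      by rewrite /cogen coform_compl /lin /= tofrac1 exp1rz expr1n divr1.
    rewrite cE; move: f; rewrite c0 => f.
    rewrite -omod_hom_res.
    have -> : res (torus_chart0 k) (mktw (D q + q%:Z) chart0 1) =
        mul_hom (D q) (D q + q%:Z) (X ^+ q) torus (mktw _ torus (cogen torus (- i) None q)).
      apply: twist_ext; rewrite twist_val_res mul_homE // cogenE (val_mktw (scog q)).
      rewrite mul1r (mulfV (XN q)) val_mktw //.
      by apply: is_sect_finite => b'; apply: regular_at1.
    have := thetaP M q (omod_comp f (mul_hom (D q) (D q + q%:Z) (X ^+ q))).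
    by rewrite omod_compE => ->; rewrite fapp_comp -/(mu _ _ _ _) sX linear0.
  rewrite add0r.
  have [q [f <-]] := section_extends q1V (- i) (b : M chart1) r1.
  have cE : cogen chart1 (- i) (Some 0) q = X ^ (- i) / X ^+ q.
    by rewrite /cogen coform_compl /lin /= polyC0 subr0.
  have [_ sg _] := cogen_gen (- i) q r1.
  rewrite c1 cE in sg; rewrite cE; move: f; rewrite c1 => f.
  rewrite -omod_hom_res -linearZ /=.
  (* On the other chart the factor is x1 ^ q, which is 1 here and annihilates [s q] as well; the
     factor ['X ^ i] cancels against the generator of this chart. *)
  have -> : xpow i torus *: res (torus_chart1 k) (mktw (D q + q%:Z) chart1 (X ^ (- i) / X ^+ q)) =
      mul_hom (D q) (D q + q%:Z) 1 torus (mktw _ torus (cogen torus (- i) None q)).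
    apply: twist_ext; rewrite twist_valZ val_xpow ?sub_openxx // twist_val_res (val_mktw sg).
    rewrite mul_homE // cogenE (val_mktw (scog q)) mul1r mulrA -expfzDr // subrr expr0z //.
  have := thetaP M q (omod_comp f (mul_hom (D q) (D q + q%:Z) 1)).
  by rewrite omod_compE => ->; rewrite fapp_comp -/(mu _ _ _ _) s1 linear0.
have [zeta [nz Ez]] := @natural_coker k (functor_add (sections chart0) (sections chart1)) (sections torus) Hi F
  (htw_rho i) (htw_pi i) theta (@htw_pi_natural k i) ntheta (@htw_pi_surj k i) (@htw_pi_ker k i) kill.
exists zeta; split=> //; rewrite Ez -[RHS](sv 0%N).
(* At a = 1 the generator [cogen] is [1 / 'X], and [s 1] is v up to transport of the degree. *)
rewrite -(natural_map_twist r_torus thetaP); first by rewrite cogenE expr0 mul1r expr1 div1r.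
by apply: one_sect0; rewrite codegree_torus; lia.
Qed.

End CohomologyMap.

End TwistCohomology.

(** * Comparison with the torsion sheaf *)

Section TorsionComparison.
Variable k : closedFieldType.
Local Notation K := (ratfun k).
Local Notation "x %:F" := (tofrac x) : ring_scope.
Implicit Types (U V W : open k) (M : qcoh k) (m n : int) (f g t : K).
Local Arguments regular_at : simpl never.

Variable c : k.
Local Notation C := (compl (Some c)).
Local Notation z := (inv_coord c).

Lemma lc_neq0 : lc c != 0 :> K.
Proof. exact: lin_neq0. Qed.

Lemma inv_coordE : z = (lc c)^-1.
Proof. by rewrite /inv_coord /lin /= tofrac1 div1r. Qed.

Lemma notin_compl : ~~ mem_open (Some c) C.
Proof. by rewrite negbK inE. Qed.

(** The ring of C is k[z]: for large N, f l^N with l = [lc c] is a polynomial q, of degree at most N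
    since f is regular at infinity, and expanding q in powers of l writes f = q z^N as a polynomial
    in z. *)
Lemma inv_coord_ind (P : K -> Prop) : (forall f g, P f -> P g -> P (f + g)) ->
  (forall (a : k) b, P ((a%:P)%:F * z ^+ b)) -> forall f, is_sect 0 C f -> P f.
Proof.
move=> PD Pz f sf; have l0 := lc_neq0; have lN N := expf_neq0 N l0.
have [N NP] := regular_at_pole (Some c) f.
have rf x : x != Some c -> regular_at x f.
  by move=> xc; apply/twist_at0/sf; rewrite /mem_open inE.
have uE : uni (Some c) = lc c by rewrite /uni divr1.
have [q Eq] : exists q, f * lc c ^+ N = q%:F.
  apply: regular_at_finite_poly => a; have [->|ac] := eqVneq a c.
    by have := NP N (leqnn N); rewrite uE.
  apply: regular_atM; last by apply: regular_atX; apply: regular_at_poly.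
  by apply: rf; apply: contraNneq ac => -[->].
have sq : (size q <= N.+1)%N.
  apply/regular_at_inftyP; rewrite -Eq -mulrA -expr_div_n.
  apply: regular_atM; first exact: rf.
  by apply: regular_atX; have := regular_at_lin None (Some c).
have -> : f = q%:F * z ^+ N by rewrite -Eq inv_coordE exprVn (mulfK (lN N)).
elim: N q sq {NP Eq} => [|N IHN] q sq.
  have -> : q = (q`_0)%:P by apply: size1_polyC.
  exact: Pz.
have [r Er] : exists r, q - (q.[c])%:P = r * ('X - c%:P).
  by apply/factor_theorem; rewrite rootE !hornerE subrr.
have -> : q%:F * z ^+ N.+1 = (q.[c]%:P)%:F * z ^+ N.+1 + r%:F * z ^+ N.
  have -> : q = (q.[c])%:P + r * ('X - c%:P) by rewrite -Er addrC subrK.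
  rewrite !hornerE subrr mulr0 addr0 tofracD mulrDl; congr (_ + _).
  rewrite tofracM exprS mulrA -(mulrA r%:F) [_ * z](_ : _ = 1) ?mulr1 //.
  by rewrite inv_coordE; exact: mulfV lc_neq0.
apply: PD; [exact: Pz|apply: IHN].
have [->|r0] := eqVneq r 0; first by rewrite size_poly0.
have : (size (r * ('X - c%:P))%R <= N.+2)%N.
  rewrite -Er; apply: leq_trans (size_polyD _ _) _; rewrite geq_max sq size_polyN.
  exact: leq_trans (size_polyC_leq1 _) _.
by rewrite (size_Mmonic r0 (monicXsubC c)) size_XsubC addn2.
Qed.

Variables (d : nat) (Z : 'I_d -> 'I_d -> k).
Local Notation sectC := (functor_power d (sections C)).
Local Notation H0T := (functor_comp (H0 k) (torsion_tens c Z)).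
Local Notation chars := (char_sections c Z).
Local Notation glb := (glob c Z).

Lemma lc_gen n : is_gen n C (lc c ^ n).
Proof. exact: linz_gen notin_compl. Qed.

Lemma z_sect b : is_sect 0 C (z ^+ b).
Proof.
have zs : is_sect 0 C z := is_sect_ratio None notin_compl.
by move=> x xC; apply/twist_at0/regular_atX/twist_at0/zs.
Qed.

Lemma lz_sect n (a : k) b : is_sect n C (lc c ^ n * ((a%:P)%:F * z ^+ b)).
Proof.
have [_ sl _] := lc_gen n; rewrite -[n]addr0; apply: is_sectM; first by rewrite addr0.
exact/is_sectCM/z_sect.
Qed.

Definition cval n (x : fval sectC (twist_qcoh k n)) j : K :=
  twist_val ((x : direct_sum _) j : twist k n C).

Definition cvec n (f : 'I_d -> K) : fval sectC (twist_qcoh k n) :=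
  mk_dsum (E := fun=> kspace (twist_qcoh k n C)) (fun j => mktw n C (f j)).

Lemma cval_cvec n (f : 'I_d -> K) j : is_sect n C (f j) -> cval (cvec n f) j = f j.
Proof. exact: val_mktw. Qed.

Lemma cval_sect n (x : fval sectC (twist_qcoh k n)) j : is_sect n C (cval x j).
Proof. exact: twist_sectP. Qed.

Lemma cval_ext n (x y : fval sectC (twist_qcoh k n)) : (forall j, cval x j = cval y j) -> x = y.
Proof. by move=> xy; apply: dsum_ext => j; apply/twist_ext/xy. Qed.

Lemma cvalL n (a : k) (x y : fval sectC (twist_qcoh k n)) j :
  cval (a *: x + y) j = (a%:P)%:F * cval x j + cval y j.
Proof. exact: (twist_valL (regfun_const C a)). Qed.

Lemma cvalB n (x y : fval sectC (twist_qcoh k n)) j : cval (x - y) j = cval x j - cval y j.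
Proof. by rewrite addrC -scaleN1r cvalL polyCN tofracN tofrac1 mulN1r addrC. Qed.

Lemma cval_mul m n g (x : fval sectC (twist_qcoh k m)) j : is_sect (n - m) (whole k) g ->
  cval (fapp sectC (mul_hom m n g) x) j = g * cval x j.
Proof. exact: mul_homE. Qed.

Lemma twist_val_sum n U (r : seq 'I_d) (F : 'I_d -> twist k n U) :
  twist_val (\sum_(i <- r) F i) = \sum_(i <- r) (twist_val (F i) : K) :> K.
Proof. by elim: r => [|i r IHr]; rewrite ?big_nil // !big_cons twist_valD IHr. Qed.

Lemma cval_char n (x : fval sectC (twist_qcoh k n)) j :
  cval (chars _ x) j = z * cval x j - \sum_i ((Z i j)%:P)%:F * cval x i.
Proof.
transitivity (twist_val (inv_coord_on c C *: ((x : direct_sum _) j : twist k n C) -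
    \sum_i regfun_const C (Z i j) *: ((x : direct_sum _) i : twist k n C)) : K).
  exact: (congr1 (fun t : twist k n C => twist_val t : K) 
    (@mx_act_char k c d Z (twist_qcoh k n) C (fun i => (x : direct_sum _) i : twist k n C) j)).
rewrite -scaleN1r addrC twist_valL twist_valZ twist_val_sum val_inv_coord ?sub_openxx //.
rewrite [val (-1)](_ : _ = -1) // mulN1r addrC; congr (_ - _).
Qed.

(** The vector v z^b, written on the generator l^n of O(n) over C. *)
Definition zvec n b (v : 'I_d -> k) := cvec n (fun j => lc c ^ n * (((v j)%:P)%:F * z ^+ b)).

Lemma zvec_step n b v : glb (twist_qcoh k n) (zvec n b.+1 v) = glb _ (zvec n b (fun j => \sum_i Z i j * v i)).
Proof.
apply/subr0_eq; rewrite -linearB /=; apply/glob_ker; exists (zvec n b v).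
apply: cval_ext => j; rewrite cval_char cvalB !cval_cvec; try exact: lz_sect.
rewrite rmorph_sum rmorph_sum mulr_suml mulr_sumr; congr (_ - _); first by rewrite exprS; ring.
apply: eq_bigr => i _; rewrite cval_cvec; last exact: lz_sect.
by rewrite /= polyCM tofracM; ring.
Qed.

(** In the cokernel z acts through Z, so powers of z can be removed one by one; as the ring of C is
    k[z], constant vectors represent all classes. *)
Lemma glob_zvec n x : exists v, glb (twist_qcoh k n) x = glb _ (zvec n 0 v).
Proof.
pose S (x : fval sectC (twist_qcoh k n)) := exists v, glb (twist_qcoh k n) x = glb _ (zvec n 0 v).
have SD u v : S u -> S v -> S (u + v).
  move=> [a Ea] [b Eb]; exists (fun j => a j + b j).
  transitivity (glb (twist_qcoh k n) u + glb _ v); first exact: linearD.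
  rewrite Ea Eb -[LHS](linearD (glb _)); congr (glb _ _); apply: cval_ext => j; rewrite -[u in u + _]scale1r.
  rewrite cvalL !cval_cvec; try exact: lz_sect.
  by rewrite polyCD tofracD tofrac1; ring.
have Sz b v : S (zvec n b v).
  by elim: b v => [|b IHb] v; [exists v|rewrite /S zvec_step; apply: IHb].
pose e (j : 'I_d) (f : K) := cvec n (fun i : 'I_d => if i == j then lc c ^ n * f else 0).
have se (j : 'I_d) f : is_sect 0 C f -> forall i : 'I_d, is_sect n C (if i == j then lc c ^ n * f else 0).
  move=> sf i; case: eqP => _; last exact: is_sect0.
  by have [_ sl _] := lc_gen n; rewrite -[n]addr0; apply: is_sectM sf; rewrite addr0.
have Se (j : 'I_d) f : is_sect 0 C f -> S (e j f).
  move=> sf; suff [] : is_sect 0 C f /\ S (e j f) by [].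
  move: f sf; apply: inv_coord_ind => [f g [sf Sf] [sg Sg]|a b].
    split; first by move=> x' xC; apply: twist_atD; [exact: sf|exact: sg].
    have -> : e j (f + g) = e j f + e j g; last exact: SD.
    apply: cval_ext => i; rewrite -[e j f]scale1r cvalL !cval_cvec; try exact: se.
      by rewrite tofrac1; case: eqP => _; ring.
    by apply: se => x' xC; apply: twist_atD; [exact: sf|exact: sg].
  split; first exact/is_sectCM/z_sect.
  have -> : e j ((a%:P)%:F * z ^+ b) = zvec n b (fun i => if i == j then a else 0); last exact: Sz.
  apply: cval_ext => i; rewrite !cval_cvec; [|exact: lz_sect|exact/se/is_sectCM/z_sect].
  by case: eqP => _; rewrite ?polyC0 ?tofrac0 ?mul0r ?mulr0.
have -> : x = \sum_j e j (cval x j / lc c ^ n).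
  apply: cval_ext => i.
  have cS (r : seq 'I_d) (F : 'I_d -> fval sectC (twist_qcoh k n)) :
      cval (\sum_(j <- r) F j) i = \sum_(j <- r) cval (F j) i.
    elim: r => [|j r IHr]; first by rewrite !big_nil.
    by rewrite !big_cons -IHr -[X in cval (X + _)]scale1r cvalL tofrac1 mul1r.
  rewrite cS (bigD1 i) //= big1 => [|j ji].
    rewrite addr0 cval_cvec ?eqxx; first by rewrite mulrC divfK //; exact: expfz_neq0 lc_neq0.
    by have := se i _ (gen_ratio (lc_gen n) (cval_sect x i)) i; rewrite eqxx.
  rewrite cval_cvec; first by rewrite eq_sym (negPf ji).
  exact: se (gen_ratio (lc_gen n) (cval_sect x j)) i.
elim: (index_enum _) => [|j r IHr]; last first.
  by rewrite big_cons; apply: SD IHr; apply/Se/gen_ratio/cval_sect/lc_gen.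
rewrite big_nil; exists (fun=> 0); congr (glb _ _); apply: cval_ext => j.
rewrite cval_cvec; last exact: lz_sect.
by rewrite polyC0 tofrac0 mul0r mulr0.
Qed.

(* Dividing by the linear form [lc c], which is invertible away from [c]. *)
Lemma torsion_lc_inj n v : mu H0T n (n + 1) (lc c) v = 0 -> v = 0.
Proof.
have [x <-] := glob_surj (M := twist_qcoh k n) v.
have s1 : is_sect (n + 1 - n) (whole k) (lc c) by apply: (sect_degree (@lc_sect k c _)); lia.
rewrite /mu -glob_natural => /glob_ker[r Er]; apply/glob_ker.
have sr j : is_sect n C (cval r j / lc c).
  have [_ _ sl] := lc_gen 1; rewrite expr1z in sl.
  apply: (sect_degree (n := n + 1 - 1)); last exact: addrK.
  by apply: is_sectM sl; exact: cval_sect.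
exists (cvec n (fun j => cval r j / lc c)); apply: cval_ext => j.
apply: (mulfI lc_neq0); rewrite -(cval_mul _ _ s1) -(cval_mul x j s1).
rewrite -Er -char_sections_natural; congr (cval _ j); congr (chars _ _).
apply: cval_ext => i; rewrite (cval_mul _ _ s1) cval_cvec //.
by rewrite mulrC (divfK lc_neq0).
Qed.

Section TorsionMap.
Variables (F : functor (Qcoh k) (Modk k)) (n0 : int).
Hypothesis sc : forall n, lc_surj F c n.
Hypothesis st : forall n, n0 <= n -> forall v : graded F n, mu F n (n + 1) (lc c) v = 0 -> v = 0.
Let D a := codegree C n0 a.
Variable s : forall a, 'I_d -> graded F (D a).
Hypothesis s0 : is_basis (s 0%N).
Hypothesis s_step : forall a j, mu F (D a.+1) (D a) (lc c) (s a.+1 j) = s a j.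
Hypothesis s_one : forall a j, mu F (D a.+1) (D a) 1 (s a.+1 j) = \sum_i Z j i *: s a i.

Lemma lc_pow_bij (e : nat) : (forall w, exists u, mu F n0 (n0 + e%:Z) (lc c ^+ e) u = w) /\
  (forall u, mu F n0 (n0 + e%:Z) (lc c ^+ e) u = 0 -> u = 0).
Proof.
have se N : is_sect (n0 + N%:Z - n0) (whole k) (lc c ^+ N).
  apply: (sect_degree (n := N%:Z)); last lia.
  by have := fun x (_ : mem_open x (whole k)) => @twist_at_linX k x (Some c) N.
have s1 N : is_sect (n0 + N.+1%:Z - (n0 + N%:Z)) (whole k) (lc c).
  by apply: (sect_degree (@lc_sect k c _)); lia.
elim: e => [|e [IHs IHi]].
  have E u : mu F n0 (n0 + 0%:Z) (lc c ^+ 0) u = 0 -> u = 0.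
    by move: u; rewrite addr0 expr0 => u; rewrite mu1.
  split=> //; rewrite addr0 expr0 => w; exists w; exact: mu1.
have dg : n0 + e.+1%:Z = n0 + e%:Z + 1 by lia.
split=> [w|u].
  have [x Ex] : exists x, mu F (n0 + e%:Z) (n0 + e.+1%:Z) (lc c) x = w.
    by move: w; rewrite dg; apply: sc.
  have [u Eu] := IHs x; exists u; rewrite -Ex -Eu mu_comp ?exprS //.
rewrite exprS -(mu_comp _ (se e) (s1 e)) => E; apply: IHi.
apply: (@st (n0 + e%:Z)); first lia.
by move: E; rewrite dg.
Qed.

(** The d systems give maps theta_j with theta_j (z m) = sum of Z j i theta_i (m), so their sum
    kills the image of z - Z and descends. In degree n0 + e the class of a constant vector v goes to
    l^e times the sum of the v_j s_0j; here s 0 is a basis and multiplication by l^e is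
    bijective. *)
Lemma torsion_map : exists zeta : forall M, linmap (fval H0T M) (fval F M),
  natural zeta /\ forall n, n0 <= n ->
    (forall v, zeta (twist_qcoh k n) v = 0 -> v = 0) /\
    (forall w, exists v, zeta (twist_qcoh k n) v = w).
Proof.
have rC := notin_compl.
have cogenE a : cogen C n0 (Some c) a = lc c ^ n0 / lc c ^+ a by rewrite /cogen coform_compl.
have scog a : is_sect (D a) C (lc c ^ n0 / lc c ^+ a).
  by have [_ sg _] := cogen_gen n0 a rC; rewrite -cogenE.
have step j a : mu F (D a.+1) (D a) (coform C) (s a.+1 j) = s a j by rewrite coform_compl; apply: s_step.
have [theta thetaP] := dep_choice (fun j => natural_map rC (step j)).
have ntheta j := natural_map_natural rC (thetaP j).
have theta_z j M (m : M C) : theta j M (inv_coord_on c C *: m : M C) = \sum_i Z j i *: theta i M m.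
  have [q qV] := exists_mem_open C; have [a [f <-]] := section_extends qV n0 m rC.
  have o1 : is_sect (D a - D a.+1) (whole k) (1 : K).
    by apply: (sect_degree (@one_sect k _)); rewrite /D !codegree_compl; lia.
  rewrite -linearZ /=.
  (* Since z = x1 / l, multiplying the generator by z gives x1 times the generator one degree lower,
     where [s_one] applies. *)
  have -> : inv_coord_on c C *: (mktw _ C (cogen C n0 (Some c) a) : twist k (D a) C) =
      mul_hom (D a.+1) (D a) 1 C (mktw _ C (cogen C n0 (Some c) a.+1)).
    apply: twist_ext; rewrite twist_valZ val_inv_coord ?sub_openxx // mul_homE //.
    rewrite !cogenE (val_mktw (scog a)) (val_mktw (scog a.+1)) inv_coordE exprS invfM mul1r.
    by rewrite mulrCA.
  have := thetaP j M a.+1 (omod_comp f (mul_hom (D a.+1) (D a) 1)).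
  rewrite omod_compE => ->; rewrite fapp_comp -/(mu _ _ _ _) s_one linear_sum /=.
  by apply: eq_bigr => i _; rewrite linearZ /= thetaP.
have [Theta [nT ET]] := @natural_dsum k _ (fun _ : 'I_d => sections C) F theta ntheta.
have {}ET M x : Theta M x = \sum_j theta j M ((x : direct_sum _) j).
  by rewrite ET (fsumE (s := index_enum _)) ?index_enum_uniq // => j; rewrite mem_index_enum.
have kill M r : Theta M (chars M r) = 0.
  have E j : theta j M ((chars M r : direct_sum _) j) =
      \sum_i Z j i *: theta i M ((r : direct_sum _) j) - \sum_i Z i j *: theta j M ((r : direct_sum _) i).
    have -> : (chars M r : direct_sum _) j = (inv_coord_on c C *: ((r : direct_sum _) j : M C) : kspace (M C)) -
        (\sum_i Z i j *: ((r : direct_sum _) i : kspace (M C))) by exact: mx_act_char.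
    rewrite linearB /= theta_z linear_sum; congr (_ - _).
    by apply: eq_bigr => i _; rewrite linearZ.
  rewrite ET; under eq_bigr do rewrite E.
  by rewrite sumrB exchange_big subrr.
have [zeta [nz Ez]] := @natural_coker k sectC sectC H0T F chars glb Theta
  (@glob_natural k c d Z) nT (@glob_surj k c d Z) (@glob_ker k c d Z) kill.
exists zeta; split=> // n le_n.
have en : n = n0 + (absz (n - n0))%:Z by lia.
move: (absz (n - n0)) en => e en; subst n.
have D0 : D 0 = n0 by rewrite /D codegree_compl subr0.
have [surj inj] := lc_pow_bij e.
have Ezv v : zeta (twist_qcoh k (n0 + e%:Z)) (glb _ (zvec (n0 + e%:Z) 0 v)) =
    mu F (D 0) (n0 + e%:Z) (lc c ^+ e) (\sum_j v j *: s 0 j).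
  rewrite Ez ET linear_sum; apply: eq_bigr => j _; rewrite linearZ /=.
  have sl : is_sect (n0 + e%:Z - D 0) (whole k) (lc c ^+ e).
    apply: (sect_degree (n := e%:Z)); last by rewrite D0; lia.
    by have := fun x (_ : mem_open x (whole k)) => @twist_at_linX k x (Some c) e.
  rewrite -(natural_map_twist rC (thetaP j) sl) -linearZ /=; congr (theta j _ _).
  have [_ sln _] := lc_gen (n0 + e%:Z).
  have E' : mktw (n0 + e%:Z) C (lc c ^ (n0 + e%:Z) * (((v j)%:P)%:F * z ^+ 0)) =
      regfun_const C (v j) *: mktw (n0 + e%:Z) C (lc c ^+ e * cogen C n0 (Some c) 0).
    apply: twist_ext; rewrite twist_valZ (val_mktw (lz_sect _ _ _)) cogenE.
    have -> : lc c ^+ e * (lc c ^ n0 / lc c ^+ 0) = lc c ^ (n0 + e%:Z).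
      by rewrite expr0 divr1 expfzDr ?lc_neq0 // mulrC.
    by rewrite (val_mktw sln) expr0 mulr1 mulrC.
  exact: E'.
have [is0 ss0] := s0.
have inj' u : mu F (D 0) (n0 + e%:Z) (lc c ^+ e) u = 0 -> u = 0.
  by move: u; rewrite D0.
have surj' w : exists u, mu F (D 0) (n0 + e%:Z) (lc c ^+ e) u = w.
  by move: w; rewrite D0.
split=> [g|w].
  have [x <-] := glob_surj g; have [v ->] := glob_zvec x; rewrite Ezv => /inj' /is0 v0.
  rewrite -[RHS](linear0 (glb (twist_qcoh k (n0 + e%:Z)))); congr (glb _ _); apply: cval_ext => j.
  by rewrite cval_cvec; [rewrite v0 polyC0 tofrac0 mul0r mulr0|exact: lz_sect].
have [u <-] := surj' w; have [v ->] := ss0 u I.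
by exists (glb _ (zvec (n0 + e%:Z) 0 v)).
Qed.

End TorsionMap.

End TorsionComparison.

(** * The isomorphism *)

Section Assembly.
Variable k : closedFieldType.
Local Notation K := (ratfun k).
Local Notation "x %:F" := (tofrac x) : ring_scope.
Local Notation Hi i := (functor_comp (cech_cohomology k) (tw_tensor k i)).
Implicit Types (A B : qcoh k).
Local Arguments regular_at : simpl never.

(** The class of [1 / 'X] spans H^1(P^1, O(-2)), which sits in the only degree where H^1(-(i)) has a
    socle. *)
Definition pole_class i : fval (Hi i) (twist_qcoh k (- i - 2)) :=
  htw_pi i _ (mktw (- i - 2) (torus k) 'X%:F^-1).

Lemma functor_iso_of_bijection (F G : functor (Qcoh k) (Modk k))
    (zeta : forall A, linmap (fval G A) (fval F A)) : natural zeta ->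
  (forall A v, zeta A v = 0 -> v = 0) -> (forall A w, exists v, zeta A v = w) ->
  functor_iso F G.
Proof.
move=> nz inj surj.
have injz A u v : zeta A u = zeta A v -> u = v.
  by move=> E; apply/subr0_eq/inj; rewrite linearB /= E subrr.
have [g gP] := dep_choice (fun A => dep_choice (surj A)).
have lg A : linear (g A).
  by move=> a u v; apply: (injz A); rewrite linearP /= !gP.
exists (fun A => mk_linmap (lg A) : @hom k (Modk k) (F A) (G A)); split=> [A B f|A].
  apply: linmap_ext => v; apply: (injz B).
  transitivity (fapp F (f : omod_hom A B) v); first exact: gP.
  have E : zeta B (fapp G (f : omod_hom A B) (g A v)) = fapp F (f : omod_hom A B) v by rewrite nz gP.
  exact: esym E.
exists (zeta A : @hom k (Modk k) (G A) (F A)); split; apply: linmap_ext => v; first exact: gP.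
by apply: (injz A); exact: gP.
Qed.

Lemma power_map (F : functor (Qcoh k) (Modk k)) (i : int) (m : nat) (e : 'I_m -> graded F (- i - 2)) :
  right_exact F -> (forall j (b : bool), xmul F (- i - 2) (- i - 2 + 1) b (e j) = 0) ->
  exists zeta : forall A, linmap (fval (functor_power m (Hi i)) A) (fval F A),
    natural zeta /\ forall (x : fval (functor_power m (Hi i)) (twist_qcoh k (- i - 2))) (a : 'I_m -> k),
      (forall j, (x : direct_sum _) j = a j *: pole_class i) -> zeta _ x = \sum_j a j *: e j.
Proof.
move=> rF se; have [z zP] := dep_choice (fun j => cohomology_map rF (se j)).
have [zeta [nz Ez]] := @natural_dsum k _ (fun _ : 'I_m => Hi i) F z (fun j => (zP j).1).
exists zeta; split=> // x a xa.
rewrite Ez (fsumE (s := index_enum _)) ?index_enum_uniq // => [|j]; last by rewrite mem_index_enum.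
by apply: eq_bigr => j _; rewrite xa linearZ /= (zP j).2.
Qed.

Section Bijection.
Variables (F : functor (Qcoh k) (Modk k)) (c : k) (n0 : nat) (d : nat) (Z : 'I_d -> 'I_d -> k).
Hypotheses (rF : right_exact F) (sF : preserves_sums F).
Variables (m : int -> nat) (e : forall i, 'I_(m i) -> graded F (- i - 2)).
Hypothesis e_socle : forall i j (b : bool), xmul F (- i - 2) (- i - 2 + 1) b (@e i j) = 0.
Hypothesis e_indep : forall i, indep (@e i).
Hypothesis e_spans : forall i v, (forall b : bool, xmul F (- i - 2) (- i - 2 + 1) b v = 0) ->
  exists a : 'I_(m i) -> k, v = \sum_j a j *: e j.

Local Notation H0T := (functor_comp (H0 k) (torsion_tens c Z)).
Local Notation idx := {i : int | - (n0.+1)%:Z <= i}.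
Local Notation GH := (functor_dsum (fun i : idx => functor_power (m (sval i)) (Hi (sval i)))).
Local Notation G := (functor_add GH H0T).

Variable zT : forall A, linmap (fval H0T A) (fval F A).
Hypothesis nT : natural zT.
Hypothesis zT_bij : forall n, n0%:Z <= n -> (forall v, zT (twist_qcoh k n) v = 0 -> v = 0) /\
  (forall w, exists v, zT (twist_qcoh k n) v = w).

Definition comp_ij A (h : fval GH A) (i : idx) (j : 'I_(m (sval i))) : fval (Hi (sval i)) A :=
  ((h : direct_sum _) i : direct_sum _) j.

Arguments comp_ij {A} h i j.

Lemma GH_zero A (h : fval GH A) : (forall i j, comp_ij h i j = 0) -> h = 0.
Proof. by move=> h0; apply: dsum_ext => i; apply: dsum_ext => j; apply: h0. Qed.

Lemma GH_single A (i : idx) (x : fval (functor_power (m (sval i)) (Hi (sval i))) A) :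
  exists h : fval GH A, (forall j, comp_ij h i j = (x : direct_sum _) j) /\
    forall i' j, i' != i -> comp_ij h i' j = 0.
Proof.
pose f : pi_mod (fun i' : idx => fval (functor_power (m (sval i')) (Hi (sval i'))) A) := dfwith (fun _ => 0) x.
have fi : f i = x by apply: dfwith_in.
have f0 i' : i' != i -> f i' = 0 by move=> ne; apply: dfwith_out; rewrite eq_sym.
have ff : f \in @fin_supp k _ _.
  by apply/asboolP; exists [:: i] => i'; rewrite inE; apply: f0.
exists (DirectSum ff); split=> [j|i' j ne].
  exact: (congr1 (fun y : direct_sum _ => y j) fi).
exact: (congr1 (fun y : direct_sum _ => y j) (f0 i' ne)).
Qed.

(** All indices satisfy i >= - (n0 + 1), so n + i >= -1 and every H^1(O(n + i)) vanishes: from n0 on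
    only the torsion summand is left. *)
Lemma GH_high n (h : fval GH (twist_qcoh k n)) : n0%:Z <= n -> h = 0.
Proof.
move=> le_n; apply: GH_zero => i j; apply: htw_high.
by have := svalP i; lia.
Qed.

(** From n0 on, bijectivity is that of the torsion map. Below n0 only socles are compared: the
    torsion summand has none, as [lc c] acts injectively on it, and the H^1 summand of index i has
    one only in degree - i - 2, spanned by the pole class, whose copies go to the basis e of the
    socle of F. *)
Lemma assembled_iso : functor_iso F G.
Proof.
have [zi ziP] := dep_choice (fun i : int => power_map rF (@e_socle i)).
have [zH [nH EH]] := @natural_dsum k idx (fun i : idx => functor_power (m (sval i)) (Hi (sval i))) F
  (fun i => zi (sval i)) (fun i => (ziP (sval i)).1).
have [zeta [nz Ez]] := natural_add nH nT.
have [rG sG] : good G.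
  apply: good_add; last exact: good_torsion.
  by apply: good_dsum => i; apply: good_dsum => _; apply: good_htw.
have high_inj n : n0%:Z <= n -> forall v, zeta (twist_qcoh k n) v = 0 -> v = 0.
  move=> le_n [h t]; rewrite Ez /= (GH_high h le_n) linear0 add0r => /(zT_bij le_n).1 ->.
  by [].
have high_surj n : n0%:Z <= n -> forall w, exists v, zeta (twist_qcoh k n) v = w.
  move=> le_n w; have [t Et] := (zT_bij le_n).2 w; exists (0, t).
  by rewrite Ez /= linear0 add0r.
have idx_ex n : n < n0%:Z -> exists i : idx, n = - sval i - 2.
  move=> lt_n; have Pi : - (n0.+1)%:Z <= - n - 2 by lia.
  by exists (exist _ (- n - 2) Pi) => /=; lia.
have zH_mid (i : idx) (h : fval GH (twist_qcoh k (- sval i - 2))) (a : 'I_(m (sval i)) -> k) :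
    (forall j, comp_ij h i j = a j *: pole_class (sval i)) ->
    (forall i' j, i' != i -> comp_ij h i' j = 0) -> zH _ h = \sum_j a j *: e j.
  move=> ha h0; rewrite EH (@fsum1 _ _ _ i) => [|i' ne]; first exact: (ziP (sval i)).2.
  rewrite [X in zi _ _ X](_ : _ = 0) ?linear0 //.
  by apply: dsum_ext => j; apply: h0.
have low_surj n : n < n0%:Z -> forall w : fval F (twist_qcoh k n),
    (forall b, xmul F n (n + 1) b w = 0) -> exists v, zeta (twist_qcoh k n) v = w.
  move=> /idx_ex[i ->] w sw; have [a ->] := e_spans sw.
  have [h [hi h0]] := GH_single (mk_dsum (E := fun=> fval (Hi (sval i)) (twist_qcoh k (- sval i - 2)))
    (fun j => a j *: pole_class (sval i))).
  by exists (h, 0); rewrite Ez /= linear0 addr0; apply: zH_mid h0.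
have low_inj n : n < n0%:Z -> forall v : fval G (twist_qcoh k n),
    (forall b, xmul G n (n + 1) b v = 0) -> zeta (twist_qcoh k n) v = 0 -> v = 0.
  move=> /idx_ex[i ->] [h t] shf zv.
  have sh b : fapp GH (mul_hom _ (- sval i - 2 + 1) (xsect k b)) h = 0 by exact: (congr1 fst (shf b)).
  have stn b : xmul H0T _ (- sval i - 2 + 1) b t = 0 by exact: (congr1 snd (shf b)).
  have t0 : t = 0.
    by apply: (@torsion_lc_inj k c d Z); rewrite mu_lc // [mu _ _ _ _ t](stn true) [mu _ _ _ _ t](stn false) scaler0 subrr.
  have shc i' j b : xmul (Hi (sval i')) _ (- sval i - 2 + 1) b (comp_ij h i' j) = 0.
    have E : comp_ij (0 : fval GH (twist_qcoh k (- sval i - 2 + 1))) i' j = 0 by [].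
    by rewrite -E -(sh b).
  (* For i' different from i the component vanishes in both ranges: the group is zero when n + i' >=
     -1, and has no socle when n + i' <= -3. *)
  have h0 i' j : i' != i -> comp_ij h i' j = 0.
    move=> ne; have {}ne : sval i' != sval i by apply: contraNneq ne => E; apply/eqP/val_inj.
    have [hi|lo] := lerP (-1) (- sval i - 2 + sval i'); first exact: htw_high.
    apply: htw_low => [|b]; last exact: shc.
    by move/eqP: ne lo; move: (sval i) (sval i') => p q; lia.
  have [a Ea] := dep_choice (fun j => htw_mid (comp_ij h i j) (erefl _)).
  have := zv; rewrite Ez /= t0 linear0 addr0 (zH_mid i h a) // => /e_indep a0.
  congr pair; apply: GH_zero => i' j; have [E|/h0 //] := eqVneq i' i.
  by subst i'; rewrite Ea a0 scale0r.
have bij n := @socle_bijection k F G zeta nz rG n0%:Z high_inj high_surj low_inj low_surj n.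
apply: (functor_iso_of_bijection nz) => [A v|A w].
  exact: (nat_inj nz rF rG sF sG (fun n => (bij n).1) (fun n => (bij n).2)).
exact: (nat_surj nz rF sF (fun n => (bij n).2)).
Qed.
End Bijection.

Fact socle0 (F : functor (Qcoh k) (Modk k)) n : forall b : bool, xmul F n (n + 1) b 0 = 0.
Proof. by move=> b; apply: linear0. Qed.

Fact socleL (F : functor (Qcoh k) (Modk k)) n (a : k) u v :
  (forall b : bool, xmul F n (n + 1) b u = 0) -> (forall b : bool, xmul F n (n + 1) b v = 0) ->
  forall b : bool, xmul F n (n + 1) b (a *: u + v) = 0.
Proof. by move=> u0 v0 b; rewrite linearP /= u0 v0 scaler0 addr0. Qed.

Definition socle (F : functor (Qcoh k) (Modk k)) n : submodule (graded F n) :=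
  Submodule (@socle0 F n) (@socleL F n).

End Assembly.

Theorem mainTheorem1 (k : closedFieldType) (F : functor (Qcoh k) (Modk k)) :
  right_exact F ->
  preserves_direct_limits F ->
  preserves_coherence F ->
  exists (T : qcoh k) (n : nat) (m : int -> nat),
    coherent T /\ torsion T /\
    exists (H : first_cohomology k)
           (tw : forall i : int, tensor_functor (twist k i))
           (tT : tensor_functor T),
      functor_iso F
        (functor_add
          (functor_dsum (fun i : {i : int | - n%:Z <= i} =>
             functor_power (m (sval i)) (functor_comp H (tw (sval i)))))
          (functor_comp (H0 k) tT)).
Proof.
move=> rF dF fF.
have [c sc] := exists_lc_surj rF fF; have [n0 st] := exists_stable fF sc.
have [d [s [Z [s0 s_step s_one]]]] := torsion_system rF fF sc st.
have [zT [nT zT_bij]] := torsion_map sc st s0 s_step s_one.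
have basis (i : int) : exists (m : nat) (e : 'I_m -> graded F (- i - 2)),
    [/\ forall j, socle F _ (e j), indep e & spans e (socle F (- i - 2))].
  by have [d' [g [_ sg]]] := graded_basis fF (- i - 2); apply: basis_exists sg.
have [m mP] := dep_choice basis; have [e eP] := dep_choice mP.
(* A degree - i - 2 is below n0 exactly for i >= - (n0 + 1); [m i] is the dimension of the socle in
   degree - i - 2. *)
exists (torsion_sheaf c Z), n0.+1, m.
split; first exact: torsion_sheaf_coherent.
split; first exact: torsion_sheaf_torsion.
exists (cech_cohomology k), (tw_tensor k), (torsion_tensor c Z).
apply: (assembled_iso rF (direct_limits_sums dF) (e := e) _ _ _ nT zT_bij) => [i j b|i|i v sv].
- by have [se _ _] := eP i; apply: se.
- by have [_ ie _] := eP i.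
by have [_ _ pe] := eP i; apply: pe.
Qed.
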